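(* Fix constants $a>0$ and $\kappa>2$, and let $\eta\in[(\log n)^{-a},1]$. Consider the correlated Wigner model (defined in the context) with $n\ge d\ge(\log n)^{c_0}$, where $c_0>\max(32+4a,\,4+7a)$. Then there exist constants $C,n_0>0$ depending on $(a,\kappa)$ and a deterministic quantity $r(n)\equiv r(n,\eta,d,a)$ with $r(n)\to0$ as $n\to\infty$, such that for all $n\ge n_0$, with probability at least $1-n^{-10}$, the matrix $X$ defined in the context satisfies $$\max_{k}\max_{\ell\ne\pi_*(k)}|X_{k\ell}|\le C(\log n)^{\kappa}\frac{1}{\sqrt\eta},\qquad \max_k\Big|X_{k\pi_*(k)}-\frac{1-\sigma^2}{\eta}\Big|\le C\Big(\frac{r(n)}{\eta}+\frac{\sigma}{\eta^2}+(\log n)^{\kappa}\frac{1}{\sqrt\eta}\Big).$$ If moreover there is a universal constant $K$ such that all $a_{ij},b_{ij}$ are sub-Gaussian with $\|a_{ij}\|_{\psi_2},\|b_{ij}\|_{\psi_2}\le K/\sqrt n$, then the same conclusion also holds with $\kappa=1$.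
   Context: Correlated Wigner model: $n$ is a positive integer, $d=d(n)$ a sparsity parameter, $\sigma\in[0,1]$ an ($n$-dependent) noise parameter, $\pi_*$ a permutation of $[n]$ with permutation matrix $\Pi_*$ given by $(\Pi_* )_{i\pi_*(i)}=1$. $A=(a_{ij})$ and $B=(b_{ij})$ are real symmetric $n\times n$ random matrices such that the pairs $\{(a_{ij},b_{\pi_*(i)\pi_*(j)}):i\le j\}$ are independent; each of $A$ and $B$ satisfies: $\mathbb E[a_{ij}]=0$ for all $i,j$, $\mathbb E[a_{ij}^2]=1/n$ for all $i\ne j$, and $\mathbb E|a_{ij}|^k\le C^k/(n d^{(k-2)/2})$ for all $i,j$ and every $k\in[2,(\log n)^{10\log\log n}]$, for an absolute constant $C>0$ (and likewise for $B$); $\mathbb E[a_{ij}b_{\pi_*(i)\pi_*(j)}]\ge(1-\sigma^2)/n$ for all $i\ne j$; and for a constant $C>0$, any $D>0$ and all $n\ge n_0(D)$, $\mathbb P(\|A-\Pi_*B\Pi_*^\top\|\le C\sigma)\ge1-n^{-D}$, where $\|\cdot\|$ is the spectral norm. Write spectral decompositions $A=\sum_i\lambda_iv_iv_i^\top$, $B=\sum_j\mu_jw_jw_j^\top$, and for $\eta>0$ define $X=\sum_{i,j}\frac{\eta}{(\lambda_i-\mu_j)^2+\eta^2}v_iv_i^\top\mathbf J w_jw_j^\top$, where $\mathbf J$ is the $n\times n$ all-ones matrix. The sub-Gaussian norm is $\|Y\|_{\psi_2}=\sup_{k\ge1}k^{-1/2}(\mathbb E|Y|^k)^{1/k}$.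 *)

(* Defs.v *)
From HB Require Import structures.
From mathcomp Require Import all_boot all_order all_algebra fingroup perm.
From mathcomp Require Import all_classical all_reals all_analysis.
Set Implicit Arguments. Unset Strict Implicit. Unset Printing Implicit Defensive.
Import Order.TTheory GRing.Theory Num.Theory.
Import numFieldNormedType.Exports.
Local Open Scope classical_set_scope.
Local Open Scope ring_scope.

Section Defs.
Context {R : realType}.

Definition vnorm (n : nat) (v : 'cV[R]_n) : R := Num.sqrt (\sum_i v i 0 ^+ 2).

Definition specnorm (n : nat) (M : 'M[R]_n) : R :=
  sup [set vnorm (M *m v) | v in [set v : 'cV[R]_n | vnorm v = 1]].

Definition spec_decomp (n : nat) (A V : 'M[R]_n) (lam : 'I_n -> R) : Prop :=
  V^T *m V = 1%:M /\ A = \sum_i lam i *: (col i V *m (col i V)^T).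

Definition Xmat (n : nat) (eta : R) (V W : 'M[R]_n) (lam mu : 'I_n -> R) : 'M[R]_n :=
  \sum_i \sum_j (eta / ((lam i - mu j) ^+ 2 + eta ^+ 2)) *:
     ((col i V *m (col i V)^T) *m const_mx 1 *m (col j W *m (col j W)^T)).
End Defs.

Section Prob.
Context {d : measure_display} {T : measurableType d} {R : realType}.
Context (P : probability T R).

Definition prob_atleast (E : set T) (p : R) : Prop :=
  exists F, measurable F /\ F `<=` E /\ (p%:E <= P F)%E.

Definition pairs_indep (n : nat) (X Y : 'I_n -> 'I_n -> T -> R) : Prop :=
  forall S : 'I_n -> 'I_n -> set (R * R), (forall i j, measurable (S i j)) ->
    fine (P (\bigcap_(ij in [set ij : 'I_n * 'I_n | (ij.1 <= ij.2)%N])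
              [set w | (X ij.1 ij.2 w, Y ij.1 ij.2 w) \in S ij.1 ij.2]))
    = \prod_(ij : 'I_n * 'I_n | (ij.1 <= ij.2)%N)
        fine (P [set w | (X ij.1 ij.2 w, Y ij.1 ij.2 w) \in S ij.1 ij.2]).

Definition psi2norm (Y : T -> R) : \bar R :=
  ereal_sup [set ((k `^ (-2^-1))%:E * poweR ('E_P[fun w => (`|Y w| `^ k)%R]) k^-1)%E
            | k in [set k : R | 1 <= k]].
End Prob.

Section Model.
Context {R : realType}.
Local Open Scope ring_scope.

Definition corr_wigner (n : nat) (dd sigma : R) (pi : {perm 'I_n})
  {d : measure_display} {T : measurableType d} (P : probability T R)
  (A B : T -> 'M[R]_n) (Cm Cs : R) (n0m : R -> nat) : Prop :=
  (forall w, (A w)^T = A w /\ (B w)^T = B w) /\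
      (forall i j, measurable_fun setT (fun w => A w i j) /\
                   measurable_fun setT (fun w => B w i j)) /\
      pairs_indep P (fun i j w => A w i j) (fun i j w => B w (pi i) (pi j)) /\
      (forall i j, ('E_P[fun w => A w i j] = 0)%E /\ ('E_P[fun w => B w i j] = 0)%E) /\
      (forall i j, i != j -> ('E_P[fun w => (A w i j ^+ 2)%R] = (n%:R^-1)%:E)%E /\
                             ('E_P[fun w => (B w i j ^+ 2)%R] = (n%:R^-1)%:E)%E) /\
      (forall i j (k : R), 2 <= k -> k <= ln (n%:R) `^ (10 * ln (ln (n%:R))) ->
         ('E_P[fun w => (`|A w i j| `^ k)%R] <= (Cm `^ k / (n%:R * dd `^ ((k - 2) / 2)))%:E)%E /\
         ('E_P[fun w => (`|B w i j| `^ k)%R] <= (Cm `^ k / (n%:R * dd `^ ((k - 2) / 2)))%:E)%E) /\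
      (forall i j, i != j ->
         (((1 - sigma ^+ 2) / n%:R)%:E <= 'E_P[fun w => (A w i j * B w (pi i) (pi j))%R])%E) /\
      (forall D : R, 0 < D -> (n0m D <= n)%N ->
         prob_atleast P [set w | specnorm (A w - perm_mx pi *m B w *m (perm_mx pi)^T)
                                   <= Cs * sigma] (1 - n%:R `^ (- D))).

Definition subgaussian_entries (n : nat) {d : measure_display} {T : measurableType d}
  (P : probability T R) (A B : T -> 'M[R]_n) (K : R) : Prop :=
  forall i j, (psi2norm P (fun w => A w i j) <= (K / Num.sqrt n%:R)%:E)%E /\
              (psi2norm P (fun w => B w i j) <= (K / Num.sqrt n%:R)%:E)%E.

(* The event of the theorem (X does not depend on the chosen eigenbases). *)
Definition X_bounds (n : nat) (pi : {perm 'I_n}) (sigma eta C kappa rn : R)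
  (A B : 'M[R]_n) : Prop :=
  forall (V W : 'M[R]_n) (lam mu : 'I_n -> R),
    spec_decomp A V lam -> spec_decomp B W mu ->
    let X := Xmat eta V W lam mu in
    (forall k l, l != pi k ->
       `|X k l| <= C * (ln (n%:R) `^ kappa / Num.sqrt eta)) /\
    (forall k, `|X k (pi k) - (1 - sigma ^+ 2) / eta| <=
       C * (rn / eta + sigma / eta ^+ 2 + ln (n%:R) `^ kappa / Num.sqrt eta)).

Definition admissible (a c0 : R) (n : nat) (eta dd : R) : Prop :=
  [/\ ln (n%:R) `^ (- a) <= eta, eta <= 1,
      ln (n%:R) `^ c0 <= dd & dd <= n%:R].

Definition thm_conclusion (a kappa c0 Cm Cs : R) (n0m : R -> nat) (oK : option R) : Prop :=
  exists (C : R) (n0 : nat) (r : nat -> R -> R -> R),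
    0 < C /\ (0 < n0)%N /\
    (forall eps : R, 0 < eps -> exists N : nat, forall n eta dd, (N <= n)%N ->
        admissible a c0 n eta dd -> `|r n eta dd| <= eps) /\
    forall (n : nat) (eta dd sigma : R) (pi : {perm 'I_n})
           (d : measure_display) (T : measurableType d) (P : probability T R)
           (A B : T -> 'M[R]_n),
      (n0 <= n)%N -> admissible a c0 n eta dd -> 0 <= sigma <= 1 ->
      corr_wigner dd sigma pi P A B Cm Cs n0m ->
      (match oK with Some K => subgaussian_entries P A B K | None => True end) ->
      prob_atleast P [set w | X_bounds pi sigma eta C kappa (r n eta dd) (A w) (B w)]
                   (1 - (n%:R ^+ 10)^-1).
End Model.

(* Main.v *)
Require Import Defs.
From HB Require Import structures.
From mathcomp Require Import all_boot all_order all_algebra fingroup perm.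
From mathcomp Require Import all_classical all_reals all_analysis.
From mathcomp Require Import measurable_realfun complex ring lra.
Set Implicit Arguments. Unset Strict Implicit. Unset Printing Implicit Defensive.
Import Order.TTheory GRing.Theory Num.Theory.
Import numFieldNormedType.Exports.
Local Open Scope ring_scope.

(** The kernel eta/((l-m)^2+eta^2) is, up to a Riemann sum on a grid of points z = x + i eta/2, the
    integral over x of 1/((l-z)(m-conj z)), so that X_kl is approximately the real part of
    sum_z w (G_A(z) 1)_k conj (G_B(z) 1)_l with G the resolvents. A Schur complement with respect to
    T = {k, l} writes (G_A 1)_k = S_A (1 - a_k . u_A + small), where a_k is the k-th row of A outside
    T, u_A = G^(T) 1 is independent of that row, and S is a scalar of modulus at most 1 which decays
    like 1/|x|. Expanding, X_kl is a bilinear form in the independent rows a_k and b_l whose matrix M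
    depends only on the remaining entries, plus O(log n / sqrt eta). The resolvent identity gives
    |M|_F^2 <= C n^2 / eta, so the centred bilinear form is O(log n / sqrt eta) with high probability.
    For l = k its mean is (1/n) tr M, and |A - B| <= C sigma together with the averaged law
    (1/n) 1.G 1 = S + o(1), proved by summing the Schur formula over blocks of about log^3 n / eta^2
    rows, identifies the mean with 1/eta. All probabilistic inputs follow from one exponential
    supermartingale for predictable sums of bounded independent variables, applied to the entries
    truncated at exp(30) max(1, C) / sqrt d. *)

(** * Resolvents and minors *)

(** Bounding every Gram entry of the vectors u by their norms would only give |M|_F^2 of order n^2 /
    eta^2. At two grid points the Gram entry is at most 4 n / |z_s - conj z_t|, and summing its
    square over t saves a power of eta. A single entry of G 1 is not close to S, since a_k . u
    fluctuates by log n / sqrt eta up to constants. Rows removed together share one vector u, so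
    their sum over a block of b rows fluctuates only like sqrt b; the chosen b leaves a relative
    error (log n)^(-1/2), and this is r(n). No limiting law is computed. With s = (1/n) tr G, c =
    eta / 2 and S = -1 / (z + s), one has S close to s and exactly Im S = |S|^2 (c + Im s). The Ward
    identity gives |u|^2 close to n Im S / c, so (1/n) tr M is close to (1/c) sum_z w |S|^2 Im s,
    hence to (1/c) (sum_z w Im s - c sum_z w |S|^2). The first sum is nearly 1/2, because the
    eigenvalue distribution has mass 1, and 1 / (2 c) = 1 / eta; the second costs O(1). B is
    relabelled by the permutation, T is removed from both matrices, and the scalars use traces of
    minors; this keeps M independent of both rows although A and B are correlated. *)

Section ComplexModulus.
Context {R : realType}.
Local Notation C := R[i].
Implicit Types (x y z : C).

(* The library norm on [R[i]] takes its values in [R[i]]. *)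
Definition md (z : C) : R := Num.sqrt (complex.Re z ^+ 2 + complex.Im z ^+ 2).

Lemma md_normc z : md z = Normc.normc z.
Proof. by case: z. Qed.

Lemma md_ge0 z : 0 <= md z. Proof. exact: sqrtr_ge0. Qed.
Hint Resolve md_ge0 : core.
Lemma mdM x y : md (x * y) = md x * md y.
Proof. by rewrite !md_normc Normc.normcM. Qed.
Lemma mdD x y : md (x + y) <= md x + md y.
Proof. rewrite !md_normc; exact: le_normcD. Qed.
Lemma mdN x : md (- x) = md x.
Proof. by rewrite !md_normc normcN. Qed.
Lemma mdB x y : md (x - y) <= md x + md y.
Proof. by rewrite -(mdN y); exact: mdD. Qed.
Lemma mdBC x y : md (x - y) = md (y - x).
Proof. by rewrite -mdN opprB. Qed.
Lemma mdV x : md x^-1 = (md x)^-1.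
Proof. by rewrite !md_normc Normc.normcV. Qed.
Lemma md_real (a : R) : md a%:C%C = `|a|.
Proof. by rewrite /md /= expr0n addr0 sqrtr_sqr. Qed.
Lemma md0 : md 0 = 0. Proof. by rewrite (md_real 0) normr0. Qed.
Lemma md1 : md 1 = 1. Proof. by rewrite (md_real 1) normr1. Qed.
Lemma md_nat k : md k%:R = k%:R.
Proof. by rewrite -(rmorph_nat (real_complex R)) md_real normr_nat. Qed.
Lemma md_conj x : md x^*%C = md x.
Proof. by case: x => a b; rewrite /md /= sqrrN. Qed.
Lemma md_sqr x : md x ^+ 2 = complex.Re x ^+ 2 + complex.Im x ^+ 2.
Proof. by rewrite sqr_sqrtr // addr_ge0 // sqr_ge0. Qed.
Lemma Re_le_md x : `|complex.Re x| <= md x.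
Proof. by rewrite -sqrtr_sqr ler_wsqrtr // lerDl sqr_ge0. Qed.
Lemma Im_le_md x : `|complex.Im x| <= md x.
Proof. by rewrite -sqrtr_sqr ler_wsqrtr // lerDr sqr_ge0. Qed.
Lemma md_le_ReIm x : md x <= `|complex.Re x| + `|complex.Im x|.
Proof.
rewrite -(@ler_pXn2r _ 2) ?nnegrE ?addr_ge0 // md_sqr sqrrD !real_normK ?num_real //.
by rewrite lerD2r lerDl mulrn_wge0 // mulr_ge0.
Qed.
Lemma md_eq0 x : (md x == 0) = (x == 0).
Proof.
apply/eqP/eqP => [|->]; last exact: md0.
by rewrite md_normc => /Normc.eq0_normc.
Qed.
Lemma md_gt0 x : (0 < md x) = (x != 0).
Proof. by rewrite lt_def md_eq0 md_ge0 andbT. Qed.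
Lemma mulc_conj x : x * x^*%C = (md x ^+ 2)%:C%C.
Proof. by rewrite md_sqr; case: x => a b; simpc; rewrite -!expr2 [b * a]mulrC addNr. Qed.

Lemma md_sum (I : Type) (r : seq I) (P : pred I) (F : I -> C) :
  md (\sum_(i <- r | P i) F i) <= \sum_(i <- r | P i) md (F i).
Proof.
elim/big_ind2: _ => //; first by rewrite md0.
by move=> x a y b xa yb; apply: le_trans (mdD _ _) (lerD xa yb).
Qed.

Lemma ReD x y : complex.Re (x + y) = complex.Re x + complex.Re y.
Proof. by case: x y => [a b] [c d]. Qed.
Lemma ImD x y : complex.Im (x + y) = complex.Im x + complex.Im y.
Proof. by case: x y => [a b] [c d]. Qed.
Lemma ReN x : complex.Re (- x) = - complex.Re x.
Proof. by case: x. Qed.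
Lemma ImN x : complex.Im (- x) = - complex.Im x.
Proof. by case: x. Qed.
Lemma ReM x y : complex.Re (x * y) =
  complex.Re x * complex.Re y - complex.Im x * complex.Im y.
Proof. by case: x y => [a b] [c d]. Qed.
Lemma ImM x y : complex.Im (x * y) =
  complex.Re x * complex.Im y + complex.Im x * complex.Re y.
Proof. by case: x y => [a b] [c d]. Qed.
Lemma Re_sum (I : Type) (r : seq I) (P : pred I) (F : I -> C) :
  complex.Re (\sum_(i <- r | P i) F i) = \sum_(i <- r | P i) complex.Re (F i).
Proof. by elim/big_rec2: _ => // i a x _ <-; rewrite ReD. Qed.
Lemma Im_sum (I : Type) (r : seq I) (P : pred I) (F : I -> C) :
  complex.Im (\sum_(i <- r | P i) F i) = \sum_(i <- r | P i) complex.Im (F i).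
Proof. by elim/big_rec2: _ => // i a x _ <-; rewrite ImD. Qed.
Lemma ReMr (a : R) x : complex.Re (a%:C%C * x) = a * complex.Re x.
Proof. by rewrite ReM /= mul0r subr0. Qed.
Lemma ImMr (a : R) x : complex.Im (a%:C%C * x) = a * complex.Im x.
Proof. by rewrite ImM /= mul0r addr0. Qed.
Lemma conjcD x y : (x + y)^*%C = x^*%C + y^*%C. Proof. exact: raddfD. Qed.
Lemma conjcM x y : (x * y)^*%C = x^*%C * y^*%C. Proof. exact: rmorphM. Qed.
Lemma conjc_sum (I : Type) (r : seq I) (P : pred I) (F : I -> C) :
  (\sum_(i <- r | P i) F i)^*%C = \sum_(i <- r | P i) (F i)^*%C.
Proof. exact: raddf_sum. Qed.

End ComplexModulus.
#[export] Hint Resolve md_ge0 : core.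

Section CauchySchwarz.
Context {R : realType} {I : finType}.

Lemma sum_sqr_ge0 (F : I -> R) : 0 <= \sum_i F i ^+ 2.
Proof. by apply: sumr_ge0 => i _; exact: sqr_ge0. Qed.

(** Lagrange's identity: twice the gap between the two sides is the double sum of the squares of
    [F i * G j - F j * G i]. *)
Lemma cauchy_schwarz (F G : I -> R) :
  (\sum_i F i * G i) ^+ 2 <= (\sum_i F i ^+ 2) * (\sum_i G i ^+ 2).
Proof.
have : 0 <= \sum_i \sum_j (F i * G j - F j * G i) ^+ 2.
  by apply: sumr_ge0 => i _; apply: sumr_ge0 => j _; exact: sqr_ge0.
suff -> : \sum_i \sum_j (F i * G j - F j * G i) ^+ 2 =
  2 * ((\sum_i F i ^+ 2) * (\sum_i G i ^+ 2) - (\sum_i F i * G i) ^+ 2) by lra.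
have e1 : (\sum_i F i ^+ 2) * (\sum_i G i ^+ 2) = \sum_i \sum_j F i ^+ 2 * G j ^+ 2.
  by rewrite mulr_suml; apply: eq_bigr => i _; rewrite mulr_sumr.
have e1' : (\sum_i F i ^+ 2) * (\sum_i G i ^+ 2) = \sum_i \sum_j F j ^+ 2 * G i ^+ 2.
  by rewrite exchange_big /= -e1.
have e2 : (\sum_i F i * G i) ^+ 2 = \sum_i \sum_j (F i * G i) * (F j * G j).
  by rewrite expr2 mulr_suml; apply: eq_bigr => i _; rewrite mulr_sumr.
rewrite mulrBr (_ : 2 * (_ * _) = \sum_i \sum_j F i ^+ 2 * G j ^+ 2
  + \sum_i \sum_j F j ^+ 2 * G i ^+ 2); last by rewrite -e1 -e1'; lra.
rewrite e2 mulr_sumr -big_split -sumrB /=; apply: eq_bigr => i _.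
rewrite mulr_sumr -big_split -sumrB /=; apply: eq_bigr => j _; lra.
Qed.

Lemma cauchy_schwarz_sqrt (F G : I -> R) (a b : R) : 0 <= a -> 0 <= b ->
  \sum_i F i ^+ 2 <= a ^+ 2 -> \sum_i G i ^+ 2 <= b ^+ 2 ->
  `|\sum_i F i * G i| <= a * b.
Proof.
move=> a0 b0 Fa Gb; rewrite -(@ler_pXn2r _ 2) ?nnegrE ?mulr_ge0 //.
rewrite real_normK ?num_real // exprMn.
apply: le_trans (cauchy_schwarz _ _) _.
by apply: ler_pM => //; exact: sum_sqr_ge0.
Qed.

Lemma cauchy_schwarz_md (F G : I -> R[i]) (a b : R) : 0 <= a -> 0 <= b ->
  \sum_i md (F i) ^+ 2 <= a ^+ 2 -> \sum_i md (G i) ^+ 2 <= b ^+ 2 ->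
  \sum_i md (F i) * md (G i) <= a * b.
Proof.
move=> a0 b0 Fa Gb; apply: le_trans (ler_norm _) _.
exact: cauchy_schwarz_sqrt.
Qed.

End CauchySchwarz.

(** * The resolvent, its norm bound and the Ward identity *)

Section Resolvent.
Context {R : realType} {n : nat}.
Local Notation C := R[i].
Implicit Types (A B : 'M[R]_n) (z : C) (u v w y : 'cV[C]_n) (T : {set 'I_n}).

Definition toCm A : 'M[C]_n := map_mx (real_complex R) A.
Definition res A z : 'M[C]_n := invmx (toCm A - z%:M).
Definition n2 (v : 'cV[C]_n) : R := \sum_i md (v i 0) ^+ 2.
(** Bilinear, without conjugation: the resolvent is complex symmetric, so it moves across [dot]
    unchanged. The Hermitian product is [hdot]. *)
Definition dot (u v : 'cV[C]_n) : C := \sum_i u i 0 * v i 0.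
Definition unit_col (k : 'I_n) : 'cV[C]_n := delta_mx k 0.

Lemma n2_ge0 v : 0 <= n2 v.
Proof. by apply: sumr_ge0 => i _; exact: sqr_ge0. Qed.

Lemma dotC u v : dot u v = dot v u.
Proof. by apply: eq_bigr => i _; rewrite mulrC. Qed.

Lemma dotBr u v w : dot u (v - w) = dot u v - dot u w.
Proof. by rewrite -sumrB; apply: eq_bigr => i _; rewrite !mxE mulrBr. Qed.

Lemma dotZr u a v : dot u (a *: v) = a * dot u v.
Proof. by rewrite mulr_sumr; apply: eq_bigr => i _; rewrite mxE mulrCA. Qed.

Lemma dot_sumr u (I : Type) (r : seq I) (P : pred I) F :
  dot u (\sum_(i <- r | P i) F i) = \sum_(i <- r | P i) dot u (F i).
Proof.
rewrite /dot exchange_big /=; apply: eq_bigr => i _.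
by rewrite summxE mulr_sumr.
Qed.

Lemma dot_unit_col u k : dot (unit_col k) u = u k 0.
Proof.
rewrite /dot (bigD1 k) //= mxE !eqxx mul1r big1 ?addr0 // => i ik.
by rewrite mxE (negbTE ik) mul0r.
Qed.

Lemma md_dot u v (a b : R) : 0 <= a -> 0 <= b -> n2 u <= a ^+ 2 -> n2 v <= b ^+ 2 ->
  md (dot u v) <= a * b.
Proof.
move=> a0 b0 ua vb; apply: le_trans (md_sum _ _ _) _.
under eq_bigr do rewrite mdM.
exact: cauchy_schwarz_md.
Qed.

Lemma shift_mulE A z (y : 'cV[C]_n) i :
  ((toCm A - z%:M) *m y) i 0 = \sum_j (A i j)%:C%C * y j 0 - z * y i 0.
Proof.
rewrite mulmxBl mul_scalar_mx !mxE; congr (_ - _).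
by apply: eq_bigr => j _; rewrite mxE.
Qed.

(** The quadratic form of a real symmetric matrix is real: the terms in [A i j] are antisymmetric
    under exchange of i and j and cancel. Invertibility of A - z, the norm bound and the Ward
    identity are all read off from this. *)
Lemma im_form A z (y : 'cV[C]_n) : A^T = A ->
  \sum_i complex.Im ((y i 0)^*%C * ((toCm A - z%:M) *m y) i 0) = - complex.Im z * n2 y.
Proof.
move=> sA.
transitivity (\sum_i (\sum_j A i j * (complex.Re (y i 0) * complex.Im (y j 0) -
    complex.Im (y i 0) * complex.Re (y j 0)) - complex.Im z * md (y i 0) ^+ 2)).
  apply: eq_bigr => i _; rewrite shift_mulE mulrBr ImD ImN mulr_sumr Im_sum.
  congr (_ - _).
    apply: eq_bigr => j _; rewrite mulrCA ImMr ImM.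
    by case: (y i 0) (y j 0) => [a b] [c e] /=; lra.
  rewrite mulrCA [_^*%C * _]mulrC mulc_conj ImM /=; lra.
rewrite sumrB -mulr_sumr mulNr; apply/eqP; rewrite -subr_eq0 opprK addrNK; apply/eqP.
set s := (X in X = 0).
suff : s = - s by lra.
rewrite {1}/s exchange_big /= -sumrN; apply: eq_bigr => i _.
rewrite -sumrN; apply: eq_bigr => j _.
have -> : A j i = A i j by rewrite -[in LHS]sA mxE.
by lra.
Qed.

Lemma res_unit A z : A^T = A -> 0 < complex.Im z -> toCm A - z%:M \in unitmx.
Proof.
move=> sA z0; rewrite unitmxE unitfE; apply/negP => /det0P[v v0 vA].
have sM : (toCm A - z%:M)^T = toCm A - z%:M.
  by rewrite linearB /= tr_scalar_mx /toCm map_trmx sA.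
have vA' : (toCm A - z%:M) *m v^T = 0.
  by rewrite -{1}sM -trmx_mul vA trmx0.
have := im_form z v^T sA; rewrite vA'.
rewrite big1 => [|i _]; last by rewrite [(0 : 'cV[C]_n) i 0]mxE mulr0.
move/esym/eqP; rewrite mulNr oppr_eq0 mulf_eq0 gt_eqF //= => /eqP n0.
case/negP: v0; apply/eqP/rowP => i; rewrite mxE.
have /eqP := n0; rewrite /n2 psumr_eq0; last by move=> j _; exact: sqr_ge0.
move/allP/(_ i); rewrite mem_index_enum => /(_ isT) /=.
by rewrite sqrf_eq0 md_eq0 mxE => /eqP.
Qed.

Lemma res_mulK A z v : A^T = A -> 0 < complex.Im z ->
  (toCm A - z%:M) *m (res A z *m v) = v.
Proof. by move=> sA z0; rewrite mulKVmx // res_unit. Qed.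

Lemma res_uniq A z v y : A^T = A -> 0 < complex.Im z ->
  (toCm A - z%:M) *m y = v -> y = res A z *m v.
Proof. by move=> sA z0 <-; rewrite mulKmx // res_unit. Qed.

Lemma res_sym A z : A^T = A -> 0 < complex.Im z -> (res A z)^T = res A z.
Proof.
move=> sA z0; rewrite /res trmx_inv; congr invmx.
by rewrite linearB /= tr_scalar_mx /toCm map_trmx sA.
Qed.

Lemma res_symE A z i j : A^T = A -> 0 < complex.Im z -> res A z i j = res A z j i.
Proof. by move=> sA z0; rewrite -[in LHS](res_sym sA z0) mxE. Qed.

Lemma dot_res A z u v : A^T = A -> 0 < complex.Im z ->
  dot u (res A z *m v) = dot (res A z *m u) v.
Proof.
move=> sA z0; rewrite /dot.
under eq_bigr do rewrite mxE mulr_sumr.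
rewrite exchange_big /=; apply: eq_bigr => i _.
rewrite mxE mulr_suml; apply: eq_bigr => j _.
by rewrite (res_symE _ _ sA z0); ring.
Qed.

Definition real_col (v : 'cV[C]_n) := forall i, complex.Im (v i 0) = 0.

(** The Ward identity is [im_form] at y = G v; a real v lets the pairing go without conjugation. It
    turns a squared norm into the imaginary part of one scalar, and this later improves bounds of
    order n / c^2 to order n / c. *)
Lemma ward A z v : A^T = A -> 0 < complex.Im z -> real_col v ->
  complex.Im (dot v (res A z *m v)) = complex.Im z * n2 (res A z *m v).
Proof.
move=> sA z0 rv; have := im_form z (res A z *m v) sA.
rewrite res_mulK // => h; apply: oppr_inj; rewrite -mulNr -h Im_sum -sumrN.
apply: eq_bigr => i _; move: (rv i); case: (v i 0) => a b /= ->.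
by case: ((res A z *m v) i 0) => c e /=; lra.
Qed.

(** The operator bound |G| <= 1 / Im z in squared form: [im_form] and Cauchy-Schwarz give Im z |y|^2
    <= |y| |v|, from which one factor |y| is divided out. *)
Lemma res_n2 A z v : A^T = A -> 0 < complex.Im z ->
  complex.Im z ^+ 2 * n2 (res A z *m v) <= n2 v.
Proof.
move=> sA z0; have := im_form z (res A z *m v) sA.
rewrite res_mulK //; set y := res A z *m v => h.
have h1 : complex.Im z * n2 y <= Num.sqrt (n2 y) * Num.sqrt (n2 v).
  rewrite -[leLHS]opprK -mulNr -h -sumrN.
  apply: (@le_trans _ _ (\sum_i md (y i 0) * md (v i 0))).
    apply: ler_sum => i _; apply: le_trans (ler_norm _) _.
    by rewrite normrN; apply: le_trans (Im_le_md _) _; rewrite mdM md_conj.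
  by apply: cauchy_schwarz_md; rewrite ?sqrtr_ge0 // sqr_sqrtr ?n2_ge0.
have [y0|y0] := eqVneq (n2 y) 0; first by rewrite y0 mulr0 n2_ge0.
have yp : 0 < n2 y by rewrite lt_def y0 n2_ge0.
have : (complex.Im z * n2 y) ^+ 2 <= (Num.sqrt (n2 y) * Num.sqrt (n2 v)) ^+ 2.
  by rewrite ler_pXn2r // nnegrE ?mulr_ge0 ?sqrtr_ge0 ?n2_ge0 // ltW.
rewrite !exprMn !sqr_sqrtr ?n2_ge0 // expr2 [n2 y ^+ 2]expr2 mulrA -expr2.
by rewrite [n2 y * n2 v]mulrC ler_pM2r.
Qed.

Lemma n2_unit_col k : n2 (unit_col k) = 1.
Proof.
rewrite /n2 (bigD1 k) //= mxE !eqxx (@md_nat R 1) expr1n big1 ?addr0 // => i ik.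
by rewrite mxE (negbTE ik) (@md_nat R 0) expr0n.
Qed.

Lemma real_unit_col k : real_col (unit_col k).
Proof. by move=> i; rewrite mxE; case: (_ && _). Qed.

Lemma res_col A z k i : (res A z *m unit_col k) i 0 = res A z i k.
Proof.
rewrite mxE (bigD1 k) //= mxE !eqxx mulr1 big1 ?addr0 // => j jk.
by rewrite mxE (negbTE jk) mulr0.
Qed.

Lemma ward_diag A z k : A^T = A -> 0 < complex.Im z ->
  complex.Im (res A z k k) = complex.Im z * n2 (res A z *m unit_col k).
Proof.
by move=> sA z0; rewrite -ward ?dot_unit_col ?res_col //; exact: real_unit_col.
Qed.

Lemma md_res_le A z i j : A^T = A -> 0 < complex.Im z ->
  md (res A z i j) <= (complex.Im z)^-1.
Proof.
move=> sA z0; have := res_n2 (unit_col j) sA z0; rewrite n2_unit_col => h.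
have c0 := ltW z0; rewrite -(@ler_pXn2r _ 2) ?nnegrE ?invr_ge0 ?md_ge0 // exprVn.
rewrite -[leRHS]mul1r ler_pdivlMr ?exprn_gt0 // mulrC.
apply: le_trans h; rewrite ler_pM2l ?exprn_gt0 // -res_col /n2 (bigD1 i) //=.
by rewrite lerDl; apply: sumr_ge0 => k _; exact: sqr_ge0.
Qed.

End Resolvent.

(** * Minors and Schur complements *)

Section Minors.
Context {R : realType} {n : nat}.
Local Notation C := R[i].
Implicit Types (A B : 'M[R]_n) (z : C) (T : {set 'I_n}) (u v y b : 'cV[C]_n).

(* The minor with rows and columns in [T] removed is kept at size [n] by zeroing them. *)
Definition mask T A : 'M[R]_n :=
  \matrix_(i, j) if (i \in T) || (j \in T) then 0 else A i j.
Definition mcol T v : 'cV[C]_n := \col_i if i \in T then 0 else v i 0.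
Definition al T A j : 'cV[C]_n := \col_i if i \in T then 0 else (A j i)%:C%C.
Definition ones : 'cV[C]_n := const_mx 1.
Definition str T A z : C := (\tr (res (mask T A) z)) / n%:R.

Lemma mask_sym T A : A^T = A -> (mask T A)^T = mask T A.
Proof.
by move=> sA; apply/matrixP => i j; rewrite !mxE orbC; case: ifP => // _; rewrite -[in LHS]sA mxE.
Qed.

Lemma mask0 A : mask finset.set0 A = A.
Proof. by apply/matrixP => i j; rewrite !mxE !inE. Qed.

Lemma maskU T T' A : mask T (mask T' A) = mask (T :|: T') A.
Proof.
by apply/matrixP => i j; rewrite !mxE !inE; do 4! case: (_ \in _).
Qed.

Lemma mcol_real T v : real_col v -> real_col (mcol T v).
Proof. by move=> rv i; rewrite mxE; case: ifP. Qed.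

Lemma real_ones : real_col ones.
Proof. by move=> i; rewrite mxE. Qed.

Lemma real_al T A j : real_col (al T A j).
Proof. by move=> i; rewrite mxE; case: ifP. Qed.

Section Schur.
Variables (T : {set 'I_n}) (A : 'M[R]_n) (z : C) (b y : 'cV[C]_n).
Hypotheses (sA : A^T = A) (z0 : 0 < complex.Im z).
Hypothesis yb : (toCm A - z%:M) *m y = b.

(** The equations outside T, with the columns of T moved to the right side, form a system for the
    minor. The right side b stays general: unit columns give entries of the resolvent and [ones]
    gives its row sums. *)
Lemma schur_mcol : mcol T y =
  res (mask T A) z *m (mcol T b - \sum_(j in T) y j 0 *: al T A j).
Proof.
apply: res_uniq => //; first exact: mask_sym.
apply/colP => i; rewrite shift_mulE !mxE summxE; case: ifP => iT.
  rewrite mulr0 subr0 [X in _ - X]big1 ?subr0 => [|j _]; last by rewrite !mxE iT mulr0.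
  by apply: big1 => j _; rewrite !mxE iT mul0r.
rewrite -yb shift_mulE (bigID (mem T)) /= big1 ?add0r => [|j jT]; last first.
  by rewrite !mxE jT orbT mul0r.
rewrite [in RHS](bigID (mem T)) /=.
rewrite [X in _ = _ - X](eq_bigr (fun j => (A i j)%:C%C * y j 0)) => [|j jT]; last first.
  rewrite !mxE iT mulrC; have -> // : A j i = A i j.
  by rewrite -[in LHS]sA mxE.
rewrite [X in X - _ = _](eq_bigr (fun j => (A i j)%:C%C * y j 0)) => [|j /negbTE jT].
  by ring.
by rewrite !mxE iT jT.
Qed.

(** The equation of row k once the unknowns outside T are eliminated: what remains is a system on T
    alone. *)
Lemma schur_row k : k \in T ->
  - z * y k 0 = b k 0 - dot (al T A k) (res (mask T A) z *m mcol T b) -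
    \sum_(j in T) ((A k j)%:C%C - dot (al T A k) (res (mask T A) z *m al T A j)) * y j 0.
Proof.
move=> kT; rewrite -yb shift_mulE (bigID (mem T)) /=.
have -> : \sum_(i < n | i \notin T) (A k i)%:C%C * y i 0 = dot (al T A k) (mcol T y).
  rewrite /dot [RHS](bigID (mem T)) /= [X in _ = X + _]big1 ?add0r; last first.
    by move=> i iT; rewrite !mxE iT mul0r.
  by apply: eq_bigr => i /negbTE iT; rewrite !mxE iT.
rewrite schur_mcol mulmxBr dotBr mulmx_sumr dot_sumr yb.
under [X in _ + (_ - X)]eq_bigr do rewrite -scalemxAr dotZr mulrC.
under [X in _ = _ - X]eq_bigr do rewrite mulrBl.
by rewrite sumrB; ring.
Qed.

End Schur.

(* The kernel of [A - z] restricted to [T] is decoupled from the minor. *)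
Lemma res_mask_in T A z v k : A^T = A -> 0 < complex.Im z -> k \in T ->
  - z * (res (mask T A) z *m v) k 0 = v k 0.
Proof.
move=> sA z0 kT; have sM := mask_sym T sA.
rewrite -[in RHS](res_mulK v sM z0) shift_mulE big1 ?sub0r ?mulNr // => j _.
by rewrite mxE kT mul0r.
Qed.

Lemma Im_gt0_neq0 z : 0 < complex.Im z -> z != 0.
Proof. by move=> z0; apply: contraTneq z0 => ->; rewrite ltxx. Qed.

Lemma n2_eq0 v : n2 v = 0 -> v = 0.
Proof.
move=> /eqP; rewrite /n2 psumr_eq0; last by move=> j _; exact: sqr_ge0.
move=> /allP h; apply/colP => i; move: (h i); rewrite mem_index_enum => /(_ isT) /=.
by rewrite sqrf_eq0 md_eq0 mxE => /eqP.
Qed.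

Lemma Im_res_gt0 A z k : A^T = A -> 0 < complex.Im z -> 0 < complex.Im (res A z k k).
Proof.
move=> sA z0; rewrite ward_diag // mulr_gt0 // lt_def n2_ge0 andbT.
apply/eqP => /n2_eq0 h; have := res_mulK (unit_col k) sA z0.
rewrite h mulmx0 => /colP/(_ k); rewrite !mxE !eqxx => /eqP.
by rewrite eq_sym oner_eq0.
Qed.

(** Elimination gives G_jj - G'_jj = G_jk^2 / G_kk for j other than k. The sum of these terms is at
    most |G e_k|^2 / |G_kk|, hence at most 1 / Im z by the Ward identity. The second 1 / Im z pays
    for the entry at k of the padded minor. *)
Lemma tr_minor1 A z k : A^T = A -> 0 < complex.Im z ->
  md (\tr (res A z) - \tr (res (mask [set k]%SET A) z)) <= 2 / complex.Im z.
Proof.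
move=> sA z0; set c := complex.Im z; set G := res A z; set G' := res _ z.
have sM := mask_sym [set k]%SET sA.
have yE j : (toCm A - z%:M) *m (G *m unit_col j) = unit_col j by exact: res_mulK.
pose h i : C := (G' *m al [set k]%SET A k) i 0.
have Gk i : i != k -> G i k = - (h i * G k k).
  move=> ik; have /colP/(_ i) := schur_mcol [set k]%SET sA z0 (yE k).
  rewrite big_set1 !res_col -/G -/G'.
  have -> : mcol [set k]%SET (unit_col k) = 0.
    by apply/colP => l; rewrite !mxE inE; case: eqP.
  rewrite sub0r mulmxN -scalemxAr [mcol _ _ _ _]mxE inE (negbTE ik) res_col => ->.
  by rewrite [LHS]mxE [in LHS]mxE -/(h i) mulrC.
have Gj j i : j != k -> i != k -> G i j = G' i j - h i * G k j.
  move=> jk ik; have /colP/(_ i) := schur_mcol [set k]%SET sA z0 (yE j).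
  rewrite big_set1 !res_col -/G -/G'.
  have -> : mcol [set k]%SET (unit_col j) = unit_col j.
    by apply/colP => l; rewrite !mxE inE; case: (eqVneq l k) => // ->; rewrite eq_sym (negbTE jk).
  rewrite mulmxBr -scalemxAr [mcol _ _ _ _]mxE inE (negbTE ik) res_col => ->.
  rewrite [LHS]mxE res_col; congr (_ + _).
  by rewrite [LHS]mxE [in LHS]mxE -/(h i) mulrC.
have Gs i j : G i j = G j i by exact: res_symE.
have I0 : 0 < complex.Im (G k k) by exact: Im_res_gt0.
have G0 := Im_gt0_neq0 I0.
set E := \sum_j G j k ^+ 2 / G k k.
have trE : \tr G - \tr G' = E - G' k k.
  rewrite /mxtrace /E (bigD1 k) //= [X in _ - X](bigD1 k) //= [in RHS](bigD1 k) //=.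
  rewrite expr2 mulfK // opprD addrACA -sumrB.
  rewrite (eq_bigr (fun j => G j k ^+ 2 / G k k)) => [|j jk]; first by ring.
  by rewrite (Gj j j) // (Gs k j) (Gk j jk); field.
rewrite trE; apply: le_trans (mdB _ _) _.
have -> : 2 / c = c^-1 + c^-1 by rewrite mulrDl mul1r.
apply: lerD; last exact: md_res_le.
rewrite /E -mulr_suml mdM mdV ler_pdivrMr ?md_gt0 //.
apply: (@le_trans _ _ (n2 (G *m unit_col k))).
  apply: le_trans (md_sum _ _ _) _; apply: ler_sum => j _.
  by rewrite res_col expr2 mdM -expr2.
rewrite mulrC ler_pdivlMr // mulrC -ward_diag //.
by apply: le_trans (ler_norm _) (Im_le_md _).
Qed.

Lemma tr_minor A z T : A^T = A -> 0 < complex.Im z ->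
  md (\tr (res A z) - \tr (res (mask T A) z)) <= (#|T|%:R * 2) / complex.Im z.
Proof.
move=> sA z0; have [m] := ubnP #|T|; elim: m T => // m IH T.
have [->|] := set_0Vmem T.
  by rewrite mask0 cards0 subrr md0 !mul0r.
move=> [k kT] hT; rewrite -(finset.setD1K kT) -maskU.
have := cardsD1 k T; rewrite kT add1n => cT.
set T' := (T :\ k)%SET.
have sM := mask_sym T' sA.
have -> : \tr (res A z) - \tr (res (mask [set k]%SET (mask T' A)) z) =
  (\tr (res A z) - \tr (res (mask T' A) z)) +
  (\tr (res (mask T' A) z) - \tr (res (mask [set k]%SET (mask T' A)) z)).
  by rewrite addrA subrK.
apply: le_trans (mdD _ _) _; rewrite finset.setD1K // cT -natr1 2!mulrDl mul1r.
by apply: lerD; [apply: IH; rewrite cT ltnS in hT | exact: tr_minor1].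
Qed.

Lemma res_mask_ones T A z k : A^T = A -> 0 < complex.Im z -> k \in T ->
  (res (mask T A) z *m mcol T ones) k 0 = 0.
Proof.
move=> sA z0 kT; have := res_mask_in (mcol T ones) sA z0 kT.
rewrite [mcol _ _ _ _]mxE kT => /eqP; rewrite mulf_eq0 oppr_eq0.
by rewrite (negbTE (Im_gt0_neq0 z0)) => /eqP.
Qed.

Lemma res_identity A B z : A^T = A -> B^T = B -> 0 < complex.Im z ->
  forall v, res A z *m v - res B z *m v = res A z *m (toCm (B - A) *m (res B z *m v)).
Proof.
move=> sA sB z0 v; set y := res B z *m v.
rewrite -[in LHS](res_mulK v sB z0) -/y.
rewrite -[X in _ - X](mulKmx (res_unit sA z0)) -/(res A z) -mulmxBr -mulmxBl.
congr (_ *m (_ *m _)); rewrite /toCm map_mxB /=.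
by rewrite opprB addrA subrK.
Qed.

Lemma mcol_unit_col T k : k \in T -> mcol T (unit_col k) = 0 :> 'cV[C]_n.
Proof.
move=> kT; apply/colP => l; rewrite !mxE; case: ifPn => // lT.
by case: eqP lT => // ->; rewrite kT.
Qed.

Lemma dot0r v : dot v 0 = 0.
Proof. by apply: big1 => i _; rewrite [(0 : 'cV[C]_n) i 0]mxE mulr0. Qed.

Definition hdot u v : C := \sum_i u i 0 * (v i 0)^*%C.

Lemma hdot_self u : hdot u u = (n2 u)%:C%C.
Proof.
rewrite /hdot /n2 rmorph_sum /=; apply: eq_bigr => i _.
by rewrite mulc_conj.
Qed.

Lemma md_hdot u v (a b : R) : 0 <= a -> 0 <= b -> n2 u <= a ^+ 2 -> n2 v <= b ^+ 2 ->
  md (hdot u v) <= a * b.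
Proof.
move=> a0 b0 ua vb; apply: le_trans (md_sum _ _ _) _.
under eq_bigr do rewrite mdM md_conj.
exact: cauchy_schwarz_md.
Qed.

(** The Ward identity polarised at two spectral points, a form of the first resolvent identity. The
    factor z - conj z' grows with the distance of the real parts, and the Frobenius bound on M rests
    on this decay. *)
Lemma res_two_points A z z' v : A^T = A -> 0 < complex.Im z -> 0 < complex.Im z' ->
  real_col v ->
  hdot (res A z *m v) (res A z' *m v) * (z - z'^*%C) =
  dot v (res A z *m v) - (dot v (res A z' *m v))^*%C.
Proof.
move=> sA z0 z0' rv; set u := res A z *m v; set u' := res A z' *m v.
have vc i : v i 0 = (v i 0)^*%C.
  by move: (rv i); case: (v i 0) => a b /= ->; rewrite oppr0.
have e1 : (dot v u')^*%C = \sum_i (\sum_j (A i j)%:C%C * u j 0 * (u' i 0)^*%C - z * (u i 0 * (u' i 0)^*%C)).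
  rewrite conjc_sum; apply: eq_bigr => i _.
  rewrite conjcM -vc -{1}(res_mulK v sA z0) -/u shift_mulE mulrBl mulr_suml.
  by congr (_ - _); ring.
have e2 : dot v u = \sum_i (\sum_j (A i j)%:C%C * u i 0 * (u' j 0)^*%C - z'^*%C * (u i 0 * (u' i 0)^*%C)).
  apply: eq_bigr => i _.
  rewrite vc -{1}(res_mulK v sA z0') -/u' shift_mulE conjcD raddfN conjc_sum /= conjcM.
  rewrite mulrBl mulr_suml; congr (_ - _); last by ring.
  by apply: eq_bigr => j _; rewrite conjcM conjc_real; ring.
rewrite e1 e2 !sumrB -!mulr_sumr -/(hdot u u').
have -> : \sum_i \sum_j (A i j)%:C%C * u j 0 * (u' i 0)^*%C =
          \sum_i \sum_j (A i j)%:C%C * u i 0 * (u' j 0)^*%C.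
  rewrite exchange_big /=; apply: eq_bigr => i _; apply: eq_bigr => j _.
  by have -> : A j i = A i j by rewrite -[in LHS]sA mxE.
by ring.
Qed.

End Minors.

(** * Riemann sums of Cauchy kernels *)

Section Calculus.
Context {R : realType}.
Implicit Types (x y c : R).

Lemma MVT_everywhere (f df : R -> R) (a b : R) : a <= b ->
  (forall x, a <= x <= b -> is_derive x 1 f (df x)) ->
  exists2 x, a <= x <= b & f b - f a = df x * (b - a).
Proof.
rewrite le_eqVlt => /predU1P[<- _|ab fd].
  by exists a; rewrite ?lexx // !subrr mulr0.
have fd' x : x \in `]a, b[ -> is_derive x 1 f (df x).
  by rewrite in_itv /= => /andP[/ltW ax /ltW xb]; apply: fd; rewrite ax xb.
have fc : {within `[a, b], continuous f}%classic.
  by apply: derivable_within_continuous => x; rewrite in_itv /= => /fd[].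
have [x xab e] := MVT ab fd' fc.
by exists x => //; move: xab; rewrite in_itv /= => /andP[/ltW-> /ltW->].
Qed.

Lemma is_derive_shift_div (c y x : R) : is_derive x 1 (fun x => (x - y) / c) c^-1.
Proof.
have -> : (fun x => (x - y) / c) = (id - cst y) * cst c^-1 :> (R -> R) by [].
apply: is_derive_eq.
by rewrite /GRing.scale /= mulr0 add0r subr0 mulr1.
Qed.

Lemma is_derive_atan_shift (c y x : R) : 0 < c ->
  is_derive x 1 (fun x => atan ((x - y) / c)) (c / ((x - y) ^+ 2 + c ^+ 2)).
Proof.
move=> c0; have c1 : c != 0 by rewrite gt_eqF.
have s0 : (x - y) ^+ 2 + c ^+ 2 != 0.
  by rewrite gt_eqF // ltr_wpDl ?sqr_ge0 // exprn_gt0.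
have d1 := is_derive_shift_div c y x.
have d2 := @is_derive1_comp R atan (fun x => (x - y) / c) x _ _ (is_derive1_atan ((x - y) / c)) d1.
apply: (is_derive_eq d2); rewrite /GRing.scale /=.
by field; rewrite c1 s0.
Qed.

Lemma is_derive_ln_shift (c y x : R) : 0 < c ->
  is_derive x 1 (fun x => ln ((x - y) ^+ 2 + c ^+ 2) / 2)
     ((x - y) / ((x - y) ^+ 2 + c ^+ 2)).
Proof.
move=> c0.
have s0 : 0 < (x - y) ^+ 2 + c ^+ 2 by rewrite ltr_wpDl ?sqr_ge0 // exprn_gt0.
have d1 : is_derive x 1 (fun x => (x - y) ^+ 2 + c ^+ 2) (2 * (x - y)).
  have -> : (fun x => (x - y) ^+ 2 + c ^+ 2) = (id - cst y) ^+ 2 + cst (c ^+ 2) :> (R -> R).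
    by [].
  by apply: is_derive_eq; rewrite /GRing.scale /= subr0 addr0 expr1 mulr1 -mulr_natl.
have d2 := @is_derive1_comp R (@ln R) (fun x => (x - y) ^+ 2 + c ^+ 2) x _ _ (is_derive1_ln s0) d1.
have -> : (fun x => ln ((x - y) ^+ 2 + c ^+ 2) / 2) =
   (@ln R \o (fun x => (x - y) ^+ 2 + c ^+ 2)) * cst 2^-1 :> (R -> R) by [].
apply: is_derive_eq; rewrite /GRing.scale /= mulr0 add0r.
by field; rewrite gt_eqF.
Qed.

(** The function atan x + 1 / x decreases on the positive half-line and its limit is pi / 2. The
    limit is avoided: if the value t at y were below pi / 2, then atan Y would reach t for some Y
    beyond y, while monotonicity forces atan Y + 1 / Y <= t. *)
Lemma pihalf_atan_le y : 0 < y -> pi / 2 - atan y <= y^-1.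
Proof.
move=> y0; rewrite lerBlDr leNgt; apply/negP => h.
set t := y^-1 + atan y in h.
have ay : - (pi / 2) < atan y by exact: atan_gtNpi2.
have tin : t \in `](- (pi / 2)), (pi / 2)[.
  rewrite in_itv /= h andbT (lt_le_trans ay) // lerDr.
  by rewrite invr_ge0 ltW.
set Y := Num.max (tan t) y.
have yY : y <= Y by rewrite le_max lexx orbT.
have [x /andP[yx xY] e] : exists2 x, y <= x <= Y &
    (atan Y + Y^-1) - (atan y + y^-1) = ((1 + x ^+ 2)^-1 - x ^- 2) * (Y - y).
  apply: (@MVT_everywhere (fun x => atan x + x^-1) (fun x => (1 + x ^+ 2)^-1 - x ^- 2)) => // x /andP[yx _].
  have x0 : 0 < x by exact: lt_le_trans yx.
  have d1 := is_derive1_atan x.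
  have d2 : is_derive x 1 (fun x : R => x^-1) (- x ^- 2).
    by apply: is_derive_eq; [apply: is_deriveV; rewrite gt_eqF | rewrite /GRing.scale /= mulr1].
  exact: is_deriveD d1 d2.
have x0 : 0 < x by exact: lt_le_trans yx.
have : (atan Y + Y^-1) - (atan y + y^-1) <= 0.
  rewrite e mulr_le0_ge0 ?subr_ge0 // subr_le0 lef_pV2 ?posrE ?exprn_gt0 //; last first.
    by rewrite ltr_pwDl ?sqr_ge0.
  by rewrite lerDr.
have : t <= atan Y.
  by rewrite -[leLHS](tanK tin) le_atan // le_max lexx.
have : 0 < Y^-1 by rewrite invr_gt0 (lt_le_trans y0).
rewrite /t; lra.
Qed.

End Calculus.

(** * Riemann sums of Lorentzians and of their conjugate kernels *)

Section Quadrature.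
Context {R : realType}.
Implicit Types (x y c L h : R).

Lemma norm_le_split (x b : R) : `|x| <= b -> - b <= x /\ x <= b.
Proof. by rewrite ler_norml => /andP[]. Qed.

Lemma riemann_sum (f F : R -> R) (K h a : R) (N : nat) : 0 <= h ->
  (forall x, is_derive x 1 F (f x)) ->
  (forall x y, `|f x - f y| <= K * `|x - y|) ->
  `|\sum_(t < N) h * f (a + t%:R * h) - (F (a + N%:R * h) - F a)| <= N%:R * (K * h ^+ 2).
Proof.
move=> h0 dF lf; elim: N => [|N IH].
  by rewrite big_ord0 mul0r addr0 subrr subrr normr0 mul0r.
rewrite big_ord_recr /=.
set b := a + N%:R * h in IH *.
have bS : a + N.+1%:R * h = b + h by rewrite /b -natr1; ring.
have [x /andP[bx xb] e] : exists2 x, b <= x <= b + h & F (b + h) - F b = f x * (b + h - b).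
  by apply: MVT_everywhere => //; rewrite lerDl.
rewrite bS.
have -> : \sum_(i < N) h * f (a + i%:R * h) + h * f b - (F (b + h) - F a) =
  (\sum_(i < N) h * f (a + i%:R * h) - (F b - F a)) + h * (f b - f x).
  have e' : f x * h = F (b + h) - F b by rewrite e [b + h]addrC addrK.
  by rewrite mulrBr [h * f x]mulrC e'; ring.
apply: le_trans (ler_normD _ _) _.
rewrite -natr1 mulrDl mul1r; apply: lerD => //.
rewrite normrM (ger0_norm h0) expr2 mulrCA ler_wpM2l //.
apply: le_trans (lf _ _) _.
have K0 : 0 <= K by have := lf 1 0; rewrite subr0 normr1 mulr1; apply: le_trans.
by apply: ler_wpM2l => //; rewrite distrC ger0_norm ?subr_ge0 // lerBlDl.
Qed.

Section Lipschitz.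
Variables (c a b : R).
Hypothesis c0 : 0 < c.

Let Da := a ^+ 2 + c ^+ 2.
Let Db := b ^+ 2 + c ^+ 2.

Lemma lorentz_denom_gt0 : 0 < a ^+ 2 + c ^+ 2.
Proof. by rewrite ltr_wpDl ?sqr_ge0 // exprn_gt0. Qed.

(** Both kernels have a divided difference of the form W / (D_a D_b). With x and y the shifted
    arguments the numerators are, up to sign, c (x + y) and c^2 - x y, and the sum of their squares
    is exactly D_a D_b, so each satisfies the hypothesis. *)
Lemma lipschitz_aux (W : R) : W ^+ 2 <= (a ^+ 2 + c ^+ 2) * (b ^+ 2 + c ^+ 2) ->
  `|W / ((a ^+ 2 + c ^+ 2) * (b ^+ 2 + c ^+ 2))| <= c ^- 2.
Proof.
move=> hW; set D := _ * _ in hW *.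
have c2 : 0 < c ^+ 2 by rewrite exprn_gt0.
have D1 : c ^+ 2 * c ^+ 2 <= D.
  by apply: ler_pM; rewrite ?lerDr ?sqr_ge0.
have D0 : 0 < D by apply: lt_le_trans D1; rewrite mulr_gt0.
rewrite normrM normfV (gtr0_norm D0) ler_pdivrMr // mulrC ler_pdivlMr //.
have D00 := ltW D0; have c20 := ltW c2.
rewrite -(@ler_pXn2r _ 2) ?nnegrE ?D00 ?(mulr_ge0 _ c20) // exprMn real_normK ?num_real //.
rewrite [leRHS]expr2; apply: ler_pM => //; first exact: sqr_ge0.
by rewrite sqr_ge0.
Qed.
End Lipschitz.

Lemma lipschitz_lorentz (c y a b : R) : 0 < c ->
  `|c / ((a - y) ^+ 2 + c ^+ 2) - c / ((b - y) ^+ 2 + c ^+ 2)| <= c ^- 2 * `|a - b|.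
Proof.
move=> c0; have Da := lorentz_denom_gt0 (a - y) c0; have Db := lorentz_denom_gt0 (b - y) c0.
have -> : c / ((a - y) ^+ 2 + c ^+ 2) - c / ((b - y) ^+ 2 + c ^+ 2) =
  (c * (- (a - y) - (b - y))) / (((a - y) ^+ 2 + c ^+ 2) * ((b - y) ^+ 2 + c ^+ 2)) * (a - b).
  by field; rewrite !gt_eqF.
rewrite normrM ler_wpM2r //; apply: lipschitz_aux => //.
have := sqr_ge0 ((a - y) * (b - y) - c ^+ 2); nra.
Qed.

Lemma lipschitz_lorentz_odd (c y a b : R) : 0 < c ->
  `|(a - y) / ((a - y) ^+ 2 + c ^+ 2) - (b - y) / ((b - y) ^+ 2 + c ^+ 2)| <= c ^- 2 * `|a - b|.
Proof.
move=> c0; have Da := lorentz_denom_gt0 (a - y) c0; have Db := lorentz_denom_gt0 (b - y) c0.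
have -> : (a - y) / ((a - y) ^+ 2 + c ^+ 2) - (b - y) / ((b - y) ^+ 2 + c ^+ 2) =
  (c ^+ 2 - (a - y) * (b - y)) / (((a - y) ^+ 2 + c ^+ 2) * ((b - y) ^+ 2 + c ^+ 2)) * (a - b).
  by field; rewrite !gt_eqF.
rewrite normrM ler_wpM2r //; apply: lipschitz_aux => //.
have := sqr_ge0 (c * (a - y + b - y)); nra.
Qed.

Section Grid.
Variables (L : R) (N : nat).
Hypotheses (L0 : 0 < L) (N0 : (0 < N)%N).

Definition gstep : R := 2 * L / N%:R.
Definition gpt (t : 'I_N) : R := - L + t%:R * gstep.
(** A Lorentzian has integral pi, so with the factor 1 / (2 pi) each one sums to 1/2 over the grid.
    Two of them appear in the partial fractions of [kernel_sum], which therefore ends without an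
    extra constant. *)
Definition gwt : R := gstep / (2 * pi).

Lemma gstep_gt0 : 0 < gstep.
Proof. by rewrite divr_gt0 ?mulr_gt0 ?ltr0n. Qed.

Lemma gwt_gt0 : 0 < gwt.
Proof. by rewrite divr_gt0 ?gstep_gt0 // mulr_gt0 // pi_gt0. Qed.

Lemma gend : - L + N%:R * gstep = L.
Proof. by rewrite /gstep mulrCA divff ?pnatr_eq0 -?lt0n //; ring. Qed.

Definition gerr (c : R) : R := 2 * L * gstep / c ^+ 2.

Lemma gerrE c : N%:R * (c ^- 2 * gstep ^+ 2) = gerr c.
Proof.
have Ng : N%:R * gstep = 2 * L by rewrite /gstep mulrCA divff ?pnatr_eq0 -?lt0n ?mulr1.
by rewrite /gerr -Ng; ring.
Qed.

Lemma gerr_ge0 c : 0 <= gerr c.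
Proof.
have g0 := ltW gstep_gt0; have l0 := ltW L0.
by rewrite /gerr divr_ge0 ?sqr_ge0 // !mulr_ge0.
Qed.

Lemma lorentz_sum c y : 0 < c ->
  `|\sum_(t < N) gstep * (c / ((gpt t - y) ^+ 2 + c ^+ 2)) -
     (atan ((L - y) / c) - atan ((- L - y) / c))| <= gerr c.
Proof.
move=> c0.
have := @riemann_sum (fun x => c / ((x - y) ^+ 2 + c ^+ 2)) (fun x => atan ((x - y) / c))
  (c ^- 2) gstep (- L) N (ltW gstep_gt0) (fun x => is_derive_atan_shift y x c0)
  (fun a b => lipschitz_lorentz y a b c0).
by rewrite gend gerrE.
Qed.

Lemma lorentz_odd_sum c y : 0 < c ->
  `|\sum_(t < N) gstep * ((gpt t - y) / ((gpt t - y) ^+ 2 + c ^+ 2)) -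
     (ln ((L - y) ^+ 2 + c ^+ 2) / 2 - ln ((- L - y) ^+ 2 + c ^+ 2) / 2)| <= gerr c.
Proof.
move=> c0.
have := @riemann_sum (fun x => (x - y) / ((x - y) ^+ 2 + c ^+ 2))
  (fun x => ln ((x - y) ^+ 2 + c ^+ 2) / 2)
  (c ^- 2) gstep (- L) N (ltW gstep_gt0) (fun x => is_derive_ln_shift y x c0)
  (fun a b => lipschitz_lorentz_odd y a b c0).
by rewrite gend gerrE.
Qed.

Lemma lorentz_sum_le c y : 0 < c ->
  \sum_(t < N) gwt * (c / ((gpt t - y) ^+ 2 + c ^+ 2)) <= 2^-1 + gerr c.
Proof.
move=> c0; have := lorentz_sum y c0; rewrite ler_norml => /andP[_].
set S := \sum_(t < N) _ => hS.
have -> : \sum_(t < N) gwt * (c / ((gpt t - y) ^+ 2 + c ^+ 2)) = S / (2 * pi).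
  by rewrite /S mulr_suml; apply: eq_bigr => t _; rewrite /gwt; ring.
have e0 : 0 <= gerr c.
  exact: gerr_ge0.
have p0 := pi_gt0 R; have p2 := pi_ge2 R.
rewrite ler_pdivrMr ?mulr_gt0 //.
have := atan_ltpi2 ((L - y) / c); have := atan_gtNpi2 ((- L - y) / c).
have : gerr c <= gerr c * (2 * pi) by rewrite ler_peMr //; lra.
have -> : (2^-1 + gerr c) * (2 * pi) = pi + gerr c * (2 * pi) by field.
lra.
Qed.

(** Since y keeps distance L / 2 from both ends of the grid, each arctangent misses pi / 2 by at
    most 2 c / L. *)
Lemma lorentz_sum_half c y : 0 < c -> `|y| <= L / 2 ->
  `|\sum_(t < N) gwt * (c / ((gpt t - y) ^+ 2 + c ^+ 2)) - 2^-1| <= gerr c + 4 * c / L.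
Proof.
move=> c0 yL; have := lorentz_sum y c0.
set S := \sum_(t < N) _ => hS.
have -> : \sum_(t < N) gwt * (c / ((gpt t - y) ^+ 2 + c ^+ 2)) - 2^-1 = (S - pi) / (2 * pi).
  have -> : \sum_(t < N) gwt * (c / ((gpt t - y) ^+ 2 + c ^+ 2)) = S / (2 * pi).
    by rewrite /S mulr_suml; apply: eq_bigr => t _; rewrite /gwt; ring.
  have : pi != 0 :> R by rewrite gt_eqF // pi_gt0.
  by move: (pi : R) => p p0; field.
have p0 := pi_gt0 R; have p2 := pi_ge2 R.
have p20 : 0 < 2 * pi :> R by rewrite mulr_gt0.
rewrite normrM normfV (gtr0_norm p20) ler_pdivrMr //.
have [ny1 ny2] := norm_le_split yL; have L0' : 0 < L by exact: L0.
have y1' : 0 < L - y by lra.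
have y2' : 0 < L + y by lra.
have y1 : 0 < (L - y) / c by rewrite divr_gt0.
have y2 : 0 < (L + y) / c by rewrite divr_gt0.
have a1 := pihalf_atan_le y1; have a2 := pihalf_atan_le y2.
have b1 := atan_ltpi2 ((L - y) / c); have b2 := atan_ltpi2 ((L + y) / c).
have ea : atan ((- L - y) / c) = - atan ((L + y) / c) by rewrite -atanN; congr atan; ring.
rewrite ea in hS.
have hi (u : R) : 0 < u -> L <= 2 * u -> (u / c)^-1 <= 2 * c / L.
  move=> u0 uL; rewrite invf_div ler_pdivrMr // mulrAC ler_pdivlMr //.
  by rewrite [2 * c]mulrC -mulrA ler_wpM2l // ltW.
have i1 : ((L - y) / c)^-1 <= 2 * c / L by apply: hi => //; lra.
have i2 : ((L + y) / c)^-1 <= 2 * c / L by apply: hi => //; lra.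
have e0 : 0 <= gerr c.
  exact: gerr_ge0.
have k0 : 0 <= 4 * c / L by rewrite divr_ge0 ?mulr_ge0 // ltW.
have k1 : 4 * c / L = 2 * c / L + 2 * c / L by rewrite -mulrDl -mulrDl; congr (_ * _ / _); ring.
apply: (@le_trans _ _ (gerr c + 4 * c / L)); last by rewrite ler_peMr ?addr_ge0 //; lra.
have -> : S - pi = (S - (atan ((L - y) / c) - - atan ((L + y) / c))) -
   ((pi / 2 - atan ((L - y) / c)) + (pi / 2 - atan ((L + y) / c))) by field.
apply: le_trans (ler_normB _ _) (lerD hS _).
rewrite ger0_norm; last by lra.
rewrite k1; lra.
Qed.

(** This kernel decays only like 1 / x, so its sum is small only through the symmetry of the grid:
    the primitive is half a logarithm whose arguments at L and -L have ratio 1 + O(Lam / L). The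
    auxiliary one-sided bound is applied to y and to -y. *)
Lemma lorentz_odd_small c y (Lam : R) : 0 < c -> c <= 1 -> `|y| <= Lam -> 2 * Lam <= L -> 1 <= L ->
  `|\sum_(t < N) gwt * ((gpt t - y) / ((gpt t - y) ^+ 2 + c ^+ 2))| <= gerr c + 8 * Lam / L.
Proof.
move=> c0 c1 yl lL L1; have := lorentz_odd_sum y c0.
set S := \sum_(t < N) _; set E1 := ln _; set E2 := ln _ => hS.
have -> : \sum_(t < N) gwt * ((gpt t - y) / ((gpt t - y) ^+ 2 + c ^+ 2)) = S / (2 * pi).
  by rewrite /S mulr_suml; apply: eq_bigr => t _; rewrite /gwt; ring.
have p0 := pi_gt0 R; have p2 := pi_ge2 R.
have p20 : 0 < 2 * pi :> R by rewrite mulr_gt0.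
rewrite normrM normfV (gtr0_norm p20) ler_pdivrMr //.
have e0 : 0 <= gerr c.
  exact: gerr_ge0.
have L0' : 0 < L by exact: L0.
have Lam0 : 0 <= Lam by exact: le_trans (normr_ge0 _) yl.
have k0 : 0 <= 8 * Lam / L by rewrite divr_ge0 ?mulr_ge0 // ltW.
have lnb (u v : R) : `|u| <= Lam -> `|v| <= Lam -> u = - v ->
    ln ((L - u) ^+ 2 + c ^+ 2) - ln ((L - v) ^+ 2 + c ^+ 2) <= 16 * Lam / L.
  move=> ul vl uv.
  have D1 : 0 < (L - u) ^+ 2 + c ^+ 2 by exact: lorentz_denom_gt0.
  have D2 : 0 < (L - v) ^+ 2 + c ^+ 2 by exact: lorentz_denom_gt0.
  rewrite -ln_div ?posrE //.
  set r := _ / _; have r0 : 0 < r by rewrite divr_gt0.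
  have -> : r = 1 + (r - 1) by ring.
  apply: le_trans (le_ln1Dx _) _; first by lra.
  have -> : r - 1 = (4 * L * v) / ((L - v) ^+ 2 + c ^+ 2).
    by rewrite /r uv; field; rewrite gt_eqF.
  rewrite ler_pdivrMr //.
  have [_ nv] := norm_le_split vl.
  have v1 : L / 2 <= L - v by lra.
  have v2 : L ^+ 2 / 4 <= (L - v) ^+ 2 + c ^+ 2.
    apply: (@le_trans _ _ ((L - v) ^+ 2)); last by rewrite lerDl sqr_ge0.
    have -> : L ^+ 2 / 4 = (L / 2) ^+ 2 by field.
    by rewrite ler_pXn2r // nnegrE; lra.
  apply: (@le_trans _ _ (16 * Lam / L * (L ^+ 2 / 4))).
    have -> : 16 * Lam / L * (L ^+ 2 / 4) = 4 * L * Lam by field; rewrite gt_eqF.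
    by rewrite ler_wpM2l // mulr_ge0 // ltW.
  by rewrite ler_wpM2l // divr_ge0 ?mulr_ge0 // ltW.
have hE : `|E1 / 2 - E2 / 2| <= 8 * Lam / L.
  have e2 : E2 = ln ((L - (- y)) ^+ 2 + c ^+ 2).
    by rewrite /E2; congr (ln (_ + _)); ring.
  have ny : `|- y| <= Lam by rewrite normrN.
  have h1 := lnb y (- y) yl ny (esym (opprK y)); have h2 := lnb (- y) y ny yl erefl.
  have k2 : 16 * Lam / L = 2 * (8 * Lam / L) by rewrite !mulrA; congr (_ * _ / _); ring.
  rewrite k2 in h1 h2; rewrite -e2 -/E1 in h1 h2; rewrite ler_norml; lra.
apply: (@le_trans _ _ (gerr c + 8 * Lam / L)); last by rewrite ler_peMr ?addr_ge0 //; lra.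
have -> : S = (S - (E1 / 2 - E2 / 2)) + (E1 / 2 - E2 / 2) by ring.
by apply: le_trans (ler_normD _ _) (lerD hS _).
Qed.

(* Partial fractions: the product of two Cauchy kernels integrates to a Lorentzian of twice the width. *)
Lemma kernel_sum c (Lam l m : R) : 0 < c -> c <= 1 -> `|l| <= Lam -> `|m| <= Lam ->
  2 * Lam <= L -> 1 <= L ->
  `|\sum_(t < N) gwt * (((l - gpt t) * (m - gpt t) + c ^+ 2) /
      (((l - gpt t) ^+ 2 + c ^+ 2) * ((m - gpt t) ^+ 2 + c ^+ 2))) -
    (2 * c) / ((l - m) ^+ 2 + (2 * c) ^+ 2)| <= (2 * gerr c + 12 * (Lam + 1) / L) / c.
Proof.
move=> c0 c1 lL mL LL L1.
have l1 := lorentz_odd_small c0 c1 lL LL L1; have m1 := lorentz_odd_small c0 c1 mL LL L1.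
have L0' : 0 < L by exact: L0.
have LL' : Lam <= L / 2 by lra.
have l2 := le_trans lL LL'; have m2 := le_trans mL LL'.
have l3 := lorentz_sum_half c0 l2; have m3 := lorentz_sum_half c0 m2.
move: l1 m1 l3 m3.
set a := \sum_(t < N) _; set b := \sum_(t < N) _.
set a' := \sum_(t < N) _; set b' := \sum_(t < N) _ => ha hb ha' hb'.
set D := (l - m) ^+ 2 + (2 * c) ^+ 2.
have D0 : 0 < D by apply: lorentz_denom_gt0; rewrite mulr_gt0.
have -> : \sum_(t < N) gwt * (((l - gpt t) * (m - gpt t) + c ^+ 2) /
      (((l - gpt t) ^+ 2 + c ^+ 2) * ((m - gpt t) ^+ 2 + c ^+ 2))) =
   ((b - a) * (m - l) + 2 * c * (a' + b')) / D.
  rewrite /a /b /a' /b' -sumrB -big_split /= mulr_suml mulr_sumr -big_split /= mulr_suml.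
  apply: eq_bigr => t _.
  have D1 := lorentz_denom_gt0 (gpt t - l) c0; have D2 := lorentz_denom_gt0 (gpt t - m) c0.
  rewrite -[l - gpt t]opprB -[m - gpt t]opprB !sqrrN /D.
  have -> : l - m = (gpt t - m) - (gpt t - l) by ring.
  have -> : m - l = (gpt t - l) - (gpt t - m) by ring.
  move: D1 D2; set x := gpt t - l; set y := gpt t - m => D1 D2.
  have D3 : 0 < (y - x) ^+ 2 + (2 * c) ^+ 2 by apply: lorentz_denom_gt0; rewrite mulr_gt0.
  by field; rewrite !gt_eqF.
have -> : ((b - a) * (m - l) + 2 * c * (a' + b')) / D - 2 * c / D =
  (b - a) * ((m - l) / D) + (2 * c / D) * ((a' - 2^-1) + (b' - 2^-1)).
  by field; rewrite gt_eqF.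
(* The denominator is at least 4 c |l - m| and at least 4 c^2, so the partial fractions lose no more
   than 1 / c even when l and m coincide. *)
have i1 : `|(m - l) / D| <= c^-1 / 4.
  rewrite normrM normfV (gtr0_norm D0) ler_pdivrMr // mulrAC ler_pdivlMr //.
  rewrite ler_pdivlMl //.
  rewrite /D -[(l - m) ^+ 2]real_normK ?num_real // distrC.
  have := sqr_ge0 (`|l - m| - 2 * c); nra.
have i2 : 0 <= 2 * c / D <= c^-1 / 2.
  have c00 := ltW c0; have D00 := ltW D0.
  apply/andP; split; first by rewrite divr_ge0 // mulr_ge0.
  rewrite ler_pdivrMr // mulrAC ler_pdivlMr //.
  rewrite ler_pdivlMl //.
  rewrite /D; have := sqr_ge0 (l - m); nra.
apply: le_trans (ler_normD _ _) _; rewrite normrM [`|2 * c / D * _|]normrM.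
set e := gerr c in ha hb ha' hb' *.
have e0 : 0 <= e by exact: gerr_ge0.
have La0 : 0 <= Lam by exact: le_trans (normr_ge0 _) lL.
have ic : 0 < c^-1 by rewrite invr_gt0.
have iL : 0 < L^-1 by rewrite invr_gt0.
apply: (@le_trans _ _ ((2 * (e + 8 * Lam / L)) * (c^-1 / 4) + (c^-1 / 2) * (2 * (e + 4 * c / L)))).
  apply: lerD; apply: ler_pM => //.
  - by apply: le_trans (ler_normB _ _) _; rewrite mulr2n mulrDl mul1r lerD.
  - by case/andP: i2 => i2 i3; rewrite ger0_norm.
  - by apply: le_trans (ler_normD _ _) _; rewrite mulr2n mulrDl mul1r lerD.
have -> : 2 * (e + 8 * Lam / L) * (c^-1 / 4) + c^-1 / 2 * (2 * (e + 4 * c / L)) =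
  (3 / 2 * e + (4 * Lam + 4 * c) / L) / c by field; rewrite !gt_eqF.
have ic0 := ltW ic; have iL0 := ltW iL.
rewrite ler_wpM2r //; apply: lerD; first by lra.
by rewrite ler_wpM2r //; lra.
Qed.

End Grid.
End Quadrature.

(** * The local law, given control of the minors *)

Section SelfConsistent.
Context {R : realType} {n : nat}.
Local Notation C := R[i].
Variables (A : 'M[R]_n) (z : C) (tau eps3 eps5 e c : R).
Hypotheses (sA : A^T = A) (zc : complex.Im z = c) (c0 : 0 < c) (n0 : (0 < n)%N).
Hypothesis tau_entry : forall i j, `|A i j| <= tau.
Hypothesis quad1 : forall k, let T := [set k]%SET in
  md (dot (al T A k) (res (mask T A) z *m al T A k) - str T A z) <= eps3.
Hypothesis small5 : 2 / (n%:R * c) <= eps5.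
Hypothesis eE : tau + eps3 + eps5 <= e.
Hypothesis ec : 4 * e <= c.
Hypothesis c1 : c <= 1.

Definition str0 : C := \tr (res A z) / n%:R.
(** The right side of the self-consistent equation at the empirical trace [str0], in the role
    usually given to the semicircle transform. Only its closeness to [str0] and the exact identity
    for its imaginary part are needed. *)
Definition Sst : C := - (z + str0)^-1.
Local Notation s := str0.
Local Notation S := Sst.
Local Notation G := (res A z).

Let z0 : 0 < complex.Im z. Proof. by rewrite zc. Qed.
Let nR : 0 < n%:R :> R. Proof. by rewrite ltr0n. Qed.

Lemma md_natV : md (n%:R^-1 : C) = n%:R^-1.
Proof. by rewrite mdV md_nat. Qed.

Lemma str_minor T : md (str T A z - s) <= #|T|%:R * (2 / (n%:R * c)).
Proof.
rewrite mdBC -mulrBl mdM md_natV.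
have := tr_minor T sA z0; rewrite zc => h.
apply: le_trans (ler_wpM2r _ h) _; first by rewrite invr_ge0 ltW.
have c' : c != 0 by rewrite gt_eqF. have n' : n%:R != 0 :> R by rewrite gt_eqF.
suff -> : #|T|%:R * 2 / c / n%:R = #|T|%:R * (2 / (n%:R * c)) by [].
by field; rewrite c' n'.
Qed.

Lemma Im_str0_gt0 : 0 < complex.Im s.
Proof.
rewrite /str0 mulrC -(rmorph_nat (real_complex R)) -fmorphV ImMr mulr_gt0 ?invr_gt0 //.
rewrite /mxtrace Im_sum; case: n n0 A sA => // m _ A' sA'.
rewrite big_ord_recl ltr_pwDl ?Im_res_gt0 //.
by apply: sumr_ge0 => i _; rewrite ltW // Im_res_gt0.
Qed.

Lemma e_ge0 : 0 <= e.
Proof.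
apply: le_trans eE; rewrite !addr_ge0 //.
- have i0 := Ordinal n0; exact: le_trans (normr_ge0 _) (tau_entry i0 i0).
- have i0 := Ordinal n0; exact: le_trans (md_ge0 _) (quad1 i0).
- by apply: le_trans small5; rewrite divr_ge0 // mulr_ge0 // ltW.
Qed.

Lemma zs_neq0 : z + s != 0.
Proof.
apply/negP => /eqP /(congr1 (@complex.Im R)); rewrite ImD zc /= => h.
by have := Im_str0_gt0; have := c0; lra.
Qed.

Lemma S_eq : S * (- z - s) = 1.
Proof. by rewrite /Sst -opprD mulrNN mulVf // zs_neq0. Qed.

Lemma md_S_le : md S <= c^-1.
Proof.
rewrite /Sst mdN mdV lef_pV2 ?posrE //; last by rewrite md_gt0 zs_neq0.
apply: le_trans (Im_le_md _); apply: le_trans (ler_norm _).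
by rewrite ImD zc lerDl ltW // Im_str0_gt0.
Qed.

Lemma S_gt0 : 0 < md S.
Proof. by rewrite md_gt0 oppr_eq0 invr_eq0 zs_neq0. Qed.

Lemma res_diag_eq k : exists2 x : C, md x <= e & G k k = S - S * x * G k k.
Proof.
pose T := [set k]%SET.
pose q := dot (al T A k) (res (mask T A) z *m al T A k).
exists ((A k k)%:C%C - q + s).
  apply: le_trans eE.
  have -> : (A k k)%:C%C - q + s = (A k k)%:C%C - (q - str T A z) - (str T A z - s) by ring.
  apply: le_trans (mdB _ _) (lerD (le_trans (mdB _ _) (lerD _ (quad1 k))) _).
    by rewrite md_real.
  apply: le_trans (str_minor T) _; by rewrite cards1 mul1r.
have kT : k \in T by rewrite inE.
have := schur_row sA z0 (res_mulK (unit_col k) sA z0) kT.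
rewrite big_set1 res_col -/T -/q.
rewrite mcol_unit_col // mulmx0 dot0r.
rewrite mxE !eqxx subr0 /= => h.
have h1 : G k k * (- z - s) = 1 - ((A k k)%:C%C - q + s) * G k k.
  have -> : G k k * (- z - s) = - z * G k k - s * G k k by ring.
  by rewrite h; ring.
rewrite -[LHS]mulr1 -S_eq mulrCA h1; ring.
Qed.

(** As |S| <= 1 / c and the error x is at most e <= c / 4, the error term is at most |G_kk| / 4 and
    is absorbed in the left side. *)
Lemma md_res_diag k : md (G k k) <= 2 * md S.
Proof.
have [x xe /(congr1 md) h] := res_diag_eq k.
have e0 := e_ge0.
have h1 : md (G k k) <= md S + md S * md x * md (G k k).
  by rewrite {1}h; apply: le_trans (mdB _ _) _; rewrite !mdM.
have h2 : md S * md x <= 4^-1.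
  apply: le_trans (ler_pM (md_ge0 _) (md_ge0 _) md_S_le xe) _.
  have h4 : e <= c * 4^-1 by move: ec; lra.
  by rewrite ler_pdivrMl.
have h3 := ler_wpM2r (md_ge0 (G k k)) h2.
have := md_ge0 S; lra.
Qed.

Lemma md_res_diag_sub k : md (G k k - S) <= 2 * e * md S ^+ 2.
Proof.
have [x xe h] := res_diag_eq k.
have -> : G k k - S = - (S * x * G k k) by rewrite {1}h; ring.
rewrite mdN !mdM; have S0 := md_ge0 S; have e0 := e_ge0.
have -> : 2 * e * md S ^+ 2 = md S * e * (2 * md S) by ring.
apply: ler_pM; rewrite ?mulr_ge0 ?md_ge0 //.
  by apply: ler_pM; rewrite ?md_ge0.
exact: md_res_diag.
Qed.

Lemma md_s_sub : md (s - S) <= 2 * e * md S ^+ 2.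
Proof.
have -> : s - S = (\sum_k (G k k - S)) / n%:R.
  rewrite sumrB sumr_const card_ord -[S *+ n]mulr_natr mulrBl /str0; congr (_ - _).
  by rewrite mulfK // pnatr_eq0 -lt0n.
rewrite mdM md_natV ler_pdivrMr //.
apply: le_trans (md_sum _ _ _) _.
apply: le_trans (ler_sum _ (fun k _ => md_res_diag_sub k)) _.
by rewrite sumr_const card_ord mulr_natr.
Qed.

Lemma Im_S_eq : complex.Im S = md S ^+ 2 * (c + complex.Im s).
Proof.
have h : S = - ((md S ^+ 2)%:C%C * (z + s)^*%C).
  have h1 : (S * (z + s))^*%C = -1.
    have -> : S * (z + s) = -1 by rewrite -[RHS]/(- 1) -S_eq; ring.
    by rewrite raddfN /= oppr0.
  by rewrite -mulc_conj -mulrA -conjcM h1 mulrN1 opprK.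
by rewrite {1}h ImN ImMr -mulrN; congr (_ * _); rewrite -zc -ImD; case: (z + s) => a b /=; rewrite opprK.
Qed.

(** Comparing Im S = |S|^2 (c + Im s) with Im S <= Im s + 2 e |S|^2 gives |S|^2 (c - 2 e + Im s) <=
    Im s. As 2 e < c and Im s > 0, this excludes |S| > 1; no stability analysis of a limiting
    equation is involved. *)
Lemma md_S_le1 : md S <= 1.
Proof.
have i0 := Im_str0_gt0; have h := Im_S_eq; have e0 := e_ge0; have c0' := c0; have ec' := ec.
have : complex.Im S <= complex.Im s + 2 * e * md S ^+ 2.
  rewrite -lerBlDl; apply: le_trans md_s_sub.
  rewrite mdBC -ImN -ImD; apply: le_trans (ler_norm _) (Im_le_md _).
rewrite h => h1; have S0 := md_ge0 S.
rewrite leNgt; apply/negP => S1.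
have S2 : 1 < md S ^+ 2 by rewrite expr_gt1.
have : md S ^+ 2 * (c - 2 * e + complex.Im s) <= complex.Im s by lra.
apply/negP; rewrite -ltNge.
apply: (@lt_le_trans _ _ (md S ^+ 2 * complex.Im s)); first by rewrite ltr_pMl.
by rewrite ler_wpM2l ?sqr_ge0 //; lra.
Qed.

Lemma md_s_le : md s <= 2.
Proof.
have -> : s = (s - S) + S by ring.
apply: le_trans (mdD _ _) _; have h := md_s_sub; have S1 := md_S_le1; have S0 := md_ge0 S.
have S2 : md S ^+ 2 <= 1 by rewrite exprn_ile1.
have e0 := e_ge0; have ec' := ec; have c1' := c1.
have : 2 * e * md S ^+ 2 <= 2 * e * 1 by rewrite ler_wpM2l // mulr_ge0.
lra.
Qed.

(** From S z = -(1 + S s) and |s| <= 2 follows |S z| <= 3, and 10 = 1 + 9. This decay makes the grid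
    weights summable uniformly in the length of the grid. *)
Lemma md_S_decay : md S ^+ 2 * (1 + complex.Re z ^+ 2) <= 10.
Proof.
have S1 := md_S_le1; have S0 := md_ge0 S.
have S2 : md S ^+ 2 <= 1 by rewrite exprn_ile1.
have h : md S * md z <= 3.
  rewrite -mdM; have -> : S * z = - (1 + S * s) by rewrite -S_eq; ring.
  rewrite mdN; apply: le_trans (mdD _ _) _; rewrite md1 mdM.
  have : md S * md s <= 1 * 2 by apply: ler_pM; rewrite ?md_ge0 ?md_s_le.
  lra.
have h2 : md S * `|complex.Re z| <= 3.
  by apply: le_trans h; rewrite ler_wpM2l // Re_le_md.
have h3 : md S ^+ 2 * complex.Re z ^+ 2 <= 9.
  rewrite -[complex.Re z ^+ 2]real_normK ?num_real // -exprMn.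
  have -> : 9 = 3 ^+ 2 :> R by ring.
  by rewrite ler_pXn2r ?nnegrE ?mulr_ge0 ?md_ge0.
rewrite mulrDr mulr1; lra.
Qed.

End SelfConsistent.

(** * Row sums of the resolvent: bootstrap, averaged law and pair removal *)

Section LocalLaw.
Context {R : realType} {n : nat}.
Local Notation C := R[i].
Variables (A : 'M[R]_n) (z : C) (tau eps2 eps3 eps4 eps5 e c kap : R).

Definition uvec (T : {set 'I_n}) : 'cV[C]_n := res (mask T A) z *m mcol T ones.
Definition qform (T : {set 'I_n}) (k j : 'I_n) : C :=
  dot (al T A k) (res (mask T A) z *m al T A j).

(** The probabilistic facts about one minor. The last clause is quantified over a and b because it
    is used at two levels of precision: with the operator bound, where b involves the unknown
    maximum of the row sums, and again once the norm of [uvec] has been improved. *)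
Definition minor_ctrl (T : {set 'I_n}) : Prop :=
  [/\ forall j i, j \in T -> md ((res (mask T A) z *m al T A j) i 0) <= eps2,
      forall k, k \in T -> md (qform T k k - str T A z) <= eps3,
      forall k j, k \in T -> j \in T -> k != j -> md (qform T k j) <= eps4 &
      forall k, k \in T -> forall a b : R, 0 <= a -> 0 <= b ->
        n2 (uvec T) <= n%:R * a ^+ 2 -> (forall i, md (uvec T i 0) <= b) ->
        md (dot (al T A k) (uvec T)) <= kap * (a + tau * b)].

Hypotheses (sA : A^T = A) (zc : complex.Im z = c) (c0 : 0 < c) (n0 : (0 < n)%N).
Hypothesis tau_entry : forall i j, `|A i j| <= tau.
Hypothesis ctrl1 : forall k, minor_ctrl [set k]%SET.
Hypothesis small5 : 2 / (n%:R * c) <= eps5.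
Hypothesis eE : tau + eps3 + eps5 <= e.
Hypothesis ec : 4 * e <= c.
Hypothesis c1 : c <= 1.
Hypothesis kt : 8 * kap * tau <= 1.
Hypothesis kap0 : 0 <= kap.
Hypothesis eps21 : eps2 <= 1.

Let z0 : 0 < complex.Im z. Proof. by rewrite zc. Qed.
Let nR : 0 < n%:R :> R. Proof. by rewrite ltr0n. Qed.
Let quad1 k : let T := [set k]%SET in
  md (dot (al T A k) (res (mask T A) z *m al T A k) - str T A z) <= eps3.
Proof. by have [_ h _ _] := ctrl1 k; apply: h; rewrite inE. Qed.

Local Notation s := (str0 A z).
Local Notation S := (Sst A z).
Local Notation g := (res A z *m ones).
Let gE : (toCm A - z%:M) *m g = ones. Proof. exact: res_mulK. Qed.
Let S1 : md S <= 1 := md_S_le1 sA zc c0 n0 tau_entry quad1 small5 eE ec.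

Let Sgt0 : 0 < md S := S_gt0 sA zc c0 n0.
Let Sge0 : 0 <= md S. Proof. exact: md_ge0. Qed.

Definition Gam0 : R := 4 * (1 + kap / c).

Lemma tau_ge0 : 0 <= tau.
Proof. by have i0 := Ordinal n0; exact: le_trans (normr_ge0 _) (tau_entry i0 i0). Qed.

Lemma Gam0_ge0 : 0 <= Gam0.
Proof. by have c0' := ltW c0; rewrite mulr_ge0 // addr_ge0 // divr_ge0. Qed.

Lemma n2_mcol_ones T : n2 (mcol T ones : 'cV[C]_n) <= n%:R.
Proof.
have -> : n%:R = \sum_(i < n) (1 : R) by rewrite sumr_const card_ord.
apply: ler_sum => i _.
by rewrite !mxE; case: ifP => _; rewrite ?md0 ?md1 ?expr0n ?expr1n.
Qed.

Lemma n2_uvec T : n2 (uvec T) <= n%:R * c^-1 ^+ 2.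
Proof.
have sM := mask_sym T sA.
have := res_n2 (mcol T ones) sM z0; rewrite zc => h.
rewrite exprVn ler_pdivlMr ?exprn_gt0 // mulrC.
exact: le_trans h (n2_mcol_ones T).
Qed.

(** The Schur elimination read backwards: row sums of the minor in terms of row sums of the full
    resolvent. *)
Lemma uvec_eq T i : uvec T i 0 = (if i \in T then 0 else g i 0) +
  \sum_(j in T) g j 0 * (res (mask T A) z *m al T A j) i 0.
Proof.
have := schur_mcol T sA z0 gE; rewrite mulmxBr mulmx_sumr => /esym/eqP.
rewrite subr_eq => /eqP/colP/(_ i); rewrite [RHS]mxE [mcol _ _ _ _]mxE summxE /uvec => ->.
by congr (_ + _); apply: eq_bigr => j _; rewrite -scalemxAr [LHS]mxE.
Qed.

Lemma md_uvec T Gam i : (forall i, md (g i 0) <= Gam) -> 0 <= Gam -> minor_ctrl T ->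
  #|T|%:R * eps2 <= 1 -> md (uvec T i 0) <= 2 * Gam.
Proof.
move=> hG G0 [h2 _ _ _] hT; rewrite uvec_eq; apply: le_trans (mdD _ _) _.
have -> : 2 * Gam = Gam + Gam by ring.
apply: lerD; first by case: ifP; rewrite ?md0.
apply: le_trans (md_sum _ _ _) _.
apply: (@le_trans _ _ (\sum_(j in T) Gam * eps2)).
  by apply: ler_sum => j jT; rewrite mdM ler_pM ?md_ge0 // h2.
by rewrite sumr_const -mulr_natr -mulrA -[leRHS]mulr1 ler_wpM2l // mulrC.
Qed.

(** The comparison value w is left free. The block argument takes the full trace; the pair argument
    takes the trace of the minor itself, for which the last error term vanishes. *)
Lemma row_identity (T : {set 'I_n}) k (w : C) Gam : k \in T -> minor_ctrl T -> 0 <= eps4 ->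
  (forall i, md (g i 0) <= Gam) ->
  exists2 E : C, (- z - w) * g k 0 = 1 - dot (al T A k) (uvec T) - E &
    md E <= Gam * (#|T|%:R * (tau + eps4) + (tau + eps3 + md (str T A z - w))).
Proof.
move=> kT [_ h3 h4 _] e4 hG.
have G0 : 0 <= Gam by exact: le_trans (md_ge0 _) (hG k).
have t0 := tau_ge0.
exists (\sum_(j in T | j != k) ((A k j)%:C%C - qform T k j) * g j 0 +
        ((A k k)%:C%C - qform T k k + w) * g k 0).
  have := schur_row sA z0 gE kT; rewrite [ones k 0]mxE => h.
  rewrite mulrBl h (bigD1 k) //= /uvec /qform; ring.
apply: le_trans (mdD _ _) _; rewrite mulrDr; apply: lerD.
  apply: le_trans (md_sum _ _ _) _.
  apply: (@le_trans _ _ (\sum_(j in T) Gam * (tau + eps4))).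
    rewrite [leRHS](bigD1 k) //= -[leLHS]add0r; apply: lerD.
      by rewrite mulr_ge0 // addr_ge0.
    apply: ler_sum => j /andP[jT jk]; rewrite mdM mulrC ler_pM ?md_ge0 //.
    apply: le_trans (mdB _ _) _; rewrite md_real lerD // h4 //.
    by rewrite eq_sym.
  by rewrite sumr_const -[leLHS]mulr_natr -mulrA [(tau + _) * _]mulrC.
rewrite mdM mulrC ler_pM ?md_ge0 //.
have -> : (A k k)%:C%C - qform T k k + w =
  (A k k)%:C%C - (qform T k k - str T A z) - (str T A z - w) by ring.
apply: le_trans (mdB _ _) _; rewrite lerD2r.
by apply: le_trans (mdB _ _) _; rewrite md_real lerD // h3.
Qed.

(** The Schur equations for [unit_col k] and for [ones] share the coefficient of the unknown at k,
    so eliminating it factorises the row sum exactly. *)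
Lemma res_ones_diag k : g k 0 = res A z k k * (1 - dot (al [set k]%SET A k) (uvec [set k]%SET)).
Proof.
have kT : k \in [set k]%SET by rewrite inE.
have h1 := schur_row sA z0 (res_mulK (unit_col k) sA z0) kT.
have h2 := schur_row sA z0 gE kT.
move: h1 h2; rewrite !big_set1 mcol_unit_col // mulmx0 dot0r res_col [ones k 0]mxE [unit_col k k 0]mxE !eqxx /= subr0.
rewrite -/(uvec [set k]%SET) -/(qform [set k]%SET k k).
set q := qform _ _ _; set a := (A k k)%:C%C; set u := dot _ _ => h1 h2.
have -> : 1 - u = (a - q - z) * g k 0.
  have -> : (a - q - z) * g k 0 = (a - q) * g k 0 + - z * g k 0 by ring.
  by rewrite h2; ring.
have -> : res A z k k * ((a - q - z) * g k 0) = (- z * res A z k k + (a - q) * res A z k k) * g k 0.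
  by ring.
by rewrite h1; ring.
Qed.

(** A bootstrap at the index with the largest row sum Gam: the bound on its linear form involves 2
    Gam itself through the sup norm of the minor's row sums. Since 8 kap tau <= 1, this term is at
    most Gam / 2 and is absorbed, which doubles 2 (1 + kap / c) to the constant [Gam0]. *)
Lemma md_res_ones i : md (g i 0) <= Gam0 * md S.
Proof.
have i0 := Ordinal n0.
pose k := [arg max_(k > i0) md (g k 0)]%O.
have hG j : md (g j 0) <= md (g k 0).
  by rewrite /k; case: Order.TotalTheory.arg_maxP => // l _; apply.
set Gam := md (g k 0) in hG.
apply: le_trans (hG i) _; rewrite -/Gam.
have G0 : 0 <= Gam by exact: md_ge0.
have t0 := tau_ge0.
have ctr := ctrl1 k.
have hu j : md (uvec [set k]%SET j 0) <= 2 * Gam.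
  by apply: md_uvec => //; rewrite cards1 mul1r.
have [_ _ _ h4] := ctr.
have kT : k \in [set k]%SET by rewrite inE.
have ci : 0 <= c^-1 by rewrite invr_ge0 ltW.
have G20 : 0 <= 2 * Gam by rewrite mulr_ge0.
have := h4 k kT c^-1 (2 * Gam) ci G20 (n2_uvec _) hu => hu2.
have : Gam <= 2 * md S * (1 + kap * (c^-1 + tau * (2 * Gam))).
  rewrite {1}/Gam res_ones_diag mdM ler_pM ?md_ge0 //.
    exact: (md_res_diag sA zc c0 n0 tau_entry quad1 small5 eE ec).
  by apply: le_trans (mdB _ _) _; rewrite md1 lerD2l; exact: hu2.
have h5 : kap * tau * Gam <= 8^-1 * Gam.
  by rewrite ler_wpM2r //; move: kt; lra.
have -> : 2 * md S * (1 + kap * (c^-1 + tau * (2 * Gam))) =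
  2^-1 * (Gam0 * md S) + 4 * (md S * (kap * tau * Gam)).
  by rewrite /Gam0; field; rewrite gt_eqF.
have : md S * (kap * tau * Gam) <= 1 * (8^-1 * Gam).
  by apply: ler_pM => //; rewrite !mulr_ge0.
lra.
Qed.


Variables (bn : nat) (sb r0 sc : R).
(** Rows are removed in blocks of [bn] consecutive indices. All rows of a block are paired with the
    same vector [uvec], so their sum is one linear form in independent entries. The block must be
    long for its average to be small, and short because the error of removing it, [eps6], grows with
    [bn]. *)
Definition block (r : nat) : {set 'I_n} := [set k : 'I_n | (k %/ bn == r)%N]%SET.
Definition eps6 : R := Gam0 * (bn%:R * (tau + eps4) + e).
Hypothesis bn0 : (0 < bn)%N.
Hypothesis bnn : (bn <= n)%N.
Hypothesis e40 : 0 <= eps4.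
Hypothesis sb0 : 0 <= sb.
Hypothesis ctrlB : forall r, minor_ctrl (block r).
Hypothesis blk : forall r (a b : R), 0 <= a -> 0 <= b ->
  n2 (uvec (block r)) <= n%:R * a ^+ 2 -> (forall i, md (uvec (block r) i 0) <= b) ->
  md (\sum_(k in block r) dot (al (block r) A k) (uvec (block r))) <= kap * (sb * a + tau * b).
Hypothesis eps2b : bn%:R * eps2 <= 1.
Hypothesis eps20 : 0 <= eps2.
Hypothesis small5b : bn%:R * (2 / (n%:R * c)) <= eps5.
Hypothesis small_r : 2 / bn%:R * (kap * (sb / c + tau * (2 * Gam0))) + eps6 <= r0.
Hypothesis small_pair : 2 * Gam0 * (1 + kap * (c^-1 + tau * (2 * Gam0))) / n%:R <= r0.
Hypothesis r01 : 2 * r0 <= 1.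
Hypothesis sc0 : 0 <= sc.
Hypothesis scE : sc ^+ 2 = 2 / c.

Let ci0 : 0 <= c^-1. Proof. by rewrite invr_ge0 ltW. Qed.
Let G0S : 0 <= Gam0 * md S. Proof. by rewrite mulr_ge0 ?Gam0_ge0. Qed.
Let GS1 : Gam0 * md S <= Gam0.
Proof. by rewrite -[leRHS]mulr1 ler_wpM2l // Gam0_ge0. Qed.
Let tG0 : 0 <= tau * (2 * Gam0).
Proof. by apply: mulr_ge0; [exact: tau_ge0 | apply: mulr_ge0 => //; exact: Gam0_ge0]. Qed.
Let e0 : 0 <= e := e_ge0 c0 n0 tau_entry quad1 small5 eE.

Lemma card_block r : (#|block r| <= bn)%N.
Proof.
have hk (k : 'I_n) : k \in block r -> (k : nat) = (r * bn + k %% bn)%N.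
  by rewrite inE => /eqP <-; exact: divn_eq.
pose f (k : 'I_n) : 'I_bn := Ordinal (ltn_pmod k bn0).
rewrite -[leqRHS]card_ord -(card_in_imset (f := f)); first exact: max_card.
move=> k l kr lr /(congr1 val) /= h; apply: val_inj => /=.
by rewrite (hk k kr) (hk l lr) h.
Qed.

Lemma row_S (T : {set 'I_n}) k : k \in T -> minor_ctrl T -> (#|T| <= bn)%N ->
  exists2 E : C, g k 0 = S * (1 - dot (al T A k) (uvec T) - E) & md E <= eps6.
Proof.
move=> kT cT Tb.
have [E hE mE] := row_identity s kT cT e40 (md_res_ones).
exists E; first by rewrite -hE mulrA (S_eq sA zc c0 n0) mul1r.
apply: le_trans mE _; rewrite /eps6.
have t0 := tau_ge0.
have te : 0 <= tau + eps4 by exact: addr_ge0.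
have h3 : 0 <= eps3 by have [_ h _ _] := cT; exact: le_trans (md_ge0 _) (h k kT).
apply: ler_pM => //.
  by rewrite addr_ge0 ?mulr_ge0 // !addr_ge0 ?md_ge0.
apply: lerD; first by rewrite ler_wpM2r // ler_nat.
apply: le_trans eE; rewrite lerD2l; apply: le_trans (str_minor sA zc c0 n0 T) _.
apply: le_trans small5b; rewrite ler_wpM2r ?ler_nat //.
by rewrite divr_ge0 // mulr_ge0 // ltW.
Qed.

Lemma md_uvec0 (T : {set 'I_n}) i : minor_ctrl T -> (#|T| <= bn)%N ->
  md (uvec T i 0) <= 2 * (Gam0 * md S).
Proof.
move=> cT Tb; apply: md_uvec => //; first exact: md_res_ones.
by apply: le_trans eps2b; rewrite ler_wpM2r // ler_nat.
Qed.

(** Only the linear forms a_k . u need cancellation, which the block hypothesis provides; the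
    remaining errors are bounded row by row. *)
Lemma block_sum r : md (\sum_(k in block r) (g k 0 - S)) <=
  md S * (kap * (sb / c + tau * (2 * Gam0)) + #|block r|%:R * eps6).
Proof.
set T := block r.
have cT : minor_ctrl T by exact: ctrlB.
have Tb : (#|T| <= bn)%N by exact: card_block.
have -> : \sum_(k in T) (g k 0 - S) = - (S * (\sum_(k in T) dot (al T A k) (uvec T) +
   \sum_(k in T) (1 - dot (al T A k) (uvec T) - g k 0 / S))).
  rewrite -big_split mulr_sumr -sumrN; apply: eq_bigr => k kT.
  have aux (w a b : C) : w != 0 -> b - w = - (w * (a + (1 - a - b / w))) by move=> w0; field.
  by apply: aux; rewrite -md_gt0.
rewrite mdN mdM ler_wpM2l //; apply: le_trans (mdD _ _) _; apply: lerD.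
  apply: blk => //.
  - by rewrite mulr_ge0 // Gam0_ge0.
  - exact: n2_uvec.
  - move=> i; apply: le_trans (md_uvec0 i cT Tb) _.
    by rewrite ler_wpM2l.
apply: le_trans (md_sum _ _ _) _; rewrite -sum1_card natr_sum mulr_suml.
apply: ler_sum => k kT; rewrite mul1r.
have [E -> hE] := row_S kT cT Tb.
rewrite [S * _]mulrC mulfK -?md_gt0 //.
by have -> : 1 - dot (al T A k) (uvec T) - (1 - dot (al T A k) (uvec T) - E) = E by ring.
Qed.

(** There are at most n / bn + 1 blocks, hence at most 2 n / bn because bn <= n; this is the factor
    2 / bn in [small_r]. *)
Lemma isotropic : md (dot ones g / n%:R - S) <= r0 * md S.
Proof.
have -> : dot ones g / n%:R - S = (\sum_k (g k 0 - S)) / n%:R.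
  rewrite sumrB sumr_const card_ord -[S *+ n]mulr_natr mulrBl mulfK ?pnatr_eq0 -?lt0n //.
  by congr (_ / _ - _); apply: eq_bigr => k _; rewrite [ones _ _]mxE mul1r.
rewrite mdM md_natV ler_pdivrMr //.
have kn (k : 'I_n) : (k %/ bn < (n %/ bn).+1)%N by rewrite ltnS leq_div2r // ltnW.
rewrite (partition_big (fun k : 'I_n => Ordinal (kn k)) xpredT) //=.
apply: le_trans (md_sum _ _ _) _.
have hb (r : 'I_(n %/ bn).+1) :
    md (\sum_(k < n | Ordinal (kn k) == r) (g k 0 - S)) <=
    md S * (kap * (sb / c + tau * (2 * Gam0)) + #|block r|%:R * eps6).
  rewrite (eq_bigl (fun k => k \in block r)); first exact: block_sum.
  by move=> k; rewrite inE.
apply: le_trans (ler_sum _ (fun r _ => hb r)) _.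
rewrite -mulr_sumr big_split /= sumr_const card_ord -mulr_suml.
have -> : \sum_(r < (n %/ bn).+1) (#|block r|%:R : R) = n%:R.
  rewrite -natr_sum; congr _%:R.
  rewrite -[RHS](card_ord n) -sum1_card (partition_big (fun k : 'I_n => Ordinal (kn k)) xpredT) //=.
  by apply: eq_bigr => r _; rewrite -sum1_card; apply: eq_bigl => k; rewrite inE.
rewrite -[r0 * _ * _]mulrA [r0 * (_ * _)]mulrCA ler_wpM2l //.
have hr := small_r; set x := kap * _ in hr *.
have x0 : 0 <= x.
  have c00 := ltW c0.
  by rewrite mulr_ge0 // addr_ge0 ?divr_ge0 // tG0.
have bR : 0 < bn%:R :> R by rewrite ltr0n.
apply: (@le_trans _ _ ((2 / bn%:R * x + eps6) * n%:R)); last by rewrite ler_wpM2r.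
rewrite mulrDl; apply: lerD; last by rewrite mulrC.
rewrite -[leLHS]mulr_natr [2 / bn%:R * x]mulrC -[leRHS]mulrA ler_wpM2l //.
rewrite mulrAC ler_pdivlMr // -natrM -natrM ler_nat.
by rewrite mulSn mul2n -addnn leq_add // leq_trunc_div.
Qed.

Section Pair.
Variable T : {set 'I_n}.
Hypotheses (cT : minor_ctrl T) (T2 : (#|T| <= 2)%N) (bn2 : (2 <= bn)%N).
Let Tb : (#|T| <= bn)%N. Proof. exact: leq_trans bn2. Qed.

(** Pairing the backward expansion with [ones] and moving the resolvent across the product makes the
    difference an exact sum over j in T of g_j (a_j . u - 1). Each term is of bounded size in n, so
    removing two rows is negligible after division by n. *)
Lemma dot_uvec_sub : md (dot (mcol T ones) (uvec T) - dot ones g) <=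
  2 * (Gam0 * md S) * (1 + kap * (c^-1 + tau * (2 * Gam0))).
Proof.
have -> : dot (mcol T ones) (uvec T) - dot ones g =
  \sum_(j in T) g j 0 * (dot (al T A j) (uvec T) - 1).
  have -> : dot ones g = \sum_(j in T) g j 0 + \sum_(j < n | j \notin T) g j 0.
    by rewrite /dot (bigID (mem T)) /=; congr (_ + _); apply: eq_bigr => i _; rewrite [ones _ _]mxE mul1r.
  have -> : dot (mcol T ones) (uvec T) = \sum_(j < n | j \notin T) g j 0 +
     \sum_(j in T) g j 0 * dot (al T A j) (uvec T).
    rewrite [X in _ = _ + X](eq_bigr (fun j => dot (mcol T ones) (g j 0 *: (res (mask T A) z *m al T A j)))); last first.
      by move=> j jT; rewrite dotZr (dot_res _ _ (mask_sym T sA) z0) [dot (_ *m _) _]dotC.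
    rewrite -dot_sumr /dot [\sum_(j < n | j \notin T) _]big_mkcond -big_split /=.
    apply: eq_bigr => i _; rewrite uvec_eq summxE [mcol _ _ _ _]mxE [ones _ _]mxE.
    case: ifP => iT /=; first by rewrite !mul0r addr0.
    rewrite !mul1r; congr (_ + _); apply: eq_bigr => j _; by rewrite [RHS]mxE.
  rewrite [RHS](eq_bigr (fun j => g j 0 * dot (al T A j) (uvec T) - g j 0)).
    by rewrite sumrB; ring.
  by move=> j _; rewrite mulrBr mulr1.
apply: le_trans (md_sum _ _ _) _.
set y := 1 + _; have y0 : 0 <= y.
  by rewrite addr_ge0 // mulr_ge0 // addr_ge0 // tG0.
apply: (@le_trans _ _ (\sum_(j in T) Gam0 * md S * y)).
  apply: ler_sum => j jT; rewrite mdM ler_pM ?md_ge0 ?md_res_ones //.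
  apply: le_trans (mdB _ _) _; rewrite md1 addrC lerD2l.
  have [_ _ _ h4] := cT; apply: h4 => //.
  - by rewrite mulr_ge0 // Gam0_ge0.
  - exact: n2_uvec.
  - by move=> i; apply: le_trans (md_uvec0 i cT Tb) _; rewrite ler_wpM2l.
rewrite sumr_const.
have -> : (Gam0 * md S * y) *+ #|T| = #|T|%:R * (Gam0 * md S) * y by rewrite -[LHS]mulr_natr; ring.
rewrite ler_wpM2r // ler_wpM2r //.
by rewrite ler_nat.
Qed.

Lemma isotropic_pair : md (dot (mcol T ones) (uvec T) / n%:R - S) <= 2 * r0 * md S.
Proof.
have -> : dot (mcol T ones) (uvec T) / n%:R - S =
  (dot (mcol T ones) (uvec T) - dot ones g) / n%:R + (dot ones g / n%:R - S).
  by rewrite mulrBl; ring.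
apply: le_trans (mdD _ _) _.
have -> : 2 * r0 * md S = r0 * md S + r0 * md S by ring.
apply: lerD; last exact: isotropic.
rewrite mdM md_natV ler_pdivrMr //; apply: le_trans dot_uvec_sub _.
rewrite mulrA mulrAC [r0 * _ * _]mulrAC ler_wpM2r //.
by rewrite -ler_pdivrMr.
Qed.

Lemma md_dot_pair : md (dot (mcol T ones) (uvec T)) <= 2 * n%:R * md S.
Proof.
have -> : dot (mcol T ones) (uvec T) = n%:R * ((dot (mcol T ones) (uvec T) / n%:R - S) + S).
  by rewrite addrNK mulrCA mulfV ?mulr1 // pnatr_eq0 -lt0n.
rewrite mdM md_nat [2 * _]mulrC -mulrA ler_wpM2l //; apply: le_trans (mdD _ _) _.
have h := isotropic_pair.
have : 2 * r0 * md S <= 1 * md S by rewrite ler_wpM2r.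
lra.
Qed.

Lemma n2_uvec_Im : n2 (uvec T) = complex.Im (dot (mcol T ones) (uvec T)) / c.
Proof.
rewrite /uvec ward //; last first.
- by apply: mcol_real; exact: real_ones.
- exact: mask_sym.
by rewrite zc mulrC mulKf // gt_eqF.
Qed.

(** The Ward identity and the averaged law improve the bound n / c^2 to 2 n / c. This is the origin
    of 1 / sqrt eta, instead of 1 / eta, in the final estimate. *)
Lemma n2_uvec_pair : n2 (uvec T) <= n%:R * (2 / c * md S).
Proof.
rewrite n2_uvec_Im ler_pdivrMr //.
have -> : n%:R * (2 / c * md S) * c = 2 * n%:R * md S by field; rewrite gt_eqF.
apply: le_trans md_dot_pair; apply: le_trans (ler_norm _) (Im_le_md _).
Qed.

(** Second pass of the row bound: with the improved norm the linear form has leading order kap /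
    sqrt c instead of kap / c. *)
Lemma md_al_uvec k : k \in T -> md (dot (al T A k) (uvec T)) <= kap * (sc + tau * (2 * Gam0)).
Proof.
move=> kT; have [_ _ _ h4] := cT; apply: h4 => //.
- by rewrite mulr_ge0 // Gam0_ge0.
- apply: le_trans n2_uvec_pair _; rewrite ler_wpM2l // scE -[leRHS]mulr1 ler_wpM2l //.
  by rewrite divr_ge0 // ltW.
- by move=> i; apply: le_trans (md_uvec0 i cT Tb) _; rewrite ler_wpM2l.
Qed.

(** Built from the trace of the minor and not of A: it depends only on entries with both indices
    outside T, so the matrix of the bilinear form will be independent of the removed rows. *)
Definition ST : C := - (z + str T A z)^-1.

Hypothesis eps52 : 2 * eps5 <= 1.

Lemma md_strT : md (str T A z - s) <= eps5.
Proof.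
apply: le_trans (str_minor sA zc c0 n0 T) _.
apply: le_trans small5b; rewrite ler_wpM2r ?ler_nat //.
by rewrite divr_ge0 // mulr_ge0 // ltW.
Qed.

Lemma md_zs : md (z + s) = (md S)^-1.
Proof. by rewrite /Sst mdN mdV invrK. Qed.

(** Since |S| <= 1 means |z + s| >= 1, a change of the trace by at most 1/2 cannot destroy more than
    half of |z + s|. *)
Lemma zsT_ge : (2 * md S)^-1 <= md (z + str T A z).
Proof.
have h : md (z + s) <= md (z + str T A z) + md (str T A z - s).
  by rewrite (_ : z + s = (z + str T A z) - (str T A z - s)); [exact: mdB | ring].
have h1 := md_strT.
have h2 : 1 <= (md S)^-1 by rewrite -[leLHS]invr1 lef_pV2 ?posrE.
rewrite md_zs in h; rewrite invfM; move: eps52 h2 h h1; lra.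
Qed.

Lemma zsT_neq0 : z + str T A z != 0.
Proof.
by rewrite -md_gt0; apply: lt_le_trans zsT_ge; rewrite invr_gt0 mulr_gt0.
Qed.

Lemma md_ST : md ST <= 2 * md S.
Proof.
have h := zsT_ge; have p0 : 0 < (2 * md S)^-1 by rewrite invr_gt0 mulr_gt0.
by rewrite /ST mdN mdV -[leRHS]invrK lef_pV2 ?posrE // (lt_le_trans p0 h).
Qed.

Lemma md_ST_sub : md (ST - S) <= 2 * md S ^+ 2 * eps5.
Proof.
have -> : ST - S = (str T A z - s) * (ST * S).
  have := zsT_neq0; have := zs_neq0 sA zc c0 n0; rewrite /ST /Sst.
  move: (str T A z) (s) => x y h1 h2; field; by rewrite h1 h2.
rewrite !mdM; have -> : 2 * md S ^+ 2 * eps5 = eps5 * (2 * md S * md S) by ring.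
by rewrite ler_pM ?mulr_ge0 ?md_ge0 ?md_strT // ler_wpM2r // md_ST.
Qed.

Definition eps7 : R := Gam0 * (2 * (tau + eps4) + e).

Lemma row_ST k : k \in T -> exists2 E : C,
  g k 0 = ST * (1 - dot (al T A k) (uvec T) - E) & md E <= eps7.
Proof.
move=> kT.
have [E hE mE] := row_identity (str T A z) kT cT e40 (md_res_ones).
exists E.
  rewrite -hE mulrA /ST.
  have -> : - (z + str T A z)^-1 * (- z - str T A z) = 1.
    by rewrite -opprD mulrNN mulVf // zsT_neq0.
  by rewrite mul1r.
apply: le_trans mE _; rewrite subrr md0 addr0 /eps7.
have t0 := tau_ge0.
have h3 : 0 <= eps3 by have [_ h _ _] := cT; exact: le_trans (md_ge0 _) (h k kT).
have h5 : 0 <= eps5 by exact: le_trans (md_ge0 _) md_strT.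
apply: ler_pM => //.
  by rewrite !addr_ge0 // mulr_ge0 // addr_ge0.
apply: lerD; first by rewrite ler_wpM2r ?addr_ge0 // ler_nat.
by apply: le_trans eE; rewrite lerDl.
Qed.

Record local_out : Prop := LocalOut {
  lo_S1 : md S <= 1;
  lo_Sx : md S ^+ 2 * (1 + complex.Re z ^+ 2) <= 10;
  lo_ImS : complex.Im S = md S ^+ 2 * (c + complex.Im s);
  lo_sS : md (s - S) <= 2 * e * md S ^+ 2;
  lo_s2 : md s <= 2;
  lo_Ims : 0 < complex.Im s;
  lo_zs : z + s != 0;
  lo_u : forall i, md (uvec T i 0) <= 2 * Gam0;
  lo_n2 : n2 (uvec T) = complex.Im (dot (mcol T ones) (uvec T)) / c;
  lo_iso : md (dot (mcol T ones) (uvec T) / n%:R - S) <= 2 * r0;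
  lo_dot : md (dot (mcol T ones) (uvec T)) <= 2 * n%:R;
  lo_n2le : n2 (uvec T) <= n%:R * (2 / c);
  lo_al : forall k, k \in T -> md (dot (al T A k) (uvec T)) <= kap * (sc + tau * (2 * Gam0));
  lo_ST : md ST <= 2 * md S;
  lo_STS : md (ST - S) <= 2 * md S ^+ 2 * eps5;
  lo_row : forall k, k \in T -> exists2 E : C,
    g k 0 = ST * (1 - dot (al T A k) (uvec T) - E) & md E <= eps7 }.

Lemma local_outP : local_out.
Proof.
have r00 : 0 <= r0.
  have := le_trans (md_ge0 _) isotropic; rewrite pmulr_lge0 //.
have n00 : 0 <= n%:R :> R by [].
split.
- exact: S1.
- exact: (md_S_decay sA zc c0 n0 tau_entry quad1 small5 eE ec c1).
- exact: (Im_S_eq sA zc c0 n0).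
- exact: (md_s_sub sA zc c0 n0 tau_entry quad1 small5 eE ec).
- exact: (md_s_le sA zc c0 n0 tau_entry quad1 small5 eE ec c1).
- exact: (Im_str0_gt0 sA zc c0 n0).
- exact: (zs_neq0 sA zc c0 n0).
- by move=> i; apply: le_trans (md_uvec0 i cT Tb) _; rewrite ler_wpM2l.
- exact: n2_uvec_Im.
- by apply: le_trans isotropic_pair _; rewrite -[leRHS]mulr1 ler_wpM2l // mulr_ge0.
- by apply: le_trans md_dot_pair _; rewrite -[leRHS]mulr1 ler_wpM2l // mulr_ge0.
- apply: le_trans n2_uvec_pair _; rewrite ler_wpM2l // -[leRHS]mulr1 ler_wpM2l //.
  by rewrite divr_ge0 // ltW.
- exact: md_al_uvec.
- exact: md_ST.
- exact: md_ST_sub.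
- exact: row_ST.
Qed.

End Pair.
End LocalLaw.

(** * The grid sum and the deterministic bound *)

Section GridSum.
Context {R : realType} {n N : nat}.
Local Notation C := R[i].
Variables (w c : R) (x : 'I_N -> R) (SA SB STA STB : 'I_N -> C) (uA uB : 'I_N -> 'cV[C]_n).
Variables (eps5 eps7 ka Gam : R).
Hypotheses (w0 : 0 <= w) (c0 : 0 < c) (n0 : (0 < n)%N).
Hypotheses (SA1 : forall t, md (SA t) <= 1) (SB1 : forall t, md (SB t) <= 1).
Hypotheses (SAx : forall t, md (SA t) ^+ 2 * (1 + x t ^+ 2) <= 10)
           (SBx : forall t, md (SB t) ^+ 2 * (1 + x t ^+ 2) <= 10).
Hypotheses (STA2 : forall t, md (STA t) <= 2 * md (SA t)) (STB2 : forall t, md (STB t) <= 2 * md (SB t)).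
Hypothesis wx : \sum_t w * (1 + x t ^+ 2)^-1 <= 1.

Definition wD t : R := w * (md (SA t) * md (SB t)).
Definition phi t : C := STA t * (STB t)^*%C.

Lemma one_sqr_gt0 (y : R) : 0 < 1 + y ^+ 2.
Proof. by rewrite ltr_pwDl ?sqr_ge0. Qed.

Lemma md_prod_decay t : md (SA t) * md (SB t) <= 10 * (1 + x t ^+ 2)^-1.
Proof.
have y0 := one_sqr_gt0 (x t).
rewrite -(@ler_pXn2r _ 2) ?nnegrE ?mulr_ge0 ?md_ge0 ?invr_ge0 ?(ltW y0) //.
rewrite !exprMn.
have h (S : C) : md S ^+ 2 * (1 + x t ^+ 2) <= 10 -> md S ^+ 2 <= 10 * (1 + x t ^+ 2)^-1.
  by rewrite ler_pdivlMr.
have -> : 10 ^+ 2 * (1 + x t ^+ 2)^-1 ^+ 2 = (10 * (1 + x t ^+ 2)^-1) * (10 * (1 + x t ^+ 2)^-1).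
  by ring.
by apply: ler_pM; rewrite ?sqr_ge0 ?h.
Qed.

Lemma wD_ge0 t : 0 <= wD t.
Proof. by rewrite /wD !mulr_ge0 ?md_ge0. Qed.

Lemma sum_wD : \sum_t wD t <= 10.
Proof.
apply: (@le_trans _ _ (10 * \sum_t w * (1 + x t ^+ 2)^-1)); last first.
  by rewrite -[leRHS]mulr1 ler_wpM2l.
rewrite mulr_sumr; apply: ler_sum => t _; rewrite /wD [10 * (w * _)]mulrCA ler_wpM2l //.
exact: md_prod_decay.
Qed.

Lemma sum_wSA : \sum_t w * md (SA t) ^+ 2 <= 10.
Proof.
apply: (@le_trans _ _ (10 * \sum_t w * (1 + x t ^+ 2)^-1)); last first.
  by rewrite -[leRHS]mulr1 ler_wpM2l.
rewrite mulr_sumr; apply: ler_sum => t _; rewrite [10 * (w * _)]mulrCA ler_wpM2l //.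
by rewrite ler_pdivlMr ?one_sqr_gt0.
Qed.

Lemma md_phi t : w * md (phi t) <= 4 * wD t.
Proof.
rewrite /wD [4 * (w * _)]mulrCA ler_wpM2l // /phi mdM md_conj.
have -> : 4 * (md (SA t) * md (SB t)) = (2 * md (SA t)) * (2 * md (SB t)) by ring.
by rewrite ler_pM ?md_ge0.
Qed.

(** The weights carry total mass at most 40: a factor 4 from replacing the minors' scalars by S and
    a factor 10 from the decay of S. *)
Lemma md_wsum (F : 'I_N -> C) (b : R) : 0 <= b -> (forall t, md (F t) <= b) ->
  md (\sum_t w%:C%C * phi t * F t) <= 40 * b.
Proof.
move=> b0 hF; apply: le_trans (md_sum _ _ _) _.
apply: (@le_trans _ _ (\sum_t (4 * wD t) * b)).
  apply: ler_sum => t _; rewrite mdM [md (w%:C%C * _)]mdM md_real (ger0_norm w0).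
  by rewrite ler_pM ?mulr_ge0 ?md_ge0 ?md_phi.
rewrite -mulr_suml -mulr_sumr ler_wpM2r //.
have -> : 40 = 4 * 10 :> R by ring.
by rewrite ler_wpM2l // sum_wD.
Qed.

Section Linear.
Variables (gA gB aA aB EA EB : 'I_N -> C).
Hypotheses (gAE : forall t, gA t = STA t * (1 - aA t - EA t))
           (gBE : forall t, gB t = STB t * (1 - aB t - EB t)).
Hypotheses (aAk : forall t, md (aA t) <= ka) (aBk : forall t, md (aB t) <= ka).
Hypotheses (EA7 : forall t, md (EA t) <= eps7) (EB7 : forall t, md (EB t) <= eps7) (e71 : eps7 <= 1).
Hypothesis ka0 : 0 <= ka.

(** In the product of 1 - a - E and the conjugate of 1 - a' - E', only the term a a' may be
    quadratically large, and it is kept as the bilinear form. Everything else is at most 4 + 4 ka,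
    and the total weight 40 turns this into 160 (1 + ka). *)
Lemma linear_part : md (\sum_t w%:C%C * (gA t * (gB t)^*%C) - \sum_t w%:C%C * phi t * (aA t * (aB t)^*%C))
  <= 160 * (1 + ka).
Proof.
rewrite -sumrB.
rewrite (eq_bigr (fun t => w%:C%C * phi t * ((1 - EA t) * (1 - EB t)^*%C - (1 - EA t) * (aB t)^*%C - (1 - EB t)^*%C * aA t))).
  have -> : 160 * (1 + ka) = 40 * (4 + 4 * ka) by ring.
  apply: md_wsum; first by rewrite addr_ge0 // mulr_ge0.
  move=> t.
  have h (E : C) : md E <= eps7 -> md (1 - E) <= 2.
    by move=> hE; apply: le_trans (mdB _ _) _; rewrite md1; have e71' := e71; lra.
  have hA := h _ (EA7 t); have hB := h _ (EB7 t).
  apply: le_trans (mdB _ _) _; apply: (@le_trans _ _ ((4 + 2 * ka) + 2 * ka)); last by lra.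
  apply: lerD; last by rewrite mdM md_conj ler_pM ?md_ge0.
  apply: le_trans (mdB _ _) _; apply: lerD; last by rewrite mdM md_conj ler_pM ?md_ge0.
  have -> : 4 = 2 * 2 :> R by ring.
  by rewrite mdM md_conj ler_pM ?md_ge0.
move=> t _; rewrite gAE gBE /phi !(conjcM, conjcD, raddfN) /=; ring.
Qed.

End Linear.

Definition Mmat (i j : 'I_n) : C := \sum_t w%:C%C * phi t * (uA t i 0 * (uB t j 0)^*%C).

Lemma quad_part (al be : 'cV[C]_n) :
  \sum_t w%:C%C * phi t * (dot al (uA t) * (dot be (uB t))^*%C) =
  \sum_i \sum_j al i 0 * (be j 0)^*%C * Mmat i j.
Proof.
have e (t : 'I_N) : w%:C%C * phi t * (dot al (uA t) * (dot be (uB t))^*%C) =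
    \sum_i \sum_j al i 0 * (be j 0)^*%C * (w%:C%C * phi t * (uA t i 0 * (uB t j 0)^*%C)).
  rewrite /dot conjc_sum mulr_suml mulr_sumr; apply: eq_bigr => i _.
  by rewrite mulr_sumr mulr_sumr; apply: eq_bigr => j _; rewrite conjcM; ring.
rewrite (eq_bigr _ (fun t _ => e t)) exchange_big /=; apply: eq_bigr => i _.
by rewrite exchange_big /=; apply: eq_bigr => j _; rewrite /Mmat mulr_sumr.
Qed.

Hypotheses (uAG : forall t i, md (uA t i 0) <= Gam) (uBG : forall t i, md (uB t i 0) <= Gam).

Lemma Mmat_max i j : md (Mmat i j) <= 40 * Gam ^+ 2.
Proof.
apply: md_wsum => [|t]; first exact: sqr_ge0.
by rewrite mdM md_conj expr2 ler_pM ?md_ge0.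
Qed.

Variable eta : R.
Hypothesis eta0 : 0 < eta.
Hypotheses
  (hA : forall s t, md (hdot (uA s) (uA t)) ^+ 2 * ((x s - x t) ^+ 2 + eta ^+ 2) <= (4 * n%:R) ^+ 2)
  (hB : forall s t, md (hdot (uB s) (uB t)) ^+ 2 * ((x s - x t) ^+ 2 + eta ^+ 2) <= (4 * n%:R) ^+ 2).
Hypothesis wxx : forall s, \sum_t w / ((x s - x t) ^+ 2 + eta ^+ 2) <= eta^-1.

(** Expanding the square gives a double sum over grid points of products of Gram entries. Each
    product is at most (4 n)^2 / ((x_s - x_t)^2 + eta^2), and summing this Lorentzian over t costs
    only 1 / eta; the sum over s costs the total weight. The constant is 2560 = 4 . 10 . 4 . 4^2. *)
Lemma Mmat_frob : \sum_i \sum_j md (Mmat i j) ^+ 2 <= 2560 * n%:R ^+ 2 / eta.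
Proof.
pose y t := w%:C%C * phi t.
have e : ((\sum_i \sum_j md (Mmat i j) ^+ 2)%:C%C : C) =
    \sum_s \sum_t y s * (y t)^*%C * (hdot (uA s) (uA t) * (hdot (uB s) (uB t))^*%C).
  rewrite rmorph_sum /=.
  transitivity (\sum_i \sum_j \sum_s \sum_t y s * (y t)^*%C *
      ((uA s i 0 * (uA t i 0)^*%C) * ((uB s j 0)^*%C * uB t j 0))).
    apply: eq_bigr => i _; rewrite rmorph_sum /=; apply: eq_bigr => j _.
    rewrite -mulc_conj /Mmat conjc_sum mulr_suml; apply: eq_bigr => s _.
    rewrite mulr_sumr; apply: eq_bigr => t _.
    by rewrite /y !conjcM !conjcK; ring.
  rewrite (eq_bigr (fun i => \sum_s \sum_t \sum_j y s * (y t)^*%C *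
      ((uA s i 0 * (uA t i 0)^*%C) * ((uB s j 0)^*%C * uB t j 0)))); last first.
    by move=> i _; rewrite exchange_big /=; apply: eq_bigr => s _; rewrite exchange_big.
  rewrite exchange_big /=; apply: eq_bigr => s _; rewrite exchange_big /=; apply: eq_bigr => t _.
  rewrite /hdot conjc_sum mulr_suml mulr_sumr; apply: eq_bigr => i _.
  rewrite mulr_sumr mulr_sumr; apply: eq_bigr => j _.
  by rewrite !conjcM !conjcK; ring.
apply: (@le_trans _ _ (md ((\sum_i \sum_j md (Mmat i j) ^+ 2)%:C%C : C))).
  by rewrite md_real ler_norm.
rewrite e.
apply: (@le_trans _ _ (\sum_s (4 * wD s) * \sum_t 4 * (4 * n%:R) ^+ 2 * (w / ((x s - x t) ^+ 2 + eta ^+ 2)))).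
  apply: le_trans (md_sum _ _ _) _; apply: ler_sum => s _; rewrite mulr_sumr.
  apply: le_trans (md_sum _ _ _) _; apply: ler_sum => t _.
  set D := (x s - x t) ^+ 2 + eta ^+ 2.
  have D0 : 0 < D by exact: lorentz_denom_gt0.
  have Di : 0 <= D^-1 by rewrite invr_ge0 ltW.
  have hh : md (hdot (uA s) (uA t)) * md (hdot (uB s) (uB t)) <= (4 * n%:R) ^+ 2 / D.
    have h1 : md (hdot (uA s) (uA t)) ^+ 2 <= (4 * n%:R) ^+ 2 / D by rewrite ler_pdivlMr.
    have h2 : md (hdot (uB s) (uB t)) ^+ 2 <= (4 * n%:R) ^+ 2 / D by rewrite ler_pdivlMr.
    rewrite -(@ler_pXn2r _ 2) ?nnegrE ?mulr_ge0 ?md_ge0 ?divr_ge0 ?sqr_ge0 ?(ltW D0) //.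
    by rewrite exprMn [leRHS]expr2 ler_pM ?sqr_ge0.
  have ey r : md (y r) = w * md (phi r) by rewrite /y mdM md_real ger0_norm.
  rewrite [md (y s * _ * _)]mdM [md (y s * _)]mdM md_conj !ey mdM md_conj.
  have -> : 4 * wD s * (4 * (4 * n%:R) ^+ 2 * (w / D)) = (4 * wD s) * (4 * w) * ((4 * n%:R) ^+ 2 / D).
    by ring.
  have w4 : w * md (phi t) <= 4 * w.
    apply: le_trans (md_phi t) _; rewrite ler_wpM2l // /wD -[leRHS]mulr1 ler_wpM2l //.
    by rewrite -[leRHS]mulr1 ler_pM ?md_ge0.
  apply: ler_pM => //; rewrite ?mulr_ge0 ?md_ge0 //.
  by apply: ler_pM; rewrite ?mulr_ge0 ?md_ge0 ?md_phi.
apply: (@le_trans _ _ (\sum_s (4 * wD s) * (4 * (4 * n%:R) ^+ 2 * eta^-1))).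
  apply: ler_sum => s _; apply: ler_wpM2l; first by apply: mulr_ge0 => //; exact: wD_ge0.
  rewrite -mulr_sumr; apply: ler_wpM2l; last exact: wxx.
  by rewrite mulr_ge0 // sqr_ge0.
rewrite -mulr_suml -mulr_sumr.
have -> : 2560 * n%:R ^+ 2 / eta = 4 * 10 * (4 * (4 * n%:R) ^+ 2 * eta^-1) by ring.
rewrite ler_wpM2r ?mulr_ge0 ?sqr_ge0 ?invr_ge0 ?(ltW eta0) // ler_wpM2l //.
exact: sum_wD.
Qed.

(** * The trace of the bilinear form *)

Section Trace.
Variables (sA : 'I_N -> C) (e r0 delta theta xi : R) (q : 'I_N -> R) (ee : 'I_n -> R).
Hypothesis ImSA : forall t, complex.Im (SA t) = md (SA t) ^+ 2 * (c + complex.Im (sA t)).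
Hypothesis sASub : forall t, md (sA t - SA t) <= 2 * e * md (SA t) ^+ 2.
Hypotheses (STAsub : forall t, md (STA t - SA t) <= 2 * md (SA t) ^+ 2 * eps5)
           (STBsub : forall t, md (STB t - SB t) <= 2 * md (SB t) ^+ 2 * eps5).
Hypothesis SABsub : forall t, md (SA t - SB t) <= md (SA t) * md (SB t) * (2 * theta / c).
Hypotheses (n2A : forall t, n2 (uA t) <= n%:R * (2 / c)) (n2B : forall t, n2 (uB t) <= n%:R * (2 / c)).
Hypotheses (n2q : forall t, n2 (uA t) = q t / c)
           (qS : forall t, `|q t / n%:R - complex.Im (SA t)| <= 2 * r0).
Hypothesis n2AB : forall t, n2 (uA t - uB t) <= (theta / c) ^+ 2 * n2 (uB t).
Hypothesis sum_ImsA : `|\sum_t w * complex.Im (sA t) - 2^-1| <= delta.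
Hypotheses (e0 : 0 <= e) (r00 : 0 <= r0) (theta0 : 0 <= theta) (eps50 : 0 <= eps5) (xi0 : 0 <= xi).
Hypothesis eexi : forall j, `|ee j - n%:R^-1| <= xi.

Let c00 : 0 <= c := ltW c0.
Let cn0 : c != 0. Proof. by rewrite gt_eqF. Qed.
Let nR : 0 < n%:R :> R. Proof. by rewrite ltr0n. Qed.
Let b : R := n%:R * (2 / c).
Let b0 : 0 <= b. Proof. by rewrite /b mulr_ge0 // divr_ge0. Qed.
Let sb : R := Num.sqrt b.
Let sb0 : 0 <= sb. Proof. exact: sqrtr_ge0. Qed.
Let sbE : sb ^+ 2 = b. Proof. exact: sqr_sqrtr. Qed.

(** The diagonal of M pairs u_A with u_B, which differ by theta / c relative to u_B. After the
    replacement only the squared norm of u_A is left, to which the Ward identity applies. *)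
Lemma trace_diff1 : md (\sum_j Mmat j j - \sum_t w%:C%C * phi t * (n2 (uA t))%:C%C) <=
  40 * (b * (theta / c)).
Proof.
have -> : \sum_j Mmat j j = \sum_t w%:C%C * phi t * hdot (uA t) (uB t).
  by rewrite /Mmat exchange_big /=; apply: eq_bigr => t _; rewrite mulr_sumr.
rewrite -sumrB (eq_bigr (fun t => w%:C%C * phi t * - hdot (uA t) (uA t - uB t))).
  apply: md_wsum => [|t]; first by rewrite mulr_ge0 // divr_ge0.
  rewrite mdN; have -> : b * (theta / c) = sb * (theta / c * sb) by rewrite -sbE; ring.
  have tc : 0 <= theta / c by rewrite divr_ge0.
  apply: md_hdot => //; first by rewrite mulr_ge0.
    by rewrite sbE; exact: n2A.
  apply: le_trans (n2AB t) _; rewrite [leRHS]exprMn sbE ler_wpM2l ?sqr_ge0 //; exact: n2B.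
move=> t _; rewrite -mulrBr; congr (_ * _); rewrite -hdot_self /hdot -sumrB -sumrN.
by apply: eq_bigr => i _; rewrite [(uA t - uB t) i 0]mxE [(- uB t) i 0]mxE conjcD raddfN /=; ring.
Qed.

Lemma md_phi_sub t : w * md (phi t - (md (SA t) ^+ 2)%:C%C) <=
  4 * (eps5 + theta / c) * wD t + 2 * eps5 * (w * md (SA t) ^+ 2).
Proof.
have -> : phi t - (md (SA t) ^+ 2)%:C%C = STA t * (STB t - SA t)^*%C + (STA t - SA t) * (SA t)^*%C.
  by rewrite -mulc_conj /phi conjcD raddfN /=; ring.
have a0 := md_ge0 (SA t); have bb0 := md_ge0 (SB t).
have -> : 4 * (eps5 + theta / c) * wD t + 2 * eps5 * (w * md (SA t) ^+ 2) =
   w * (2 * md (SA t) * (2 * md (SB t) * eps5 + md (SB t) * (2 * theta / c))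
        + 2 * md (SA t) ^+ 2 * eps5).
  by rewrite /wD; ring.
rewrite ler_wpM2l //; apply: le_trans (mdD _ _) _; apply: lerD; rewrite mdM md_conj; last first.
  rewrite -[leRHS]mulr1 ler_pM ?md_ge0 ?STAsub //.
rewrite ler_pM ?md_ge0 ?STA2 //.
have -> : STB t - SA t = (STB t - SB t) - (SA t - SB t) by ring.
apply: le_trans (mdB _ _) _; apply: lerD.
  apply: le_trans (STBsub t) _; rewrite ler_wpM2r // ler_wpM2l //.
  by rewrite expr2 -[leRHS]mulr1 ler_wpM2l.
apply: le_trans (SABsub t) _; rewrite ler_wpM2r //.
  by rewrite divr_ge0 // mulr_ge0.
by rewrite -[leRHS]mul1r ler_wpM2r.
Qed.

(** The product of the minors' scalars is replaced by |S_A|^2, because |S_A|^2 is tied to Im s by an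
    exact identity. *)
Lemma trace_diff2 : md (\sum_t w%:C%C * phi t * (n2 (uA t))%:C%C -
    (\sum_t w * md (SA t) ^+ 2 * n2 (uA t))%:C%C) <= (60 * eps5 + 40 * (theta / c)) * b.
Proof.
rewrite rmorph_sum -sumrB /=; apply: le_trans (md_sum _ _ _) _.
apply: (@le_trans _ _ (\sum_t (4 * (eps5 + theta / c) * wD t + 2 * eps5 * (w * md (SA t) ^+ 2)) * b)).
  apply: ler_sum => t _.
  have -> : w%:C%C * phi t * (n2 (uA t))%:C%C - (w * md (SA t) ^+ 2 * n2 (uA t))%:C%C =
     w%:C%C * (phi t - (md (SA t) ^+ 2)%:C%C) * (n2 (uA t))%:C%C by rewrite !rmorphM /=; ring.
  rewrite mdM [md (w%:C%C * _)]mdM !md_real (ger0_norm w0) (ger0_norm (n2_ge0 _)).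
  by rewrite ler_pM ?mulr_ge0 ?md_ge0 ?n2_ge0 ?md_phi_sub // n2A.
rewrite -mulr_suml ler_wpM2r // big_split /= -[X in X + _]mulr_sumr -[X in _ + X]mulr_sumr.
have tc : 0 <= theta / c by rewrite divr_ge0.
have h1 : 4 * (eps5 + theta / c) * \sum_t wD t <= 4 * (eps5 + theta / c) * 10.
  by rewrite ler_wpM2l ?sum_wD // mulr_ge0 // addr_ge0.
have h2 : 2 * eps5 * \sum_t w * md (SA t) ^+ 2 <= 2 * eps5 * 10.
  by rewrite ler_wpM2l ?sum_wSA // mulr_ge0.
by apply: le_trans (lerD h1 h2) _; lra.
Qed.

Lemma weighted_le (F : 'I_N -> R) (d : R) : 0 <= d -> (forall t, `|F t| <= d) ->
  `|\sum_t w * md (SA t) ^+ 2 * F t| <= 10 * d.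
Proof.
move=> d0 hF; apply: le_trans (ler_norm_sum _ _ _) _.
apply: (@le_trans _ _ (\sum_t w * md (SA t) ^+ 2 * d)).
  apply: ler_sum => t _.
  have y0 : 0 <= w * md (SA t) ^+ 2 by apply: mulr_ge0 => //; exact: sqr_ge0.
  by rewrite normrM ger0_norm // ler_wpM2l.
by rewrite -mulr_suml ler_wpM2r // sum_wSA.
Qed.

(** The squared norm is q / c with q / n close to Im S, and Im S is close to Im s. The identity
    |S|^2 Im s = Im S - c |S|^2 then removes the weight |S|^2, and the plain sum of w Im s is 1/2 up
    to delta. The term c |S|^2 sums to at most 10 after division by c, which is the additive 10. *)
Lemma trace_diff3 : `|\sum_t w * md (SA t) ^+ 2 * n2 (uA t) / n%:R - (2 * c)^-1| <=
  (20 * r0 + 40 * e + delta) / c + 10.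
Proof.
pose y t : R := w * md (SA t) ^+ 2.
have eqI t : md (SA t) ^+ 2 * complex.Im (sA t) = complex.Im (SA t) - c * md (SA t) ^+ 2.
  by rewrite ImSA; ring.
have hI t : `|complex.Im (SA t) - complex.Im (sA t)| <= 2 * e * md (SA t) ^+ 2.
  apply: le_trans (sASub t); rewrite mdBC -ImN -ImD; exact: Im_le_md.
have hI' t : `|complex.Im (SA t) - complex.Im (sA t)| <= 2 * e.
  apply: le_trans (hI t) _; rewrite -[leRHS]mulr1 ler_wpM2l ?mulr_ge0 //.
  by rewrite exprn_ile1 ?md_ge0.
set d1 := \sum_t y t * (q t / n%:R - complex.Im (SA t)).
set d2 := \sum_t y t * (complex.Im (SA t) - complex.Im (sA t)).
set d3 := \sum_t w * (complex.Im (SA t) - complex.Im (sA t)).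
set d4 := \sum_t w * md (SA t) ^+ 2.
set d5 := \sum_t w * complex.Im (sA t) - 2^-1.
have -> : \sum_t w * md (SA t) ^+ 2 * n2 (uA t) / n%:R - (2 * c)^-1 =
  (d1 + d2 + d3 + d5) / c - d4.
  transitivity ((\sum_t (y t * (q t / n%:R - complex.Im (SA t)) +
     y t * (complex.Im (SA t) - complex.Im (sA t)) + w * (complex.Im (SA t) - complex.Im (sA t)) +
     w * complex.Im (sA t) - c * (w * md (SA t) ^+ 2))) / c - (2 * c)^-1).
    congr (_ - _); rewrite mulr_suml; apply: eq_bigr => t _; rewrite n2q.
    have -> : y t * (complex.Im (SA t) - complex.Im (sA t)) =
       y t * complex.Im (SA t) - w * (complex.Im (SA t) - c * md (SA t) ^+ 2).
      by rewrite mulrBr -eqI /y; ring.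
    by rewrite /y; field; rewrite cn0 gt_eqF.
  rewrite sumrB !big_split /= -[X in (_ - X) / _]mulr_sumr -/d1 -/d2 -/d3 -/d4 /d5.
  by field; rewrite cn0.
have h1 : `|d1| <= 10 * (2 * r0) by apply: weighted_le => //; rewrite mulr_ge0.
have h2 : `|d2| <= 10 * (2 * e) by apply: weighted_le => //; rewrite mulr_ge0.
have d40 : 0 <= d4 by apply: sumr_ge0 => t _; rewrite mulr_ge0 // sqr_ge0.
have h4 : d4 <= 10 by exact: sum_wSA.
have h3 : `|d3| <= 20 * e.
  apply: le_trans (ler_norm_sum _ _ _) _.
  apply: (@le_trans _ _ (\sum_t 2 * e * (w * md (SA t) ^+ 2))).
    apply: ler_sum => t _; rewrite normrM (ger0_norm w0) mulrCA ler_wpM2l //.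
  rewrite -mulr_sumr -/d4; have -> : 20 * e = 2 * e * 10 by ring.
  by rewrite ler_wpM2l // mulr_ge0.
apply: le_trans (ler_normB _ _) _; apply: lerD; last by rewrite ger0_norm.
rewrite normrM normfV (gtr0_norm c0) ler_wpM2r ?invr_ge0 //.
apply: le_trans (ler_normD _ _) _; apply: lerD => //.
apply: le_trans (ler_normD _ _) _.
have -> : 20 * r0 + 40 * e = (10 * (2 * r0) + 10 * (2 * e)) + 20 * e by ring.
apply: lerD => //.
by apply: le_trans (ler_normD _ _) (lerD h1 h2).
Qed.

(** The coefficients [ee] will be the covariances of paired entries, equal to 1 / n up to xi.
    Replacing them costs xi times the sum of the |M_jj|, which Cauchy-Schwarz over j and the total
    weight bound by 80 n / c. *)
Lemma trace_total : `|\sum_j complex.Re (Mmat j j) * ee j - (2 * c)^-1| <=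
  80 * xi * (n%:R / c) + 160 * (theta / c ^+ 2) + (120 * eps5 + 20 * r0 + 40 * e + delta) / c + 10.
Proof.
set m := \sum_t w * md (SA t) ^+ 2 * n2 (uA t) / n%:R.
set f := complex.Re (\sum_j Mmat j j) / n%:R.
have h1 : `|\sum_j complex.Re (Mmat j j) * ee j - f| <= 40 * (2 * (n%:R / c)) * xi.
  have -> : \sum_j complex.Re (Mmat j j) * ee j - f =
      \sum_j complex.Re (Mmat j j) * (ee j - n%:R^-1).
    rewrite /f Re_sum mulr_suml -sumrB; apply: eq_bigr => j _; by rewrite mulrBr.
  apply: le_trans (ler_norm_sum _ _ _) _.
  apply: (@le_trans _ _ (\sum_j (\sum_t (4 * wD t) * (md (uA t j 0) * md (uB t j 0))) * xi)).
    apply: ler_sum => j _; rewrite normrM ler_pM //.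
    apply: le_trans (Re_le_md _) _; rewrite /Mmat; apply: le_trans (md_sum _ _ _) _.
    apply: ler_sum => t _; rewrite mdM [md (w%:C%C * _)]mdM md_real (ger0_norm w0).
    by rewrite mdM md_conj ler_pM ?mulr_ge0 ?md_ge0 ?md_phi.
  rewrite -mulr_suml ler_wpM2r // exchange_big /=.
  apply: (@le_trans _ _ (\sum_t (4 * wD t) * b)).
    apply: ler_sum => t _; rewrite -mulr_sumr; apply: ler_wpM2l.
      by apply: mulr_ge0 => //; exact: wD_ge0.
    rewrite -sbE expr2; apply: cauchy_schwarz_md; rewrite ?sb0 // sbE; [exact: n2A | exact: n2B].
  rewrite -mulr_suml -mulr_sumr.
  have -> : 40 * (2 * (n%:R / c)) = 4 * 10 * b by rewrite /b; ring.
  by rewrite ler_wpM2r // ler_wpM2l // sum_wD.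
have h2 : `|f - m| <= (40 * (b * (theta / c)) + (60 * eps5 + 40 * (theta / c)) * b) / n%:R.
  rewrite /f /m -[X in _ - X]mulr_suml -mulrBl normrM normfV (gtr0_norm nR) ler_wpM2r ?invr_ge0 //.
  set m' : R := \sum_t w * md (SA t) ^+ 2 * n2 (uA t).
  have -> : complex.Re (\sum_j Mmat j j) - m' = complex.Re (\sum_j Mmat j j - m'%:C%C).
    by rewrite ReD ReN.
  apply: le_trans (Re_le_md _) _.
  rewrite (_ : \sum_j Mmat j j - m'%:C%C =
   (\sum_j Mmat j j - \sum_t w%:C%C * phi t * (n2 (uA t))%:C%C) +
   (\sum_t w%:C%C * phi t * (n2 (uA t))%:C%C - m'%:C%C)); last by ring.
  by apply: le_trans (mdD _ _) (lerD trace_diff1 trace_diff2).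
have h3 := trace_diff3; rewrite -/m in h3.
have -> : \sum_j complex.Re (Mmat j j) * ee j - (2 * c)^-1 =
  (\sum_j complex.Re (Mmat j j) * ee j - f) + (f - m) + (m - (2 * c)^-1) by ring.
apply: le_trans (ler_normD _ _) _; apply: le_trans (lerD (le_trans (ler_normD _ _) (lerD h1 h2)) h3) _.
rewrite le_eqVlt; apply/orP; left; apply/eqP; rewrite /b; field.
by rewrite cn0 gt_eqF.
Qed.

End Trace.
End GridSum.

(** * Spectral representation of the resolvent *)

Section Spectral.
Context {R : realType} {n : nat}.
Local Notation C := R[i].
Variables (A V : 'M[R]_n) (lam : 'I_n -> R).
Hypothesis sd : spec_decomp A V lam.

Lemma spec_VVt : V *m V^T = 1%:M.
Proof. by case: sd => h _; exact: mulmx1C. Qed.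

Lemma spec_diag : A = V *m diag_mx (\row_i lam i) *m V^T.
Proof.
case: sd => _ ->; apply/matrixP => k l; rewrite summxE [RHS]mxE; apply: eq_bigr => i _.
rewrite mxE mxE big_ord1 !mxE (bigD1 i) //= big1 ?addr0 => [|j ji]; last first.
  by rewrite !mxE (negbTE ji) mulr0n mulr0.
by rewrite !mxE eqxx mulr1n; ring.
Qed.

Lemma spec_row_norm k : \sum_i V k i ^+ 2 = 1.
Proof.
have /matrixP/(_ k k) := spec_VVt; rewrite !mxE eqxx => h.
by rewrite -[RHS]h; apply: eq_bigr => i _; rewrite mxE expr2.
Qed.

Definition colsum i : R := \sum_m V m i.

(** Parseval: [colsum i] is the coefficient of the all-ones vector along the i-th eigenvector. *)
Lemma spec_colsum_norm : \sum_i colsum i ^+ 2 = n%:R.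
Proof.
transitivity (\sum_k \sum_l \sum_i V k i * V l i).
  rewrite [RHS]exchange_big; under [RHS]eq_bigr do rewrite exchange_big.
  rewrite [RHS]exchange_big /=; apply: eq_bigr => i _.
  rewrite expr2 /colsum mulr_suml [RHS]exchange_big /=; apply: eq_bigr => k _.
  by rewrite mulr_sumr; apply: eq_bigr => l _; rewrite mulrC.
transitivity (\sum_(k < n) (1 : R)); last by rewrite sumr_const card_ord.
apply: eq_bigr => k _; rewrite (bigD1 k) //= [X in _ + X]big1 ?addr0.
  by rewrite -[RHS](spec_row_norm k); apply: eq_bigr => i _; rewrite expr2.
move=> l lk; have /matrixP/(_ k l) := spec_VVt; rewrite !mxE eq_sym (negbTE lk) => h.
by rewrite -[RHS]h; apply: eq_bigr => i _; rewrite mxE.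
Qed.

Section Resolvent.
Variables (z : C).
Hypotheses (sA : A^T = A) (z0 : 0 < complex.Im z).

Lemma lam_z_neq0 i : (lam i)%:C%C - z != 0.
Proof.
apply: contraTneq z0 => /(congr1 (@complex.Im R)); rewrite ImD ImN /= => h.
by rewrite -leNgt; move: h; lra.
Qed.

Lemma spec_res : res A z =
  toCm V *m diag_mx (\row_i ((lam i)%:C%C - z)^-1) *m (toCm V)^T.
Proof.
have e1 : toCm V *m (toCm V)^T = 1%:M.
  by rewrite /toCm map_trmx -map_mxM spec_VVt map_mx1.
have e2 : (toCm V)^T *m toCm V = 1%:M.
  by rewrite /toCm map_trmx -map_mxM (proj1 sd) map_mx1.
have eA : toCm A - z%:M = toCm V *m diag_mx (\row_i ((lam i)%:C%C - z)) *m (toCm V)^T.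
  have -> : diag_mx (\row_i ((lam i)%:C%C - z)) = toCm (diag_mx (\row_i lam i)) - z%:M.
    apply/matrixP => i j; rewrite !mxE; case: eqP => _.
      by rewrite !mulr1n.
    by rewrite !mulr0n subr0.
  rewrite mulmxBr mulmxBl mul_mx_scalar -scalemxAl e1 scalemx1; congr (_ - _).
  by rewrite /toCm map_trmx -!map_mxM -spec_diag.
set Y := (RHS).
have h : (toCm A - z%:M) *m Y = 1%:M.
  rewrite eA /Y !mulmxA -[_ *m (toCm V)^T *m toCm V]mulmxA e2 mulmx1.
  rewrite -[toCm V *m _ *m _]mulmxA mulmx_diag.
  have -> : (\row_j ((\row_i ((lam i)%:C%C - z)) 0 j * (\row_i ((lam i)%:C%C - z)^-1) 0 j)) = const_mx 1.
    by apply/rowP => j; rewrite !mxE mulfV // lam_z_neq0.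
  by rewrite diag_const_mx mulmx1 e1.
by rewrite -[Y](mulKmx (res_unit sA z0)) h mulmx1.
Qed.

Lemma spec_res_ones k : (res A z *m ones) k 0 =
  \sum_i (V k i * colsum i)%:C%C / ((lam i)%:C%C - z).
Proof.
rewrite spec_res -mulmxA mxE; apply: eq_bigr => i _.
rewrite [X in X * _]mxE (bigD1 i) //= [X in _ + X]big1 ?addr0 => [|j ji]; last first.
  by rewrite !mxE (negbTE ji) mulr0n mulr0.
rewrite !mxE eqxx mulr1n.
have -> : \sum_j (toCm V)^T i j * ones j 0 = (colsum i)%:C%C.
  by rewrite /colsum rmorph_sum /=; apply: eq_bigr => j _; rewrite !mxE mulr1.
by rewrite rmorphM /=; ring.
Qed.

Lemma spec_tr : \tr (res A z) = \sum_i ((lam i)%:C%C - z)^-1.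
Proof.
rewrite spec_res mxtrace_mulC mulmxA /toCm map_trmx -map_mxM (proj1 sd) map_mx1 mul1mx.
by rewrite /mxtrace; apply: eq_bigr => i _; rewrite !mxE eqxx mulr1n.
Qed.

End Resolvent.

(** A crude bound, tau times the square of the l1 norm of a unit vector. It suffices because the
    half-length of the grid will be a higher power of n. *)
Lemma spec_lam_le (tau : R) i : 0 <= tau -> (forall i j, `|A i j| <= tau) -> `|lam i| <= n%:R * tau.
Proof.
move=> t0 ht.
have e : lam i = \sum_k \sum_l V k i * A k l * V l i.
  have : V^T *m A *m V = diag_mx (\row_i lam i).
    by rewrite {1}spec_diag !mulmxA (proj1 sd) mul1mx -mulmxA (proj1 sd) mulmx1.
  move/matrixP/(_ i i); rewrite !mxE eqxx mulr1n => <-.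
  rewrite exchange_big /=; apply: eq_bigr => l _; rewrite mxE mulr_suml.
  by apply: eq_bigr => k _; rewrite mxE.
rewrite e.
have h : (\sum_k `|V k i|) ^+ 2 <= n%:R.
  have := cauchy_schwarz (fun k => `|V k i|) (fun=> 1).
  under eq_bigr do rewrite mulr1.
  have -> : \sum_k `|V k i| ^+ 2 = 1.
    have /matrixP/(_ i i) := proj1 sd; rewrite !mxE eqxx => h.
    by rewrite -[RHS]h; apply: eq_bigr => k _; rewrite mxE real_normK ?num_real // expr2.
  by rewrite mul1r sumr_const card_ord expr1n.
apply: (@le_trans _ _ ((\sum_k `|V k i|) ^+ 2 * tau)); last by rewrite ler_wpM2r.
rewrite expr2 -mulrA mulr_suml; apply: le_trans (ler_norm_sum _ _ _) _.
apply: ler_sum => k _; rewrite mulr_suml mulr_sumr; apply: le_trans (ler_norm_sum _ _ _) _.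
apply: ler_sum => l _; rewrite !normrM -mulrA ler_wpM2l // mulrC ler_wpM2l //.
Qed.

End Spectral.

Section XmatQuadrature.
Context {R : realType} {n N : nat}.
Local Notation C := R[i].
Variables (A B V W : 'M[R]_n) (lam mu : 'I_n -> R) (L c Lam : R).
Hypotheses (sdA : spec_decomp A V lam) (sdB : spec_decomp B W mu) (sA : A^T = A) (sB : B^T = B).
Hypotheses (N0 : (0 < N)%N) (L1 : 1 <= L) (LL : 2 * Lam <= L) (c0 : 0 < c) (c1 : c <= 1).
Hypotheses (lamL : forall i, `|lam i| <= Lam) (muL : forall i, `|mu i| <= Lam).

Definition zpt (t : 'I_N) : C := Complex (gpt L t) c.

Let L0 : 0 < L. Proof. exact: lt_le_trans L1. Qed.
Let z0 t : 0 < complex.Im (zpt t). Proof. by []. Qed.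

Lemma Xmat_entry eta k l : Xmat eta V W lam mu k l =
  \sum_i \sum_j eta / ((lam i - mu j) ^+ 2 + eta ^+ 2) * ((V k i * colsum V i) * (W l j * colsum W j)).
Proof.
rewrite /Xmat summxE; apply: eq_bigr => i _; rewrite summxE; apply: eq_bigr => j _.
rewrite mxE; congr (_ * _).
have e : (col i V *m (col i V)^T) *m const_mx 1 = \matrix_(a < n, b < n) (V a i * colsum V i) :> 'M[R]_n.
  apply/matrixP => a b; rewrite !mxE /colsum mulr_sumr; apply: eq_bigr => m _.
  by rewrite mxE big_ord1 !mxE mulr1.
rewrite e mxE (eq_bigr (fun m => (V k i * colsum V i) * (W m j * W l j))).
  by rewrite -mulr_sumr -mulr_suml [_ * W l j]mulrC.
by move=> m _; rewrite mxE; congr (_ * _); rewrite mxE big_ord1 !mxE.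
Qed.

Lemma Re_kernel (l m x : R) :
  complex.Re ((l%:C%C - Complex x c)^-1 * ((m%:C%C - Complex x c)^-1)^*%C) =
  ((l - x) * (m - x) + c ^+ 2) / (((l - x) ^+ 2 + c ^+ 2) * ((m - x) ^+ 2 + c ^+ 2)).
Proof.
have D1 := lorentz_denom_gt0 (l - x) c0; have D2 := lorentz_denom_gt0 (m - x) c0.
have e (u : R) : (u%:C%C - Complex x c)^-1 =
    Complex ((u - x) / ((u - x) ^+ 2 + c ^+ 2)) (c / ((u - x) ^+ 2 + c ^+ 2)).
  rewrite /GRing.inv /= sub0r sqrrN; congr Complex; rewrite mulNr opprK //.
by rewrite !e /=; field; rewrite !gt_eqF.
Qed.

(** The kernel error is uniform over pairs of eigenvalues. The two sums of coefficients are at most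
    sqrt n each, by Cauchy-Schwarz and Parseval, which gives the factor n. *)
Lemma Xmat_quadrature k l :
  `|Xmat (2 * c) V W lam mu k l - complex.Re (\sum_(t < N) (gwt L N)%:C%C *
      ((res A (zpt t) *m ones) k 0 * ((res B (zpt t) *m ones) l 0)^*%C))|
  <= n%:R * ((2 * gerr L N c + 12 * (Lam + 1) / L) / c).
Proof.
pose p i := V k i * colsum V i; pose r j := W l j * colsum W j.
pose K i j := \sum_(t < N) gwt L N * (((lam i - gpt L t) * (mu j - gpt L t) + c ^+ 2) /
      (((lam i - gpt L t) ^+ 2 + c ^+ 2) * ((mu j - gpt L t) ^+ 2 + c ^+ 2))).
have -> : complex.Re (\sum_(t < N) (gwt L N)%:C%C *
      ((res A (zpt t) *m ones) k 0 * ((res B (zpt t) *m ones) l 0)^*%C)) =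
   \sum_i \sum_j K i j * (p i * r j).
  rewrite Re_sum.
  transitivity (\sum_(t < N) \sum_i \sum_j gwt L N * (((lam i - gpt L t) * (mu j - gpt L t) + c ^+ 2) /
      (((lam i - gpt L t) ^+ 2 + c ^+ 2) * ((mu j - gpt L t) ^+ 2 + c ^+ 2))) * (p i * r j)).
    apply: eq_bigr => t _.
    rewrite (spec_res_ones sdA sA (z0 t)) (spec_res_ones sdB sB (z0 t)).
    rewrite conjc_sum mulr_suml ReMr Re_sum mulr_sumr; apply: eq_bigr => i _.
    rewrite mulr_sumr Re_sum mulr_sumr; apply: eq_bigr => j _.
    rewrite -/(p i) -/(r j) conjcM conjc_real -Re_kernel.
    have -> : (p i)%:C%C / ((lam i)%:C%C - zpt t) * ((r j)%:C%C * (((mu j)%:C%C - zpt t)^-1)^*%C) =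
       (p i * r j)%:C%C * (((lam i)%:C%C - zpt t)^-1 * (((mu j)%:C%C - zpt t)^-1)^*%C).
      have -> : (p i * r j)%:C%C = (p i)%:C%C * (r j)%:C%C :> C by exact: rmorphM.
      by ring.
    by rewrite ReMr mulrCA mulrC.
  rewrite exchange_big /=; apply: eq_bigr => i _; rewrite exchange_big /=; apply: eq_bigr => j _.
  by rewrite /K mulr_suml.
rewrite Xmat_entry -sumrB.
set del := (X in _ <= _ * X).
have hK i j : `|2 * c / ((lam i - mu j) ^+ 2 + (2 * c) ^+ 2) - K i j| <= del.
  by rewrite distrC; exact: kernel_sum.
apply: le_trans (ler_norm_sum _ _ _) _.
apply: (@le_trans _ _ (\sum_i \sum_j del * (`|p i| * `|r j|))).
  apply: ler_sum => i _; rewrite -sumrB; apply: le_trans (ler_norm_sum _ _ _) _.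
  apply: ler_sum => j _; rewrite -mulrBl normrM [`|p i * r j|]normrM.
  by rewrite ler_wpM2r // mulr_ge0.
have d0 : 0 <= del.
  have La0 : 0 <= Lam by exact: le_trans (normr_ge0 _) (lamL k).
  have c00 := ltW c0; have L00 := ltW L0.
  apply: divr_ge0 => //; apply: addr_ge0; first by rewrite mulr_ge0 // gerr_ge0.
  by apply: divr_ge0 => //; rewrite mulr_ge0 // addr_ge0.
have -> : \sum_i \sum_j del * (`|p i| * `|r j|) = del * ((\sum_i `|p i|) * (\sum_j `|r j|)).
  rewrite mulr_suml mulr_sumr; apply: eq_bigr => i _.
  by rewrite mulr_sumr mulr_sumr.
have hs (U : 'M[R]_n) (D : 'M[R]_n) nu a : spec_decomp D U nu ->
    \sum_i `|U a i * colsum U i| <= Num.sqrt n%:R.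
  move=> sd; rewrite -[leRHS]mul1r; under eq_bigr do rewrite normrM.
  apply: le_trans (ler_norm _) _; apply: cauchy_schwarz_sqrt => //.
    rewrite expr1n -(spec_row_norm sd a) le_eqVlt; apply/orP; left; apply/eqP.
    by apply: eq_bigr => i _; rewrite real_normK ?num_real.
  rewrite sqr_sqrtr // -(spec_colsum_norm sd) le_eqVlt; apply/orP; left; apply/eqP.
  by apply: eq_bigr => i _; rewrite real_normK ?num_real.
rewrite mulrC ler_wpM2r //.
have -> : n%:R = Num.sqrt n%:R * Num.sqrt n%:R :> R by rewrite -expr2 sqr_sqrtr.
by apply: ler_pM; rewrite ?sumr_ge0 //; [exact: hs sdA | exact: hs sdB].
Qed.

(** Im s is the average over the eigenvalues of Lorentzians of width c, each of which sums to nearly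
    1/2 over the grid. *)
Lemma sum_Im_str0 : (0 < n)%N ->
  `|\sum_(t < N) gwt L N * complex.Im (str0 A (zpt t)) - 2^-1| <= gerr L N c + 4 * c / L.
Proof.
move=> n0; have nR : 0 < n%:R :> R by rewrite ltr0n.
set d := (RHS in _ <= RHS).
have e t : gwt L N * complex.Im (str0 A (zpt t)) =
    (\sum_i gwt L N * (c / ((gpt L t - lam i) ^+ 2 + c ^+ 2))) / n%:R.
  rewrite /str0 -(rmorph_nat (real_complex R)) -fmorphV [\tr _ * _]mulrC ImMr (spec_tr sdA sA (z0 t)) Im_sum.
  rewrite [RHS]mulrC -mulr_sumr mulrCA; congr (_ * (_ * _)); apply: eq_bigr => i _.
  have -> : (gpt L t - lam i) ^+ 2 = (lam i - gpt L t) ^+ 2 by ring.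
  by rewrite /GRing.inv /= sub0r sqrrN mulNr opprK.
rewrite (eq_bigr _ (fun t _ => e t)) -mulr_suml exchange_big /=.
have -> : 2^-1 = (\sum_(i < n) 2^-1) / n%:R :> R.
  by rewrite sumr_const card_ord -[_ *+ n]mulr_natr mulfK // gt_eqF.
rewrite -mulrBl -sumrB normrM normfV (gtr0_norm nR) ler_pdivrMr //.
apply: le_trans (ler_norm_sum _ _ _) _.
have -> : d * n%:R = \sum_(i < n) d by rewrite sumr_const card_ord mulr_natr.
apply: ler_sum => i _; apply: lorentz_sum_half => //.
by apply: le_trans (lamL i) _; have LL' := LL; lra.
Qed.

End XmatQuadrature.

(** * Stability under a perturbation of small spectral norm *)

Section TwoMatrices.
Context {R : realType} {n : nat}.
Local Notation C := R[i].
Variables (A B : 'M[R]_n) (theta c : R) (z : C).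
Hypotheses (sA : A^T = A) (sB : B^T = B) (zc : complex.Im z = c) (c0 : 0 < c) (n0 : (0 < n)%N).
Hypothesis theta0 : 0 <= theta.
Hypothesis opAB : forall v, n2 (toCm (A - B) *m v) <= theta ^+ 2 * n2 v.

Let z0 : 0 < complex.Im z. Proof. by rewrite zc. Qed.
Let nR : 0 < n%:R :> R. Proof. by rewrite ltr0n. Qed.

Lemma n2N (v : 'cV[C]_n) : n2 (- v) = n2 v.
Proof. by apply: eq_bigr => i _; rewrite mxE mdN. Qed.

Lemma opBA v : n2 (toCm (B - A) *m v) <= theta ^+ 2 * n2 v.
Proof.
suff -> : toCm (B - A) *m v = - (toCm (A - B) *m v) by rewrite n2N.
by rewrite -mulNmx -opprB /toCm map_mxN.
Qed.

Lemma n2_mcol (T : {set 'I_n}) (v : 'cV[C]_n) : n2 (mcol T v) <= n2 v.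
Proof.
apply: ler_sum => i _; rewrite mxE; case: ifP => // _.
by rewrite md0 expr0n sqr_ge0.
Qed.

Lemma mask_mul (T : {set 'I_n}) (D : 'M[R]_n) (v : 'cV[C]_n) :
  toCm (mask T D) *m v = mcol T (toCm D *m mcol T v).
Proof.
apply/colP => i; rewrite !mxE; case: ifPn => iT.
  by apply: big1 => j _; rewrite !mxE iT mul0r.
apply: eq_bigr => j _; rewrite !mxE (negbTE iT) /=.
by case: (j \in T); rewrite ?mul0r ?mulr0.
Qed.

(** The second resolvent identity for the minors. Masking is compression by a coordinate projection
    on both sides, so the bound theta passes to the minors. *)
Lemma n2_uvec_sub (T : {set 'I_n}) :
  n2 (uvec A z T - uvec B z T) <= (theta / c) ^+ 2 * n2 (uvec B z T).
Proof.
have sMA := mask_sym T sA; have sMB := mask_sym T sB.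
rewrite /uvec (res_identity sMA sMB z0).
have -> : mask T B - mask T A = mask T (B - A).
  by apply/matrixP => i j; rewrite !mxE; case: ifP => _; rewrite ?subr0.
set w := (X in n2 (_ *m X)).
have := res_n2 w sMA z0; rewrite zc => h.
have c2 : 0 < c ^+ 2 by rewrite exprn_gt0.
rewrite expr_div_n mulrAC ler_pdivlMr // mulrC; apply: le_trans h _.
rewrite /w mask_mul; apply: le_trans (n2_mcol _ _) _.
apply: le_trans (opBA _) _; rewrite ler_wpM2l ?sqr_ge0 //.
exact: n2_mcol.
Qed.

(** Each diagonal difference is at most theta |G_A e_k| |G_B e_k|. The arithmetic-geometric
    inequality and the Ward identity turn this into theta / (2 c) times a sum of imaginary parts, so
    the loss is theta / c and not theta / c^2. *)
Lemma md_str_sub : md (str0 A z) <= 2 -> md (str0 B z) <= 2 ->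
  md (str0 A z - str0 B z) <= 2 * theta / c.
Proof.
move=> hA hB.
have hk k : md (res A z k k - res B z k k) <=
    theta / (2 * c) * (complex.Im (res A z k k) + complex.Im (res B z k k)).
  have -> : res A z k k - res B z k k =
      dot (res A z *m unit_col k) (toCm (B - A) *m (res B z *m unit_col k)).
    rewrite -dot_res // -res_identity // dotBr !dot_unit_col !res_col //.
  set a := Num.sqrt (n2 (res A z *m unit_col k)); set b := Num.sqrt (n2 (res B z *m unit_col k)).
  have aE : a ^+ 2 = n2 (res A z *m unit_col k) by rewrite sqr_sqrtr // n2_ge0.
  have bE : b ^+ 2 = n2 (res B z *m unit_col k) by rewrite sqr_sqrtr // n2_ge0.
  have a0 : 0 <= a by exact: sqrtr_ge0.
  have b0 : 0 <= b by exact: sqrtr_ge0.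
  apply: (@le_trans _ _ (a * (theta * b))).
    apply: (md_dot a0 (mulr_ge0 theta0 b0)); first by rewrite aE.
    by apply: le_trans (opBA _) _; rewrite exprMn bE.
  rewrite !ward_diag // zc -aE -bE.
  have -> : theta / (2 * c) * (c * a ^+ 2 + c * b ^+ 2) = theta * ((a ^+ 2 + b ^+ 2) / 2).
    by field; rewrite gt_eqF.
  rewrite mulrCA ler_wpM2l //; have := sqr_ge0 (a - b); rewrite sqrrB; nra.
rewrite /str0 -mulrBl mdM (md_natV (R := R) (n := n)) ler_pdivrMr // /mxtrace -sumrB.
apply: le_trans (md_sum _ _ _) _; apply: le_trans (ler_sum _ (fun k _ => hk k)) _.
rewrite -mulr_sumr big_split /= -!Im_sum -/(\tr (res A z)) -/(\tr (res B z)).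
have hI (D : 'M[R]_n) : md (str0 D z) <= 2 -> complex.Im (\tr (res D z)) <= 2 * n%:R.
  move=> hD; have -> : \tr (res D z) = n%:R * str0 D z.
    by rewrite /str0 mulrCA mulfV ?mulr1 // pnatr_eq0 -lt0n.
  apply: le_trans (ler_norm _) _; apply: le_trans (Im_le_md _) _.
  by rewrite mdM md_nat mulrC ler_wpM2r.
have -> : 2 * theta / c * n%:R = theta / (2 * c) * (2 * n%:R + 2 * n%:R).
  by field; rewrite gt_eqF.
apply: ler_wpM2l; last by apply: lerD; exact: hI.
by rewrite divr_ge0 // mulr_ge0 // ltW.
Qed.

Lemma md_Sst_sub : md (str0 A z) <= 2 -> md (str0 B z) <= 2 ->
  z + str0 A z != 0 -> z + str0 B z != 0 ->
  md (Sst A z - Sst B z) <= md (Sst A z) * md (Sst B z) * (2 * theta / c).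
Proof.
move=> hA hB nA nB.
have -> : Sst A z - Sst B z = Sst A z * Sst B z * (str0 A z - str0 B z).
  by move: nA nB; rewrite /Sst; move: (str0 A z) (str0 B z) => x y nA nB; field; rewrite nA nB.
by rewrite mdM [md (_ * _)]mdM ler_wpM2l ?mulr_ge0 ?md_ge0 // md_str_sub.
Qed.

End TwoMatrices.

(** * Entries of X on the good event *)

Section Deterministic.
Context {R : realType} {n N : nat}.
Local Notation C := R[i].
Variables (A B V W : 'M[R]_n) (lam mu : 'I_n -> R).
Variables (L c Lam tau eps4 eps5 e kap r0 sc theta xi Q : R) (ee : 'I_n -> 'I_n -> R).
Hypotheses (sdA : spec_decomp A V lam) (sdB : spec_decomp B W mu) (sA : A^T = A) (sB : B^T = B).
Hypotheses (n0 : (0 < n)%N) (N0 : (0 < N)%N) (L1 : 1 <= L) (LL : 2 * Lam <= L) (c0 : 0 < c) (c1 : c <= 1).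
Hypotheses (lamL : forall i, `|lam i| <= Lam) (muL : forall i, `|mu i| <= Lam).
Local Notation z t := (zpt L c (t : 'I_N)).
Hypothesis loA : forall (t : 'I_N) k l, local_out A (z t) tau eps4 eps5 e c kap r0 sc [set k; l]%SET.
Hypothesis loB : forall (t : 'I_N) k l, local_out B (z t) tau eps4 eps5 e c kap r0 sc [set k; l]%SET.
Hypothesis opAB : forall v, n2 (toCm (A - B) *m v) <= theta ^+ 2 * n2 v.
Hypotheses (g1 : 2 * gerr L N 1 <= 1) (g2 : 2 * gerr L N (2 * c) <= 1).
Hypotheses (e71 : eps7 tau eps4 e c kap <= 1) (eps50 : 0 <= eps5) (e0 : 0 <= e) (theta0 : 0 <= theta)
  (xi0 : 0 <= xi) (kap0 : 0 <= kap) (sc0 : 0 <= sc) (tau0 : 0 <= tau).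
Hypothesis eexi : forall k j, `|ee k j - n%:R^-1| <= xi.

(* Matrix of the bilinear form in the rows [k] of [A] and [l] of [B] that approximates the entry [(k, l)] of X. *)
Definition Mkl (k l i j : 'I_n) : C :=
  Mmat (gwt L N) (fun t => ST A (z t) [set k; l]%SET) (fun t => ST B (z t) [set k; l]%SET)
    (fun t => uvec A (z t) [set k; l]%SET) (fun t => uvec B (z t) [set k; l]%SET) i j.

Hypothesis quadQ : forall k l,
  `|\sum_i \sum_j complex.Re (al [set k; l]%SET A k i 0) * complex.Re (al [set k; l]%SET B l j 0) *
       complex.Re (Mkl k l i j) -
    (if k == l then \sum_j complex.Re (Mkl k l j j) * ee k j else 0)| <= Q.

Let ka : R := kap * (sc + tau * (2 * Gam0 c kap)).
Let Gm : R := 2 * Gam0 c kap.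
Let w0 : 0 <= gwt L N. Proof. by apply: ltW; apply: gwt_gt0 => //; exact: lt_le_trans L1. Qed.
Let L0 : 0 < L. Proof. exact: lt_le_trans L1. Qed.

Let Gm0 : 0 <= Gm. Proof. by rewrite /Gm /Gam0 mulr_ge0 // mulr_ge0 // addr_ge0 // divr_ge0 // ltW. Qed.
Let ka0 : 0 <= ka. Proof. by rewrite /ka mulr_ge0 // addr_ge0 // mulr_ge0. Qed.

Let wx : \sum_(t < N) gwt L N * (1 + gpt L t ^+ 2)^-1 <= 1.
Proof.
apply: (@le_trans _ _ (2^-1 + gerr L N 1)); last by have h := g1; lra.
apply: le_trans (lorentz_sum_le L0 N0 0 ltr01); rewrite le_eqVlt; apply/orP; left; apply/eqP.
by apply: eq_bigr => t _; rewrite subr0 expr1n mul1r addrC.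
Qed.

Let c20 : 0 < 2 * c. Proof. by rewrite mulr_gt0. Qed.

Let wxx (s : 'I_N) : \sum_(t < N) gwt L N / ((gpt L s - gpt L t) ^+ 2 + (2 * c) ^+ 2) <= (2 * c)^-1.
Proof.
rewrite -[leRHS]mul1r ler_pdivlMr // mulr_suml.
apply: (@le_trans _ _ (2^-1 + gerr L N (2 * c))); last by have h := g2; lra.
apply: le_trans (lorentz_sum_le L0 N0 (gpt L s) c20); rewrite le_eqVlt; apply/orP; left; apply/eqP.
apply: eq_bigr => t _; rewrite -[(gpt L t - _) ^+ 2]sqrrN opprB; ring.
Qed.

Let two_pts (D : 'M[R]_n) (T : {set 'I_n}) : D^T = D ->
  (forall t : 'I_N, md (dot (mcol T ones) (uvec D (z t) T)) <= 2 * n%:R) ->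
  forall s t : 'I_N, md (hdot (uvec D (z s) T) (uvec D (z t) T)) ^+ 2 *
    ((gpt L s - gpt L t) ^+ 2 + (2 * c) ^+ 2) <= (4 * n%:R) ^+ 2.
Proof.
move=> sD hD s t; have sM := mask_sym T sD.
have rv : real_col (mcol T ones : 'cV[C]_n) by apply: mcol_real; exact: real_ones.
have h := @res_two_points _ _ (mask T D) (z s) (z t) _ sM c0 c0 rv.
have e1 : md (z s - (z t)^*%C) ^+ 2 = (gpt L s - gpt L t) ^+ 2 + (2 * c) ^+ 2.
  by rewrite md_sqr /= opprK; congr (_ + _ ^+ 2); ring.
rewrite -e1 -exprMn -mdM h.
rewrite ler_pXn2r ?nnegrE ?md_ge0 ?mulr_ge0 //; apply: le_trans (mdB _ _) _; rewrite md_conj.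
have -> : 4 * n%:R = 2 * n%:R + 2 * n%:R :> R by ring.
by apply: lerD; exact: hD.
Qed.

Let gsum k l : C := \sum_(t < N) (gwt L N)%:C%C *
      ((res A (z t) *m ones) k 0 * ((res B (z t) *m ones) l 0)^*%C).

Let row_choice (D : 'M[R]_n) k (T : {set 'I_n}) : (forall t : 'I_N, local_out D (z t) tau eps4 eps5 e c kap r0 sc T) ->
  k \in T -> exists E : 'I_N -> C,
   (forall t, (res D (z t) *m ones) k 0 = ST D (z t) T * (1 - dot (al T D k) (uvec D (z t) T) - E t)) /\
   (forall t, md (E t) <= eps7 tau eps4 e c kap).
Proof.
move=> lo kT.
have h t : exists E : C, (res D (z t) *m ones) k 0 = ST D (z t) T * (1 - dot (al T D k) (uvec D (z t) T) - E)
   /\ md E <= eps7 tau eps4 e c kap.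
  by have [E h1 h2] := lo_row (lo t) kT; exists E.
by have [E hE] := boolp.choice h; exists E; split => t; case: (hE t).
Qed.

Lemma gsum_quad k l : `|complex.Re (gsum k l) -
   \sum_i \sum_j complex.Re (al [set k; l]%SET A k i 0) * complex.Re (al [set k; l]%SET B l j 0) *
       complex.Re (Mkl k l i j)| <= 160 * (1 + ka).
Proof.
set T := [set k; l]%SET.
have kT : k \in T by rewrite !inE eqxx.
have lT : l \in T by rewrite !inE eqxx orbT.
have [EA [hA mA]] := row_choice (fun t => loA t k l) kT.
have [EB [hB mB]] := row_choice (fun t => loB t k l) lT.
have h := linear_part w0 (fun t => lo_Sx (loA t k l)) (fun t => lo_Sx (loB t k l))
  (fun t => lo_ST (loA t k l)) (fun t => lo_ST (loB t k l)) wx hA hB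
  (fun t => lo_al (loA t k l) kT) (fun t => lo_al (loB t k l) lT) mA mB e71 ka0.
have -> : \sum_i \sum_j complex.Re (al T A k i 0) * complex.Re (al T B l j 0) *
       complex.Re (Mkl k l i j) = complex.Re (\sum_(t < N) (gwt L N)%:C%C *
   phi (fun t => ST A (z t) T) (fun t => ST B (z t) T) t *
   (dot (al T A k) (uvec A (z t) T) * (dot (al T B l) (uvec B (z t) T))^*%C)).
  rewrite quad_part Re_sum; apply: eq_bigr => i _; rewrite Re_sum; apply: eq_bigr => j _.
  (* The rows are real, so the real part of the form is the form with the real part of the
     matrix. *)
  rewrite -/(Mkl k l i j); have := real_al T A k i; have := real_al T B l j.
  case: (al T A k i 0) (al T B l j 0) => [a a'] [b b'] /= -> ->.
  by rewrite ReM /=; ring.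
rewrite /gsum -ReN -ReD; apply: le_trans (Re_le_md _) _; exact: h.
Qed.

Lemma Mkl_max k l i j : md (Mkl k l i j) <= 40 * Gm ^+ 2.
Proof.
exact: (Mmat_max w0 (fun t => lo_Sx (loA t k l)) (fun t => lo_Sx (loB t k l))
  (fun t => lo_ST (loA t k l)) (fun t => lo_ST (loB t k l)) wx
  (fun t => lo_u (loA t k l)) (fun t => lo_u (loB t k l))).
Qed.

Lemma Mkl_frob k l : \sum_i \sum_j md (Mkl k l i j) ^+ 2 <= 2560 * n%:R ^+ 2 / (2 * c).
Proof.
exact: (Mmat_frob w0 (fun t => lo_S1 (loA t k l)) (fun t => lo_S1 (loB t k l))
  (fun t => lo_Sx (loA t k l)) (fun t => lo_Sx (loB t k l))
  (fun t => lo_ST (loA t k l)) (fun t => lo_ST (loB t k l)) wx c20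
  (two_pts sA (fun t => lo_dot (loA t k l))) (two_pts sB (fun t => lo_dot (loB t k l))) wxx).
Qed.

Lemma trace_Mkl k : `|\sum_j complex.Re (Mkl k k j j) * ee k j - (2 * c)^-1| <=
  80 * xi * (n%:R / c) + 160 * (theta / c ^+ 2) +
  (120 * eps5 + 20 * r0 + 40 * e + (gerr L N c + 4 * c / L)) / c + 10.
Proof.
have lA t := loA t k k; have lB t := loB t k k.
set T := [set k; k]%SET in lA lB *.
have r00 : 0 <= r0.
  pose t := Ordinal N0; have := le_trans (md_ge0 _) (lo_iso (lA t)).
  by rewrite pmulr_rge0.
rewrite /Mkl -/T.
have tt := (@trace_total _ n N (gwt L N) c (fun t => gpt L t) (fun t => Sst A (z t)) (fun t => Sst B (z t))
  (fun t => ST A (z t) T) (fun t => ST B (z t) T)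
  (fun t => uvec A (z t) T) (fun t => uvec B (z t) T) eps5 w0 c0 n0 _ _ _ _ _ _ wx
  (fun t => str0 A (z t)) e r0 (gerr L N c + 4 * c / L) theta xi
  (fun t => complex.Im (dot (mcol T ones) (uvec A (z t) T))) (ee k)).
apply: tt => //.
- by move=> t; exact: lo_S1 (lA t).
- by move=> t; exact: lo_S1 (lB t).
- by move=> t; exact: lo_Sx (lA t).
- by move=> t; exact: lo_Sx (lB t).
- by move=> t; exact: lo_ST (lA t).
- by move=> t; exact: lo_ST (lB t).
- by move=> t; exact: lo_ImS (lA t).
- by move=> t; exact: lo_sS (lA t).
- by move=> t; exact: lo_STS (lA t).
- by move=> t; exact: lo_STS (lB t).
- move=> t; apply: md_Sst_sub => //; [exact: lo_s2 (lA t)|exact: lo_s2 (lB t)|exact: lo_zs (lA t)|exact: lo_zs (lB t)].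
- by move=> t; exact: lo_n2le (lA t).
- by move=> t; exact: lo_n2le (lB t).
- by move=> t; exact: lo_n2 (lA t).
- move=> t; have := lo_iso (lA t); apply: le_trans; apply: le_trans (Im_le_md _).
  by rewrite ImD [complex.Im (- Sst _ _)]ImN -(rmorph_nat (real_complex R)) -fmorphV [dot _ _ * _]mulrC ImMr mulrC.
- by move=> t; apply: n2_uvec_sub.
- exact: (sum_Im_str0 sdA sA N0 L1 LL c0 lamL n0).
Qed.

Lemma X_entry k l : `|Xmat (2 * c) V W lam mu k l - (if k == l then (2 * c)^-1 else 0)| <=
  n%:R * ((2 * gerr L N c + 12 * (Lam + 1) / L) / c) + 160 * (1 + ka) + Q +
  (if k == l then 80 * xi * (n%:R / c) + 160 * (theta / c ^+ 2) +
  (120 * eps5 + 20 * r0 + 40 * e + (gerr L N c + 4 * c / L)) / c + 10 else 0).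
Proof.
have h1 := Xmat_quadrature sdA sdB sA sB N0 L1 LL c0 c1 lamL muL k l.
have h2 := gsum_quad k l; have h3 := quadQ k l.
rewrite -/(gsum k l) in h1.
set X := Xmat _ _ _ _ _ _ _ in h1 *; set Qs := \sum_i \sum_j _ in h2 h3.
have h12 : `|X - Qs| <= n%:R * ((2 * gerr L N c + 12 * (Lam + 1) / L) / c) + 160 * (1 + ka).
  have -> : X - Qs = (X - complex.Re (gsum k l)) + (complex.Re (gsum k l) - Qs) by ring.
  by apply: le_trans (ler_normD _ _) (lerD h1 h2).
have h123 := lerD h12 h3.
case: (k =P l) h3 => [kl|_] h3; last first.
  rewrite subr0 addr0; have -> : X = (X - Qs) + (Qs - 0) by ring.
  by apply: le_trans (ler_normD _ _) (lerD h12 h3).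
have h4 := trace_Mkl k; rewrite -kl in h3.
set q := (\sum_j _) in h3 h4.
have -> : X - (2 * c)^-1 = (X - Qs) + (Qs - q) + (q - (2 * c)^-1) by ring.
apply: le_trans (ler_normD _ _) _; apply: lerD => //.
by apply: le_trans (ler_normD _ _) (lerD h12 h3).
Qed.

End Deterministic.

(** * Independence and concentration *)

Section Expectation.
Context {d : measure_display} {T : measurableType d} {R : realType} (P : probability T R).
Local Open Scope classical_set_scope.

(** A real-valued expectation; [fine] sends infinite values to 0, so this agrees with the integral
    only where the integral is finite, hence the side conditions [bdm] and later [itg]. *)
Definition Ex (f : T -> R) : R := fine (\int[P]_w (f w)%:E)%E.

Definition bdm (f : T -> R) := measurable_fun setT f /\ exists M : R, forall w, `|f w| <= M.

Lemma bdm_integrable f : bdm f -> P.-integrable setT (EFin \o f).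
Proof.
have fin : (P setT < +oo)%E by rewrite probability_setT ltry.
move=> [mf [M hM]]; apply: measurable_bounded_integrable => //.
exists M; split; first exact: num_real.
by move=> y My w _ /=; apply: le_trans (hM w) (ltW My).
Qed.

Lemma ExE f : bdm f -> (\int[P]_w (f w)%:E)%E = (Ex f)%:E.
Proof.
by move=> bf; rewrite /Ex fineK //; apply: integrable_fin_num => //; exact: bdm_integrable.
Qed.

Lemma Ex_le f g : bdm f -> bdm g -> (forall w, f w <= g w) -> Ex f <= Ex g.
Proof.
move=> bf bg fg; rewrite -lee_fin -!ExE //; apply: le_integral => //; try exact: bdm_integrable.
by move=> w _; rewrite lee_fin.
Qed.

Lemma ExD f g : bdm f -> bdm g -> Ex (fun w => f w + g w) = Ex f + Ex g.
Proof.
move=> bf bg; rewrite /Ex -[in LHS]/(fun w => (f w)%:E + (g w)%:E)%E.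
have -> : (\int[P]_w (f w + g w)%:E = \int[P]_w ((f w)%:E + (g w)%:E))%E by apply: eq_integral.
by rewrite integralD //; try exact: bdm_integrable; rewrite !ExE.
Qed.

Lemma ExZ (k : R) f : bdm f -> Ex (fun w => k * f w) = k * Ex f.
Proof.
move=> bf; rewrite /Ex.
have -> : (\int[P]_w (k * f w)%:E = \int[P]_w (k%:E * (f w)%:E))%E by apply: eq_integral.
by rewrite integralZl //; try exact: bdm_integrable; rewrite ExE.
Qed.

Lemma Ex_cst (k : R) : Ex (fun=> k) = k.
Proof. by rewrite /Ex integral_cst //= probability_setT mule1. Qed.

Lemma bdmD f g : bdm f -> bdm g -> bdm (fun w => f w + g w).
Proof.
move=> [mf [M hM]] [mg [K hK]]; split; first exact: measurable_funD.
by exists (M + K) => w; apply: le_trans (ler_normD _ _) (lerD (hM w) (hK w)).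
Qed.

Lemma bdmM f g : bdm f -> bdm g -> bdm (fun w => f w * g w).
Proof.
move=> [mf [M hM]] [mg [K hK]]; split; first exact: measurable_funM.
by exists (M * K) => w; rewrite normrM ler_pM.
Qed.

Lemma bdm_cst (k : R) : bdm (fun=> k).
Proof. by split => //; exists `|k|. Qed.

Lemma bdmZ (k : R) f : bdm f -> bdm (fun w => k * f w).
Proof. by move=> bf; apply: bdmM => //; exact: bdm_cst. Qed.

Lemma bdm_sqr f : bdm f -> bdm (fun w => f w ^+ 2).
Proof. by move=> bf; under eq_fun do rewrite expr2; exact: bdmM. Qed.

End Expectation.

(** * From the product rule on events to factorising expectations *)

Section Independence.
Context {d : measure_display} {T : measurableType d} {R : realType} (P : probability T R).
Context {I : finType} (D : pred I) (Z : I -> T -> R * R).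
Local Open Scope classical_set_scope.

Hypothesis mZ : forall i, measurable_fun setT (Z i).
Hypothesis indZ : forall S : I -> set (R * R), (forall i, measurable (S i)) ->
  fine (P (\bigcap_(i in [set i | D i]) (Z i @^-1` S i))) = \prod_(i | D i) fine (P (Z i @^-1` S i)).

Definition cyl (E : pred I) : set (set T) :=
  [set U | exists i, E i /\ exists2 V, measurable V & U = Z i @^-1` V].

Definition boxes (E : pred I) : set (set T) :=
  [set U | exists2 S : I -> set (R * R), (forall i, measurable (S i)) &
     U = \bigcap_(i in [set i | E i]) (Z i @^-1` S i)].

Local Notation TE E := (g_sigma_algebraType (cyl E)).

Lemma cyl_measurable E : cyl E `<=` @measurable d T.
Proof.
by move=> U [i [_ [V mV ->]]]; rewrite -[_ @^-1` _]setTI; exact: mZ.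
Qed.

Lemma sigma_cyl_measurable E U : <<s cyl E >> U -> measurable U.
Proof. by move: U; apply: smallest_sub; [exact: sigma_algebra_measurable | exact: cyl_measurable]. Qed.

Lemma boxes_setI E : setI_closed (boxes E).
Proof.
move=> U V [S mS ->] [S' mS' ->]; exists (fun i => S i `&` S' i).
  by move=> i; exact: measurableI.
by rewrite -bigcapI.
Qed.

Lemma cyl_boxes E : cyl E `<=` boxes E.
Proof.
move=> U [i [Ei [V mV ->]]]; exists (fun j => if j == i then V else setT).
  by move=> j; case: ifP.
apply/seteqP; split => w /=.
  by move=> h j _ /=; case: eqP => // ->.
by move=> /(_ i Ei) /=; rewrite eqxx.
Qed.

Lemma fineP_mul (U : set T) : measurable U -> P U = (fine (P U))%:E.
Proof. by move=> mU; rewrite fineK // fin_num_measure. Qed.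

(** Unconstrained coordinates receive the full set, whose factor is 1; every event involved is then
    a box over all of D, and the product rule applies. *)
Lemma box_indep (E : pred I) e U V : (forall i, E i -> D i) -> D e -> ~~ E e ->
  boxes E U -> measurable V -> P (U `&` Z e @^-1` V) = (P U * P (Z e @^-1` V))%E.
Proof.
move=> ED De Ee [S mS ->] mV.
pose S1 i := if E i then S i else setT.
pose S2 i := if i == e then V else S1 i.
have mS1 i : measurable (S1 i) by rewrite /S1; case: ifP.
have mS2 i : measurable (S2 i) by rewrite /S2; case: ifP.
have e1 : \bigcap_(i in [set i | E i]) (Z i @^-1` S i) = \bigcap_(i in [set i | D i]) (Z i @^-1` S1 i).
  apply/seteqP; split => w h i /= Hi; rewrite /S1.
    by case: ifP => // Ei; exact: h.
  by have := h i (ED _ Hi); rewrite /= /S1 Hi.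
have e2 : \bigcap_(i in [set i | E i]) (Z i @^-1` S i) `&` Z e @^-1` V =
    \bigcap_(i in [set i | D i]) (Z i @^-1` S2 i).
  rewrite e1; apply/seteqP; split => w /=.
    by move=> [h hV] i Di; rewrite /= /S2; case: eqP => [->//|_]; exact: h.
  move=> h; split.
    move=> i Di; have := h i Di; rewrite /= /S2; case: eqP => // -> _.
    by rewrite /S1 (negbTE Ee).
  by have := h e De; rewrite /= /S2 eqxx.
have mb S' : (forall i, measurable (S' i)) -> measurable (\bigcap_(i in [set i | D i]) (Z i @^-1` S' i)).
  move=> mS'; apply: fin_bigcap_measurable; first exact: finite_finset.
  by move=> i _; rewrite -[_ @^-1` _]setTI; exact: mZ.
have mV' : measurable (Z e @^-1` V) by rewrite -[_ @^-1` _]setTI; exact: mZ.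
rewrite e2 {1}e1 (fineP_mul (mb _ mS2)) (fineP_mul (mb _ mS1)) (fineP_mul mV') -EFinM !indZ //.
congr (_%:E); rewrite (bigD1 e) //= [in RHS](bigD1 e) //= mulrC.
rewrite [X in _ = X * _ * _](_ : _ = 1) ?mul1r; last first.
  by rewrite /S1 (negbTE Ee) preimage_setT probability_setT.
congr (_ * _); first by apply: eq_bigr => i /andP[_ ie]; rewrite /S2 (negbTE ie).
by rewrite /S2 eqxx.
Qed.

(** Dynkin's argument: the events independent of a fixed event of the coordinate e form a
    lambda-system, and it contains the boxes, a pi-system that generates the sigma-algebra of the
    coordinates in E. *)
Lemma sigma_indep (E : pred I) e U V : (forall i, E i -> D i) -> D e -> ~~ E e ->
  <<s cyl E >> U -> measurable V -> P (U `&` Z e @^-1` V) = (P U * P (Z e @^-1` V))%E.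
Proof.
move=> ED De Ee sU mV.
have mV' : measurable (Z e @^-1` V) by rewrite -[_ @^-1` _]setTI; exact: mZ.
pose G : set (set T) := [set U | measurable U /\ P (U `&` Z e @^-1` V) = (P U * P (Z e @^-1` V))%E].
suff : <<s cyl E >> `<=` G by move=> /(_ U sU) [].
have bm : boxes E `<=` @measurable d T.
  move=> _ [S mS ->]; apply: fin_bigcap_measurable; first exact: finite_finset.
  by move=> i _; rewrite -[_ @^-1` _]setTI; exact: mZ.
apply: (@subset_trans _ <<s boxes E >>).
  by apply: sub_smallest2r; [exact: smallest_sigma_algebra | exact: cyl_boxes].
apply: lambda_system_subset => //; first exact: boxes_setI.
- apply/dynkin_lambda_system; split.
  + by split => //; rewrite setTI probability_setT mul1e.
  + move=> A [mA hA]; split; first exact: measurableC.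
    rewrite setIC -setDE measureD //; last by rewrite ltey_eq fin_num_measure.
    rewrite [LHS](_ : _ = (P (Z e @^-1` V) - P (A `&` Z e @^-1` V))%E); last by rewrite [in RHS]setIC.
    rewrite hA probability_setC // (fineP_mul mA) (fineP_mul mV') -EFinM -EFinB -EFinM.
    by congr (_%:E); ring.
  + move=> F tF hF; split; first by apply: bigcup_measurable => n _; case: (hF n).
    rewrite setI_bigcupl measure_bigcup //; last 2 first.
      by move=> n _; apply: measurableI => //; case: (hF n).
      by apply: trivIset_setIr.
    rewrite measure_bigcup //; last by move=> n _; case: (hF n).
    rewrite (eq_eseriesr (fun n _ => (hF n).2)).
    under eq_eseriesr do rewrite muleC (fineP_mul mV').
    by rewrite nneseriesZl // -(fineP_mul mV') muleC.
- by move=> A bA; split; [exact: bm | exact: (box_indep ED)].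
Qed.

Lemma measurable_TE d' (T' : measurableType d') E (F : T -> T') :
  measurable_fun (setT : set (TE E)) (F : TE E -> T') -> measurable_fun setT F.
Proof.
move=> mF _ Y mY; rewrite setTI; have := mF measurableT Y mY; rewrite setTI.
exact: sigma_cyl_measurable.
Qed.

(** The law of the pair is the product of its marginals on rectangles, hence everywhere, and Tonelli
    factorises the integral. The absolute values in [f] keep the integrand nonnegative on the whole
    plane and change nothing on the range. *)
Lemma Ex_indep_ge0 (E : pred I) e (F Y : T -> R) (h : R * R -> R) : (forall i, E i -> D i) -> D e -> ~~ E e ->
  measurable_fun (setT : set (TE E)) (F : TE E -> R) -> measurable_fun setT h ->
  (forall w, Y w = h (Z e w)) -> bdm F -> bdm Y ->
  (forall w, 0 <= F w) -> (forall w, 0 <= Y w) ->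
  Ex P (fun w => F w * Y w) = Ex P F * Ex P Y.
Proof.
move=> ED De Ee mF mh YE bF bY F0 Y0.
have mFT := measurable_TE mF.
have mY : measurable_fun setT Y by case: bY.
pose X1 : {mfun T >-> R} := HB.pack F (isMeasurableFun.Build _ _ _ _ F mFT).
pose X2 : {mfun T >-> R} := HB.pack Y (isMeasurableFun.Build _ _ _ _ Y mY).
have mXY : measurable_fun setT (fun w => (F w, Y w)) by exact: measurable_fun_pair.
pose XY : {mfun T >-> (R * R)%type} := HB.pack (fun w => (F w, Y w)) (isMeasurableFun.Build _ _ _ _ _ mXY).
have key A B : measurable A -> measurable B ->
    distribution P XY (A `*` B) = (distribution P X1 A * distribution P X2 B)%E.
  move=> mA mB; rewrite /distribution /pushforward.
  have -> : XY @^-1` (A `*` B) = (F @^-1` A) `&` (Z e @^-1` (h @^-1` B)).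
    by apply/seteqP; split => w /=; rewrite YE.
  rewrite (sigma_indep ED De Ee) //.
  - by congr (P _ * P _)%E; apply/seteqP; split => w /=; rewrite YE.
  - by rewrite -[_ @^-1` _]setTI; exact: (mF measurableT _ mA).
  - by rewrite -[_ @^-1` _]setTI; exact: mh.
have uniq := product_measure_unique key.
pose f (xy : R * R) : \bar R := (`|xy.1| * `|xy.2|)%:E.
have mf : measurable_fun setT f.
  apply/measurable_EFinP; apply: measurable_funM; apply: measurableT_comp => //.
have f0 xy : (0 <= f xy)%E by rewrite lee_fin mulr_ge0.
have e1 : (\int[distribution P XY]_xy f xy = \int[P]_w (F w * Y w)%:E)%E.
  rewrite ge0_integral_distribution //; apply: eq_integral => w _.
  by rewrite /f /= !ger0_norm.
have e2 : (\int[distribution P XY]_xy f xy = \int[distribution P X1 \x distribution P X2]_xy f xy)%E.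
  by apply: eq_measure_integral => U mU _; rewrite -uniq.
have e3 : (\int[distribution P X1 \x distribution P X2]_xy f xy = \int[distribution P X1]_x (`|x| * Ex P Y)%:E)%E.
  rewrite fubini_tonelli1 //; apply: eq_integral => x _; rewrite /fubini_F /f /=.
  under eq_integral do rewrite EFinM.
  rewrite ge0_integralZl //; last first.
    by apply/measurable_EFinP; exact: normr_measurable.
  rewrite ge0_integral_distribution //; last first.
    by apply/measurable_EFinP; exact: normr_measurable.
  rewrite EFinM -(ExE P bY); congr (_ * _)%E; apply: eq_integral => w _ /=.
  by rewrite ger0_norm.
have e4 : (\int[distribution P X1]_x (`|x| * Ex P Y)%:E = (Ex P F * Ex P Y)%:E)%E.
  have EY0 : 0 <= Ex P Y by rewrite -(Ex_cst P 0); apply: Ex_le => //; exact: bdm_cst.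
  rewrite ge0_integral_distribution //; last 2 first.
    by apply/measurable_EFinP; apply: measurable_funM => //; exact: normr_measurable.
    by move=> y; rewrite lee_fin mulr_ge0.
  transitivity (\int[P]_w ((fun w => Ex P Y * F w) w)%:E)%E.
    by apply: eq_integral => w _ /=; rewrite ger0_norm // mulrC.
  by rewrite ExE ?ExZ //; [rewrite mulrC | exact: bdmZ].
by rewrite /Ex -e1 e2 e3 e4.
Qed.

(** Both variables are bounded, so adding constants makes them nonnegative; the extra terms cancel
    by linearity. *)
Lemma Ex_indep (E : pred I) e (F Y : T -> R) (h : R * R -> R) : (forall i, E i -> D i) -> D e -> ~~ E e ->
  measurable_fun (setT : set (TE E)) (F : TE E -> R) -> measurable_fun setT h ->
  (forall w, Y w = h (Z e w)) -> bdm F -> bdm Y ->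
  Ex P (fun w => F w * Y w) = Ex P F * Ex P Y.
Proof.
move=> ED De Ee mF mh YE bF bY.
have [_ [M hM]] := bF; have [_ [K hK]] := bY.
have hs := @Ex_indep_ge0 E e (fun w => F w + M) (fun w => Y w + K) (fun x => h x + K) ED De Ee.
have bFM : bdm (fun w => F w + M) by apply: bdmD => //; exact: bdm_cst.
have bYK : bdm (fun w => Y w + K) by apply: bdmD => //; exact: bdm_cst.
have h1 : Ex P (fun w => (F w + M) * (Y w + K)) = Ex P (fun w => F w + M) * Ex P (fun w => Y w + K).
  apply: hs => //.
  - exact: measurable_funD.
  - exact: measurable_funD.
  - by move=> w; rewrite YE.
  - by move=> w; have := hM w; rewrite ler_norml => /andP[h1 _]; rewrite -lerBlDr sub0r.
  - by move=> w; have := hK w; rewrite ler_norml => /andP[h1 _]; rewrite -lerBlDr sub0r.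
have bc k : bdm (fun _ : T => k : R) by exact: bdm_cst.
have bFY : bdm (fun w => F w * Y w) by exact: bdmM.
have h2 : Ex P (fun w => (F w + M) * (Y w + K)) =
    Ex P (fun w => F w * Y w) + (K * Ex P F + (M * Ex P Y + M * K)).
  have -> : (fun w => (F w + M) * (Y w + K)) = (fun w => F w * Y w + (K * F w + (M * Y w + M * K))).
    by apply/funext => w; ring.
  rewrite ExD //; last by apply: bdmD; [exact: bdmZ | apply: bdmD => //; exact: bdmZ].
  rewrite ExD ?ExZ //; [|exact: bdmZ|by apply: bdmD => //; exact: bdmZ].
  by rewrite ExD ?ExZ ?Ex_cst //; exact: bdmZ.
move: h1; rewrite h2 !ExD // !Ex_cst => h1.
have -> : Ex P (fun w => F w * Y w) = (Ex P F + M) * (Ex P Y + K) - (K * Ex P F + (M * Ex P Y + M * K)).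
  by rewrite -h1; ring.
by ring.
Qed.

End Independence.

(** * An exponential supermartingale and its tail bounds *)

Section Concentration.
Context {d : measure_display} {T : measurableType d} {R : realType} (P : probability T R).
Context {I : finType} (D : pred I) (Z : I -> T -> R * R).
Local Open Scope classical_set_scope.

Hypothesis mZ : forall i, measurable_fun setT (Z i).
Hypothesis indZ : forall S : I -> set (R * R), (forall i, measurable (S i)) ->
  fine (P (\bigcap_(i in [set i | D i]) (Z i @^-1` S i))) = \prod_(i | D i) fine (P (Z i @^-1` S i)).

Local Notation TE E := (g_sigma_algebraType (cyl Z E)).

Definition mE (E : pred I) (f : T -> R) := measurable_fun (setT : set (TE E)) (f : TE E -> R).

Lemma mE_sub (E E' : pred I) f : (forall i, E i -> E' i) -> mE E f -> mE E' f.
Proof.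
move=> EE' mf _ Y mY; have := mf measurableT Y mY.
apply: sub_smallest2r; first exact: smallest_sigma_algebra.
by move=> U [i [Ei h]]; exists i; split => //; exact: EE'.
Qed.

Lemma mE_meas E f : mE E f -> measurable_fun setT f.
Proof. exact: measurable_TE. Qed.

Lemma mE_Z (E : pred I) e (h : R * R -> R) : E e -> measurable_fun setT h -> mE E (fun w => h (Z e w)).
Proof.
move=> Ee mh _ Y mY; rewrite setTI.
apply: sub_sigma_algebra; exists e; split => //.
by exists (h @^-1` Y) => //; rewrite -[_ @^-1` _]setTI; exact: mh.
Qed.

(* [G] itself need not be measurable. *)
Definition pgood (G : T -> Prop) (q : R) :=
  exists F, [/\ measurable F, (P F <= q%:E)%E & forall w, ~ F w -> G w].

Lemma pgood_imp (G G' : T -> Prop) q q' : (forall w, G w -> G' w) -> q <= q' -> pgood G q -> pgood G' q'.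
Proof.
move=> GG qq [F [mF PF h]]; exists F; split => //; last by move=> w /h /GG.
by apply: le_trans PF _; rewrite lee_fin.
Qed.

Lemma pgood_and (G G' : T -> Prop) q q' : pgood G q -> pgood G' q' -> pgood (fun w => G w /\ G' w) (q + q').
Proof.
move=> [F [mF PF h]] [F' [mF' PF' h']]; exists (F `|` F'); split.
- exact: measurableU.
- by apply: (le_trans (measureU2 P mF mF')); rewrite EFinD; exact: leeD.
- by move=> w /not_orP[/h ? /h'].
Qed.

Lemma pgood_all (L : finType) (G : L -> T -> Prop) q : (forall i, pgood (G i) q) ->
  pgood (fun w => forall i, G i w) (#|L|%:R * q).
Proof.
move=> h.
suff H (s : seq L) : pgood (fun w => forall i, i \in s -> G i w) ((size s)%:R * q).
  by apply: pgood_imp (H (enum L)); [move=> w H' i; apply: H'; rewrite mem_enum | rewrite -cardE].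
elim: s => [|i s IH].
  by exists set0; split => //; rewrite measure0 mul0r.
apply: pgood_imp (pgood_and (h i) IH); last by rewrite /= -natr1 mulrDl mul1r addrC.
by move=> w [h1 h2] j; rewrite inE => /orP[/eqP -> //|]; exact: h2.
Qed.

(** The inequality exp(-x) >= 1 - x gives exp(x) <= 1 / (1 - x), and (1 + x + 2 x^2) (1 - x) = 1 +
    x^2 (1 - 2 x). *)
Lemma expR_le_quad (x : R) : `|x| <= 2^-1 -> expR x <= 1 + x + 2 * x ^+ 2.
Proof.
move=> hx; have [h1 h2] := norm_le_split hx.
have h3 := expR_ge1Dx (- x).
have h4 : expR x * (1 - x) <= 1.
  by rewrite -[leRHS](expR0 R) -(subrr x) expRD ler_pM2l ?expR_gt0.
have h5 : 0 < 1 - x by lra.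
rewrite -(ler_pM2r h5); apply: le_trans h4 _.
have -> : (1 + x + 2 * x ^+ 2) * (1 - x) = 1 + x ^+ 2 * (1 - 2 * x) by ring.
by rewrite lerDl; apply: mulr_ge0; [exact: sqr_ge0 | lra].
Qed.

(** Variables attached to distinct independent coordinates. A mean of size nu is allowed because
    truncation spoils the centring; the compensator in [stp] pays for it, and this is harmless while
    nu times the number of terms is at most t. *)
Record family (J : eqType) (s : seq J) (e : J -> I) (Y : J -> T -> R) (t v nu : R) : Prop := Family {
  fam_h : forall j, j \in s -> exists2 h, measurable_fun setT h & forall w, Y j w = h (Z (e j) w);
  fam_D : forall j, j \in s -> D (e j);
  fam_uniq : uniq (map e s);
  fam_le : forall j w, j \in s -> `|Y j w| <= t;
  fam_E : forall j, j \in s -> `|Ex P (Y j)| <= nu;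
  fam_V : forall j, j \in s -> Ex P (fun w => Y j w ^+ 2) <= v }.

Definition addE (E : pred I) (s : seq I) : pred I := fun i => E i || (i \in s).

(* Increment of the supermartingale: a predictable coefficient [y] times a variable [Y] of variance at
   most [v] and mean at most [nu], with its compensator. *)
Definition stp (v nu y Y : R) := y * Y - 2 * v * y ^+ 2 - nu * `|y|.

Lemma fam_mE (J : eqType) (s : seq J) e Y t v nu j (E : pred I) : family s e Y t v nu -> j \in s -> E (e j) -> mE E (Y j).
Proof.
move=> F js Ej; have [h mh hE] := fam_h F js.
rewrite (_ : Y j = fun w => h (Z (e j) w)); last by apply/funext => w; rewrite hE.
exact: mE_Z.
Qed.

Lemma stp_meas d' (T' : measurableType d') v nu (y Y : T' -> R) :
  measurable_fun setT y -> measurable_fun setT Y -> measurable_fun setT (fun w => expR (stp v nu (y w) (Y w))).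
Proof.
move=> my mY; apply: measurableT_comp => //; rewrite /stp.
apply: measurable_funB; first apply: measurable_funB.
- exact: measurable_funM.
- by apply: measurable_funM => //; exact: measurable_funX.
- by apply: measurable_funM => //; exact: measurableT_comp.
Qed.

(* One step of the exponential supermartingale: expand [exp] to second order and
   integrate the new variable, which is independent of [F] and [y]. *)
Lemma stp_Ex (E : pred I) e (F y Y : T -> R) (h : R * R -> R) t v nu :
  (forall i, E i -> D i) -> D e -> ~~ E e -> mE E F -> mE E y ->
  measurable_fun setT h -> (forall w, Y w = h (Z e w)) -> bdm F -> (forall w, 0 <= F w) ->
  0 < t -> 0 <= v -> 0 <= nu -> (forall w, `|Y w| <= t) -> `|Ex P Y| <= nu ->
  Ex P (fun w => Y w ^+ 2) <= v -> (forall w, `|y w| * t <= 2^-1) ->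
  bdm (fun w => F w * expR (stp v nu (y w) (Y w))) /\
  Ex P (fun w => F w * expR (stp v nu (y w) (Y w))) <= Ex P F.
Proof.
move=> ED De Ee mF my mh YE bF F0 t0 v0 nu0 Yt EY EYY yt.
have mY : measurable_fun setT Y.
  rewrite (_ : Y = h \o Z e); last by apply/funext => w; rewrite YE.
  exact: measurableT_comp.
have bY : bdm Y by split => //; exists t.
have my' := mE_meas my.
have yY w : `|y w * Y w| <= 2^-1.
  by rewrite normrM; apply: le_trans (yt w); apply: ler_wpM2l.
have b1 : bdm (fun w => expR (stp v nu (y w) (Y w))).
  split; first exact: stp_meas.
  exists (expR 1) => w; rewrite ger0_norm ?expR_ge0 // ler_expR /stp.
  have [_ h1] := norm_le_split (yY w).
  have h2 : 0 <= 2 * v * y w ^+ 2 by rewrite mulr_ge0 ?sqr_ge0 // mulr_ge0.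
  have h3 : 0 <= nu * `|y w| by rewrite mulr_ge0.
  by lra.
split; first exact: bdmM.
pose g w := F w * expR (- (2 * v * y w ^+ 2) - nu * `|y w|).
pose g1 w := g w * y w; pose g2 w := 2 * (g w * y w ^+ 2).
have mg : mE E g.
  apply: measurable_funM => //; apply: measurableT_comp => //; apply: measurable_funB.
    by apply: measurableT_comp => //; apply: measurable_funM => //; exact: measurable_funX.
  by apply: measurable_funM => //; exact: measurableT_comp.
have mg1 : mE E g1 by exact: measurable_funM.
have mg2 : mE E g2 by apply: measurable_funM => //; apply: measurable_funM => //; exact: measurable_funX.
have g0 w : 0 <= g w by rewrite mulr_ge0 ?expR_ge0.
have bg : bdm g.
  have [_ [M hM]] := bF; split; first exact: mE_meas mg.
  exists M => w; rewrite normrM -[M]mulr1 ler_pM // ger0_norm ?expR_ge0 // -[leRHS]expR0 ler_expR.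
  have h2 : 0 <= 2 * v * y w ^+ 2 by rewrite mulr_ge0 ?sqr_ge0 // mulr_ge0.
  have h3 : 0 <= nu * `|y w| by rewrite mulr_ge0.
  by lra.
have by_ : bdm y.
  split => //; exists (2^-1 / t) => w; rewrite ler_pdivlMr //; exact: yt.
have bg1 : bdm g1 by exact: bdmM.
have bg2 : bdm g2 by apply: bdmZ; apply: bdmM => //; exact: bdm_sqr.
have bY2 : bdm (fun w => Y w ^+ 2) by exact: bdm_sqr.
have bg1Y : bdm (fun w => g1 w * Y w) by exact: bdmM.
have bg2Y : bdm (fun w => g2 w * Y w ^+ 2) by exact: bdmM.
have s1 : Ex P (fun w => F w * expR (stp v nu (y w) (Y w))) <=
    Ex P (fun w => g w + (g1 w * Y w + g2 w * Y w ^+ 2)).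
  apply: Ex_le; first exact: bdmM.
    by apply: bdmD => //; exact: bdmD.
  move=> w; rewrite /stp -addrA expRD.
  have h1 := expR_le_quad (yY w).
  have -> : g w + (g1 w * Y w + g2 w * Y w ^+ 2) = g w * (1 + y w * Y w + 2 * (y w * Y w) ^+ 2).
    by rewrite /g1 /g2; ring.
  rewrite /g [X in F w * X <= _]mulrC -[leRHS]mulrA; apply: ler_wpM2l => //.
  by apply: ler_wpM2l => //; exact: expR_ge0.
apply: le_trans s1 _.
rewrite ExD //; last exact: bdmD.
rewrite ExD // (Ex_indep mZ indZ ED De Ee mg1 mh YE bg1 bY).
have -> : Ex P (fun w => g2 w * Y w ^+ 2) = Ex P g2 * Ex P (fun w => Y w ^+ 2).
  apply: (Ex_indep mZ indZ ED De Ee mg2 (h := fun x => h x ^+ 2)) => //.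
    exact: measurable_funX.
  by move=> w; rewrite YE.
have g20 : 0 <= Ex P g2.
  rewrite -(Ex_cst P 0); apply: Ex_le => //; first exact: bdm_cst.
  by move=> w; rewrite mulr_ge0 // mulr_ge0 ?sqr_ge0.
have bg1a : bdm (fun w => `|g1 w|).
  split; first by apply: measurableT_comp => //; exact: mE_meas mg1.
  by have [_ [M hM]] := bg1; exists M => w; rewrite normr_id.
have s2 : Ex P g1 * Ex P Y <= nu * Ex P (fun w => `|g1 w|).
  apply: le_trans (ler_norm _) _; rewrite normrM mulrC; apply: ler_pM => //.
  rewrite ler_norml; apply/andP; split.
    rewrite -mulN1r -ExZ //; apply: Ex_le => //; first exact: bdmZ.
    by move=> w; rewrite mulN1r; have := ler_norm (- g1 w); rewrite normrN lerNl.
  by apply: Ex_le => // w; exact: ler_norm.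
apply: (@le_trans _ _ (Ex P g + (nu * Ex P (fun w => `|g1 w|) + v * Ex P g2))).
  by rewrite lerD2l; apply: lerD => //; rewrite mulrC ler_wpM2r.
rewrite -!ExZ // -!ExD //; try exact: bdmZ; last by apply: bdmD; exact: bdmZ.
apply: Ex_le => //; first by apply: bdmD => //; apply: bdmD; exact: bdmZ.
move=> w; rewrite /g1 /g2 normrM (ger0_norm (g0 w)).
have -> : g w + (nu * (g w * `|y w|) + v * (2 * (g w * y w ^+ 2))) =
   g w * (1 + (2 * v * y w ^+ 2 + nu * `|y w|)) by ring.
rewrite /g -mulrA -[leRHS]mulr1; apply: ler_wpM2l => //.
(* With u the compensator, what remains is exp(-u) (1 + u) <= 1. *)
have -> : - (2 * v * y w ^+ 2) - nu * `|y w| = - (2 * v * y w ^+ 2 + nu * `|y w|) by ring.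
rewrite -[leRHS](expR0 R) -[in leRHS](subrr (2 * v * y w ^+ 2 + nu * `|y w|)) [in leRHS]addrC expRD.
by rewrite ler_wpM2l ?expR_ge0 // expR_ge1Dx.
Qed.

(** The head of the list is absorbed into F and its coordinate into E, so the induction runs along a
    growing sigma-algebra. The order of the list is the filtration: a coefficient may depend on E
    and on the coordinates that precede it. *)
Lemma pred_exp (J : eqType) (s : seq J) e (Y y : J -> T -> R) t v nu (E : pred I) (F : T -> R) :
  family s e Y t v nu -> 0 < t -> 0 <= v -> 0 <= nu ->
  (forall i, E i -> D i) -> (forall j, j \in s -> ~~ E (e j)) ->
  (forall s1 j s2, s = s1 ++ j :: s2 -> mE (addE E (map e s1)) (y j)) ->
  (forall j w, j \in s -> `|y j w| * t <= 2^-1) ->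
  mE E F -> bdm F -> (forall w, 0 <= F w) ->
  bdm (fun w => F w * expR (\sum_(j <- s) stp v nu (y j w) (Y j w))) /\
  Ex P (fun w => F w * expR (\sum_(j <- s) stp v nu (y j w) (Y j w))) <= Ex P F.
Proof.
move=> fam t0 v0 nu0.
elim: s E F fam => [|j s IH] E F fam ED Ees ady yt mF bF F0.
  under eq_fun do rewrite big_nil expR0 mulr1; by [].
have js : j \in j :: s by rewrite inE eqxx.
have [h mh hE] := fam_h fam js.
have Ej := Ees j js; have Dj := fam_D fam js.
have my : mE E (y j) by apply: mE_sub (ady [::] j s erefl) => i; rewrite /addE orbF.
have [bF' EF'] := stp_Ex ED Dj Ej mF my mh hE bF F0 t0 v0 nu0 (fun w => fam_le fam w js)
  (fam_E fam js) (fam_V fam js) (fun w => yt j w js).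
have fam' : family s e Y t v nu.
  have ss i : i \in s -> i \in j :: s by move=> si; rewrite inE si orbT.
  case: fam => f1 f2 f3 f4 f5 f6; split=> [i /ss /f1|i /ss /f2||i w /ss /f4|i /ss /f5|i /ss /f6] //.
  by move: f3 => /= /andP[].
pose E' := addE E [:: e j].
have EE' i : E i -> E' i by rewrite /E' /addE => ->.
have E'j : E' (e j) by rewrite /E' /addE inE eqxx orbT.
have mF' : mE E' (fun w => F w * expR (stp v nu (y j w) (Y j w))).
  apply: measurable_funM; first exact: mE_sub mF.
  by apply: stp_meas; [exact: mE_sub my | exact: fam_mE fam js _].
have [] := IH E' _ fam' _ _ _ _ mF' bF' _.
- by move=> i /orP[/ED //|]; rewrite inE => /eqP ->.
- move=> i si; rewrite /E' /addE negb_or Ees ?inE ?si ?orbT //=.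
  apply: contraTneq (fam_uniq fam) => /= <-.
  by rewrite map_f.
- move=> s1 i s2 sE; apply: mE_sub (ady (j :: s1) i s2 _); last by rewrite sE.
  by move=> k; rewrite /E' /addE /= !inE -!orbA.
- by move=> i w si; apply: yt; rewrite inE si orbT.
- by move=> w; rewrite mulr_ge0 ?expR_ge0.
have eqf : (fun w => F w * expR (\sum_(i <- j :: s) stp v nu (y i w) (Y i w))) =
    (fun w => F w * expR (stp v nu (y j w) (Y j w)) * expR (\sum_(i <- s) stp v nu (y i w) (Y i w))).
  by apply/funext => w; rewrite big_cons expRD mulrA.
by rewrite eqf => b1 h1; split => //; exact: le_trans h1 EF'.
Qed.

Lemma measurable_geset (f : T -> R) (c : R) : measurable_fun setT f -> measurable [set w | (c <= f w)%R].
Proof.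
move=> mf; rewrite (_ : [set w | _] = f @^-1` `[c, +oo[%classic).
  by rewrite -[_ @^-1` _]setTI; exact: mf.
by apply/seteqP; split => w /=; rewrite in_itv /= andbT.
Qed.

Lemma Ex_markov (f : T -> R) (la : R) : bdm f -> (forall w, 0 <= f w) -> Ex P f <= 1 ->
  (P [set w | (expR la <= f w)%R] <= (expR (- la))%:E)%E.
Proof.
move=> bf f0 Ef.
have mS : measurable [set w | (expR la <= f w)%R].
  by apply: measurable_geset; case: bf.
rewrite expRN -div1r EFinM lee_pdivlMr ?expR_gt0 //.
apply: (@le_trans _ _ (\int[P]_w (f w)%:E)%E); last by rewrite ExE // lee_fin.
rewrite muleC.
apply: (@le_trans _ _ (\int[P]_(w in [set w | (expR la <= f w)%R]) (expR la)%:E)%E).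
  by rewrite integral_cst.
apply: (@le_trans _ _ (\int[P]_(w in [set w | (expR la <= f w)%R]) (f w)%:E)%E).
  apply: ge0_le_integral => //; try by move=> w _; rewrite lee_fin ?expR_ge0 ?f0.
    by apply/measurable_EFinP; apply: measurable_funTS; case: bf.
apply: ge0_subset_integral => //; first by apply/measurable_EFinP; case: bf.
by move=> w _; rewrite lee_fin.
Qed.

Section Maximum.
Context {J : eqType}.
Implicit Types (s : seq J) (f : J -> R).

Definition mx s f : R := \big[Num.max/0]_(i <- s) f i.

Lemma mx_ge0 s f : 0 <= mx s f.
Proof. by rewrite /mx; elim: s => [|i s IH]; rewrite ?big_nil // big_cons le_max IH orbT. Qed.

Lemma le_mx s f j : j \in s -> f j <= mx s f.
Proof.
rewrite /mx; elim: s => [//|i s IH]; rewrite inE big_cons le_max => /orP[/eqP -> | /IH ->].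
  by rewrite lexx.
by rewrite orbT.
Qed.

Lemma mx_le s f b : 0 <= b -> (forall j, j \in s -> f j <= b) -> mx s f <= b.
Proof.
move=> b0; rewrite /mx; elim: s => [|i s IH] h; rewrite ?big_nil // big_cons ge_max h ?inE ?eqxx //=.
by apply: IH => j js; apply: h; rewrite inE js orbT.
Qed.

Context {d' : measure_display} {T' : measurableType d'}.

Lemma measurable_mx s (f : J -> T' -> R) : (forall j, j \in s -> measurable_fun setT (f j)) ->
  measurable_fun setT (fun w => mx s (f ^~ w)).
Proof.
rewrite /mx; elim: s => [|i s IH] h.
  by under eq_fun do rewrite big_nil; exact: measurable_cst.
under eq_fun do rewrite big_cons.
apply: measurable_maxr; first by apply: h; rewrite inE eqxx.
by apply: IH => j js; apply: h; rewrite inE js orbT.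
Qed.

Lemma measurable_sum_seq s (f : J -> T' -> R) : (forall j, j \in s -> measurable_fun setT (f j)) ->
  measurable_fun setT (fun w => \sum_(j <- s) f j w).
Proof.
elim: s => [|i s IH] h.
  by under eq_fun do rewrite big_nil; exact: measurable_cst.
under eq_fun do rewrite big_cons.
apply: measurable_funD; first by apply: h; rewrite inE eqxx.
by apply: IH => j js; apply: h; rewrite inE js orbT.
Qed.

End Maximum.

Lemma measurable_sqrt_fun d' (T' : measurableType d') (f : T' -> R) : measurable_fun setT f ->
  (forall w, 0 <= f w) -> measurable_fun setT (fun w => Num.sqrt (f w)).
Proof.
move=> mf f0; under eq_fun do rewrite -powR12_sqrt //.
by apply: (measurableT_comp (measurable_powR _)).
Qed.

Lemma measurable_inv_fun d' (T' : measurableType d') (f : T' -> R) : measurable_fun setT f ->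
  (forall w, 0 <= f w) -> measurable_fun setT (fun w => (f w)^-1).
Proof.
move=> mf f0; under eq_fun do rewrite -powR_inv1 //.
by apply: (measurableT_comp (measurable_powR _)).
Qed.

Section Tail.
Context {J : eqType} (s : seq J) (e : J -> I) (Y : J -> T -> R) (t v nu : R) (E : pred I) (p dl : R).
Hypothesis fam : family s e Y t v nu.
Hypotheses (t0 : 0 < t) (v0 : 0 <= v) (nu0 : 0 <= nu) (p1 : 1 <= p) (dl0 : 0 <= dl).
Hypothesis ED : forall i, E i -> D i.
Hypothesis Ees : forall j, j \in s -> ~~ E (e j).
Hypothesis nut : nu * (size s)%:R <= t.

Lemma pred_tail (y : J -> T -> R) :
  (forall s1 j s2, s = s1 ++ j :: s2 -> mE (addE E (map e s1)) (y j)) ->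
  (forall j w, j \in s -> `|y j w| * t <= 2^-1) ->
  pgood (fun w => \sum_(j <- s) stp v nu (y j w) (Y j w) <= dl * p) (expR (- (dl * p))).
Proof.
move=> ady yt.
have m1 : mE E (fun=> 1) by exact: measurable_cst.
have [] := pred_exp fam t0 v0 nu0 ED Ees ady yt m1 (bdm_cst 1) (fun=> ler01).
rewrite Ex_cst; under eq_fun do rewrite mul1r.
move=> b1 h1.
exists [set w | (expR (dl * p) <= expR (\sum_(j <- s) stp v nu (y j w) (Y j w)))%R]; split.
- by apply: measurable_geset; case: b1.
- exact: (Ex_markov (dl * p) b1 (fun w => expR_ge0 _) h1).
- by move=> w /= /negP; rewrite ler_expR -ltNge => /ltW.
Qed.

(** A self-normalised bound: one event serves all a and b, random ones included. The coefficients
    are divided by twice the scale S = sqrt (v / p) |N|_2 + t |N|_inf, which keeps the compensator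
    below p, and the tail bound is applied with both signs. The envelope N is separate from y
    because the scale must be E-measurable, known before any coordinate of the list, while y is only
    predictable. *)
Lemma pred_lin (y N : J -> T -> R) :
  (forall s1 j s2, s = s1 ++ j :: s2 -> mE (addE E (map e s1)) (y j)) ->
  (forall j, j \in s -> mE E (N j)) -> (forall j w, 0 <= N j w) ->
  pgood (fun w => (forall j, j \in s -> `|y j w| <= N j w) -> forall a b, 0 <= a -> 0 <= b ->
     \sum_(j <- s) N j w ^+ 2 <= a ^+ 2 -> (forall j, j \in s -> N j w <= b) ->
     `|\sum_(j <- s) y j w * Y j w| <= 2 * (dl + 1) * (Num.sqrt (v * p) * a + p * t * b))
    (2 * expR (- (dl * p))).
Proof.
move=> ady mN N0.
have p0 : 0 < p by apply: lt_le_trans p1.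
pose N2 w := Num.sqrt (\sum_(j <- s) N j w ^+ 2).
pose Ni w := mx s (N ^~ w).
pose S w := Num.sqrt (v / p) * N2 w + t * Ni w.
pose th w := (2 * S w)^-1.
(* Setting the coefficient to 0 where the envelope fails keeps it predictable and makes the bound
   1/2 hold everywhere; on the event of the claim it equals th y. *)
pose y' j w := if `|y j w| <= N j w then th w * y j w else 0.
have N20 w : 0 <= N2 w by exact: sqrtr_ge0.
have Ni0 w : 0 <= Ni w by exact: mx_ge0.
have S1 w : 0 <= Num.sqrt (v / p) * N2 w by apply: mulr_ge0 => //; exact: sqrtr_ge0.
have S2 w : 0 <= t * Ni w by apply: mulr_ge0 => //; exact: ltW.
have S0 w : 0 <= S w by exact: addr_ge0.
have th0 w : 0 <= th w by rewrite invr_ge0 mulr_ge0.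
have sumN0 w : 0 <= \sum_(j <- s) N j w ^+ 2 by apply: sumr_ge0 => j _; exact: sqr_ge0.
have mth : mE E th.
  apply: measurable_inv_fun; last by move=> w; rewrite mulr_ge0.
  apply: measurable_funM => //; apply: measurable_funD; apply: measurable_funM => //.
    apply: measurable_sqrt_fun => //; apply: measurable_sum_seq => j js.
    by apply: measurable_funX; exact: mN.
  by apply: measurable_mx.
have mNE (E' : pred I) : (forall i, E i -> E' i) -> forall j, j \in s -> mE E' (N j).
  by move=> EE j js; apply: mE_sub (mN j js).
have ady' s1 j s2 : s = s1 ++ j :: s2 -> mE (addE E (map e s1)) (y' j).
  move=> sE; have js : j \in s by rewrite sE mem_cat inE eqxx orbT.
  have EE i : E i -> addE E (map e s1) i by rewrite /addE => ->.
  have my := ady _ _ _ sE.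
  apply: measurable_fun_ifT => //.
    by apply: measurable_fun_ler; [exact: measurableT_comp | exact: mNE].
  by apply: measurable_funM => //; exact: mE_sub mth.
have thS w : th w * S w <= 2^-1.
  have [e0|e0] := eqVneq (S w) 0; first by rewrite e0 mulr0.
  by rewrite /th invfM -mulrA mulVf ?mulr1.
have yt' j w : j \in s -> `|y' j w| * t <= 2^-1.
  move=> js; rewrite /y'; case: ifP => [yN|_]; last by rewrite normr0 mul0r.
  apply: le_trans (thS w); rewrite normrM ger0_norm // -mulrA ler_wpM2l //.
  apply: (@le_trans _ _ (t * Ni w)); last by rewrite lerDr.
  by rewrite mulrC; apply: ler_wpM2l; [exact: ltW | apply: le_trans yN _; exact: le_mx].
have ady'' s1 j s2 : s = s1 ++ j :: s2 -> mE (addE E (map e s1)) (fun w => - y' j w).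
  by move=> /ady' h; apply: measurableT_comp.
have yt'' j w : j \in s -> `|- y' j w| * t <= 2^-1 by rewrite normrN; exact: yt'.
have := pgood_and (pred_tail ady' yt') (pred_tail ady'' yt'').
apply: pgood_imp; last by rewrite -mulr2n -[leLHS]mulr_natl.
move=> w [h1 h2] yN a b a0 b0 ha hb.
have y'E j : j \in s -> y' j w = th w * y j w by move=> js; rewrite /y' yN.
have N2a : N2 w <= a by rewrite -(ger0_norm a0) -sqrtr_sqr ler_wsqrtr.
have Nib : Ni w <= b by apply: mx_le.
pose U := \sum_(j <- s) y j w * Y j w.
pose Q := \sum_(j <- s) (2 * v * y' j w ^+ 2 + nu * `|y' j w|).
have e1 : \sum_(j <- s) stp v nu (y' j w) (Y j w) = th w * U - Q.
  rewrite /U /Q mulr_sumr -sumrB big_seq [in RHS]big_seq; apply: eq_bigr => j js.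
  by rewrite /stp (y'E _ js); ring.
have e2 : \sum_(j <- s) stp v nu (- y' j w) (Y j w) = - (th w * U) - Q.
  rewrite /U /Q mulr_sumr -sumrN -sumrB big_seq [in RHS]big_seq; apply: eq_bigr => j js.
  by rewrite /stp (y'E _ js) normrN sqrrN; ring.
have hQ : Q <= p.
  rewrite /Q big_split /=.
  have q1 : \sum_(j <- s) 2 * v * y' j w ^+ 2 <= p / 2.
    rewrite -mulr_sumr.
    have q3 : \sum_(j <- s) y' j w ^+ 2 <= th w ^+ 2 * N2 w ^+ 2.
      rewrite /N2 sqr_sqrtr // mulr_sumr big_seq [leRHS]big_seq; apply: ler_sum => j js.
      rewrite (y'E _ js) exprMn ler_wpM2l ?sqr_ge0 // -real_normK ?num_real //.
      by rewrite lerXn2r ?nnegrE //; exact: yN.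
    have q4 : Num.sqrt (v / p) * N2 w * th w <= 2^-1.
      apply: le_trans (thS w); rewrite mulrC; apply: ler_wpM2l => //; by rewrite lerDl.
    have q5 : (Num.sqrt (v / p) * N2 w * th w) ^+ 2 <= 4^-1.
      have -> : 4^-1 = (2^-1) ^+ 2 :> R by field.
      by rewrite lerXn2r ?nnegrE // mulr_ge0.
    rewrite !exprMn sqr_sqrtr in q5; last by rewrite divr_ge0 // ltW.
    apply: (@le_trans _ _ (2 * v * (th w ^+ 2 * N2 w ^+ 2))).
      by apply: ler_wpM2l => //; rewrite mulr_ge0.
    have -> : 2 * v * (th w ^+ 2 * N2 w ^+ 2) = 2 * p * (v / p * N2 w ^+ 2 * th w ^+ 2).
      by field; rewrite gt_eqF.
    have -> : p / 2 = 2 * p * 4^-1 by field.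
    by apply: ler_wpM2l => //; rewrite mulr_ge0 // ltW.
  have q2 : \sum_(j <- s) nu * `|y' j w| <= p / 2.
    apply: (@le_trans _ _ (\sum_(j <- s) nu * (th w * Ni w))).
      rewrite big_seq [leRHS]big_seq; apply: ler_sum => j js; apply: ler_wpM2l => //.
      rewrite (y'E _ js) normrM ger0_norm //; apply: ler_wpM2l => //.
      by apply: le_trans (yN _ js) _; exact: le_mx.
    rewrite big_const_seq count_predT iter_addr addr0 -[leLHS]mulr_natr.
    have -> : nu * (th w * Ni w) * (size s)%:R = nu * (size s)%:R * (th w * Ni w) by ring.
    apply: (@le_trans _ _ (t * (th w * Ni w))); first by apply: ler_wpM2r => //; apply: mulr_ge0.
    have q6 : t * (th w * Ni w) <= 2^-1.
      apply: le_trans (thS w); rewrite mulrCA; apply: ler_wpM2l => //; by rewrite lerDr.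
    by move: p1 => p1' ; apply: le_trans q6 _; lra.
  by lra.
move: h1 h2; rewrite e1 e2 => h1 h2.
have h3 : th w * `|U| <= (dl + 1) * p.
  rewrite -[th w](ger0_norm (th0 w)) -normrM ler_norml; apply/andP; split; lra.
have pS : p * S w <= Num.sqrt (v * p) * a + p * t * b.
  have -> : Num.sqrt (v * p) = p * Num.sqrt (v / p).
    rewrite -{2}(ger0_norm (ltW p0)) -sqrtr_sqr -sqrtrM ?sqr_ge0 //; congr Num.sqrt; field.
    by rewrite gt_eqF.
  rewrite -!mulrA -mulrDr ler_wpM2l ?(ltW p0) //; apply: lerD.
    by apply: ler_wpM2l => //; exact: sqrtr_ge0.
  by apply: ler_wpM2l => //; exact: ltW.
have dl1 : 0 <= dl + 1 by apply: addr_ge0.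
(* If S = 0 then th = 0 by the convention for inverses and the bound on th U is empty; but then the
   envelope vanishes, and all coefficients with it. *)
have [e0|e0] := eqVneq (S w) 0.
  have Ni00 : Ni w = 0.
    apply/eqP; have : t * Ni w <= 0 by rewrite -e0 /S lerDr.
    by rewrite pmulr_rle0 // => h; rewrite eq_le h Ni0.
  have -> : \sum_(j <- s) y j w * Y j w = 0.
    rewrite big_seq big1 // => j js; apply/eqP; rewrite mulf_eq0 -normr_le0.
    by rewrite (le_trans (yN _ js)) // -Ni00; exact: le_mx.
  rewrite normr0 mulr_ge0 ?mulr_ge0 // addr_ge0 ?mulr_ge0 ?sqrtr_ge0 ?(ltW p0) ?(ltW t0) //.
have Sp : 0 < S w by rewrite lt_neqAle eq_sym e0 S0.
apply: (@le_trans _ _ (2 * (dl + 1) * (p * S w))); last by apply: ler_wpM2l => //; apply: mulr_ge0.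
have -> : `|\sum_(j <- s) y j w * Y j w| = 2 * S w * (th w * `|U|).
  by rewrite /th mulrA mulfV ?mul1r // mulf_neq0.
have -> : 2 * (dl + 1) * (p * S w) = 2 * S w * ((dl + 1) * p) by ring.
by apply: ler_wpM2l => //; apply: mulr_ge0.
Qed.

(** Coefficients known before the whole list can serve as their own envelope. *)
Lemma linear_tail (u : J -> T -> R) : (forall j, j \in s -> mE E (u j)) ->
  pgood (fun w => forall a b, 0 <= a -> 0 <= b ->
     \sum_(j <- s) u j w ^+ 2 <= a ^+ 2 -> (forall j, j \in s -> `|u j w| <= b) ->
     `|\sum_(j <- s) u j w * Y j w| <= 2 * (dl + 1) * (Num.sqrt (v * p) * a + p * t * b))
    (2 * expR (- (dl * p))).
Proof.
move=> mu; have h1 := @pred_lin u (fun j w => `|u j w|).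
apply: pgood_imp (h1 _ _ _) => //.
- move=> w h a b a0 b0 ha hb; apply: h => //.
  apply: le_trans ha; rewrite le_eqVlt; apply/orP; left; apply/eqP; apply: eq_bigr => j _.
  by rewrite real_normK ?num_real.
- move=> s1 j s2 sE; apply: (@mE_sub E).
    by move=> i; rewrite /addE => ->.
  by apply: mu; rewrite sE mem_cat inE eqxx orbT.
- by move=> j js; apply: measurableT_comp => //; exact: mu.
Qed.

End Tail.

End Concentration.

(** * Bilinear forms in independent variables *)

Section Bilinear.
Context {d : measure_display} {T : measurableType d} {R : realType} (P : probability T R).
Context {I : finType} (D : pred I) (Z : I -> T -> R * R).
Local Open Scope classical_set_scope.

Hypothesis mZ : forall i, measurable_fun setT (Z i).
Hypothesis indZ : forall S : I -> set (R * R), (forall i, measurable (S i)) ->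
  fine (P (\bigcap_(i in [set i | D i]) (Z i @^-1` S i))) = \prod_(i | D i) fine (P (Z i @^-1` S i)).

Context {J : finType} (s1 s2 : seq J) (e1 e2 : J -> I) (X Y : J -> T -> R).
Variables (t nu p dl : R) (n : nat) (E E1 : pred I) (chi : J -> J -> bool) (M : J -> J -> T -> R).
Hypotheses (famX : family P D Z s1 e1 X t n%:R^-1 nu) (famY : family P D Z s2 e2 Y t n%:R^-1 nu).
Hypotheses (n0 : (0 < n)%N) (t0 : 0 < t) (t1 : t <= 1) (nu0 : 0 <= nu) (p1 : 1 <= p) (dl0 : 0 <= dl).
Hypothesis EE1 : forall i, E i -> E1 i.
Hypothesis ED1 : forall i, E1 i -> D i.
Hypothesis Es1 : forall j, j \in s1 -> ~~ E (e1 j).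
Hypothesis Es2 : forall j, j \in s2 -> ~~ E1 (e2 j).
Hypotheses (sz1 : (size s1 <= n)%N) (sz2 : (size s2 <= n)%N) (nut : nu * n%:R <= t).
Hypothesis mM : forall i j, i \in s1 -> j \in s2 -> mE Z E (M i j).
Hypothesis chiP : forall l1 j l2 i, s2 = l1 ++ j :: l2 -> i \in s1 -> chi i j ->
  addE E1 (map e2 l1) (e1 i).

(** For each j the inner sum over i is predictable, and [linear_tail] puts it below an envelope that
    depends on M alone; [pred_lin] with this envelope treats the outer sum. The relation [chi] keeps
    pairs whose X_i is revealed before Y_j: all pairs when the rows differ, the pairs i < j when
    they carry the same index. *)
Lemma bilinear_tail :
  pgood P (fun w => forall f b, 0 <= f -> 0 <= b ->
     \sum_(j <- s2) \sum_(i <- s1) M i j w ^+ 2 <= f ^+ 2 ->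
     (forall i j, i \in s1 -> j \in s2 -> `|M i j w| <= b) ->
     `|\sum_(j <- s2) (\sum_(i <- s1) (if chi i j then X i w * M i j w else 0)) * Y j w| <=
       (2 * (dl + 1)) ^+ 2 * (2 * (p / n%:R) * f + 4 * p ^+ 2 * t * b))
    ((2 * #|J|%:R + 2) * expR (- (dl * p))).
Proof.
pose K := 2 * (dl + 1).
have K0 : 0 <= K by rewrite /K mulr_ge0 // addr_ge0.
have p0 : 0 <= p by apply: le_trans p1.
have n0' : 0 < n%:R :> R by rewrite ltr0n.
have v0 : 0 <= n%:R^-1 :> R by rewrite invr_ge0 ler0n.
have nut1 s : (size s <= n)%N -> nu * (size s : nat)%:R <= t.
  by move=> h; apply: le_trans nut; rewrite ler_wpM2l // ler_nat.
pose vp : R := Num.sqrt (n%:R^-1 * p).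
have vp0 : 0 <= vp by exact: sqrtr_ge0.
have vp2 : vp ^+ 2 = p / n%:R by rewrite sqr_sqrtr ?mulr_ge0 // mulrC.
pose c2 j w := Num.sqrt (\sum_(i <- s1) M i j w ^+ 2).
pose ci j w := mx s1 (fun i => `|M i j w|).
pose N j w := K * (vp * c2 j w + p * t * ci j w).
have c20 j w : 0 <= c2 j w by exact: sqrtr_ge0.
have ci0 j w : 0 <= ci j w by exact: mx_ge0.
have pt0 : 0 <= p * t by rewrite mulr_ge0 // ltW.
have N0 j w : 0 <= N j w by rewrite mulr_ge0 // addr_ge0 // mulr_ge0.
pose y j w := \sum_(i <- s1) (if chi i j then X i w * M i j w else 0).
have g1 : pgood P (fun w => forall j, j \in s2 -> `|y j w| <= N j w)
     (#|J|%:R * (2 * expR (- (dl * p)))).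
  apply: pgood_all => j.
  have [js|js] := boolP (j \in s2); last first.
    exists set0; split => //; rewrite measure0 lee_fin.
    by rewrite mulr_ge0 ?expR_ge0.
  pose u i w := if chi i j then M i j w else 0.
  have mu i : i \in s1 -> mE Z E (u i).
    by move=> si; rewrite /u; case: (chi i j); [exact: mM | exact: measurable_cst].
  have := linear_tail mZ indZ famX t0 v0 nu0 p1 dl0 (fun i Ei => ED1 (EE1 Ei)) Es1 (nut1 _ _ sz1) mu.
  apply: pgood_imp => // w h _.
  have -> : y j w = \sum_(i <- s1) u i w * X i w.
    by apply: eq_bigr => i _; rewrite /u; case: ifP => _; rewrite ?mul0r // mulrC.
  have uM i : `|u i w| <= `|M i j w| by rewrite /u; case: ifP => // _; rewrite normr0.
  apply: h => //.
    rewrite sqr_sqrtr; last by apply: sumr_ge0 => i _; exact: sqr_ge0.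
    apply: ler_sum => i _; rewrite -real_normK ?num_real // -[leRHS]real_normK ?num_real //.
    by rewrite lerXn2r ?nnegrE.
  by move=> i si; apply: le_trans (uM i) _; exact: (@le_mx _ _ s1 (fun i => `|M i j w|)).
have mN j : j \in s2 -> mE Z E1 (N j).
  move=> js; apply: (mE_sub EE1); apply: measurable_funM => //; apply: measurable_funD; apply: measurable_funM => //.
    apply: measurable_sqrt_fun; last by move=> w; apply: sumr_ge0 => i _; exact: sqr_ge0.
    by apply: measurable_sum_seq => i si; apply: measurable_funX; exact: mM.
  by apply: measurable_mx => i si; apply: measurableT_comp => //; exact: mM.
have ady l1 j l2 : s2 = l1 ++ j :: l2 -> mE Z (addE E1 (map e2 l1)) (y j).
  move=> sE; have js : j \in s2 by rewrite sE mem_cat inE eqxx orbT.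
  apply: measurable_sum_seq => i si; have [ch|_] := boolP (chi i j); last exact: measurable_cst.
  apply: measurable_funM.
    by apply: (fam_mE famX si); exact: chiP sE si ch.
  by apply: mE_sub (mM si js) => k /EE1; rewrite /addE => ->.
have g2 := pred_lin mZ indZ famY t0 v0 nu0 p1 dl0 ED1 Es2 (nut1 _ _ sz2) ady mN N0.
have := pgood_and g1 g2.
apply: pgood_imp; last by rewrite le_eqVlt; apply/orP; left; apply/eqP; ring.
move=> w [h1 h2] f b f0 b0 hf hb.
have cib j : j \in s2 -> ci j w <= b by move=> js; apply: mx_le => // i si; exact: hb.
have sn : 0 <= Num.sqrt n%:R :> R by exact: sqrtr_ge0.
have sn2 : Num.sqrt n%:R ^+ 2 = n%:R :> R by rewrite sqr_sqrtr // ler0n.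
have c2b j : j \in s2 -> c2 j w <= Num.sqrt n%:R * b.
  move=> js; rewrite -(ger0_norm b0) -sqrtr_sqr -sqrtrM ?ler0n // ler_wsqrtr //.
  apply: (@le_trans _ _ (\sum_(i <- s1) b ^+ 2)).
    rewrite big_seq [leRHS]big_seq; apply: ler_sum => i si.
    by rewrite -real_normK ?num_real // lerXn2r ?nnegrE //; exact: hb.
  rewrite big_const_seq count_predT iter_addr addr0 -[leLHS]mulr_natl.
  by apply: ler_wpM2r; [exact: sqr_ge0 | rewrite ler_nat].
pose a := K * (2 * vp * f + 2 * (p * t) * (Num.sqrt n%:R * b)).
have sb0 : 0 <= Num.sqrt n%:R * b by rewrite mulr_ge0.
have a0 : 0 <= a by rewrite mulr_ge0 // addr_ge0 // mulr_ge0 // mulr_ge0.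
have Na : \sum_(j <- s2) N j w ^+ 2 <= a ^+ 2.
  apply: (@le_trans _ _ (\sum_(j <- s2) K ^+ 2 * (2 * (vp ^+ 2 * (\sum_(i <- s1) M i j w ^+ 2) + (p * t) ^+ 2 * b ^+ 2)))).
    rewrite big_seq [leRHS]big_seq; apply: ler_sum => j js.
    have -> : \sum_(i <- s1) M i j w ^+ 2 = c2 j w ^+ 2.
      by rewrite sqr_sqrtr //; apply: sumr_ge0 => i _; exact: sqr_ge0.
    rewrite /N exprMn; apply: ler_wpM2l; first exact: sqr_ge0.
    have h3 : (p * t * ci j w) ^+ 2 <= (p * t) ^+ 2 * b ^+ 2.
      by rewrite -exprMn lerXn2r ?nnegrE //; [exact: mulr_ge0 | exact: mulr_ge0 | apply: ler_wpM2l => //; exact: cib].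
    have h4 := sqr_ge0 (vp * c2 j w - p * t * ci j w).
    rewrite -[vp ^+ 2 * _]exprMn; move: h3 h4.
    set q1 := vp * c2 j w; set q2 := p * t * ci j w; move=> h3 h4.
    have : (q1 - q2) ^+ 2 = q1 ^+ 2 - 2 * (q1 * q2) + q2 ^+ 2 by ring.
    have -> : (q1 + q2) ^+ 2 = q1 ^+ 2 + 2 * (q1 * q2) + q2 ^+ 2 by ring.
    by move=> h5; rewrite h5 in h4; lra.
  rewrite -mulr_sumr -mulr_sumr big_split /= -mulr_sumr big_const_seq count_predT iter_addr addr0 -mulr_natr.
  have h5 : (p * t) ^+ 2 * b ^+ 2 * (size s2)%:R <= (p * t) ^+ 2 * (Num.sqrt n%:R * b) ^+ 2.
    rewrite [(Num.sqrt n%:R * b) ^+ 2]exprMn sn2 -mulrA; apply: ler_wpM2l; first exact: sqr_ge0.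
    by rewrite mulrC; apply: ler_wpM2r; [exact: sqr_ge0 | rewrite ler_nat].
  have h6 : vp ^+ 2 * (\sum_(j <- s2) \sum_(i <- s1) M i j w ^+ 2) <= vp ^+ 2 * f ^+ 2.
    by apply: ler_wpM2l => //; exact: sqr_ge0.
  rewrite /a [leRHS]exprMn; apply: ler_wpM2l; first exact: sqr_ge0.
  move: h5 h6; rewrite -!exprMn.
  have z1 : 0 <= vp * f by rewrite mulr_ge0.
  have z2 : 0 <= p * t * (Num.sqrt n%:R * b) by rewrite mulr_ge0.
  rewrite -!(mulrA 2).
  move: z1 z2; set q1 := vp * f; set q2 := p * t * _ => z1 z2 h5 h6.
  have z3 : 0 <= q1 * q2 by rewrite mulr_ge0.
  have z4 := sqr_ge0 q1; have z5 := sqr_ge0 q2.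
  have -> : (2 * q1 + 2 * q2) ^+ 2 = 4 * q1 ^+ 2 + 8 * (q1 * q2) + 4 * q2 ^+ 2 by ring.
  lra.
pose bb := K * (vp * (Num.sqrt n%:R * b) + p * t * b).
have bb0 : 0 <= bb by rewrite mulr_ge0 // addr_ge0 // mulr_ge0.
have Nb j : j \in s2 -> N j w <= bb.
  move=> js; apply: ler_wpM2l => //; apply: lerD; apply: ler_wpM2l => //.
    exact: c2b.
  exact: cib.
have := h2 h1 a bb a0 bb0 Na Nb; rewrite -/vp -/K => h3.
apply: (le_trans h3); rewrite -/K [K ^+ 2]expr2 -[leRHS]mulrA; apply: ler_wpM2l => //.
have -> : vp * a + p * t * bb =
   K * (2 * vp ^+ 2 * f + (3 * (p * t) * (vp * Num.sqrt n%:R) * b + (p * t) ^+ 2 * b)).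
  by rewrite /a /bb; ring.
apply: ler_wpM2l => //; rewrite vp2; apply: lerD => //.
have vs : vp * Num.sqrt n%:R <= p.
  rewrite -sqrtrM ?mulr_ge0 //; have -> : n%:R^-1 * p * n%:R = p by field; rewrite gt_eqF.
  rewrite -{2}(ger0_norm p0) -sqrtr_sqr ler_wsqrtr // expr2.
  by rewrite -{1}[p]mulr1 ler_wpM2l.
have -> : 4 * p ^+ 2 * t * b = 3 * (p * t) * p * b + p * p * t * b by ring.
apply: lerD.
  by apply: ler_wpM2r => //; apply: ler_wpM2l => //; rewrite mulr_ge0.
rewrite expr2; apply: ler_wpM2r => //.
have -> : p * t * (p * t) = p * p * t * t by ring.
by rewrite -[leRHS]mulr1; apply: ler_wpM2l => //; rewrite !mulr_ge0 // ltW.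
Qed.

End Bilinear.

(** * Random inputs of the local law *)

Section ComplexMeasurable.
Context {R : realType} {d : measure_display} {T : measurableType d}.
Local Notation C := R[i].
Local Open Scope classical_set_scope.
Implicit Types f g : T -> C.

Definition cm f := measurable_fun setT (fun w => complex.Re (f w)) /\
  measurable_fun setT (fun w => complex.Im (f w)).

Lemma cm_cst z : cm (fun=> z). Proof. by split; exact: measurable_cst. Qed.

Lemma cm_real (f : T -> R) : measurable_fun setT f -> cm (fun w => (f w)%:C%C).
Proof. by move=> mf; split => //; exact: measurable_cst. Qed.

Lemma cmD f g : cm f -> cm g -> cm (fun w => f w + g w).
Proof.
move=> [f1 f2] [g1 g2]; split.
  by under eq_fun do rewrite ReD; exact: measurable_funD.
by under eq_fun do rewrite ImD; exact: measurable_funD.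
Qed.

Lemma cmM f g : cm f -> cm g -> cm (fun w => f w * g w).
Proof.
move=> [f1 f2] [g1 g2]; split.
  by under eq_fun do rewrite ReM; apply: measurable_funB; exact: measurable_funM.
by under eq_fun do rewrite ImM; apply: measurable_funD; exact: measurable_funM.
Qed.

Lemma cmN f : cm f -> cm (fun w => - f w).
Proof.
move=> [f1 f2]; split.
  by under eq_fun do rewrite ReN; exact: measurableT_comp.
by under eq_fun do rewrite ImN; exact: measurableT_comp.
Qed.

Lemma cm_conj f : cm f -> cm (fun w => (f w)^*%C).
Proof.
move=> [f1 f2]; split.
  by rewrite (_ : (fun w => _) = (fun w => complex.Re (f w))) //; apply/funext => w; case: (f w).
rewrite (_ : (fun w => _) = (fun w => - complex.Im (f w))); first exact: measurableT_comp.
by apply/funext => w; case: (f w).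
Qed.

Lemma invc_md (x : C) : x^-1 = x^*%C * ((md x ^+ 2)^-1)%:C%C.
Proof.
have [->|x0] := eqVneq x 0; first by rewrite invr0 [in RHS]rmorph0 mul0r.
apply: (mulfI x0); rewrite mulfV // mulrA mulc_conj -rmorphM /= mulfV //.
by rewrite expf_eq0 /= md_eq0.
Qed.

Lemma cmV f : cm f -> cm (fun w => (f w)^-1).
Proof.
move=> cf; under eq_fun do rewrite invc_md.
apply: cmM; first exact: cm_conj.
apply: cm_real; apply: measurable_inv_fun; last by move=> w; exact: sqr_ge0.
under eq_fun do rewrite md_sqr; case: cf => f1 f2.
by apply: measurable_funD; exact: measurable_funX.
Qed.

Lemma cm_sum (J : finType) (Q : pred J) (f : J -> T -> C) : (forall j, cm (f j)) ->
  cm (fun w => \sum_(j | Q j) f j w).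
Proof.
move=> cf; elim: (index_enum J) => [|j s IH].
  by under eq_fun do rewrite big_nil; exact: cm_cst.
under eq_fun do rewrite big_cons; case: (Q j) => //.
exact: cmD.
Qed.

Lemma cm_prod (J : finType) (f : J -> T -> C) : (forall j, cm (f j)) ->
  cm (fun w => \prod_j f j w).
Proof.
move=> cf; elim: (index_enum J) => [|j s IH].
  by under eq_fun do rewrite big_nil; exact: cm_cst.
by under eq_fun do rewrite big_cons; exact: cmM.
Qed.

Definition cmx m1 m2 (M : T -> 'M[C]_(m1, m2)) := forall i j, cm (fun w => M w i j).

Lemma cm_det m (M : T -> 'M[C]_m) : cmx M -> cm (fun w => \det (M w)).
Proof.
move=> cM; apply: cm_sum => s; apply: cmM; first exact: cm_cst.
by apply: cm_prod => i; exact: cM.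
Qed.

Lemma cmx_mul m1 m2 m3 (M : T -> 'M[C]_(m1, m2)) (N : T -> 'M[C]_(m2, m3)) :
  cmx M -> cmx N -> cmx (fun w => M w *m N w).
Proof.
move=> cM cN i j; under eq_fun do rewrite mxE.
by apply: cm_sum => k; exact: cmM.
Qed.

(** By Cramer's rule the inverse is made of polynomials in the entries and one division by the
    determinant. *)
Lemma cmx_inv m (M : T -> 'M[C]_m) : cmx M -> (forall w, M w \in unitmx) ->
  cmx (fun w => invmx (M w)).
Proof.
move=> cM uM i j.
have -> : (fun w => invmx (M w) i j) = (fun w => (\det (M w))^-1 * \adj (M w) i j).
  by apply/funext => w; rewrite /invmx uM !mxE.
apply: cmM; first by apply: cmV; exact: cm_det.
under eq_fun do rewrite mxE /cofactor.
apply: cmM; first exact: cm_cst.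
apply: cm_det => a b; under eq_fun do rewrite !mxE; exact: cM.
Qed.

End ComplexMeasurable.

Section ResolventMeasurable.
Context {R : realType} {n : nat} {d : measure_display} {T : measurableType d}.
Local Notation C := R[i].
Local Open Scope classical_set_scope.
Variables (A : T -> 'M[R]_n) (z : C) (S : {set 'I_n}).
Hypotheses (sA : forall w, (A w)^T = A w) (z0 : 0 < complex.Im z).
Hypothesis mA : forall i j, measurable_fun setT (fun w => mask S (A w) i j).

Lemma cmx_res : cmx (fun w => res (mask S (A w)) z).
Proof.
apply: cmx_inv; last by move=> w; apply: res_unit => //; exact: mask_sym.
move=> i j; rewrite (_ : (fun w => _) = fun w => (mask S (A w) i j)%:C%C - (z%:M : 'M[C]_n) i j).
  by apply: cmD; [exact: cm_real | exact: cm_cst].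
by apply/funext => w; rewrite !mxE.
Qed.

Lemma cmx_uvec : cmx (fun w => uvec (A w) z S).
Proof. by apply: cmx_mul; [exact: cmx_res | move=> i j; exact: cm_cst]. Qed.

Lemma cm_str : cm (fun w => str S (A w) z).
Proof.
apply: cmM; last exact: cm_cst.
by apply: cm_sum => i; exact: cmx_res.
Qed.

End ResolventMeasurable.

(** * Linear and quadratic forms in the rows of one matrix *)

Section RandomInputs.
Context {d : measure_display} {T : measurableType d} {R : realType} (P : probability T R) {n : nat}.
Local Notation C := R[i].
Local Notation I := ('I_n * 'I_n)%type.
Context (Z : I -> T -> R * R).
Local Open Scope classical_set_scope.

Definition ordp : pred I := fun e => (e.1 <= e.2)%N.
(* Index of the pair of entries carrying position [(i, j)]; the pairs are independent for [i <= j]. *)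
Definition upair (i j : 'I_n) : I := if (i <= j)%N then (i, j) else (j, i).
Definition avoid (S : {set 'I_n}) : pred I := fun e => [&& ordp e, e.1 \notin S & e.2 \notin S].
Definition outside (S : {set 'I_n}) : seq 'I_n := [seq j <- enum 'I_n | j \notin S].

Lemma upair_ord i j : ordp (upair i j).
Proof. by rewrite /upair /ordp; case: (leqP i j) => h /=; [exact: h | exact: ltnW]. Qed.

Lemma upair_mem (S : {set 'I_n}) i j : ((upair i j).1 \notin S) && ((upair i j).2 \notin S) = (i \notin S) && (j \notin S).
Proof. by rewrite /upair; case: ifP => //= _; rewrite andbC. Qed.

Lemma upair_avoid (S : {set 'I_n}) i j : i \notin S -> j \notin S -> avoid S (upair i j).
Proof. by move=> iS jS; rewrite /avoid upair_ord upair_mem iS jS. Qed.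

Lemma upair_Navoid (S : {set 'I_n}) i j : i \in S -> ~~ avoid S (upair i j).
Proof. by move=> iS; rewrite /avoid upair_mem iS /= andbF. Qed.

Lemma avoid_ord S e : avoid S e -> ordp e. Proof. by case/and3P. Qed.

Lemma upair_inj (S : {set 'I_n}) k j k' j' : k \in S -> k' \in S -> j \notin S -> j' \notin S ->
  upair k j = upair k' j' -> k = k' /\ j = j'.
Proof.
move=> kS kS' jS jS'; rewrite /upair; do 2! case: ifP => _; case=> e1 e2; subst; split=> //.
all: by move: jS jS'; rewrite ?kS ?kS'.
Qed.

Lemma mem_outside S j : (j \in outside S) = (j \notin S).
Proof. by rewrite mem_filter mem_enum andbT. Qed.

Lemma sum_outside (V : nmodType) S (f : 'I_n -> V) : \sum_(j <- outside S) f j = \sum_(j | j \notin S) f j.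
Proof. by rewrite big_filter big_enum_cond. Qed.

Lemma size_outside S : (size (outside S) <= n)%N.
Proof. by rewrite size_filter (leq_trans (count_size _ _)) // size_enum_ord. Qed.

(** The enumeration of the indices outside S is increasing, so the condition i < j is also
    precedence in the list, hence predictability. *)
Lemma outside_sorted S l1 j l2 i : outside S = l1 ++ j :: l2 -> i \notin S -> (i < j)%N -> i \in l1.
Proof.
move=> sE; rewrite -mem_outside sE mem_cat inE => /orP[//|] /orP[/eqP -> |il]; first by rewrite ltnn.
have : sorted ltn (map val (outside S)).
  have st : sorted ltn (map val (enum 'I_n)) by rewrite val_enum_ord iota_ltn_sorted.
  by rewrite sorted_map; apply: sorted_filter; [move=> x y z /=; exact: ltn_trans | rewrite -sorted_map].
rewrite sE map_cat /= sorted_cat_cons => /andP[_].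
rewrite path_sortedE; last by move=> x y z; exact: ltn_trans.
move=> /andP[/allP h _] ij; have := h (val i) (map_f _ il).
by rewrite /= ltnNge (ltnW ij).
Qed.

Variables (A : T -> 'M[R]_n) (tau nu p dl : R).
Hypothesis mZ : forall i, measurable_fun setT (Z i).
Hypothesis indZ : forall S : I -> set (R * R), (forall i, measurable (S i)) ->
  fine (P (\bigcap_(i in [set i | ordp i]) (Z i @^-1` S i))) = \prod_(i | ordp i) fine (P (Z i @^-1` S i)).
Hypothesis sA : forall w, (A w)^T = A w.
Hypothesis AZ : forall i j, exists2 h, measurable_fun setT h & forall w, A w i j = h (Z (upair i j) w).
Hypothesis Atau : forall w i j, `|A w i j| <= tau.
Hypothesis EA : forall i j, i != j -> `|Ex P (fun w => A w i j)| <= nu.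
Hypothesis EA2 : forall i j, i != j -> Ex P (fun w => A w i j ^+ 2) <= n%:R^-1.
Hypothesis EA2' : forall i j, i != j -> `|Ex P (fun w => A w i j ^+ 2) - n%:R^-1| <= nu * tau.
Hypotheses (n0 : (0 < n)%N) (t0 : 0 < tau) (t1 : tau <= 1) (nu0 : 0 <= nu) (p1 : 1 <= p) (dl0 : 0 <= dl).
Hypothesis nut : nu * n%:R ^+ 2 <= tau.
Hypothesis ntau : n%:R^-1 <= tau ^+ 2.

Local Notation TE E := (g_sigma_algebraType (cyl Z E)).

Let nR : 0 < n%:R :> R. Proof. by rewrite ltr0n. Qed.
Let n1 : 1 <= n%:R :> R. Proof. by rewrite ler1n. Qed.
Let v0 : 0 <= n%:R^-1 :> R. Proof. by rewrite invr_ge0 ler0n. Qed.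

Lemma A_meas i j : measurable_fun setT (fun w => A w i j).
Proof.
have [h mh hE] := AZ i j; under eq_fun do rewrite hE.
exact: measurableT_comp.
Qed.

Lemma A_mE (E : pred I) i j : E (upair i j) -> mE Z E (fun w => A w i j).
Proof. by move=> Eij; have [h mh hE] := AZ i j; under eq_fun do rewrite hE; exact: mE_Z. Qed.

Lemma mask_mE S i j : mE Z (avoid S) (fun w => mask S (A w) i j).
Proof.
under eq_fun do rewrite mxE.
have [_|] := boolP ((i \in S) || (j \in S)); first exact: measurable_cst.
by rewrite negb_or => /andP[iS jS]; apply: A_mE; exact: upair_avoid.
Qed.

Definition cmE (E : pred I) (f : T -> C) := @cm R _ (TE E) f.

Lemma cmE_sub (E E' : pred I) f : (forall i, E i -> E' i) -> cmE E f -> cmE E' f.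
Proof. by move=> EE [h1 h2]; split; apply: (mE_sub EE). Qed.

Lemma uniq_row (S : {set 'I_n}) k : k \in S -> uniq (map (upair k) (outside S)).
Proof.
move=> kS; rewrite map_inj_in_uniq; first by apply: filter_uniq; exact: enum_uniq.
by move=> j j'; rewrite !mem_outside => jS jS' /(upair_inj kS kS jS jS') [].
Qed.

Lemma family_row (S : {set 'I_n}) k : k \in S ->
  family P ordp Z (outside S) (upair k) (fun j w => A w k j) tau n%:R^-1 nu.
Proof.
move=> kS; have kj j : j \in outside S -> k != j.
  by rewrite mem_outside => jS; apply: contraNneq jS => <-.
split.
- by move=> j _; exact: AZ.
- by move=> j _; exact: upair_ord.
- exact: uniq_row.
- by move=> j w _; exact: Atau.
- by move=> j /kj; exact: EA.
- by move=> j /kj; exact: EA2.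
Qed.

Lemma bdmA i j : bdm (fun w => A w i j).
Proof. by split; [exact: A_meas | exists tau => w; exact: Atau]. Qed.

(** Centred at 1 / n instead of the exact mean; truncation accounts for the defect nu tau. Since a^4
    <= tau^2 a^2 and 1 / n <= tau^2, two terms tau^2 / n bound the second moment. *)
Lemma family_sq (S : {set 'I_n}) k : k \in S ->
  family P ordp Z (outside S) (upair k) (fun j w => A w k j ^+ 2 - n%:R^-1)
    (2 * tau ^+ 2) (2 * tau ^+ 2 / n%:R) (nu * tau).
Proof.
move=> kS; have kj j : j \in outside S -> k != j.
  by rewrite mem_outside => jS; apply: contraNneq jS => <-.
have b2 j : bdm (fun w => A w k j ^+ 2) by apply: bdm_sqr; exact: bdmA.
have bc : bdm (fun _ : T => - n%:R^-1 : R) by exact: bdm_cst.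
have A2 w j : A w k j ^+ 2 <= tau ^+ 2.
  by rewrite -real_normK ?num_real // lerXn2r ?nnegrE // ltW.
split.
- move=> j _; have [h mh hE] := AZ k j; exists (fun x => h x ^+ 2 - n%:R^-1); last by move=> w; rewrite hE.
  by apply: measurable_funB => //; exact: measurable_funX.
- by move=> j _; exact: upair_ord.
- exact: uniq_row.
- move=> j w _; rewrite ler_norml; apply/andP; split.
    have := sqr_ge0 (A w k j); have := sqr_ge0 tau; have h := ntau; lra.
  have := A2 w j; have := sqr_ge0 tau; have h := v0; lra.
- by move=> j /kj h; rewrite ExD // Ex_cst; exact: EA2'.
- move=> j /kj h.
  apply: (@le_trans _ _ (Ex P (fun w => tau ^+ 2 * A w k j ^+ 2 + tau ^+ 2 / n%:R))).
    apply: Ex_le.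
    + by apply: bdm_sqr; exact: bdmD.
    + by apply: bdmD; [exact: bdmZ | exact: bdm_cst].
    + move=> w.
      have h1 : A w k j ^+ 2 * A w k j ^+ 2 <= tau ^+ 2 * A w k j ^+ 2.
        by apply: ler_wpM2r => //; exact: sqr_ge0.
      have h2 : n%:R^-1 * n%:R^-1 <= tau ^+ 2 * n%:R^-1 by apply: ler_wpM2r.
      have h3 : 0 <= A w k j ^+ 2 * n%:R^-1 by rewrite mulr_ge0 ?sqr_ge0.
      have -> : (A w k j ^+ 2 - n%:R^-1) ^+ 2 =
        A w k j ^+ 2 * A w k j ^+ 2 + n%:R^-1 * n%:R^-1 - 2 * (A w k j ^+ 2 * n%:R^-1) by ring.
      lra.
  rewrite ExD; try exact: bdmZ; try exact: bdm_cst.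
  rewrite ExZ // Ex_cst.
  have h1 : tau ^+ 2 * Ex P (fun w => A w k j ^+ 2) <= tau ^+ 2 / n%:R.
    by apply: ler_wpM2l; [exact: sqr_ge0 | exact: EA2].
  lra.
Qed.

Definition cross (S : {set 'I_n}) : seq I := [seq e <- enum {: I} | (e.1 \in S) && (e.2 \notin S)].

Lemma family_cross (S : {set 'I_n}) :
  family P ordp Z (cross S) (fun e => upair e.1 e.2) (fun e w => A w e.1 e.2) tau n%:R^-1 nu.
Proof.
have h e : e \in cross S -> e.1 != e.2.
  by rewrite mem_filter => /andP[/andP[h1 h2] _]; apply: contraNneq h2 => <-.
split.
- by move=> e _; exact: AZ.
- by move=> e _; exact: upair_ord.
- rewrite map_inj_in_uniq; [by apply: filter_uniq; exact: enum_uniq | move=> e e'].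
  rewrite !mem_filter => /andP[/andP[h1 h2] _] /andP[/andP[h1' h2'] _].
  by move=> /(upair_inj h1 h1' h2 h2') []; case: e {h1 h2}; case: e' {h1' h2'} => /= a b a' b' -> ->.
- by move=> j w _; exact: Atau.
- by move=> e /h; exact: EA.
- by move=> e /h; exact: EA2.
Qed.

Let K := 2 * (dl + 1).
Let q := expR (- (dl * p)).
Let rho := Num.sqrt (n%:R^-1 * p).

Let K2 : 2 <= K. Proof. by rewrite /K; move: dl0 => h; lra. Qed.
Let K0 : 0 <= K. Proof. by apply: le_trans K2. Qed.
Let q0 : 0 <= q. Proof. exact: expR_ge0. Qed.
Let p0 : 0 <= p. Proof. exact: le_trans p1. Qed.
Let rho0 : 0 <= rho. Proof. exact: sqrtr_ge0. Qed.

Lemma nu_small (m : nat) : (m <= n ^ 2)%N -> nu * m%:R <= tau.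
Proof. by move=> h; apply: le_trans nut; rewrite ler_wpM2l // -natrX ler_nat. Qed.

Lemma Re_dot_al (S : {set 'I_n}) w k (v : 'cV[C]_n) :
  complex.Re (dot (al S (A w) k) v) = \sum_(j <- outside S) complex.Re (v j 0) * A w k j /\
  complex.Im (dot (al S (A w) k) v) = \sum_(j <- outside S) complex.Im (v j 0) * A w k j.
Proof.
split; rewrite sum_outside /dot ?Re_sum ?Im_sum [in RHS]big_mkcond /=; apply: eq_bigr => j _;
    rewrite !mxE; case: (j \in S) => /=; rewrite ?mul0r //.
  by rewrite ReMr mulrC.
by rewrite ImMr mulrC.
Qed.

Lemma sum_outside_le (S : {set 'I_n}) (f : 'I_n -> R) : (forall j, 0 <= f j) ->
  \sum_(j <- outside S) f j <= \sum_j f j.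
Proof.
move=> f0; rewrite sum_outside big_mkcond; apply: ler_sum => j _.
by case: ifP.
Qed.

Lemma n2_Re (v : 'cV[C]_n) : \sum_j complex.Re (v j 0) ^+ 2 <= n2 v /\ \sum_j complex.Im (v j 0) ^+ 2 <= n2 v.
Proof.
split; apply: ler_sum => j _; rewrite md_sqr.
  by rewrite lerDl sqr_ge0.
by rewrite lerDr sqr_ge0.
Qed.

Lemma lin_row (S : {set 'I_n}) k (E : pred I) (v : T -> 'cV[C]_n) :
  k \in S -> (forall e, E e -> ordp e) -> (forall j, j \notin S -> ~~ E (upair k j)) ->
  (forall j, cmE E (fun w => v w j 0)) ->
  pgood P (fun w => forall a b, 0 <= a -> 0 <= b -> n2 (v w) <= a ^+ 2 -> (forall i, md (v w i 0) <= b) ->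
    md (dot (al S (A w) k) (v w)) <= 2 * K * (rho * a + p * tau * b)) (4 * q).
Proof.
move=> kS ED Ek mv.
have Ek' j : j \in outside S -> ~~ E (upair k j) by rewrite mem_outside; exact: Ek.
have sz : nu * (size (outside S))%:R <= tau.
  by apply: nu_small; rewrite (leq_trans (size_outside S)) // -mulnn leq_pmulr.
have f := family_row kS.
have l1 := linear_tail mZ indZ f t0 v0 nu0 p1 dl0 ED Ek' sz (fun j _ => (mv j).1).
have l2 := linear_tail mZ indZ f t0 v0 nu0 p1 dl0 ED Ek' sz (fun j _ => (mv j).2).
have := pgood_and l1 l2; apply: pgood_imp; last by rewrite -/q; lra.
move=> w [h1 h2] a b a0 b0 ha hb.
have [e1 e2] := Re_dot_al S w k (v w); have [r1 r2] := n2_Re (v w).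
apply: le_trans (md_le_ReIm _) _; rewrite e1 e2.
have -> : 2 * K * (rho * a + p * tau * b) = K * (rho * a + p * tau * b) + K * (rho * a + p * tau * b) by ring.
apply: lerD.
  apply: h1 => //.
    apply: le_trans (le_trans r1 ha); apply: sum_outside_le => j; exact: sqr_ge0.
  by move=> j _; apply: le_trans (Re_le_md _) _.
apply: h2 => //.
  apply: le_trans (le_trans r2 ha); apply: sum_outside_le => j; exact: sqr_ge0.
by move=> j _; apply: le_trans (Im_le_md _) _.
Qed.

(** X_j and Y_j may share a coordinate, so a pair is revealed at its larger index. The part i < j is
    predictable as it stands; the part i > j becomes so after exchanging the roles of X and Y and
    transposing M. *)
Lemma offdiag_tail (S : {set 'I_n}) k (X Y : 'I_n -> T -> R) (M : 'I_n -> 'I_n -> T -> R) : k \in S ->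
  family P ordp Z (outside S) (upair k) X tau n%:R^-1 nu ->
  family P ordp Z (outside S) (upair k) Y tau n%:R^-1 nu ->
  (forall i j, mE Z (avoid S) (M i j)) ->
  pgood P (fun w => forall f b, 0 <= f -> 0 <= b -> \sum_j \sum_i M i j w ^+ 2 <= f ^+ 2 ->
    (forall i j, `|M i j w| <= b) ->
    `|\sum_(j <- outside S) \sum_(i <- outside S) (if i == j then 0 else X i w * M i j w * Y j w)| <=
      2 * K ^+ 2 * (2 * (p / n%:R) * f + 4 * p ^+ 2 * tau * b)) ((4 * n%:R + 4) * q).
Proof.
move=> kS fX fY mM.
have nn1 : nu * n%:R <= tau by apply: nu_small; rewrite -mulnn leq_pmulr.
have kE j : j \in outside S -> ~~ avoid S (upair k j) by move=> _; exact: upair_Navoid.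
have chiP l1 j l2 i : outside S = l1 ++ j :: l2 -> i \in outside S -> (i < j)%N ->
    addE (avoid S) (map (upair k) l1) (upair k i).
  rewrite mem_outside => sE iS ij; apply/orP; right; apply: map_f.
  exact: outside_sorted sE iS ij.
have g1 := bilinear_tail mZ indZ fX fY n0 t0 t1 nu0 p1 dl0 (fun _ h => h) (@avoid_ord S) kE kE
  (size_outside S) (size_outside S) nn1 (fun i j _ _ => mM i j) chiP.
have g2 := bilinear_tail mZ indZ fY fX n0 t0 t1 nu0 p1 dl0 (fun _ h => h) (@avoid_ord S) kE kE
  (size_outside S) (size_outside S) nn1 (fun i j _ _ => mM j i) chiP.
have := pgood_and g1 g2; apply: pgood_imp; last by rewrite card_ord -/q; lra.
move=> w [h1 h2] f b f0 b0 hf hb.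
have sum2 (G : 'I_n -> 'I_n -> R) : (forall i j, 0 <= G i j) ->
    \sum_(j <- outside S) \sum_(i <- outside S) G i j <= \sum_j \sum_i G i j.
  move=> G0; apply: (@le_trans _ _ (\sum_(j <- outside S) \sum_i G i j)).
    by apply: ler_sum => j _; exact: sum_outside_le.
  by apply: sum_outside_le => j; apply: sumr_ge0.
have M0 i j : 0 <= M i j w ^+ 2 by exact: sqr_ge0.
have {}h1 := h1 f b f0 b0 (le_trans (sum2 _ M0) hf) (fun i j _ _ => hb i j).
have hf' : \sum_j \sum_i M j i w ^+ 2 <= f ^+ 2 by rewrite exchange_big.
have {}h2 := h2 f b f0 b0 (le_trans (sum2 (fun i j => M j i w ^+ 2) (fun i j => M0 j i)) hf')
  (fun i j _ _ => hb j i).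
pose U1 := \sum_(j <- outside S) (\sum_(i <- outside S) (if (i < j)%N then X i w * M i j w else 0)) * Y j w.
pose U2 := \sum_(j <- outside S) (\sum_(i <- outside S) (if (i < j)%N then Y i w * M j i w else 0)) * X j w.
rewrite -/U1 in h1; rewrite -/U2 in h2.
have -> : \sum_(j <- outside S) \sum_(i <- outside S) (if i == j then 0 else X i w * M i j w * Y j w) = U1 + U2.
  have -> : U2 = \sum_(j <- outside S) \sum_(i <- outside S) (if (j < i)%N then Y j w * M i j w else 0) * X i w.
    by rewrite /U2; under eq_bigr do rewrite mulr_suml; rewrite exchange_big.
  rewrite /U1 -big_split /=; apply: eq_bigr => j _.
  rewrite mulr_suml -big_split /=; apply: eq_bigr => i _.
  rewrite -val_eqE /=; case: ltngtP => _; rewrite ?mul0r ?addr0 ?add0r //.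
  by ring.
apply: le_trans (ler_normD _ _) _.
have -> : 2 * K ^+ 2 * (2 * (p / n%:R) * f + 4 * p ^+ 2 * tau * b) =
  K ^+ 2 * (2 * (p / n%:R) * f + 4 * p ^+ 2 * tau * b) + K ^+ 2 * (2 * (p / n%:R) * f + 4 * p ^+ 2 * tau * b) by ring.
exact: lerD.
Qed.

Variables (z : C) (c : R).
Hypotheses (zc : complex.Im z = c) (c0 : 0 < c) (c1 : c <= 1).

Let z0 : 0 < complex.Im z. Proof. by rewrite zc. Qed.

Definition res_row_eps := 4 * K * p * tau / c.
Definition qform_eps := 34 * K ^+ 2 * p ^+ 2 * tau / c.
Definition cross_eps := 2 * K * (rho * (2 / c) + p * tau * res_row_eps).

Let pt0 : 0 < p * tau. Proof. by rewrite mulr_gt0 // (lt_le_trans ltr01 p1). Qed.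

Lemma rho_le : rho <= p * tau.
Proof.
rewrite -(ger0_norm (ltW pt0)) -sqrtr_sqr ler_wsqrtr // exprMn mulrC.
apply: ler_pM => //; rewrite expr2 -{1}[p]mulr1; exact: ler_wpM2l.
Qed.

Lemma rhon : rho * Num.sqrt n%:R <= p.
Proof.
rewrite -sqrtrM ?mulr_ge0 //; have -> : n%:R^-1 * p * n%:R = p by field; rewrite gt_eqF.
rewrite -{2}(ger0_norm p0) -sqrtr_sqr ler_wsqrtr // expr2.
by rewrite -{1}[p]mulr1 ler_wpM2l.
Qed.

Lemma res_mE (S : {set 'I_n}) i j : cmE (avoid S) (fun w => res (mask S (A w)) z i j).
Proof. by apply: (@cmx_res _ _ _ (TE (avoid S)) A z S) => // i' j'; exact: mask_mE. Qed.

(** By symmetry of the resolvent the entry is a linear form in row j whose coefficients are a column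
    of the resolvent of the minor, independent of that row. *)
Lemma clause1 (S : {set 'I_n}) :
  pgood P (fun w => forall ji : I, ji.1 \in S -> md ((res (mask S (A w)) z *m al S (A w) ji.1) ji.2 0) <= res_row_eps)
    (n%:R ^+ 2 * (4 * q)).
Proof.
have -> : n%:R ^+ 2 = #|{: I}|%:R :> R by rewrite card_prod card_ord natrM expr2.
apply: pgood_all => -[j i] /=.
have [jS|jS] := boolP (j \in S); last first.
  by exists set0; split => //; rewrite measure0 lee_fin mulr_ge0.
have mv m : cmE (avoid S) (fun w => (res (mask S (A w)) z *m unit_col i) m 0).
  by under eq_fun do rewrite res_col; exact: res_mE.
have := lin_row jS (@avoid_ord S) (fun m _ => upair_Navoid m jS) mv.
apply: pgood_imp => // w h _.
have sM := mask_sym S (sA w).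
have c10 : 0 <= c^-1 by rewrite invr_ge0 ltW.
have -> : (res (mask S (A w)) z *m al S (A w) j) i 0 = dot (al S (A w) j) (res (mask S (A w)) z *m unit_col i).
  by rewrite dot_res // dotC dot_unit_col.
have n2c : n2 (res (mask S (A w)) z *m unit_col i) <= c^-1 ^+ 2.
  have := res_n2 (unit_col i) sM z0; rewrite zc n2_unit_col => h1.
  by rewrite exprVn -div1r ler_pdivlMr ?exprn_gt0 // mulrC.
apply: le_trans (h _ _ c10 c10 n2c _) _.
  by move=> m; rewrite res_col -zc; exact: md_res_le.
have -> : res_row_eps = 2 * K * (p * tau / c + p * tau / c) by rewrite /res_row_eps; ring.
apply: ler_wpM2l; first by rewrite mulr_ge0.
by rewrite lerD2r; apply: ler_wpM2r => //; exact: rho_le.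
Qed.

(** The padded trace also runs over S; its part there is the last term. What remains is a sum of
    centred squares and an off-diagonal form. *)
Lemma qform_split (S : {set 'I_n}) w k :
  qform (A w) z S k k - str S (A w) z =
  (\sum_(j <- outside S) res (mask S (A w)) z j j * (A w k j ^+ 2 - n%:R^-1)%:C%C +
   \sum_(j <- outside S) \sum_(i <- outside S) (if i == j then 0 else
     (A w k i)%:C%C * res (mask S (A w)) z i j * (A w k j)%:C%C)) -
  (\sum_(j in S) res (mask S (A w)) z j j) / n%:R.
Proof.
set G := res _ z.
have -> : qform (A w) z S k k = \sum_(j <- outside S) \sum_(i <- outside S) (A w k i)%:C%C * G i j * (A w k j)%:C%C.
  rewrite /qform /dot exchange_big /= sum_outside [in RHS]big_mkcond /=; apply: eq_bigr => i _.
  rewrite !mxE; case: (i \in S) => /=; first by rewrite mul0r.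
  rewrite mulr_sumr sum_outside [in RHS]big_mkcond /=; apply: eq_bigr => j _.
  by rewrite !mxE; case: (j \in S) => /=; rewrite ?mulr0 ?mulrA.
have -> : str S (A w) z = \sum_(j <- outside S) G j j / n%:R + (\sum_(j in S) G j j) / n%:R.
  rewrite /str /mxtrace -/G (bigID (mem S)) /= mulrDl addrC; congr (_ + _).
  by rewrite mulr_suml sum_outside.
rewrite opprD addrA; congr (_ - _); rewrite -sumrB -big_split /=.
rewrite !sum_outside; apply: eq_bigr => j jS; rewrite !sum_outside.
rewrite (bigD1 j) //= [in RHS](bigD1 j) //= eqxx add0r.
have -> : \sum_(i | (i \notin S) && (i != j)) (if i == j then 0 else (A w k i)%:C%C * G i j * (A w k j)%:C%C) =
   \sum_(i | (i \notin S) && (i != j)) (A w k i)%:C%C * G i j * (A w k j)%:C%C.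
  by apply: eq_bigr => i /andP[_ /negbTE ->].
rewrite addrAC; congr (_ + _).
rewrite rmorphB rmorphXn /= fmorphV rmorph_nat; ring.
Qed.

Lemma invn_sqrt : n%:R^-1 * Num.sqrt n%:R <= tau.
Proof.
have h1 : (n%:R^-1 * Num.sqrt n%:R) ^+ 2 <= tau ^+ 2.
  rewrite exprMn sqr_sqrtr ?ler0n //; apply: le_trans ntau.
  by rewrite expr2 -mulrA mulVf ?mulr1 // gt_eqF.
by rewrite -ler_sqr ?nnegrE ?(ltW t0) // mulr_ge0 ?sqrtr_ge0.
Qed.

Lemma res_col_n2 (S : {set 'I_n}) w j : \sum_i md (res (mask S (A w)) z i j) ^+ 2 <= c^-1 ^+ 2.
Proof.
have := res_n2 (unit_col j) (mask_sym S (sA w)) z0; rewrite zc n2_unit_col => h1.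
rewrite exprVn -div1r ler_pdivlMr ?exprn_gt0 // mulrC; apply: le_trans h1.
apply: ler_wpM2l; first exact: sqr_ge0.
by apply: ler_sum => i _; rewrite res_col.
Qed.

Lemma sum_cinv : \sum_(j < n) c^-1 ^+ 2 = (Num.sqrt n%:R / c) ^+ 2.
Proof.
rewrite sumr_const card_ord exprMn sqr_sqrtr; last exact: ler0n.
by rewrite -[LHS]mulr_natl.
Qed.

Lemma res_frob (S : {set 'I_n}) w : \sum_j \sum_i md (res (mask S (A w)) z i j) ^+ 2 <= (Num.sqrt n%:R / c) ^+ 2.
Proof.
apply: (@le_trans _ _ (\sum_(j < n) c^-1 ^+ 2)); first by apply: ler_sum => j _; exact: res_col_n2.
by rewrite sum_cinv.
Qed.

Lemma res_le (S : {set 'I_n}) w i j : md (res (mask S (A w)) z i j) <= c^-1.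
Proof. by rewrite -zc; apply: md_res_le => //; exact: mask_sym. Qed.

Let ci0 : 0 <= c^-1. Proof. by rewrite invr_ge0 ltW. Qed.

Lemma Re_sqr_le (x : C) : complex.Re x ^+ 2 <= md x ^+ 2 /\ complex.Im x ^+ 2 <= md x ^+ 2.
Proof. by rewrite md_sqr; split; rewrite ?lerDl ?lerDr sqr_ge0. Qed.

Lemma square_tail (S : {set 'I_n}) k (Y u : 'I_n -> T -> R) : k \in S ->
  family P ordp Z (outside S) (upair k) Y (2 * tau ^+ 2) (2 * tau ^+ 2 / n%:R) (nu * tau) ->
  (forall j, mE Z (avoid S) (u j)) ->
  pgood P (fun w => forall b, 0 <= b -> (forall j, `|u j w| <= b) ->
    `|\sum_(j <- outside S) u j w * Y j w| <= 4 * K * p * tau * b) (2 * q).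
Proof.
move=> kS fY mu.
have kE j : j \in outside S -> ~~ avoid S (upair k j) by move=> _; exact: upair_Navoid.
have t20 : 0 < 2 * tau ^+ 2 by rewrite mulr_gt0 // exprn_gt0.
have v20 : 0 <= 2 * tau ^+ 2 / n%:R by rewrite mulr_ge0 // ltW.
have nt0 : 0 <= nu * tau by rewrite mulr_ge0 // ltW.
have sz : nu * tau * (size (outside S))%:R <= 2 * tau ^+ 2.
  have h1 : nu * (size (outside S))%:R <= tau.
    by apply: nu_small; rewrite (leq_trans (size_outside S)) // -mulnn leq_pmulr.
  rewrite mulrAC; apply: (@le_trans _ _ (tau * tau)); first by apply: ler_wpM2r => //; exact: ltW.
  by rewrite -expr2 ler_peMl ?sqr_ge0 // ler1n.
have l1 := linear_tail mZ indZ fY t20 v20 nt0 p1 dl0 (@avoid_ord S) kE sz (fun j _ => mu j).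
apply: pgood_imp l1 => // w h b b0 ub.
apply: le_trans (h (Num.sqrt n%:R * b) b _ b0 _ _) _ => //.
- by rewrite mulr_ge0 // sqrtr_ge0.
- apply: le_trans (sum_outside_le _ (fun j => sqr_ge0 _)) _.
  apply: (@le_trans _ _ (\sum_(j < n) b ^+ 2)).
    by apply: ler_sum => j _; rewrite -real_normK ?num_real // lerXn2r ?nnegrE.
  by rewrite sumr_const card_ord -[leLHS]mulr_natl exprMn sqr_sqrtr ?ler0n.
rewrite -/K.
have s1 : Num.sqrt (2 * tau ^+ 2 / n%:R * p) <= 2 * tau * rho.
  have -> : 2 * tau * rho = Num.sqrt ((2 * tau) ^+ 2 * (n%:R^-1 * p)).
    by rewrite sqrtrM ?sqr_ge0 // sqrtr_sqr ger0_norm // mulr_ge0 // ltW.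
  apply: ler_wsqrtr; rewrite -mulrA exprMn; apply: ler_wpM2r; first exact: mulr_ge0.
  by apply: ler_wpM2r; [exact: sqr_ge0 | lra].
have s2 : 2 * tau * rho * (Num.sqrt n%:R * b) <= 2 * tau * p * b.
  have -> : 2 * tau * rho * (Num.sqrt n%:R * b) = 2 * tau * (rho * Num.sqrt n%:R) * b by ring.
  apply: ler_wpM2r => //; apply: ler_wpM2l; first by rewrite mulr_ge0 // ltW.
  exact: rhon.
have s3 : p * (2 * tau ^+ 2) * b <= 2 * tau * p * b.
  apply: ler_wpM2r => //; rewrite mulrC; apply: ler_wpM2r => //; apply: ler_wpM2l => //.
  by rewrite expr2 -[leRHS]mulr1; apply: ler_wpM2l => //; exact: ltW.
have -> : 4 * K * p * tau * b = K * (2 * tau * p * b + 2 * tau * p * b) by ring.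
apply: ler_wpM2l => //; apply: lerD => //; apply: le_trans s2.
by apply: ler_wpM2r => //; rewrite mulr_ge0 // sqrtr_ge0.
Qed.

(** The padded diagonal contributes at most |S| / (n c), whence the limit tau n on the number of
    removed rows. The factor 34 dominates the three contributions because K p >= 2. *)
Lemma clause2 (S : {set 'I_n}) : #|S|%:R <= tau * n%:R ->
  pgood P (fun w => forall k, k \in S -> md (qform (A w) z S k k - str S (A w) z) <= qform_eps)
    (n%:R * ((8 * n%:R + 12) * q)).
Proof.
move=> hS; rewrite -[X in X%:R * _]card_ord; apply: pgood_all => k.
have [kS|kS] := boolP (k \in S); last first.
  by exists set0; split => //; rewrite measure0 lee_fin mulr_ge0 // addr_ge0 // mulr_ge0.
have mG i j := res_mE S i j.
have d1 := square_tail kS (family_sq kS) (fun j => (mG j j).1).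
have d2 := square_tail kS (family_sq kS) (fun j => (mG j j).2).
have o1 := offdiag_tail kS (family_row kS) (family_row kS) (fun i j => (mG i j).1).
have o2 := offdiag_tail kS (family_row kS) (family_row kS) (fun i j => (mG i j).2).
have := pgood_and (pgood_and d1 d2) (pgood_and o1 o2).
apply: pgood_imp; last by lra.
move=> w [[h1 h2] [h3 h4]] _.
have {}h1 := h1 _ ci0 (fun j => le_trans (Re_le_md _) (res_le S w j j)).
have {}h2 := h2 _ ci0 (fun j => le_trans (Im_le_md _) (res_le S w j j)).
have f0 : 0 <= Num.sqrt n%:R / c by rewrite mulr_ge0 // sqrtr_ge0.
have fr1 : \sum_j \sum_i complex.Re (res (mask S (A w)) z i j) ^+ 2 <= (Num.sqrt n%:R / c) ^+ 2.
  apply: le_trans (res_frob S w); apply: ler_sum => j _; apply: ler_sum => i _; exact: (Re_sqr_le _).1.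
have fr2 : \sum_j \sum_i complex.Im (res (mask S (A w)) z i j) ^+ 2 <= (Num.sqrt n%:R / c) ^+ 2.
  apply: le_trans (res_frob S w); apply: ler_sum => j _; apply: ler_sum => i _; exact: (Re_sqr_le _).2.
have {}h3 := h3 _ _ f0 ci0 fr1
  (fun i j => le_trans (Re_le_md _) (res_le S w i j)).
have {}h4 := h4 _ _ f0 ci0 fr2
  (fun i j => le_trans (Im_le_md _) (res_le S w i j)).
rewrite qform_split.
set G := res _ z in h1 h2 h3 h4 *.
pose D1 := \sum_(j <- outside S) G j j * (A w k j ^+ 2 - n%:R^-1)%:C%C.
pose O1 := \sum_(j <- outside S) \sum_(i <- outside S) (if i == j then 0 else (A w k i)%:C%C * G i j * (A w k j)%:C%C).
pose S1 := \sum_(j in S) G j j.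
rewrite -/D1 -/O1 -/S1.
have Y := p1.
have hD : md D1 <= 8 * K * p * tau / c.
  apply: le_trans (md_le_ReIm _) _; rewrite /D1 Re_sum Im_sum.
  have -> : 8 * K * p * tau / c = 4 * K * p * tau / c + 4 * K * p * tau / c by ring.
  apply: lerD; [move: h1 | move: h2]; apply: le_trans; rewrite le_eqVlt; apply/orP; left; apply/eqP;
    congr (`| _ |); apply: eq_bigr => j _; by rewrite mulrC ?ReMr ?ImMr mulrC.
have bO : 2 * K ^+ 2 * (2 * (p / n%:R) * (Num.sqrt n%:R / c) + 4 * p ^+ 2 * tau / c) <= 12 * K ^+ 2 * p ^+ 2 * tau / c.
  have -> : 2 * (p / n%:R) * (Num.sqrt n%:R / c) = 2 * p * (n%:R^-1 * Num.sqrt n%:R) / c by ring.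
  have b1 : 2 * p * (n%:R^-1 * Num.sqrt n%:R) / c <= 2 * p ^+ 2 * tau / c.
    apply: ler_wpM2r => //; rewrite expr2 mulrA -!mulrA; apply: ler_wpM2l => //; apply: ler_wpM2l => //.
    apply: (@le_trans _ _ tau); first exact: invn_sqrt.
    by rewrite ler_peMl // ltW.
  have -> : 12 * K ^+ 2 * p ^+ 2 * tau / c = 2 * K ^+ 2 * (2 * p ^+ 2 * tau / c + 4 * p ^+ 2 * tau / c) by ring.
  apply: ler_wpM2l; first by rewrite mulr_ge0 // sqr_ge0.
  by rewrite lerD2r.
have hO : md O1 <= 24 * K ^+ 2 * p ^+ 2 * tau / c.
  apply: le_trans (md_le_ReIm _) _; rewrite /O1 Re_sum Im_sum.
  have -> : 24 * K ^+ 2 * p ^+ 2 * tau / c = 12 * K ^+ 2 * p ^+ 2 * tau / c + 12 * K ^+ 2 * p ^+ 2 * tau / c by ring.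
  apply: lerD; apply: le_trans bO; [move: h3 | move: h4]; apply: le_trans; rewrite le_eqVlt; apply/orP; left; apply/eqP;
    congr (`| _ |); apply: eq_bigr => j _; rewrite ?Re_sum ?Im_sum; apply: eq_bigr => i _; case: (i == j) => //.
    by rewrite mulrC ReMr ReMr; ring.
  by rewrite mulrC ImMr ImMr; ring.
have hS1 : md (S1 / n%:R) <= tau / c.
  rewrite [md (S1 / _)]mdM mdV md_nat ler_pdivrMr //.
  apply: le_trans (md_sum _ _ _) _.
  apply: (@le_trans _ _ (\sum_(j in S) c^-1)); first by apply: ler_sum => j _; exact: res_le.
  rewrite sumr_const -[leLHS]mulr_natl [leRHS]mulrAC; exact: ler_wpM2r.
apply: le_trans (mdB _ _) _; apply: le_trans (lerD (mdD _ _) (lexx _)) _.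
apply: le_trans (lerD (lerD hD hO) hS1) _; rewrite /qform_eps.
have -> : 8 * K * p * tau / c + 24 * K ^+ 2 * p ^+ 2 * tau / c + tau / c =
  (8 * (K * p) + 24 * (K * p) ^+ 2 + 1) * (tau / c) by ring.
have -> : 34 * K ^+ 2 * p ^+ 2 * tau / c = 34 * (K * p) ^+ 2 * (tau / c) by ring.
apply: ler_wpM2r; first by rewrite mulr_ge0 // ltW.
have Kp : 2 <= K * p by rewrite -[leLHS]mulr1; apply: ler_pM.
have : 2 * (K * p) <= (K * p) ^+ 2 by rewrite expr2; apply: ler_wpM2r => //; exact: mulr_ge0.
by move: Kp; set x := K * p; move=> h5 h6; lra.
Qed.

Lemma md_str (S : {set 'I_n}) w : md (str S (A w) z) <= c^-1.
Proof.
rewrite /str [md (_ / _)]mdM mdV md_nat ler_pdivrMr //.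
apply: le_trans (md_sum _ _ _) _.
apply: (@le_trans _ _ (\sum_(j < n) c^-1)); first by apply: ler_sum => j _; exact: res_le.
by rewrite sumr_const card_ord -[leLHS]mulr_natr.
Qed.

(** For k other than j this is a linear form in row k with coefficients v = G a_j, determined by the
    minor and row j. Its norm is not bounded a priori: the Ward identity gives c |v|^2 = Im (a_j . G
    a_j), and the second clause bounds the right side by 2 / c. The first two clauses are therefore
    premises inside the event. *)
Lemma clause3 (S : {set 'I_n}) : 34 * K ^+ 2 * p ^+ 2 * tau <= 1 ->
  pgood P (fun w => (forall ji : I, ji.1 \in S -> md ((res (mask S (A w)) z *m al S (A w) ji.1) ji.2 0) <= res_row_eps) ->
    (forall k, k \in S -> md (qform (A w) z S k k - str S (A w) z) <= qform_eps) ->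
    forall kj : I, kj.1 \in S -> kj.2 \in S -> kj.1 != kj.2 -> md (qform (A w) z S kj.1 kj.2) <= cross_eps)
    (n%:R ^+ 2 * (4 * q)).
Proof.
move=> small.
have e31 : qform_eps <= c^-1 by rewrite /qform_eps ler_pdivrMr // mulVf // gt_eqF.
suff : pgood P (fun w => forall kj : I, (forall ji : I, ji.1 \in S -> md ((res (mask S (A w)) z *m al S (A w) ji.1) ji.2 0) <= res_row_eps) ->
    (forall k, k \in S -> md (qform (A w) z S k k - str S (A w) z) <= qform_eps) ->
    kj.1 \in S -> kj.2 \in S -> kj.1 != kj.2 -> md (qform (A w) z S kj.1 kj.2) <= cross_eps)
    (n%:R ^+ 2 * (4 * q)).
  by apply: pgood_imp => // w h h1 h2 kj; exact: h.
have -> : n%:R ^+ 2 = #|{: I}|%:R :> R by rewrite card_prod card_ord natrM expr2.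
apply: pgood_all => -[k j] /=.
have [/and3P[kS jS kj]|no] := boolP [&& k \in S, j \in S & k != j]; last first.
  exists set0; split => //; first by rewrite measure0 lee_fin mulr_ge0.
  by move=> w _ _ _ kS jS kj; move: no; rewrite kS jS kj.
pose E := addE (avoid S) (map (upair j) (outside S)).
have ED e : E e -> ordp e.
  by move=> /orP[/avoid_ord //|/mapP[m _ ->]]; exact: upair_ord.
have Ek m : m \notin S -> ~~ E (upair k m).
  move=> mS; rewrite /E /addE negb_or upair_Navoid //=; apply/mapP => -[m'].
  rewrite mem_outside => m'S /(upair_inj kS jS mS m'S) [kj' _].
  by rewrite kj' eqxx in kj.
have mv m : cmE E (fun w => (res (mask S (A w)) z *m al S (A w) j) m 0).
  have cE : (forall i, avoid S i -> E i) by move=> i; rewrite /E /addE => ->.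
  apply: (@cmx_mul _ _ (TE E) _ _ _ (fun w => res (mask S (A w)) z) (fun w => al S (A w) j)).
    by move=> a b; apply: cmE_sub cE _; exact: res_mE.
  move=> a b; under eq_fun do rewrite mxE.
  have [_|aS] := boolP (a \in S); first exact: cm_cst.
  apply: cm_real; apply: A_mE; apply/orP; right; apply: map_f.
  by rewrite mem_outside.
have := lin_row kS ED Ek mv; apply: pgood_imp => // w h h1 h2 _ _ _.
have sM := mask_sym S (sA w).
have c20 : 0 <= 2 / c by rewrite mulr_ge0.
have e20 : 0 <= res_row_eps.
  by apply: mulr_ge0 => //; apply: mulr_ge0; [apply: mulr_ge0 => //; exact: mulr_ge0 | exact: ltW].
apply: h => //; last by move=> i; exact: (h1 (j, i) jS).
have hj := h2 j jS.
have w1 := ward sM z0 (real_al S (A w) j); rewrite -/(qform (A w) z S j j) zc in w1.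
have q2 : md (qform (A w) z S j j) <= 2 / c.
  have -> : qform (A w) z S j j = (qform (A w) z S j j - str S (A w) z) + str S (A w) z by rewrite subrK.
  apply: le_trans (mdD _ _) _; have h3 := md_str S w.
  have -> : 2 / c = c^-1 + c^-1 by ring.
  by apply: lerD => //; exact: le_trans e31.
have q3 : c * n2 (res (mask S (A w)) z *m al S (A w) j) <= 2 / c.
  by rewrite -w1; apply: le_trans q2; apply: le_trans (Im_le_md _); exact: ler_norm.
rewrite -(ler_pM2l c0); apply: (le_trans q3).
have -> : c * (2 / c) ^+ 2 = 2 * (2 / c) by field; rewrite gt_eqF.
by rewrite ler_peMl // ler1n.
Qed.

Definition kp := 2 * K * p.

Lemma kp_bound a b : 0 <= a -> 0 <= b -> 2 * K * (rho * (Num.sqrt n%:R * a) + p * tau * b) <= kp * (a + tau * b).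
Proof.
move=> a0 b0; have -> : kp * (a + tau * b) = 2 * K * (p * a + p * tau * b) by rewrite /kp; ring.
apply: ler_wpM2l; first by rewrite mulr_ge0.
by rewrite lerD2r mulrA; apply: ler_wpM2r => //; exact: rhon.
Qed.

Lemma uvec_mE (S : {set 'I_n}) i : cmE (avoid S) (fun w => uvec (A w) z S i 0).
Proof. by apply: (@cmx_uvec _ _ _ (TE (avoid S)) A z S) => // i' j'; exact: mask_mE. Qed.

Lemma clause4 (S : {set 'I_n}) :
  pgood P (fun w => forall k, k \in S -> forall a b : R, 0 <= a -> 0 <= b ->
    n2 (uvec (A w) z S) <= n%:R * a ^+ 2 -> (forall i, md (uvec (A w) z S i 0) <= b) ->
    md (dot (al S (A w) k) (uvec (A w) z S)) <= kp * (a + tau * b)) (n%:R * (4 * q)).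
Proof.
rewrite -[X in X%:R * _]card_ord; apply: pgood_all => k.
have [kS|kS] := boolP (k \in S); last first.
  by exists set0; split => //; rewrite measure0 lee_fin mulr_ge0.
have := lin_row kS (@avoid_ord S) (fun m _ => upair_Navoid m kS) (uvec_mE S).
apply: pgood_imp => // w h _ a b a0 b0 ha hb.
apply: le_trans (kp_bound a0 b0); apply: h => //; first by rewrite mulr_ge0 // sqrtr_ge0.
by rewrite exprMn sqr_sqrtr // ler0n.
Qed.

Lemma sum_cross (V : nmodType) S (f : I -> V) : \sum_(e <- cross S) f e = \sum_(k in S) \sum_(j | j \notin S) f (k, j).
Proof.
rewrite big_filter big_enum_cond /= (eq_bigl (fun e : I => (e.1 \in S) && (e.2 \notin S))) //.
by rewrite pair_big /=; apply: eq_bigr => -[].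
Qed.

(** The rows of S are paired with one vector u, so their sum is a single linear form in the
    independent entries with exactly one index in S, with coefficient norm at most sqrt bn times
    that of u. The list can have up to n^2 entries, which is why nu n^2 has to be small. *)
Lemma clauseB (S : {set 'I_n}) (bn : nat) : (#|S| <= bn)%N ->
  pgood P (fun w => forall a b : R, 0 <= a -> 0 <= b ->
    n2 (uvec (A w) z S) <= n%:R * a ^+ 2 -> (forall i, md (uvec (A w) z S i 0) <= b) ->
    md (\sum_(k in S) dot (al S (A w) k) (uvec (A w) z S)) <= kp * (Num.sqrt bn%:R * a + tau * b)) (4 * q).
Proof.
move=> hS.
have kE e : e \in cross S -> ~~ avoid S (upair e.1 e.2).
  by rewrite mem_filter => /andP[/andP[h _] _]; exact: upair_Navoid.
have sz : nu * (size (cross S))%:R <= tau.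
  apply: nu_small; rewrite size_filter (leq_trans (count_size _ _)) // -cardE card_prod card_ord mulnn.
  exact: leqnn.
have mu := uvec_mE S.
have l1 := linear_tail mZ indZ (family_cross S) t0 v0 nu0 p1 dl0 (@avoid_ord S) kE sz (fun e _ => (mu e.2).1).
have l2 := linear_tail mZ indZ (family_cross S) t0 v0 nu0 p1 dl0 (@avoid_ord S) kE sz (fun e _ => (mu e.2).2).
have := pgood_and l1 l2; apply: pgood_imp; last by rewrite -/q; lra.
move=> w [h1 h2] a b a0 b0 ha hb.
set u := uvec (A w) z S in h1 h2 ha hb *.
pose a' := Num.sqrt n%:R * (Num.sqrt bn%:R * a).
have a'0 : 0 <= a' by rewrite mulr_ge0 ?sqrtr_ge0 // mulr_ge0 ?sqrtr_ge0.
have a'2 : a' ^+ 2 = bn%:R * (n%:R * a ^+ 2).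
  by rewrite /a' !exprMn !sqr_sqrtr ?ler0n //; ring.
have sumle (f : 'I_n -> R) : (forall j, 0 <= f j) -> \sum_j f j <= n2 u -> \sum_(e <- cross S) f e.2 <= a' ^+ 2.
  move=> f0 fu; rewrite (sum_cross S (fun e => f e.2)) /= sumr_const -[leLHS]mulr_natl a'2; apply: ler_pM => //.
  - exact: sumr_ge0.
  - by rewrite ler_nat.
  - by apply: le_trans ha; apply: le_trans fu; rewrite -sum_outside; exact: sum_outside_le.
have [r1 r2] := n2_Re u.
have eR : complex.Re (\sum_(k in S) dot (al S (A w) k) u) = \sum_(e <- cross S) complex.Re (u e.2 0) * A w e.1 e.2.
  rewrite Re_sum (sum_cross S (fun e => complex.Re (u e.2 0) * A w e.1 e.2)); apply: eq_bigr => k _.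
  by rewrite (Re_dot_al S w k u).1 sum_outside.
have eI : complex.Im (\sum_(k in S) dot (al S (A w) k) u) = \sum_(e <- cross S) complex.Im (u e.2 0) * A w e.1 e.2.
  rewrite Im_sum (sum_cross S (fun e => complex.Im (u e.2 0) * A w e.1 e.2)); apply: eq_bigr => k _.
  by rewrite (Re_dot_al S w k u).2 sum_outside.
have sb0 : 0 <= Num.sqrt bn%:R * a by rewrite mulr_ge0 ?sqrtr_ge0.
apply: le_trans (kp_bound sb0 b0); rewrite -/a'.
apply: le_trans (md_le_ReIm _) _; rewrite eR eI.
have -> : 2 * K * (rho * a' + p * tau * b) = K * (rho * a' + p * tau * b) + K * (rho * a' + p * tau * b) by ring.
apply: lerD; [apply: h1 | apply: h2] => //.
- by apply: (sumle (fun j => complex.Re (u j 0) ^+ 2)) => // j; exact: sqr_ge0.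
- by move=> e _; apply: le_trans (Re_le_md _) _.
- by apply: (sumle (fun j => complex.Im (u j 0) ^+ 2)) => // j; exact: sqr_ge0.
- by move=> e _; apply: le_trans (Im_le_md _) _.
Qed.

Lemma minor_random (S : {set 'I_n}) (bn : nat) : (#|S| <= bn)%N -> bn%:R <= tau * n%:R ->
  34 * K ^+ 2 * p ^+ 2 * tau <= 1 ->
  pgood P (fun w => minor_ctrl (A w) z tau res_row_eps qform_eps cross_eps kp S /\
    forall a b : R, 0 <= a -> 0 <= b ->
    n2 (uvec (A w) z S) <= n%:R * a ^+ 2 -> (forall i, md (uvec (A w) z S i 0) <= b) ->
    md (\sum_(k in S) dot (al S (A w) k) (uvec (A w) z S)) <= kp * (Num.sqrt bn%:R * a + tau * b))
  (36 * n%:R ^+ 2 * q).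
Proof.
move=> hS hb small.
have hS' : #|S|%:R <= tau * n%:R by apply: le_trans hb; rewrite ler_nat.
have := pgood_and (pgood_and (pgood_and (clause1 S) (clause2 hS')) (pgood_and (clause3 S small) (clause4 S))) (clauseB hS).
apply: pgood_imp.
  move=> w [[[h1 h2] [h3 h4]] h5]; split => //; split => //.
  - by move=> j i; exact: (h1 (j, i)).
  - by move=> k j kS jS kj; exact: (h3 h1 h2 (k, j)).
have n2n : n%:R * 1 <= n%:R * n%:R :> R by apply: ler_wpM2l.
rewrite expr2; set x := n%:R * n%:R in n2n *; rewrite mulr1 in n2n.
have n1' := n1.
have -> : x * (4 * q) + n%:R * ((8 * n%:R + 12) * q) + (x * (4 * q) + n%:R * (4 * q)) + 4 * q =
  (16 * x + 16 * n%:R + 4) * q by rewrite /x; ring.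
by apply: ler_wpM2r => //; lra.
Qed.

End RandomInputs.

(** * Bilinear forms in one row of each matrix *)

Section CrossInputs.
Context {d : measure_display} {T : measurableType d} {R : realType} (P : probability T R) {n N : nat}.
Local Notation C := R[i].
Local Notation I := ('I_n * 'I_n)%type.
Context (Z : I -> T -> R * R).
Local Open Scope classical_set_scope.
Variables (A B : T -> 'M[R]_n) (tau nu p dl L c : R).
Hypothesis mZ : forall i, measurable_fun setT (Z i).
Hypothesis indZ : forall S : I -> set (R * R), (forall i, measurable (S i)) ->
  fine (P (\bigcap_(i in [set i | ordp i]) (Z i @^-1` S i))) = \prod_(i | ordp i) fine (P (Z i @^-1` S i)).
Hypotheses (sA : forall w, (A w)^T = A w) (sB : forall w, (B w)^T = B w).
Hypothesis AZ : forall i j, exists2 h, measurable_fun setT h & forall w, A w i j = h (Z (upair i j) w).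
Hypothesis BZ : forall i j, exists2 h, measurable_fun setT h & forall w, B w i j = h (Z (upair i j) w).
Hypotheses (Atau : forall w i j, `|A w i j| <= tau) (Btau : forall w i j, `|B w i j| <= tau).
Hypothesis EA : forall i j, i != j -> `|Ex P (fun w => A w i j)| <= nu.
Hypothesis EB : forall i j, i != j -> `|Ex P (fun w => B w i j)| <= nu.
Hypothesis EA2 : forall i j, i != j -> Ex P (fun w => A w i j ^+ 2) <= n%:R^-1.
Hypothesis EB2 : forall i j, i != j -> Ex P (fun w => B w i j ^+ 2) <= n%:R^-1.
Hypotheses (n0 : (0 < n)%N) (t0 : 0 < tau) (t1 : tau <= 1) (nu0 : 0 <= nu) (p1 : 1 <= p) (dl0 : 0 <= dl).
Hypothesis nut : nu * n%:R ^+ 2 <= tau.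
Hypothesis ntau : n%:R^-1 <= tau ^+ 2.
Hypothesis c0 : 0 < c.

Local Notation TE E := (g_sigma_algebraType (cyl Z E)).

(** The model says nothing about the covariance on the diagonal. The index j = k lies in the removed
    set, where M vanishes, so the value is free there, and 1 / n makes its deviation from 1 / n
    equal to 0. *)
Definition ecov k j : R := if k == j then n%:R^-1 else Ex P (fun w => A w k j * B w k j).

Let K := 2 * (dl + 1).
Let q := expR (- (dl * p)).
Let q0 : 0 <= q. Proof. exact: expR_ge0. Qed.
Let p0 : 0 <= p. Proof. exact: le_trans p1. Qed.
Let K0 : 0 <= K. Proof. by rewrite /K mulr_ge0 // addr_ge0. Qed.

Lemma bdmAB k j : bdm (fun w => A w k j * B w k j).
Proof. by apply: bdmM; [exact: (bdmA mZ AZ Atau k j) | exact: (bdmA mZ BZ Btau k j)]. Qed.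

Lemma family_ab (S : {set 'I_n}) k : k \in S ->
  family P ordp Z (outside S) (upair k) (fun j w => A w k j * B w k j - ecov k j)
    (2 * tau ^+ 2) (2 * tau ^+ 2 / n%:R) (nu * tau).
Proof.
move=> kS.
have AB w j : `|A w k j * B w k j| <= tau ^+ 2 by rewrite normrM expr2 ler_pM.
have kj j : j \in outside S -> ecov k j = Ex P (fun w => A w k j * B w k j) /\ k != j.
  rewrite mem_outside => jS; have h : k != j by apply: contraNneq jS => <-.
  by rewrite /ecov (negbTE h).
have Ele j : `|Ex P (fun w => A w k j * B w k j)| <= tau ^+ 2.
  rewrite ler_norml; apply/andP; split.
    rewrite -(Ex_cst P (- tau ^+ 2)); apply: Ex_le; [exact: bdm_cst|exact: bdmAB|].
    by move=> w; have [] := norm_le_split (AB w j).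
  rewrite -(Ex_cst P (tau ^+ 2)); apply: Ex_le; [exact: bdmAB|exact: bdm_cst|].
  by move=> w; have [] := norm_le_split (AB w j).
have bc (x : R) : bdm (fun _ : T => x) by exact: bdm_cst.
have bAB := bdmAB k.
split.
- move=> j _; have [h mh hE] := AZ k j; have [g mg gE] := BZ k j.
  exists (fun x => h x * g x - ecov k j); last by move=> w; rewrite hE gE.
  by apply: measurable_funB => //; exact: measurable_funM.
- by move=> j _; exact: upair_ord.
- exact: uniq_row.
- move=> j w /kj [-> _]; apply: le_trans (ler_normB _ _) _.
  have -> : 2 * tau ^+ 2 = tau ^+ 2 + tau ^+ 2 by ring.
  exact: lerD.
- move=> j /kj [-> _]; rewrite ExD // Ex_cst subrr normr0.
  by rewrite mulr_ge0 // ltW.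
- move=> j /kj [-> kj']; set m := Ex P (fun w => A w k j * B w k j).
  have e1 : Ex P (fun w => (A w k j * B w k j - m) ^+ 2) = Ex P (fun w => (A w k j * B w k j) ^+ 2) - m ^+ 2.
    have -> : (fun w => (A w k j * B w k j - m) ^+ 2) = (fun w => (A w k j * B w k j) ^+ 2 + ((- (2 * m)) * (A w k j * B w k j) + m ^+ 2)).
      by apply/funext => w; ring.
    rewrite ExD //; [|exact: bdm_sqr|by apply: bdmD => //; exact: bdmZ].
    rewrite ExD //; last exact: bdmZ.
    by rewrite ExZ // Ex_cst -/m; ring.
  rewrite e1; apply: (@le_trans _ _ (Ex P (fun w => tau ^+ 2 * A w k j ^+ 2))).
    apply: (@le_trans _ _ (Ex P (fun w => (A w k j * B w k j) ^+ 2))); first by rewrite lerBlDr lerDl sqr_ge0.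
    apply: Ex_le; [exact: bdm_sqr | by apply: bdmZ; apply: bdm_sqr; exact: (bdmA mZ AZ Atau k j)|].
    move=> w; rewrite exprMn mulrC; apply: ler_wpM2r; first exact: sqr_ge0.
    by rewrite -real_normK ?num_real // lerXn2r ?nnegrE // ltW.
  rewrite ExZ; last by apply: bdm_sqr; exact: (bdmA mZ AZ Atau k j).
  apply: (@le_trans _ _ (tau ^+ 2 / n%:R)).
    by apply: ler_wpM2l; [exact: sqr_ge0 | exact: EA2].
  by rewrite -mulrA ler_peMl ?ler1n // mulr_ge0 ?sqr_ge0 // invr_ge0 ler0n.
Qed.

Lemma sum_al (S : {set 'I_n}) w k l (M : 'I_n -> 'I_n -> R) :
  \sum_i \sum_j complex.Re (al S (A w) k i 0) * complex.Re (al S (B w) l j 0) * M i j =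
  \sum_(j <- outside S) \sum_(i <- outside S) A w k i * M i j * B w l j.
Proof.
rewrite exchange_big /= sum_outside [in RHS]big_mkcond /=; apply: eq_bigr => j _.
have [jS|jS] := boolP (j \in S).
  by apply: big1 => i _; rewrite [al S (B w) l j 0]mxE jS /= mulr0 mul0r.
rewrite sum_outside [in RHS]big_mkcond /=; apply: eq_bigr => i _; rewrite !mxE (negbTE jS).
by case: (i \in S) => /=; rewrite ?mul0r // mulrAC.
Qed.

Lemma Mkl_mE k l i j : mE Z (avoid [set k; l]%SET) (fun w => complex.Re (Mkl (N := N) (A w) (B w) L c k l i j)).
Proof.
set S := [set k; l]%SET; set E := avoid S.
suff h : cmE Z E (fun w => Mkl (N := N) (A w) (B w) L c k l i j) by exact: h.1.
have mST (D : T -> 'M[R]_n) t : (forall w, (D w)^T = D w) ->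
   (forall i j, exists2 h, measurable_fun setT h & forall w, D w i j = h (Z (upair i j) w)) ->
   cmE Z E (fun w => ST (D w) (zpt L c (t : 'I_N)) S).
  move=> sD DZ; apply: (@cmN _ _ (TE E)); apply: cmV; apply: cmD; first exact: cm_cst.
  by apply: (@cm_str _ _ _ (TE E)) => // a b; exact: (mask_mE DZ a b).
apply: (@cm_sum _ _ (TE E)) => t; apply: cmM; first (apply: cmM; first exact: cm_cst).
  apply: cmM; first exact: (mST A t sA AZ).
  by apply: cm_conj; exact: (mST B t sB BZ).
apply: cmM; first exact: (uvec_mE sA AZ (erefl : complex.Im (zpt L c t) = c) c0).
by apply: cm_conj; exact: (uvec_mE sB BZ (erefl : complex.Im (zpt L c t) = c) c0).
Qed.

Definition Qb (f b : R) : R := 2 * K ^+ 2 * (2 * (p / n%:R) * f + 4 * p ^+ 2 * tau * b) + 4 * K * p * tau * b.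

(** For k = l the products a_kj b_kj share a coordinate and are centred by [ecov], while the
    off-diagonal products are split by order. For k and l distinct, row k of A is revealed entirely
    before row l of B, and nothing has to be split or centred. *)
Lemma quad_tail k l (M : 'I_n -> 'I_n -> T -> R) (S := [set k; l]%SET) :
  (forall i j, mE Z (avoid S) (M i j)) ->
  (forall i j w, j \in S -> M i j w = 0) ->
  pgood P (fun w => forall f b, 0 <= f -> 0 <= b -> \sum_j \sum_i M i j w ^+ 2 <= f ^+ 2 ->
    (forall i j, `|M i j w| <= b) ->
    `|\sum_i \sum_j complex.Re (al S (A w) k i 0) * complex.Re (al S (B w) l j 0) * M i j w -
      (if k == l then \sum_j M j j w * ecov k j else 0)| <= Qb f b) ((4 * n%:R + 6) * q).
Proof.
move=> mM M0.
have kS : k \in S by rewrite !inE eqxx.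
have lS : l \in S by rewrite !inE eqxx orbT.
have fA := family_row AZ Atau EA EA2 kS; have fB := family_row BZ Btau EB EB2 lS.
have Q1 f b : 0 <= f -> 0 <= b -> 0 <= 2 * (p / n%:R) * f + 4 * p ^+ 2 * tau * b.
  move=> f0 b0; apply: addr_ge0; apply: mulr_ge0 => //.
    by apply: mulr_ge0 => //; rewrite divr_ge0.
  by apply: mulr_ge0; [rewrite mulr_ge0 // sqr_ge0 | exact: ltW].
have Q2 b : 0 <= b -> 0 <= 4 * K * p * tau * b.
  by move=> b0; rewrite mulr_ge0 // mulr_ge0 ?(ltW t0) // mulr_ge0 // mulr_ge0.
have [kl|kl] := eqVneq k l.
  rewrite -kl in fB.
  have g1 := offdiag_tail mZ indZ n0 t0 t1 nu0 p1 dl0 nut kS fA fB mM.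
  have g2 := square_tail mZ indZ n0 t0 t1 nu0 p1 dl0 nut kS (family_ab kS) (fun j => mM j j).
  have := pgood_and g1 g2; apply: pgood_imp; last by rewrite -/q; lra.
  move=> w [h1 h2] f b f0 b0 hf hb; rewrite sum_al.
  have {}h1 := h1 f b f0 b0 hf hb; have {}h2 := h2 b b0 (fun j => hb j j).
  apply: le_trans (lerD h1 h2); apply: le_trans _ (ler_normD _ _).
  rewrite le_eqVlt; apply/orP; left; apply/eqP; congr `| _ |.
  have -> : \sum_j M j j w * ecov k j = \sum_(j <- outside S) M j j w * ecov k j.
    rewrite sum_outside [in RHS]big_mkcond; apply: eq_bigr => j _.
    by case: ifPn => //; rewrite negbK => jS; rewrite M0 // mul0r.
  rewrite -sumrB -big_split /= !sum_outside; apply: eq_bigr => j jS.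
  rewrite !sum_outside (bigD1 j) //= [X in _ = X + _](bigD1 j) //= eqxx add0r -kl.
  have -> : \sum_(i | (i \notin S) && (i != j)) (if i == j then 0 else A w k i * M i j w * B w k j) =
     \sum_(i | (i \notin S) && (i != j)) A w k i * M i j w * B w k j.
    by apply: eq_bigr => i /andP[_ /negbTE ->].
  by ring.
pose E1 := addE (avoid S) (map (upair k) (outside S)).
have EE1 e : avoid S e -> E1 e by rewrite /E1 /addE => ->.
have ED1 e : E1 e -> ordp e by move=> /orP[/avoid_ord //|/mapP[m _ ->]]; exact: upair_ord.
have kE j : j \in outside S -> ~~ avoid S (upair k j) by move=> _; exact: upair_Navoid.
have lE j : j \in outside S -> ~~ E1 (upair l j).
  rewrite mem_outside => jS; rewrite /E1 /addE negb_or upair_Navoid //=; apply/mapP => -[m'].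
  rewrite mem_outside => m'S /(upair_inj lS kS jS m'S) [lk _].
  by rewrite lk eqxx in kl.
have nn1 : nu * n%:R <= tau.
  by apply: le_trans nut; apply: ler_wpM2l => //; rewrite -natrX ler_nat -mulnn leq_pmulr.
have chiP l1 j l2 i : outside S = l1 ++ j :: l2 -> i \in outside S -> true ->
    addE E1 (map (upair l) l1) (upair k i).
  by move=> _ iS _; apply/orP; left; apply/orP; right; exact: map_f.
have := bilinear_tail mZ indZ fA fB n0 t0 t1 nu0 p1 dl0 EE1 ED1 kE lE (size_outside S) (size_outside S) nn1
  (fun i j _ _ => mM i j) (chi := fun _ _ => true) chiP.
apply: pgood_imp; last first.
  by rewrite card_ord -/q; apply: ler_wpM2r => //; have : 0 <= n%:R :> R by []; lra.
move=> w h f b f0 b0 hf hb; rewrite sum_al subr0.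
have hf' : \sum_(j <- outside S) \sum_(i <- outside S) M i j w ^+ 2 <= f ^+ 2.
  apply: le_trans hf; apply: (@le_trans _ _ (\sum_(j <- outside S) \sum_i M i j w ^+ 2)).
    by apply: ler_sum => j _; apply: sum_outside_le => i; exact: sqr_ge0.
  by apply: sum_outside_le => j; apply: sumr_ge0 => i _; exact: sqr_ge0.
have {}h := h f b f0 b0 hf' (fun i j _ _ => hb i j).
have -> : \sum_(j <- outside S) \sum_(i <- outside S) A w k i * M i j w * B w l j =
  \sum_(j <- outside S) (\sum_(i <- outside S) A w k i * M i j w) * B w l j.
  by apply: eq_bigr => j _; rewrite mulr_suml.
apply: (le_trans h); rewrite /Qb -/K.
have h1 := Q1 f b f0 b0; have h2 := Q2 b b0.
have h3 : 0 <= K ^+ 2 * (2 * (p / n%:R) * f + 4 * p ^+ 2 * tau * b) by rewrite mulr_ge0 // sqr_ge0.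
by rewrite -mulrA; lra.
Qed.

Lemma Mkl_mask0 k l i j w : j \in [set k; l]%SET -> complex.Re (Mkl (N := N) (A w) (B w) L c k l i j) = 0.
Proof.
move=> jS; rewrite /Mkl /Mmat big1 // => t _.
by rewrite [uvec _ _ _ j 0](res_mask_ones (z := zpt L c t)) // conjc0 !mulr0.
Qed.

End CrossInputs.

(** * Choice of parameters *)

Ltac nonneg := repeat first [ assumption | exact: ler01 | exact: ler0n | apply: sqr_ge0 | rewrite invr_ge0
  | apply: sqrtr_ge0 | apply: addr_ge0 | apply: mulr_ge0 | apply: exprn_ge0 ].

Section Smallness.
Context {R : realType} {n : nat}.
Variables (dl p c tau : R) (bn : nat).
Let K := 2 * (dl + 1).
Let rho := Num.sqrt (n%:R^-1 * p).
Hypotheses (n0 : (0 < n)%N) (dl0 : 0 <= dl) (p1 : 1 <= p) (c0 : 0 < c) (c1 : c <= 1) (t0 : 0 < tau) (t1 : tau <= 1).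
Hypothesis ntau : n%:R^-1 <= tau ^+ 2.
Hypothesis small_tau : 100 ^+ 3 * K ^+ 4 * p ^+ 6 * tau <= c ^+ 3.
Hypothesis small_rho : 100 ^+ 3 * K ^+ 4 * p ^+ 6 * rho <= c ^+ 4.
Hypothesis large_p : 10 * K <= Num.sqrt p.
Hypotheses (bn_ge : p ^+ 3 / c ^+ 2 <= bn%:R) (bn_le : bn%:R <= 2 * p ^+ 3 / c ^+ 2).

(** The common unit of smallness. The two smallness hypotheses carry p^6 while error monomials have
    degree at most 4 in p; the two spare powers put the errors well below 1 / sqrt p, the order of
    [rsm]. *)
Definition Ysm : R := (100 ^+ 3 * p ^+ 2)^-1.
Local Notation Y := Ysm.
Local Notation kap := (kp p dl).
Local Notation G0 := (Gam0 c kap).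
Definition trace_eps : R := bn%:R * (2 / (n%:R * c)).
Definition esum : R := tau + qform_eps tau p dl c + trace_eps.
Definition rsm : R := 5 * K / Num.sqrt p.

Let K2 : 2 <= K. Proof. by rewrite /K; have h := dl0; lra. Qed.
Let K1 : 1 <= K. Proof. by have h := K2; lra. Qed.
Let K0 : 0 < K. Proof. exact: lt_le_trans K1. Qed.
Let p0 : 0 < p. Proof. exact: lt_le_trans p1. Qed.
Let Kn : 0 <= K. Proof. exact: ltW. Qed.
Let pn : 0 <= p. Proof. exact: ltW. Qed.
Let cn : 0 <= c. Proof. exact: ltW. Qed.
Let tn : 0 <= tau. Proof. exact: ltW. Qed.
Let nR : 0 < n%:R :> R. Proof. by rewrite ltr0n. Qed.
Let rho0 : 0 <= rho. Proof. exact: sqrtr_ge0. Qed.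
Let Y0 : 0 < Y. Proof. by rewrite invr_gt0 mulr_gt0 // exprn_gt0. Qed.
Let ci1 : 1 <= c^-1. Proof. by rewrite invf_ge1. Qed.
Let ci0 : 0 < c^-1. Proof. by rewrite invr_gt0. Qed.
Let Yn : 0 <= Y. Proof. exact: ltW. Qed.

Lemma Y_small : 100 ^+ 3 * Y <= 1.
Proof.
rewrite /Ysm invfM mulrA mulfV ?mul1r; last by rewrite expf_neq0.
by rewrite invf_le1 ?exprn_gt0 // exprn_ege1.
Qed.

Let Y1 : 100 * 100 * 100 * Y <= 1. Proof. by have := Y_small; rewrite !exprS expr0 mulr1 !mulrA. Qed.

(** K, p and 1 / c are at least 1, so among the admissible exponents the extreme ones dominate, and
    one hypothesis controls every monomial. *)
Lemma mono_gen (x : R) (m k i j : nat) : 0 <= x -> (k <= 4)%N -> (i <= 4)%N -> (j <= m)%N ->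
  100 ^+ 3 * K ^+ 4 * p ^+ 6 * x <= c ^+ m -> K ^+ k * p ^+ i * x / c ^+ j <= Y.
Proof.
move=> x0 k4 i4 jm h.
have cm0 : 0 < c ^+ m by rewrite exprn_gt0.
apply: (@le_trans _ _ (K ^+ 4 * p ^+ 4 * x / c ^+ m)).
  apply: ler_pM.
  - by nonneg.
  - by rewrite invr_ge0 exprn_ge0 // ltW.
  - apply: ler_wpM2r => //; apply: ler_pM; rewrite ?exprn_ge0 ?(ltW K0) ?(ltW p0) //; exact: ler_weXn2l.
  - by rewrite lef_pV2 ?posrE ?exprn_gt0 //; apply: ler_wiXn2l => //; exact: ltW.
rewrite ler_pdivrMr // /Ysm [leRHS]mulrC ler_pdivlMr; last by rewrite mulr_gt0 // exprn_gt0.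
by apply: le_trans h; rewrite le_eqVlt; apply/orP; left; apply/eqP; ring.
Qed.

Lemma mono1 (k i j : nat) : (k <= 4)%N -> (i <= 4)%N -> (j <= 3)%N -> K ^+ k * p ^+ i * tau / c ^+ j <= Y.
Proof. by move=> h1 h2 h3; apply: mono_gen small_tau => //; exact: ltW. Qed.

Lemma mono2 (k i j : nat) : (k <= 4)%N -> (i <= 4)%N -> (j <= 4)%N -> K ^+ k * p ^+ i * rho / c ^+ j <= Y.
Proof. by move=> h1 h2 h3; apply: mono_gen small_rho. Qed.

Lemma rho_sqr : n%:R^-1 = rho ^+ 2 / p.
Proof. by rewrite sqr_sqrtr ?mulr_ge0 ?invr_ge0 ?ler0n ?(ltW p0) // mulfK // gt_eqF. Qed.

Let rho1 : rho <= 1.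
Proof. by have := @mono2 0 0 0 isT isT isT; rewrite !expr0 !mul1r divr1 => h; have := Y1; have := Y0; lra. Qed.

Let rhop : rho <= p * tau.
Proof. exact: (rho_le t0 p1 ntau). Qed.

Lemma Gam0_le : G0 <= 12 * K * p / c.
Proof.
rewrite /Gam0 /kp -/K.
have h : 1 <= K * p / c.
  by rewrite ler_pdivlMr // mul1r; apply: (le_trans c1); rewrite -[1]mulr1; apply: ler_pM.
have -> : 4 * (1 + 2 * K * p / c) = 4 + 8 * (K * p / c) by ring.
have -> : 12 * K * p / c = 12 * (K * p / c) by ring.
lra.
Qed.

Let G00 : 0 <= G0.
Proof. by rewrite /Gam0 /kp -/K; nonneg. Qed.
Let kapn : 0 <= kap. Proof. by rewrite /kp -/K; nonneg. Qed.

Lemma trace_eps_le : trace_eps <= 4 * p ^+ 2 * rho ^+ 2 / c ^+ 3.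
Proof.
rewrite /trace_eps invfM rho_sqr.
have -> : bn%:R * (2 * (rho ^+ 2 / p / c)) = bn%:R * (2 * rho ^+ 2 / p / c) by ring.
have -> : 4 * p ^+ 2 * rho ^+ 2 / c ^+ 3 = 2 * p ^+ 3 / c ^+ 2 * (2 * rho ^+ 2 / p / c).
  by field; rewrite !gt_eqF.
apply: ler_wpM2r => //; apply: divr_ge0; last exact: ltW.
by apply: divr_ge0; [rewrite mulr_ge0 // sqr_ge0 | exact: ltW].
Qed.

Lemma trace_eps_ge0 : 0 <= trace_eps.
Proof. by nonneg. Qed.

Lemma res_row_eps_ge0 : 0 <= res_row_eps tau p dl c.
Proof. by rewrite /res_row_eps -/K; nonneg. Qed.
Lemma qform_eps_ge0 : 0 <= qform_eps tau p dl c.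
Proof. by rewrite /qform_eps -/K; nonneg. Qed.
Lemma cross_eps_ge0 : 0 <= @cross_eps _ n tau p dl c.
Proof.
rewrite /cross_eps -/K -/rho; apply: mulr_ge0; first by nonneg.
apply: addr_ge0; first by nonneg.
by apply: mulr_ge0 res_row_eps_ge0; rewrite mulr_ge0 // ltW.
Qed.
Lemma esum_ge0 : 0 <= esum.
Proof. by rewrite /esum; nonneg. Qed.

Lemma esum_le : K * p * esum / c <= 39 * Y.
Proof.
have h1 := @mono1 1 1 1 isT isT isT; have h2 := @mono1 3 3 2 isT isT isT.
have h3 := @mono2 1 3 4 isT isT isT.
have h4 : K * p * trace_eps / c <= 4 * (K ^+ 1 * p ^+ 3 * rho / c ^+ 4).
  apply: (@le_trans _ _ (K * p * (4 * p ^+ 2 * rho ^+ 2 / c ^+ 3) / c)).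
    apply: ler_wpM2r; first exact: ltW.
    by apply: ler_wpM2l trace_eps_le; rewrite mulr_ge0 // ltW.
  have -> : K * p * (4 * p ^+ 2 * rho ^+ 2 / c ^+ 3) / c = 4 * (K ^+ 1 * p ^+ 3 * rho / c ^+ 4) * rho.
    by field; rewrite gt_eqF.
  rewrite -[leRHS]mulr1; apply: ler_wpM2l => //.
  by nonneg.
have -> : K * p * esum / c = K ^+ 1 * p ^+ 1 * tau / c ^+ 1 + 34 * (K ^+ 3 * p ^+ 3 * tau / c ^+ 2) + K * p * trace_eps / c.
  by rewrite /esum /qform_eps -/K; field; rewrite gt_eqF.
by have := Y0; lra.
Qed.

Lemma esum_c : esum / c <= 39 * Y.
Proof.
apply: le_trans esum_le; apply: ler_wpM2r; first exact: ltW.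
rewrite ler_peMl ?esum_ge0 // -[1]mulr1; exact: ler_pM.
Qed.

Lemma esum_small : 4 * esum <= c.
Proof.
have h : esum <= 39 * Y * c by rewrite -ler_pdivrMr //; exact: esum_c.
have h2 : Y * c <= 100^-1 * 100^-1 * c.
  by apply: ler_wpM2r; [exact: ltW | have := Y1; lra].
by have h3 := c0; rewrite -mulrA in h; lra.
Qed.

Lemma trace_eps_c : trace_eps / c <= 39 * Y.
Proof.
apply: le_trans esum_c; apply: ler_wpM2r; first exact: ltW.
by rewrite lerDr addr_ge0 ?qform_eps_ge0 // ltW.
Qed.

Lemma trace_eps_small : 2 * trace_eps <= 1.
Proof.
have h : trace_eps <= 39 * Y * c by rewrite -ler_pdivrMr //; exact: trace_eps_c.
have h2 : Y * c <= Y * 1 by apply: ler_wpM2l => //; exact: ltW.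
by have h3 := Y1; rewrite -mulrA in h; lra.
Qed.

Lemma kap_small : 8 * kap * tau <= 1.
Proof.
have h := @mono1 1 1 0 isT isT isT; have h3 := Y1; rewrite /kp -/K.
have -> : 8 * (2 * K * p) * tau = 16 * (K ^+ 1 * p ^+ 1 * tau / c ^+ 0) by rewrite expr0 divr1; ring.
by lra.
Qed.

Lemma bn_res_row_eps : bn%:R * res_row_eps tau p dl c <= 1.
Proof.
have h := @mono1 1 4 3 isT isT isT; have h3 := Y1.
apply: (@le_trans _ _ (2 * p ^+ 3 / c ^+ 2 * res_row_eps tau p dl c)).
  by apply: ler_wpM2r => //; exact: res_row_eps_ge0.
have -> : 2 * p ^+ 3 / c ^+ 2 * res_row_eps tau p dl c = 8 * (K ^+ 1 * p ^+ 4 * tau / c ^+ 3).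
  by rewrite /res_row_eps -/K; field; rewrite gt_eqF.
by lra.
Qed.

Lemma bn_ge1 : 1 <= bn%:R :> R.
Proof.
apply: le_trans bn_ge; rewrite ler_pdivlMr ?exprn_gt0 // mul1r.
apply: (@le_trans _ _ 1); first by rewrite exprn_ile1 // ltW.
exact: exprn_ege1.
Qed.

Lemma res_row_eps_le1 : res_row_eps tau p dl c <= 1.
Proof. by apply: le_trans bn_res_row_eps; rewrite ler_peMl ?res_row_eps_ge0 // bn_ge1. Qed.

Lemma bn_tau : bn%:R <= tau * n%:R.
Proof.
have h := @mono2 0 3 2 isT isT isT; have h3 := Y1.
rewrite -ler_pdivrMr // rho_sqr.
apply: (@le_trans _ _ (2 * p ^+ 3 / c ^+ 2 * (rho * (p * tau) / p))).
  apply: ler_pM => //.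
    by nonneg.
  by apply: ler_wpM2r; [rewrite invr_ge0 ltW | rewrite expr2; exact: ler_wpM2l].
have -> : 2 * p ^+ 3 / c ^+ 2 * (rho * (p * tau) / p) = 2 * (K ^+ 0 * p ^+ 3 * rho / c ^+ 2) * tau.
  by rewrite expr0; field; rewrite !gt_eqF.
rewrite ler_piMl ?(ltW t0) //; have := Y0; lra.
Qed.

Lemma bn_n : (bn <= n)%N.
Proof. by rewrite -(ler_nat R); apply: le_trans bn_tau _; rewrite ler_piMl // ltW. Qed.

Lemma eps6_le : eps6 tau (@cross_eps _ n tau p dl c) esum c kap bn <= 780 * Y.
Proof.
have h1 := @mono1 1 4 3 isT isT isT; have h2 := @mono2 2 4 4 isT isT isT.
have h3 := @mono1 3 4 3 isT isT isT; have h4 := @mono1 0 2 1 isT isT isT.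
have te : 0 <= tau + @cross_eps _ n tau p dl c by nonneg.
rewrite /eps6; apply: (@le_trans _ _ (12 * K * p / c * (2 * p ^+ 3 / c ^+ 2 * (tau + @cross_eps _ n tau p dl c) + esum))).
  apply: ler_pM => //; first by nonneg.
    exact: Gam0_le.
  by rewrite lerD2r; apply: ler_wpM2r.
have -> : 12 * K * p / c * (2 * p ^+ 3 / c ^+ 2 * (tau + @cross_eps _ n tau p dl c) + esum) =
  24 * (K ^+ 1 * p ^+ 4 * tau / c ^+ 3) + 96 * (K ^+ 2 * p ^+ 4 * rho / c ^+ 4) +
  192 * ((K ^+ 3 * p ^+ 4 * tau / c ^+ 3) * (K ^+ 0 * p ^+ 2 * tau / c ^+ 1)) + 12 * (K * p * esum / c).
  by rewrite /cross_eps /res_row_eps -/K -/rho; field; rewrite gt_eqF.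
have h5 := esum_le.
have h6 : (K ^+ 3 * p ^+ 4 * tau / c ^+ 3) * (K ^+ 0 * p ^+ 2 * tau / c ^+ 1) <= Y * 1.
  apply: ler_pM => //.
  - by nonneg.
  - by nonneg.
  - by apply: (le_trans h4); have := Y1; have := Y0; lra.
by have := Y0; lra.
Qed.

Lemma eps7_le : (2 <= bn)%N -> eps7 tau (@cross_eps _ n tau p dl c) esum c kap <= 1.
Proof.
move=> b2; apply: (@le_trans _ _ (780 * Y)); last by have := Y1; have := Y0; lra.
apply: le_trans eps6_le; apply: ler_wpM2l => //; rewrite lerD2r; apply: ler_wpM2r.
  by nonneg.
by rewrite (ler_nat R 2).
Qed.

Let sp0 : 0 < Num.sqrt p. Proof. by rewrite sqrtr_gt0. Qed.

Lemma Y_sqrt : 100 * 10 * Y <= K / Num.sqrt p.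
Proof.
have hs : Num.sqrt p <= p.
  rewrite -{2}(ger0_norm (ltW p0)) -sqrtr_sqr ler_wsqrtr // expr2.
  by rewrite -{1}[p]mulr1 ler_wpM2l // ltW.
have h1 : Y * Num.sqrt p <= 100^-1 * 100^-1 * 100^-1.
  apply: (@le_trans _ _ (Y * p ^+ 2)).
    apply: ler_wpM2l => //; apply: (le_trans hs).
    by rewrite expr2 -{1}[p]mulr1 ler_wpM2l // ltW.
  rewrite /Ysm invfM divfK; last by rewrite expf_neq0 // gt_eqF.
  by rewrite !exprS expr0 mulr1 !invfM !mulrA.
by rewrite ler_pdivlMr // -mulrA; have := K1; lra.
Qed.

Lemma rsm_small : 2 * rsm <= 1.
Proof. by rewrite /rsm mulrA ler_pdivrMr // mul1r; have := large_p; lra. Qed.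

(** As sqrt bn >= p^(3/2) / c, the fluctuation of a block is at most 4 K / sqrt p; the other errors
    fit into the remaining K / sqrt p of [rsm]. *)
Lemma small_r_ok : 2 / bn%:R * (kap * (Num.sqrt bn%:R / c + tau * (2 * G0))) +
  eps6 tau (@cross_eps _ n tau p dl c) esum c kap bn <= rsm.
Proof.
have b1 := bn_ge1; have b0 : 0 < bn%:R :> R by exact: lt_le_trans b1.
have sb0 : 0 < Num.sqrt bn%:R :> R by rewrite sqrtr_gt0.
have sb : p * Num.sqrt p / c <= Num.sqrt bn%:R.
  rewrite -(ler_sqr (R := R)) ?nnegrE ?(ltW sb0) //; last by nonneg.
  rewrite sqr_sqrtr ?(ltW b0) // expr_div_n exprMn sqr_sqrtr ?(ltW p0) //.
  by apply: le_trans bn_ge; rewrite -exprSr.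
have h1 : 2 / bn%:R * (kap * (Num.sqrt bn%:R / c)) <= 4 * (K / Num.sqrt p).
  have -> : 2 / bn%:R * (kap * (Num.sqrt bn%:R / c)) = 4 * (K * p / (Num.sqrt bn%:R * c)).
    rewrite /kp -/K -{1}[bn%:R]sqr_sqrtr ?(ltW b0) //; field; by rewrite !gt_eqF.
  apply: ler_wpM2l => //; rewrite ler_pdivrMr ?mulr_gt0 // [leRHS]mulrAC ler_pdivlMr //.
  rewrite -[leLHS]mulrA; apply: ler_wpM2l => //.
  by rewrite -ler_pdivrMr.
have h2 : 2 / bn%:R * (kap * (tau * (2 * G0))) <= 96 * Y.
  apply: (@le_trans _ _ (2 * (kap * (tau * (2 * (12 * K * p / c)))))).
    apply: ler_pM => //.
    - by nonneg.
    - by rewrite ler_pdivrMr // ler_peMr.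
    - apply: ler_wpM2l; first by nonneg.
      by apply: ler_wpM2l; [exact: ltW | rewrite ler_wpM2l // Gam0_le].
  have -> : 2 * (kap * (tau * (2 * (12 * K * p / c)))) = 96 * (K ^+ 2 * p ^+ 2 * tau / c ^+ 1).
    by rewrite /kp -/K; field; rewrite gt_eqF.
  by have := @mono1 2 2 1 isT isT isT; lra.
rewrite !mulrDr; have := eps6_le; have := Y_sqrt.
have -> : rsm = 5 * (K / Num.sqrt p) by rewrite /rsm mulrA.
have := Y0; lra.
Qed.

Lemma small_pair_ok : 2 * G0 * (1 + kap * (c^-1 + tau * (2 * G0))) / n%:R <= rsm.
Proof.
have h1 := @mono2 1 1 1 isT isT isT; have h2 := @mono1 2 2 1 isT isT isT.
have h3 := @mono2 0 0 0 isT isT isT.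
have n1 : n%:R^-1 <= rho * rho :> R.
  by rewrite rho_sqr -expr2 ler_pdivrMr // ler_peMr // sqr_ge0.
have kG : kap * (tau * (2 * G0)) <= 48 * Y.
  apply: (@le_trans _ _ (kap * (tau * (2 * (12 * K * p / c))))).
    apply: ler_wpM2l; first by nonneg.
    by apply: ler_wpM2l; [exact: ltW | rewrite ler_wpM2l // Gam0_le].
  have -> : kap * (tau * (2 * (12 * K * p / c))) = 48 * (K ^+ 2 * p ^+ 2 * tau / c ^+ 1).
    by rewrite /kp -/K; field; rewrite gt_eqF.
  lra.
have kG0 : 0 <= kap * (tau * (2 * G0)) by nonneg.
have a1 : 2 * G0 * rho <= 24 * Y.
  apply: (@le_trans _ _ (2 * (12 * K * p / c) * rho)).
    by apply: ler_wpM2r => //; rewrite ler_wpM2l // Gam0_le.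
  have -> : 2 * (12 * K * p / c) * rho = 24 * (K ^+ 1 * p ^+ 1 * rho / c ^+ 1) by ring.
  lra.
have a2 : (1 + kap * (c^-1 + tau * (2 * G0))) * rho <= 51 * Y.
  have e : kap * c^-1 * rho = 2 * (K ^+ 1 * p ^+ 1 * rho / c ^+ 1) by rewrite /kp -/K; ring.
  rewrite !expr0 !mul1r divr1 in h3.
  have r2 : kap * (tau * (2 * G0)) * rho <= 48 * Y * 1 by apply: ler_pM.
  rewrite mulrDl mul1r mulrDr mulrDl e; lra.
have a20 : 0 <= 1 + kap * (c^-1 + tau * (2 * G0)).
  by nonneg.
apply: (@le_trans _ _ (24 * Y * (51 * Y))).
  apply: (@le_trans _ _ (2 * G0 * (1 + kap * (c^-1 + tau * (2 * G0))) * (rho * rho))).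
    by apply: ler_wpM2l => //; nonneg.
  have -> : 2 * G0 * (1 + kap * (c^-1 + tau * (2 * G0))) * (rho * rho) =
    (2 * G0 * rho) * ((1 + kap * (c^-1 + tau * (2 * G0))) * rho) by ring.
  by apply: ler_pM => //; nonneg.
have -> : rsm = 5 * (K / Num.sqrt p) by rewrite /rsm mulrA.
have h4 : 24 * Y * (51 * Y) <= 24 * Y * 1.
  by apply: ler_wpM2l; [nonneg | have := Y1; have := Y0; lra].
by have := Y_sqrt; have := Y0; lra.
Qed.

End Smallness.

(** * Union bound over grid points, pairs and blocks *)

Section Assembly.
Context {d : measure_display} {T : measurableType d} {R : realType} (P : probability T R) {n : nat}.
Local Notation C := R[i].
Local Notation I := ('I_n * 'I_n)%type.
Context (Z : I -> T -> R * R).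
Local Open Scope classical_set_scope.
Variables (nu dl p c tau : R) (bn : nat).
Hypothesis mZ : forall i, measurable_fun setT (Z i).
Hypothesis indZ : forall S : I -> set (R * R), (forall i, measurable (S i)) ->
  fine (P (\bigcap_(i in [set i | ordp i]) (Z i @^-1` S i))) = \prod_(i | ordp i) fine (P (Z i @^-1` S i)).

Let K := 2 * (dl + 1).
Let q := expR (- (dl * p)).
Let rho := Num.sqrt (n%:R^-1 * p).
(** With half-length n^4 the mesh is 2 n^-7 and the Riemann error 4 n^-3 / c^2. Both this error and
    the cut tails then stay small after the factor n / c lost in the quadrature of X. *)
Let N := (n ^ 11)%N.
Let L : R := n%:R ^+ 4.

Hypotheses (n0 : (0 < n)%N) (dl0 : 0 <= dl) (p1 : 1 <= p) (c0 : 0 < c) (c1 : c <= 1) (t0 : 0 < tau) (t1 : tau <= 1).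
Hypotheses (nu0 : 0 <= nu) (nut : nu * n%:R ^+ 2 <= tau).
Hypothesis ntau : n%:R^-1 <= tau ^+ 2.
Hypothesis small_tau : 100 ^+ 3 * K ^+ 4 * p ^+ 6 * tau <= c ^+ 3.
Hypothesis small_rho : 100 ^+ 3 * K ^+ 4 * p ^+ 6 * rho <= c ^+ 4.
Hypothesis large_p : 10 * K <= Num.sqrt p.
Hypotheses (bn_ge : p ^+ 3 / c ^+ 2 <= bn%:R) (bn_le : bn%:R <= 2 * p ^+ 3 / c ^+ 2).

Local Notation kap := (kp p dl).
Local Notation G0 := (Gam0 c kap).
Let sc : R := Num.sqrt (2 / c).
Local Notation local_ctrl A := (fun w => forall (t : 'I_N) k l,
  local_out (A w) (zpt L c t) tau (@cross_eps _ n tau p dl c) (@trace_eps _ n c bn) (@esum _ n dl p c tau bn) c kap (rsm dl p) sc [set k; l]%SET).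

Let K2 : 2 <= K. Proof. by rewrite /K; have h := dl0; lra. Qed.
Let Kn : 0 <= K. Proof. by have h := K2; lra. Qed.
Let p0 : 0 < p. Proof. exact: lt_le_trans p1. Qed.
Let pn : 0 <= p. Proof. exact: ltW. Qed.
Let cn : 0 <= c. Proof. exact: ltW. Qed.
Let tn : 0 <= tau. Proof. exact: ltW. Qed.
Let q0 : 0 <= q. Proof. exact: expR_ge0. Qed.
Let nR : 0 < n%:R :> R. Proof. by rewrite ltr0n. Qed.
Let bn0 : (0 < bn)%N. Proof. by rewrite -(ltr_nat R) (lt_le_trans _ (bn_ge1 p1 c0 c1 bn_ge)). Qed.
Let kapn : 0 <= kap. Proof. by rewrite /kp -/K; nonneg. Qed.
Let G00 : 0 <= G0. Proof. by rewrite /Gam0; nonneg. Qed.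
Let Y1 : 100 * 100 * 100 * Ysm p <= 1. Proof. by have := Y_small p1; rewrite !exprS expr0 mulr1 !mulrA. Qed.
Let Y0 : 0 <= Ysm p. Proof. by rewrite /Ysm; nonneg. Qed.

Lemma bn2 : (2 <= bn)%N.
Proof.
rewrite -(ler_nat R); apply: le_trans bn_ge.
have p2 : 2 <= p.
  have h : 2 <= Num.sqrt p by have := large_p; have := K2; lra.
  have h2 : 2 * 2 <= Num.sqrt p * Num.sqrt p by apply: ler_pM.
  by move: h2; rewrite -[X in _ <= X]expr2 sqr_sqrtr //; lra.
rewrite ler_pdivlMr ?exprn_gt0 //; apply: (@le_trans _ _ 2).
  by rewrite ler_piMr // exprn_ile1.
apply: (le_trans p2); rewrite -{1}[p]expr1; exact: ler_weXn2l.
Qed.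

Lemma inv_n_small : n%:R^-1 <= Ysm p * c ^+ 4.
Proof.
have h := @mono2 R n dl p c dl0 p1 c0 c1 small_rho 0 0 4 isT isT isT.
rewrite !expr0 !mul1r ler_pdivrMr ?exprn_gt0 // in h.
have r0 : 0 <= rho by exact: sqrtr_ge0.
have r1 : rho <= 1.
  apply: (le_trans h); rewrite -[1]mulr1; apply: ler_pM => //; rewrite ?exprn_ge0 ?exprn_ile1 //.
  by have := Y1; have := Y0; lra.
apply: le_trans h; rewrite [leLHS](@rho_sqr _ n p p1) // -/rho ler_pdivrMr //.
rewrite expr2; apply: ler_wpM2l => //; exact: le_trans p1.
Qed.

Section OneMatrix.
Variable A : T -> 'M[R]_n.
Hypothesis sA : forall w, (A w)^T = A w.
Hypothesis AZ : forall i j, exists2 h, measurable_fun setT h & forall w, A w i j = h (Z (upair i j) w).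
Hypothesis Atau : forall w i j, `|A w i j| <= tau.
Hypothesis EA : forall i j, i != j -> `|Ex P (fun w => A w i j)| <= nu.
Hypothesis EA2 : forall i j, i != j -> Ex P (fun w => A w i j ^+ 2) <= n%:R^-1.
Hypothesis EA2' : forall i j, i != j -> `|Ex P (fun w => A w i j ^+ 2) - n%:R^-1| <= nu * tau.

Lemma locals_random : pgood P (local_ctrl A) (N%:R * ((n%:R ^+ 2 + (n%:R + 1)) * (36 * n%:R ^+ 2 * q))).
Proof.
rewrite -[N in N%:R * _]card_ord; apply: pgood_all => t.
have small : 34 * K ^+ 2 * p ^+ 2 * tau <= 1.
  have h := @mono1 R dl p c tau dl0 p1 c0 c1 t0 small_tau 2 2 0 isT isT isT.
  rewrite expr0 divr1 -/K in h; have -> : 34 * K ^+ 2 * p ^+ 2 * tau = 34 * (K ^+ 2 * p ^+ 2 * tau) by ring.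
  by have := Y1; have := Y0; lra.
pose S (x : I + 'I_n.+1) : {set 'I_n} := match x with inl kl => [set kl.1; kl.2]%SET | inr r => block bn r end.
have cS x : (#|S x| <= bn)%N.
  case: x => [kl|r] /=; last exact: card_block.
  by apply: leq_trans bn2; rewrite cards2; case: (_ != _).
have btau := bn_tau n0 dl0 p1 c0 c1 t0 ntau small_rho bn_le.
have g x := minor_random mZ indZ sA AZ Atau EA EA2 EA2' n0 t0 t1 nu0 p1 dl0 nut ntau
   (erefl : complex.Im (zpt L c t) = c) c0 (cS x) btau small.
have := pgood_all g; apply: pgood_imp; last first.
  by rewrite card_sum card_prod !card_ord natrD natrM -natr1 -expr2.
move=> w h k l.
have hB r : minor_ctrl (A w) (zpt L c t) tau (res_row_eps tau p dl c) (qform_eps tau p dl c) (@cross_eps _ n tau p dl c) kap (block bn r) /\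
    forall a b : R, 0 <= a -> 0 <= b ->
    n2 (uvec (A w) (zpt L c t) (block bn r)) <= n%:R * a ^+ 2 -> (forall i, md (uvec (A w) (zpt L c t) (block bn r) i 0) <= b) ->
    md (\sum_(k in block bn r) dot (al (block bn r) (A w) k) (uvec (A w) (zpt L c t) (block bn r))) <= kap * (Num.sqrt bn%:R * a + tau * b).
  have [rn|rn] := ltnP r n.+1; first exact: (h (inr (Ordinal rn))).
  (* Blocks of index at least n are empty, so the block of index n stands for all of them in a
     finite union bound. *)
  suff -> : block bn r = block bn n :> {set 'I_n} by exact: (h (inr ord_max)).
  apply/setP => m; rewrite !inE; have mn : (m %/ bn < n)%N by apply: leq_ltn_trans (leq_div _ _) (ltn_ord m).
  by rewrite !ltn_eqF // (ltn_trans mn).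
have hP a b := (h (inl (a, b))).1.
have e4n := @cross_eps_ge0 R n dl p c tau dl0 p1 c0 t0.
apply: (local_outP (sA w) (erefl : complex.Im (zpt L c t) = c) c0 n0 (Atau w) _ _ _
  (esum_small dl0 p1 c0 c1 t0 small_tau small_rho bn_le) c1 (kap_small dl0 p1 c0 c1 t0 small_tau) kapn
  (res_row_eps_le1 dl0 p1 c0 c1 t0 small_tau bn_ge bn_le) bn0
  (bn_n n0 dl0 p1 c0 c1 t0 t1 ntau small_rho bn_le) e4n (sqrtr_ge0 _) (fun r => (hB r).1) (fun r => (hB r).2)
  (bn_res_row_eps dl0 p1 c0 c1 t0 small_tau bn_le) (@res_row_eps_ge0 R dl p c tau dl0 p1 c0 t0) (lexx _)
  (small_r_ok dl0 p1 c0 c1 t0 small_tau small_rho bn_ge bn_le)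
  (small_pair_ok dl0 p1 c0 c1 t0 small_tau small_rho) (rsm_small p1 large_p) (sqrtr_ge0 _) _ _ _ bn2
  (trace_eps_small dl0 p1 c0 c1 t0 small_tau small_rho bn_le)).
- by move=> m; have := hP m m; rewrite /S /= finset.setUid.
- rewrite /trace_eps ler_peMl ?(bn_ge1 p1 c0 c1 bn_ge) //; by nonneg.
- exact: lexx.
- by rewrite sqr_sqrtr // divr_ge0.
- exact: hP.
- by rewrite cards2; case: (_ != _).
Qed.

End OneMatrix.

Let iN := n%:R^-1 : R.
Let isc : R := (Num.sqrt c)^-1.
Let YY := Ysm p.
Let iNn : 0 <= iN. Proof. by rewrite invr_ge0 ltW. Qed.

Lemma inv_n_pow (j : nat) : (j <= 4)%N -> iN / c ^+ j <= YY.
Proof.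
move=> j4; rewrite ler_pdivrMr ?exprn_gt0 //; apply: (le_trans inv_n_small).
by apply: ler_wpM2l => //; apply: ler_wiXn2l.
Qed.

Let iN1 : iN <= YY. Proof. by have := @inv_n_pow 0 isT; rewrite expr0 divr1. Qed.
Let YY1 : 100 * 100 * 100 * YY <= 1. Proof. exact: Y1. Qed.
Let YYn : 0 <= YY. Proof. exact: Y0. Qed.

Let iNle1 : iN <= 1. Proof. by have := iN1; have := YY1; have := YYn; lra. Qed.

Lemma n_large : (100 <= n)%N.
Proof.
rewrite -(ler_nat R) -[leRHS]invrK -[leLHS]invrK lef_pV2 ?posrE ?invr_gt0 //.
by have := iN1; have := YY1; have := YYn; rewrite /iN; lra.
Qed.

Let N0 : (0 < N)%N. Proof. by rewrite expn_gt0 n0. Qed.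
Let L1 : 1 <= L. Proof. by rewrite exprn_ege1 // ler1n. Qed.

Lemma gerr_gridE x : 0 < x -> gerr L N x = 4 * iN ^+ 3 / x ^+ 2.
Proof.
by move=> x0; rewrite /gerr /gstep /L /N natrX /iN; field; rewrite !gt_eqF.
Qed.

Let iN3 (j : nat) : (j <= 4)%N -> iN ^+ 3 / c ^+ j <= YY.
Proof.
move=> j4; apply: le_trans (inv_n_pow j4); apply: ler_wpM2r; first by nonneg.
by rewrite -[leRHS]expr1; apply: ler_wiXn2l.
Qed.

Let g1 : 2 * gerr L N 1 <= 1.
Proof.
rewrite gerr_gridE // expr1n divr1; have := @iN3 0 isT; rewrite expr0 divr1.
by have := YY1; have := YYn; lra.
Qed.

Let g2 : 2 * gerr L N (2 * c) <= 1.
Proof.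
rewrite gerr_gridE ?mulr_gt0 //; have := @iN3 2 isT.
have -> : 4 * iN ^+ 3 / (2 * c) ^+ 2 = iN ^+ 3 / c ^+ 2 by field; rewrite gt_eqF.
by have := YY1; have := YYn; lra.
Qed.

Let LL : 2 * n%:R <= L.
Proof.
have n1 : 1 <= n%:R :> R by rewrite ler1n.
have n2' : 2 <= n%:R :> R by rewrite ler_nat (leq_trans _ n_large).
rewrite /L; apply: (@le_trans _ _ (n%:R * n%:R)); first by apply: ler_wpM2r => //; exact: ltW.
by rewrite -expr2; exact: ler_weXn2l.
Qed.

Let quad_err : n%:R * ((2 * gerr L N c + 12 * (n%:R + 1) / L) / c) <= 1.
Proof.
rewrite gerr_gridE // /L.
have -> : n%:R * ((2 * (4 * iN ^+ 3 / c ^+ 2) + 12 * (n%:R + 1) / n%:R ^+ 4) / c) =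
  8 * (iN / c ^+ 3) * iN + 12 * ((iN / c ^+ 1) * iN) + 12 * ((iN / c ^+ 1) * iN ^+ 2).
  by rewrite /iN; field; rewrite !gt_eqF.
have h1 := @inv_n_pow 3 isT; have h2 := @inv_n_pow 1 isT.
have k1 : (iN / c ^+ 3) * iN <= YY * 1 by apply: ler_pM => //; nonneg.
have k2 : (iN / c ^+ 1) * iN <= YY * 1 by apply: ler_pM => //; nonneg.
have k3 : (iN / c ^+ 1) * iN ^+ 2 <= YY * 1 by apply: ler_pM => //; [nonneg | nonneg | exact: exprn_ile1].
by rewrite -mulrA; have := YY1; have := YYn; lra.
Qed.

Let trace_err : (gerr L N c + 4 * c / L) / c <= 8 * YY.
Proof.
rewrite gerr_gridE // /L.
have -> : (4 * iN ^+ 3 / c ^+ 2 + 4 * c / n%:R ^+ 4) / c = 4 * (iN ^+ 3 / c ^+ 3) + 4 * (iN ^+ 3 * iN).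
  by rewrite /iN; field; rewrite !gt_eqF.
have h1 := @iN3 3 isT.
have h2 : iN ^+ 3 * iN <= 1 * YY by apply: ler_pM => //; [nonneg | exact: exprn_ile1].
by lra.
Qed.

Let isc0 : 0 <= isc. Proof. by rewrite invr_ge0 sqrtr_ge0. Qed.
Let isc2 : isc ^+ 2 = c^-1. Proof. by rewrite /isc exprVn sqr_sqrtr. Qed.
Let pisc1 : 1 <= p * isc.
Proof.
rewrite -[1]mulr1; apply: ler_pM => //.
by rewrite /isc invf_ge1 ?sqrtr_gt0 // -[leRHS](sqrtr1 R); exact: ler_wsqrtr.
Qed.

Let scle : sc <= 2 * isc.
Proof.
have s2 : 0 <= 2 * isc by nonneg.
rewrite -(ger0_norm s2) -sqrtr_sqr; apply: ler_wsqrtr.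
by rewrite exprMn isc2; apply: ler_wpM2r; [rewrite invr_ge0 | rewrite expr2; lra].
Qed.

Let ka_le : kap * (sc + tau * (2 * G0)) <= 4 * (K * (p * isc)) + 1.
Proof.
have h := @mono1 R dl p c tau dl0 p1 c0 c1 t0 small_tau 2 2 1 isT isT isT.
have h1 : kap * (tau * (2 * G0)) <= 48 * YY.
  apply: (@le_trans _ _ (kap * (tau * (2 * (12 * K * p / c))))).
    apply: ler_wpM2l => //; apply: ler_wpM2l => //; apply: ler_wpM2l => //.
    exact: (Gam0_le dl0 p1 c0 c1).
  have -> : kap * (tau * (2 * (12 * K * p / c))) = 48 * (K ^+ 2 * p ^+ 2 * tau / c ^+ 1).
    by rewrite /kp -/K; field; rewrite gt_eqF.
  by apply: ler_wpM2l.
have h2 : kap * sc <= 4 * (K * (p * isc)).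
  apply: le_trans (ler_wpM2l kapn scle) _; rewrite /kp -/K.
  by rewrite le_eqVlt; apply/orP; left; apply/eqP; ring.
by rewrite mulrDr; have := YY1; have := YYn; lra.
Qed.

Let Q := @Qb R n tau p dl (36 * n%:R * isc) (40 * (2 * G0) ^+ 2).

Let Q_le : Q <= 144 * (K ^+ 2 * (p * isc)) + 1.
Proof.
have h := @mono1 R dl p c tau dl0 p1 c0 c1 t0 small_tau 4 4 2 isT isT isT.
rewrite -/K -/YY in h.
have hb : 40 * (2 * G0) ^+ 2 <= 40 * (2 * (12 * K * p / c)) ^+ 2.
  apply: ler_wpM2l => //; rewrite lerXn2r ?nnegrE //; first by nonneg.
    by nonneg.
  apply: ler_wpM2l => //; exact: (Gam0_le dl0 p1 c0 c1).
rewrite /Q /Qb -/K; set b := 40 * (2 * G0) ^+ 2 in hb *.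
have b0 : 0 <= b by rewrite /b; nonneg.
have -> : 2 * K ^+ 2 * (2 * (p / n%:R) * (36 * n%:R * isc) + 4 * p ^+ 2 * tau * b) + 4 * K * p * tau * b =
   144 * (K ^+ 2 * (p * isc)) + (8 * (K ^+ 2 * p ^+ 2 * tau * b) + 4 * (K * p * tau * b)).
  by field; rewrite gt_eqF.
have kp1 : 1 <= K * p by rewrite -[1]mulr1; apply: ler_pM => //; have := K2; lra.
have h2 : K * p * tau * b <= K ^+ 2 * p ^+ 2 * tau * b.
  apply: ler_wpM2r => //; apply: ler_wpM2r => //; rewrite -exprMn expr2 ler_peMl //; nonneg.
have h3 : K ^+ 2 * p ^+ 2 * tau * b <= 40 * (24 * (24 * YY)).
  apply: (@le_trans _ _ (K ^+ 2 * p ^+ 2 * tau * (40 * (2 * (12 * K * p / c)) ^+ 2))).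
    by apply: ler_wpM2l => //; nonneg.
  have -> : K ^+ 2 * p ^+ 2 * tau * (40 * (2 * (12 * K * p / c)) ^+ 2) =
     40 * (24 * (24 * (K ^+ 4 * p ^+ 4 * tau / c ^+ 2))) by field; rewrite gt_eqF.
  by apply: ler_wpM2l => //; apply: ler_wpM2l => //; apply: ler_wpM2l.
rewrite lerD2l.
have y1 : 24 * YY <= 3^-1 * (100^-1 * 100^-1) by have := YY1; have := YYn; lra.
by have := YYn; lra.
Qed.

Variables A B : T -> 'M[R]_n.
Hypotheses (sA : forall w, (A w)^T = A w) (sB : forall w, (B w)^T = B w).
Hypothesis AZ : forall i j, exists2 h, measurable_fun setT h & forall w, A w i j = h (Z (upair i j) w).
Hypothesis BZ : forall i j, exists2 h, measurable_fun setT h & forall w, B w i j = h (Z (upair i j) w).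
Hypotheses (Atau : forall w i j, `|A w i j| <= tau) (Btau : forall w i j, `|B w i j| <= tau).
Hypothesis EA : forall i j, i != j -> `|Ex P (fun w => A w i j)| <= nu.
Hypothesis EB : forall i j, i != j -> `|Ex P (fun w => B w i j)| <= nu.
Hypothesis EA2 : forall i j, i != j -> Ex P (fun w => A w i j ^+ 2) <= n%:R^-1.
Hypothesis EB2 : forall i j, i != j -> Ex P (fun w => B w i j ^+ 2) <= n%:R^-1.
Hypothesis EA2' : forall i j, i != j -> `|Ex P (fun w => A w i j ^+ 2) - n%:R^-1| <= nu * tau.
Hypothesis EB2' : forall i j, i != j -> `|Ex P (fun w => B w i j ^+ 2) - n%:R^-1| <= nu * tau.
Variable xi : R.
Hypotheses (xi0 : 0 <= xi) (eexi : forall k j, `|ecov P A B k j - n%:R^-1| <= xi).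

(** Eigenbases and theta are quantified inside the event, which speaks of resolvents and bilinear
    forms only. The power n^15 comes from n^11 grid points, about n^2 minors for each, and a failure
    probability of order n^2 q per minor. *)
Theorem X_random : pgood P (fun w => forall theta V W lam mu, 0 <= theta ->
  spec_decomp (A w) V lam -> spec_decomp (B w) W mu ->
  (forall v, n2 (toCm (A w - B w) *m v) <= theta ^+ 2 * n2 v) ->
  forall k l, `|Xmat (2 * c) V W lam mu k l - (if k == l then (2 * c)^-1 else 0)| <=
    600 * K ^+ 2 * (p * isc) + (if k == l then 80 * xi * (n%:R / c) + 160 * (theta / c ^+ 2) +
      100 * K / (Num.sqrt p * c) + 12 else 0)) (100 * 3 * n%:R ^+ 15 * q).
Proof.
have lA := locals_random sA AZ Atau EA EA2 EA2'.
have lB := locals_random sB BZ Btau EB EB2 EB2'.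
have lQ (kl : I) := quad_tail mZ indZ AZ BZ Atau Btau EA EB EA2 EB2 n0 t0 t1 nu0 p1 dl0 nut
  (fun i j => @Mkl_mE _ _ _ n N Z A B L c sA sB AZ BZ c0 kl.1 kl.2 i j)
  (fun i j w => @Mkl_mask0 _ _ _ n N A B L c sB c0 kl.1 kl.2 i j w).
have := pgood_and (pgood_and lA lB) (pgood_all lQ).
apply: pgood_imp; last first.
  rewrite card_prod card_ord natrM -/q /N natrX.
  have n1 : 1 <= n%:R :> R by rewrite ler1n.
  set x : R := n%:R in n1 *.
  have xm (i : nat) : (i <= 15)%N -> x ^+ i <= x ^+ 15 by move=> h; exact: ler_weXn2l.
  have -> : x ^+ 11 * ((x ^+ 2 + (x + 1)) * (36 * x ^+ 2 * q)) + x ^+ 11 * ((x ^+ 2 + (x + 1)) * (36 * x ^+ 2 * q)) +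
    x * x * ((4 * x + 6) * q) = (72 * x ^+ 15 + 72 * x ^+ 14 + 72 * x ^+ 13 + 4 * x ^+ 3 + 6 * x ^+ 2) * q by ring.
  apply: ler_wpM2r => //.
  have := xm 14 isT; have := xm 13 isT; have := xm 3 isT; have := xm 2 isT; move=> m1 m2 m3 m4.
  have : 0 <= x ^+ 15 by rewrite exprn_ge0 // ltW.
  lra.
move=> w [[loA loB] hQ] theta V W lam mu th0 sdA sdB opAB k l.
have n1 : 1 <= n%:R :> R by rewrite ler1n.
have lamL (M U : 'M[R]_n) (la : 'I_n -> R) i : spec_decomp M U la -> (forall a b, `|M a b| <= tau) -> `|la i| <= n%:R.
  by move=> sd ht; apply: le_trans (spec_lam_le sd i tn ht) _; rewrite ler_piMr // ltW.
have f0 : 0 <= 36 * n%:R * isc by nonneg.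
have b0 : 0 <= 40 * (2 * G0) ^+ 2 by nonneg.
have quadQ a b : `|\sum_i \sum_j complex.Re (al [set a; b]%SET (A w) a i 0) * complex.Re (al [set a; b]%SET (B w) b j 0) *
       complex.Re (Mkl (N := N) (A w) (B w) L c a b i j) -
    (if a == b then \sum_j complex.Re (Mkl (N := N) (A w) (B w) L c a b j j) * ecov P A B a j else 0)| <= Q.
  apply: (hQ (a, b) _ _ f0 b0).
    rewrite exchange_big /=.
    apply: (@le_trans _ _ (\sum_i \sum_j md (Mkl (N := N) (A w) (B w) L c a b i j) ^+ 2)).
      by apply: ler_sum => i _; apply: ler_sum => j _; exact: (Re_sqr_le _).1.
    apply: le_trans (Mkl_frob (sA w) (sB w) N0 L1 c0 loA loB g1 g2 a b) _.
    rewrite !exprMn isc2.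
    have -> : 2560 * n%:R ^+ 2 / (2 * c) = 1280 * (n%:R ^+ 2 / c) by field; rewrite gt_eqF.
    rewrite -mulrA; apply: ler_wpM2r; first by nonneg.
    rewrite expr2; lra.
  by move=> i j; apply: le_trans (Re_le_md _) (Mkl_max N0 L1 loA loB g1 a b i j).
have e0' : 0 <= @esum R n dl p c tau bn by exact: esum_ge0.
have e5n : 0 <= @trace_eps R n c bn by exact: trace_eps_ge0.
have X := X_entry sdA sdB (sA w) (sB w) n0 N0 L1 LL c0 c1 (fun i => lamL _ _ _ i sdA (Atau w))
  (fun i => lamL _ _ _ i sdB (Btau w)) loA loB opAB g1
  (eps7_le dl0 p1 c0 c1 t0 small_tau small_rho bn_le bn2)
  e5n e0' th0 xi0 kapn (sqrtr_ge0 _) tn eexi quadQ k l.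
apply: (le_trans X).
have KK : 2 * K <= K ^+ 2 by rewrite expr2; apply: ler_wpM2r.
have u1 : K ^+ 2 <= K ^+ 2 * (p * isc) by rewrite ler_peMr // sqr_ge0.
have u2 : 2 * (K * (p * isc)) <= K ^+ 2 * (p * isc).
  by rewrite mulrA; apply: ler_wpM2r => //; nonneg.
apply: lerD.
  have := K2; have := quad_err; have := ka_le; have := Q_le.
  rewrite -[600 * K ^+ 2 * _]mulrA.
  set qq := Q; set k1 := kap * _; set k2 := n%:R * _; set k3 := K ^+ 2 * (p * isc) in u1 u2 *.
  set k4 := K * (p * isc) in u2 *.
  lra.
case: (k == l) => //; rewrite -!addrA; do 2! rewrite lerD2l.
have e5c := trace_eps_c dl0 p1 c0 c1 t0 small_tau small_rho bn_le.
have ec := esum_c dl0 p1 c0 c1 t0 small_tau small_rho bn_le.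
have te := trace_err.
have -> : 100 * K / (Num.sqrt p * c) = 20 * (rsm dl p / c).
  by rewrite /rsm -/K; field; rewrite !gt_eqF // sqrtr_gt0.
have -> : (120 * @trace_eps R n c bn + (20 * rsm dl p + (40 * @esum R n dl p c tau bn + (gerr L N c + 4 * c / L)))) / c =
  120 * (@trace_eps R n c bn / c) + 20 * (rsm dl p / c) + 40 * (@esum R n dl p c tau bn / c) + (gerr L N c + 4 * c / L) / c.
  by ring.
have y1 : 39 * YY <= 100^-1 * 2^-1 by have := YY1; have := YYn; lra.
have := YYn; rewrite -/YY in e5c ec; move: e5c ec te.
move: (@trace_eps R n c bn / c) (@esum R n dl p c tau bn / c) ((gerr L N c + 4 * c / L) / c) (rsm dl p / c) => a1 a2 a3 a4.
lra.
Qed.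

End Assembly.

(** * Truncation *)

Section RealInequalities.
Context {R : realType}.
Implicit Types x y : R.

Lemma mul_le_half_sqr x y : x * y <= 2^-1 * (x ^+ 2 + y ^+ 2).
Proof.
have := sqr_ge0 (x - y); have -> : (x - y) ^+ 2 = x ^+ 2 - 2 * (x * y) + y ^+ 2 by ring.
lra.
Qed.

Lemma dist_interval (x y u lo del : R) : `|x - y| <= del -> lo <= x -> x <= u -> `|y - u| <= u - lo + del.
Proof.
move=> /norm_le_split [h1 h2] h3 h4.
by rewrite ler_norml; apply/andP; split; lra.
Qed.

End RealInequalities.

Section Truncation.
Context {d : measure_display} {T : measurableType d} {R : realType} (P : probability T R).
Local Open Scope classical_set_scope.
Implicit Types f g h : T -> R.

Definition itg f := P.-integrable setT (EFin \o f).

Lemma itgE f : itg f -> (\int[P]_w (f w)%:E)%E = (Ex P f)%:E.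
Proof. by move=> hf; rewrite /Ex fineK //; exact: integrable_fin_num. Qed.

Lemma itg_meas f : itg f -> measurable_fun setT f.
Proof. by move=> /measurable_int /measurable_EFinP. Qed.

Lemma itg_le f g : itg f -> itg g -> (forall w, f w <= g w) -> Ex P f <= Ex P g.
Proof.
move=> hf hg fg; rewrite -lee_fin -!itgE //; apply: le_integral => //.
by move=> w _; rewrite lee_fin.
Qed.

Lemma itgD f g : itg f -> itg g -> itg (fun w => f w + g w) /\ Ex P (fun w => f w + g w) = Ex P f + Ex P g.
Proof.
move=> hf hg; split; first exact: (integrableD measurableT hf hg).
rewrite /Ex; have -> : (\int[P]_w (f w + g w)%:E = \int[P]_w ((f w)%:E + (g w)%:E))%E by apply: eq_integral.
by rewrite integralD // !itgE.
Qed.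

Lemma itgZ (k : R) f : itg f -> itg (fun w => k * f w) /\ Ex P (fun w => k * f w) = k * Ex P f.
Proof.
move=> hf; split; first exact: (integrableZl measurableT k hf).
rewrite /Ex; have -> : (\int[P]_w (k * f w)%:E = \int[P]_w (k%:E * (f w)%:E))%E by apply: eq_integral.
by rewrite integralZl // itgE.
Qed.

Lemma itg_dom f g : measurable_fun setT f -> itg g -> (forall w, `|f w| <= g w) -> itg f.
Proof.
move=> mf hg fg; apply: (le_integrable measurableT _ _ hg); first exact/measurable_EFinP.
by move=> w _ /=; rewrite lee_fin; apply: le_trans (fg w) _; exact: ler_norm.
Qed.

Lemma itg_cst (k : R) : itg (fun=> k).
Proof. by apply: bdm_integrable; exact: bdm_cst. Qed.

Lemma itg_ge0 f (m : R) : measurable_fun setT f -> (forall w, 0 <= f w) -> ('E_P[f] <= m%:E)%E ->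
  itg f /\ Ex P f <= m.
Proof.
rewrite unlock => mf f0 fm.
have hf : itg f.
  apply/integrableP; split; first exact/measurable_EFinP.
  apply: (@le_lt_trans _ _ m%:E); last exact: ltry.
  apply: le_trans fm; rewrite le_eqVlt; apply/orP; left; apply/eqP; apply: eq_integral => w _ /=.
  by rewrite ger0_norm.
by split => //; rewrite -lee_fin -itgE.
Qed.

Lemma expect_eq f (m : R) : itg f -> ('E_P[f] = m%:E)%E -> Ex P f = m.
Proof. by rewrite unlock => hf; rewrite /Ex => ->. Qed.

Lemma itg_abs f : itg f -> `|Ex P f| <= Ex P (fun w => `|f w|).
Proof.
move=> hf; have ha : itg (fun w => `|f w|).
  have := integrable_norm hf; by apply: eq_integrable => // w _ /=.
rewrite ler_norml; apply/andP; split; last by apply: itg_le => // w; exact: ler_norm.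
rewrite -mulN1r -(itgZ (-1) ha).2; apply: itg_le => //; first exact: (itgZ (-1) ha).1.
by move=> w; rewrite mulN1r lerNl -normrN; exact: ler_norm.
Qed.

Definition trunc (tau x : R) : R := if `|x| <= tau then x else 0.

Lemma trunc_meas tau : measurable_fun setT (trunc tau).
Proof.
apply: measurable_fun_ifT => //; apply: measurable_fun_ler => //; exact: measurableT_comp.
Qed.

Lemma trunc_le tau x : 0 <= tau -> `|trunc tau x| <= tau.
Proof. by move=> t0; rewrite /trunc; case: ifP => // _; rewrite normr0. Qed.

Lemma bdm_trunc tau f : 0 <= tau -> measurable_fun setT f -> bdm (fun w => trunc tau (f w)).
Proof.
move=> t0 mf; split; last by exists tau => w; exact: trunc_le.
by apply: measurableT_comp => //; exact: trunc_meas.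
Qed.

Variables (q tau delta : R).
Hypotheses (q2 : 2 <= q) (tau0 : 0 < tau).

(* Normalised so that the tail weight dominates [1], [|x|/tau] and [(x/tau)^2] beyond [tau]. *)
Definition tailw (x : R) : R := `|x| `^ q / tau `^ q.

Definition tail_bound f := itg (fun w => tailw (f w)) /\ Ex P (fun w => tailw (f w)) <= delta.

Lemma tailw_ge0 x : 0 <= tailw x. Proof. by rewrite divr_ge0 ?powR_ge0. Qed.

Lemma tailw_gt x : tau < `|x| -> 1 <= tailw x /\ `|x| / tau <= tailw x /\ x ^+ 2 / tau ^+ 2 <= tailw x.
Proof.
move=> tx; have u1 : 1 <= `|x| / tau by rewrite ler_pdivlMr // mul1r ltW.
have u0 : 0 <= `|x| / tau by apply: le_trans u1.
have -> : tailw x = (`|x| / tau) `^ q.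
  by rewrite /tailw powRM ?invr_ge0 ?(ltW tau0) // -[tau^-1]powR_inv1 ?(ltW tau0) // -powRrM mulN1r powRN.
have e2 : x ^+ 2 / tau ^+ 2 = (`|x| / tau) `^ 2.
  by rewrite powR_mulrn // expr_div_n real_normK ?num_real.
have h1 : `|x| / tau <= (`|x| / tau) `^ q.
  by rewrite -{1}[`|x| / tau]powRr1 //; apply: ler_powR => //; have := q2; lra.
split; first exact: le_trans h1.
by split=> //; rewrite e2; apply: ler_powR.
Qed.

Lemma trunc_sub x : `|x - trunc tau x| <= tau * tailw x.
Proof.
rewrite /trunc; case: (leP `|x| tau) => h; rewrite ?subrr ?subr0.
  by rewrite normr0 mulr_ge0 ?tailw_ge0 // ltW.
by have [_ [h2 _]] := tailw_gt h; rewrite mulrC -ler_pdivrMr.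
Qed.

Lemma trunc_sqr x : trunc tau x ^+ 2 <= x ^+ 2 <= trunc tau x ^+ 2 + tau ^+ 2 * tailw x.
Proof.
rewrite /trunc; case: (leP `|x| tau) => h.
  by rewrite lexx /= lerDl mulr_ge0 ?tailw_ge0 ?sqr_ge0.
rewrite expr0n /= sqr_ge0 add0r /=.
by have [_ [_ h2]] := tailw_gt h; rewrite mulrC -ler_pdivrMr ?exprn_gt0.
Qed.

(** If the product changes, the larger of |x| and |y| exceeds tau; the product is then at most the
    square of the larger one, which its tail weight controls. *)
Lemma trunc_mul x y : `|x * y - trunc tau x * trunc tau y| <= tau ^+ 2 * tailw x + tau ^+ 2 * tailw y.
Proof.
have t20 : 0 <= tau ^+ 2 by exact: sqr_ge0.
have key a b : tau < `|a| -> `|b| <= `|a| -> `|a * b| <= tau ^+ 2 * tailw a.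
  move=> h ba; have [_ [_ h2]] := tailw_gt h.
  rewrite normrM; apply: (@le_trans _ _ (a ^+ 2)).
    by rewrite -real_normK ?num_real // expr2 ler_wpM2l.
  by rewrite mulrC -ler_pdivrMr ?exprn_gt0.
have wn z : 0 <= tau ^+ 2 * tailw z by rewrite mulr_ge0 ?tailw_ge0.
have wx := wn x; have wy := wn y.
have big : ~~ ((`|x| <= tau) && (`|y| <= tau)) -> `|x * y| <= tau ^+ 2 * tailw x + tau ^+ 2 * tailw y.
  rewrite negb_and -!ltNge => h; have [yx|xy] := leP `|y| `|x|.
    apply: le_trans (key x y _ yx) _; last by rewrite lerDl.
    by case/orP: h => // h; exact: lt_le_trans yx.
  rewrite mulrC; apply: le_trans (key y x _ (ltW xy)) _; last by rewrite lerDr.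
  by case/orP: h => // h; exact: lt_trans xy.
move: big; rewrite /trunc; case: (leP `|x| tau) => hx; case: (leP `|y| tau) => hy /= big.
- by rewrite subrr normr0 addr_ge0.
- by rewrite mulr0 subr0; exact: big.
- by rewrite mul0r subr0; exact: big.
- by rewrite mul0r subr0; exact: big.
Qed.

Lemma tail_prob f : measurable_fun setT f -> tail_bound f ->
  pgood P (fun w => `|f w| <= tau) delta.
Proof.
move=> mf [hi he]; exists [set w | (1 <= tailw (f w))%R]; split.
- exact: (measurable_geset 1 (itg_meas hi)).
- have mS := measurable_geset 1 (itg_meas hi).
  apply: (@le_trans _ _ (\int[P]_w (tailw (f w))%:E)%E); last by rewrite itgE // lee_fin.
  apply: (@le_trans _ _ (\int[P]_(w in [set w | (1 <= tailw (f w))%R]) 1%:E)%E).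
    by rewrite integral_cst // mul1e.
  apply: (@le_trans _ _ (\int[P]_(w in [set w | (1 <= tailw (f w))%R]) (tailw (f w))%:E)%E).
    apply: ge0_le_integral => //; try by move=> w _; rewrite lee_fin ?tailw_ge0.
      by apply/measurable_EFinP; apply: measurable_funTS; exact: itg_meas hi.
  apply: ge0_subset_integral => //; first by apply/measurable_EFinP; exact: itg_meas hi.
  by move=> w _; rewrite lee_fin tailw_ge0.
- by move=> w /= h; rewrite leNgt; apply/negP => /tailw_gt [h1 _]; exact: h.
Qed.

Let tau_n : 0 <= tau. Proof. exact: ltW. Qed.

Lemma itg_bdm f : bdm f -> itg f. Proof. exact: bdm_integrable. Qed.

Lemma sqr_itg f (v : R) : measurable_fun setT f -> ('E_P[fun w => (f w ^+ 2)%R] = v%:E)%E ->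
  itg (fun w => f w ^+ 2) /\ Ex P (fun w => f w ^+ 2) = v.
Proof.
move=> mf e; have [|||h _] := @itg_ge0 (fun w => f w ^+ 2) v; rewrite ?e //.
- exact: measurable_funX.
- by move=> w; exact: sqr_ge0.
by split => //; exact: expect_eq.
Qed.

Lemma trunc_mean f (v : R) : measurable_fun setT f -> tail_bound f ->
  ('E_P[fun w => (f w ^+ 2)%R] = v%:E)%E -> ('E_P[f] = 0)%E ->
  `|Ex P (fun w => trunc tau (f w))| <= tau * delta.
Proof.
move=> mf [hi he] e2 e1.
have [h2 _] := sqr_itg mf e2.
(* Integrability, needed for linearity, comes from |f| <= 1 + f^2. *)
have hf : itg f.
  apply: (itg_dom mf (itgD (itg_cst 1) h2).1) => w.
  rewrite -[f w ^+ 2]real_normK ?num_real //; have := sqr_ge0 (`|f w| - 1).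
  have -> : (`|f w| - 1) ^+ 2 = `|f w| ^+ 2 - 2 * `|f w| + 1 by ring.
  by have := normr_ge0 (f w); move: `|f w| => x; lra.
have ht := itg_bdm (bdm_trunc tau_n mf).
have hm := itgZ (-1) ht; have hd := itgD hf hm.1.
have e0 : Ex P f = 0 by apply: expect_eq.
have -> : `|Ex P (fun w => trunc tau (f w))| = `|Ex P (fun w => f w + -1 * trunc tau (f w))|.
  by rewrite hd.2 hm.2 e0 add0r mulN1r normrN.
apply: le_trans (itg_abs hd.1) _.
have hw := itgZ tau hi.
apply: (@le_trans _ _ (tau * Ex P (fun w => tailw (f w)))); last exact: ler_wpM2l.
rewrite -hw.2; apply: itg_le => //; first last.
- by move=> w; rewrite mulN1r; exact: trunc_sub.
- exact: hw.1.
- have := integrable_norm hd.1; by apply: eq_integrable => // w _ /=.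
Qed.

Lemma trunc_second f (v : R) : measurable_fun setT f -> tail_bound f ->
  ('E_P[fun w => (f w ^+ 2)%R] = v%:E)%E ->
  Ex P (fun w => trunc tau (f w) ^+ 2) <= v /\ `|Ex P (fun w => trunc tau (f w) ^+ 2) - v| <= tau * delta * tau.
Proof.
move=> mf [hi he] e2; have [h2 <-] := sqr_itg mf e2.
have ht := itg_bdm (bdm_sqr (bdm_trunc tau_n mf)).
have hw := itgZ (tau ^+ 2) hi; have hs := itgD ht hw.1.
have l1 : Ex P (fun w => trunc tau (f w) ^+ 2) <= Ex P (fun w => f w ^+ 2).
  by apply: itg_le => // w; case/andP: (trunc_sqr (f w)).
have l2 : Ex P (fun w => f w ^+ 2) <= Ex P (fun w => trunc tau (f w) ^+ 2) + tau ^+ 2 * delta.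
  apply: (@le_trans _ _ (Ex P (fun w => trunc tau (f w) ^+ 2 + tau ^+ 2 * tailw (f w)))).
    by apply: itg_le => //; [exact: hs.1 | move=> w; case/andP: (trunc_sqr (f w))].
  by rewrite hs.2 hw.2 lerD2l; apply: ler_wpM2l => //; exact: sqr_ge0.
split=> //; rewrite ler0_norm ?subr_le0 // opprB.
have -> : tau * delta * tau = tau ^+ 2 * delta by ring.
by lra.
Qed.

(** The model bounds the covariance from below only. The upper bound v is the arithmetic-geometric
    inequality for variables of equal second moment v. *)
Lemma trunc_cov f g (v lo : R) : measurable_fun setT f -> measurable_fun setT g -> tail_bound f -> tail_bound g ->
  ('E_P[fun w => (f w ^+ 2)%R] = v%:E)%E -> ('E_P[fun w => (g w ^+ 2)%R] = v%:E)%E ->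
  (lo%:E <= 'E_P[fun w => (f w * g w)%R])%E -> lo <= v ->
  `|Ex P (fun w => trunc tau (f w) * trunc tau (g w)) - v| <= (v - lo) + 2 * tau ^+ 2 * delta.
Proof.
move=> mf mg [hi he] [hi' he'] e2 e2' elo lov.
have [h2 E2] := sqr_itg mf e2; have [h2' E2'] := sqr_itg mg e2'.
have mfg : measurable_fun setT (fun w => f w * g w) by exact: measurable_funM.
have hs := itgD h2 h2'; have hh := itgZ 2^-1 hs.1.
have am w : `|f w * g w| <= 2^-1 * (f w ^+ 2 + g w ^+ 2).
  have -> : f w ^+ 2 + g w ^+ 2 = `|f w| ^+ 2 + `|g w| ^+ 2 by rewrite !real_normK ?num_real.
  by rewrite normrM; exact: mul_le_half_sqr.
have hfg : itg (fun w => f w * g w) := itg_dom mfg hh.1 am.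
have up : Ex P (fun w => f w * g w) <= v.
  apply: (@le_trans _ _ (Ex P (fun w => 2^-1 * (f w ^+ 2 + g w ^+ 2)))).
    by apply: itg_le => //; [exact: hh.1 | move=> w; exact: le_trans (ler_norm _) (am w)].
  by rewrite hh.2 hs.2 E2 E2' -mulr2n -[v *+ 2]mulr_natl mulKf // pnatr_eq0.
have low : lo <= Ex P (fun w => f w * g w) by rewrite -lee_fin -itgE //; move: elo; rewrite unlock.
have ht := itg_bdm (bdmM (bdm_trunc tau_n mf) (bdm_trunc tau_n mg)).
have hm := itgZ (-1) ht; have hd := itgD hfg hm.1.
have hw := itgZ (tau ^+ 2) hi; have hw' := itgZ (tau ^+ 2) hi'; have hww := itgD hw.1 hw'.1.
have t20 : 0 <= tau ^+ 2 by exact: sqr_ge0.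
have df : `|Ex P (fun w => f w * g w) - Ex P (fun w => trunc tau (f w) * trunc tau (g w))| <= 2 * tau ^+ 2 * delta.
  have <- : Ex P (fun w => f w * g w + -1 * (trunc tau (f w) * trunc tau (g w))) =
    Ex P (fun w => f w * g w) - Ex P (fun w => trunc tau (f w) * trunc tau (g w)).
    by rewrite hd.2 hm.2 mulN1r.
  apply: le_trans (itg_abs hd.1) _.
  apply: (@le_trans _ _ (Ex P (fun w => tau ^+ 2 * tailw (f w) + tau ^+ 2 * tailw (g w)))).
    apply: itg_le; [|exact: hww.1|by move=> w; rewrite mulN1r; exact: trunc_mul].
    have := integrable_norm hd.1; by apply: eq_integrable => // w _ /=.
  rewrite hww.2 hw.2 hw'.2.
  have -> : 2 * tau ^+ 2 * delta = tau ^+ 2 * delta + tau ^+ 2 * delta by ring.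
  by apply: lerD; exact: ler_wpM2l.
exact: dist_interval df low up.
Qed.

End Truncation.

(** * The correlated Wigner model *)

Section SpectralNorm.
Context {R : realType} {n : nat}.
Local Notation C := R[i].
Local Open Scope classical_set_scope.
Implicit Types M : 'M[R]_n.

Lemma vnorm_sqr (v : 'cV[R]_n) : vnorm v ^+ 2 = \sum_i v i 0 ^+ 2.
Proof. by rewrite sqr_sqrtr // sumr_ge0 // => i _; exact: sqr_ge0. Qed.

Lemma frob_bound M (v : 'cV[R]_n) : vnorm (M *m v) ^+ 2 <= (\sum_i \sum_j M i j ^+ 2) * vnorm v ^+ 2.
Proof.
rewrite !vnorm_sqr mulr_suml; apply: ler_sum => i _; rewrite mxE.
exact: cauchy_schwarz.
Qed.

(** A real supremum dominates its elements only if the set is bounded above; the Frobenius norm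
    supplies the bound. *)
Lemma specnorm_unit M (v : 'cV[R]_n) : vnorm v = 1 -> vnorm (M *m v) <= specnorm M.
Proof.
move=> v1; apply: ub_le_sup; last by exists v.
(* If x^2 <= F then x <= 1 + F, which avoids the square root of F. *)
exists (1 + \sum_i \sum_j M i j ^+ 2) => _ [u /= u1 <-].
have F0 : 0 <= \sum_i \sum_j M i j ^+ 2 by do 2! apply: sumr_ge0 => ? _; exact: sqr_ge0.
have := frob_bound M u; rewrite u1 expr1n mulr1; set F := \sum_i _ in F0 *.
have := sqr_ge0 (vnorm (M *m u) - 1); set x := vnorm _.
have -> : (x - 1) ^+ 2 = x ^+ 2 - 2 * x + 1 by ring.
by move=> h1 h2; have : 0 <= x by [exact: sqrtr_ge0]; lra.
Qed.

Lemma specnorm_vec M theta (v : 'cV[R]_n) : specnorm M <= theta ->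
  vnorm (M *m v) ^+ 2 <= theta ^+ 2 * vnorm v ^+ 2.
Proof.
move=> hM; have [v0|v0] := eqVneq (vnorm v) 0.
  by have := frob_bound M v; rewrite v0 expr0n /= !mulr0.
have vp : 0 < vnorm v by rewrite lt_neqAle eq_sym v0 sqrtr_ge0.
have nZ (a : R) (u : 'cV[R]_n) : vnorm (a *: u) ^+ 2 = a ^+ 2 * vnorm u ^+ 2.
  by rewrite !vnorm_sqr mulr_sumr; apply: eq_bigr => i _; rewrite mxE exprMn.
pose u := (vnorm v)^-1 *: v.
have u1 : vnorm u = 1.
  have : vnorm u ^+ 2 = 1 by rewrite nZ exprVn mulVf // expf_neq0.
  by move/eqP; rewrite sqrp_eq1 ?sqrtr_ge0 // => /eqP.
have h := le_trans (specnorm_unit M u1) hM.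
have -> : M *m v = vnorm v *: (M *m u) by rewrite /u -scalemxAr scalerA mulfV // scale1r.
rewrite nZ mulrC; apply: ler_wpM2r; first exact: sqr_ge0.
by rewrite lerXn2r ?nnegrE ?sqrtr_ge0 // (le_trans (sqrtr_ge0 _) h).
Qed.

Lemma specnorm_n2 M theta (v : 'cV[C]_n) : specnorm M <= theta ->
  n2 (toCm M *m v) <= theta ^+ 2 * n2 v.
Proof.
move=> hM; pose re : 'cV[R]_n := \col_i complex.Re (v i 0); pose im : 'cV[R]_n := \col_i complex.Im (v i 0).
have e0 : n2 v = vnorm re ^+ 2 + vnorm im ^+ 2.
  by rewrite !vnorm_sqr -big_split /=; apply: eq_bigr => i _; rewrite md_sqr !mxE.
have e1 : n2 (toCm M *m v) = vnorm (M *m re) ^+ 2 + vnorm (M *m im) ^+ 2.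
  rewrite !vnorm_sqr -big_split /=; apply: eq_bigr => i _; rewrite md_sqr !mxE Re_sum Im_sum.
  by congr (_ ^+ 2 + _ ^+ 2); apply: eq_bigr => j _; rewrite !mxE ?ReMr ?ImMr.
by rewrite e0 e1 mulrDr lerD // specnorm_vec.
Qed.

End SpectralNorm.

(** * Reduction to the identity permutation *)

Section Relabelling.
Context {R : realType} {n : nat}.
Variable pi : {perm 'I_n}.
Implicit Types A B V W : 'M[R]_n.

Definition conjp B : 'M[R]_n := \matrix_(i, j) B (pi i) (pi j).

Lemma conjpE B : perm_mx pi *m B *m (perm_mx pi)^T = conjp B.
Proof.
rewrite -row_permE; apply/matrixP => i j; rewrite [LHS]mxE (bigD1 (pi j)) //= big1 ?addr0.
  by rewrite !mxE eqxx mulr1.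
by move=> m mj; rewrite !mxE eq_sym (negbTE mj) mulr0.
Qed.

Lemma sum_perm (V : nmodType) (F : 'I_n -> V) : \sum_i F (pi i) = \sum_i F i.
Proof. by rewrite [RHS](reindex_inj (perm_inj (s := pi))). Qed.

Lemma spec_decomp_conjp B W mu : spec_decomp B W mu -> spec_decomp (conjp B) (row_perm pi W) mu.
Proof.
move=> [h1 h2]; split.
  rewrite -h1; apply/matrixP => i j; rewrite !mxE.
  under eq_bigr do rewrite !mxE; rewrite (sum_perm (fun m => W m i * W m j)).
  by apply: eq_bigr => m _; rewrite !mxE.
apply/matrixP => i j; rewrite mxE h2 !summxE; apply: eq_bigr => m _.
by rewrite !mxE !big_ord1 !mxE.
Qed.

(** The all-ones vector is invariant under relabelling, so conjugating B by the permutation only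
    permutes the columns of X. *)
Lemma Xmat_conjp eta V W lam mu k l : Xmat eta V (row_perm pi W) lam mu k l = Xmat eta V W lam mu k (pi l).
Proof.
rewrite !Xmat_entry; apply: eq_bigr => i _; apply: eq_bigr => j _.
rewrite mxE; congr (_ * (_ * (_ * _))); rewrite /colsum -(sum_perm (fun m => W m j)).
by apply: eq_bigr => m _; rewrite mxE.
Qed.

End Relabelling.

(** * Truncated entries of the model *)

Section WignerBound.
Context {d : measure_display} {T : measurableType d} {R : realType} (P : probability T R) {n : nat}.
Local Notation I := ('I_n * 'I_n)%type.
Local Open Scope classical_set_scope.
Variables (dd sigma Cm Cs c dl : R) (pi : {perm 'I_n}) (A B : T -> 'M[R]_n) (n0m : R -> nat).

Let p : R := ln n%:R.
Let K := 2 * (dl + 1).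
Let q := expR (- (dl * p)).
Let rho := Num.sqrt (n%:R^-1 * p).
Let CC := Num.max 1 Cm.

Definition cutoff : R := CC * expR dl * dd `^ (- 2^-1).
Local Notation tau := cutoff.

Hypothesis W : corr_wigner dd sigma pi P A B Cm Cs n0m.
Hypotheses (Cm0 : 0 < Cm) (Cs0 : 0 < Cs) (sig : 0 <= sigma <= 1) (dd0 : 0 < dd) (ddn : dd <= n%:R).
Hypotheses (dl30 : 30 <= dl) (c0 : 0 < c) (c1 : c <= 1) (t1 : tau <= 1).
Hypothesis small_tau : 100 ^+ 3 * K ^+ 4 * p ^+ 6 * tau <= c ^+ 3.
Hypothesis small_rho : 100 ^+ 3 * K ^+ 4 * p ^+ 6 * rho <= c ^+ 4.
Hypothesis large_p : 10 * K <= Num.sqrt p.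
Hypothesis n12 : (n0m 12 <= n)%N.

Let Z (ij : I) (w : T) : R * R := (A w ij.1 ij.2, B w (pi ij.1) (pi ij.2)).
Let At w : 'M[R]_n := \matrix_(i, j) trunc tau (A w i j).
Let Bt w : 'M[R]_n := \matrix_(i, j) trunc tau (conjp pi (B w) i j).

Let dl0 : 0 <= dl. Proof. by have := dl30; lra. Qed.
Let K2 : 60 <= K. Proof. by rewrite /K; have := dl30; lra. Qed.
Let nR : 0 < n%:R :> R. Proof. exact: lt_le_trans dd0 ddn. Qed.
Let n0 : (0 < n)%N. Proof. by have := nR; rewrite ltr0n. Qed.

Let p2 : 2 <= p.
Proof.
have s2 : 2 <= Num.sqrt p by have := large_p; have := K2; lra.
have pn : 0 <= p by rewrite leNgt; apply/negP => h; move: s2; rewrite ler0_sqrtr ?(ltW h) //; lra.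
rewrite -[p]sqr_sqrtr //; apply: (le_trans s2).
by rewrite expr2 -{1}[Num.sqrt p]mulr1 ler_wpM2l ?sqrtr_ge0 //; lra.
Qed.

Let p1 : 1 <= p. Proof. by have := p2; lra. Qed.
Let q0 : 0 <= q. Proof. exact: expR_ge0. Qed.

Let t0 : 0 < tau.
Proof. by rewrite /cutoff !mulr_gt0 ?expR_gt0 ?powR_gt0 // lt_max ltr01. Qed.

Let CC1 : 1 <= CC. Proof. by rewrite le_max lexx. Qed.

Let ntau : n%:R^-1 <= tau ^+ 2.
Proof.
have e1 : 1 <= CC * expR dl by rewrite -[1]mulr1; apply: ler_pM => //; rewrite -[1](expR0 R) ler_expR.
have dh : (dd `^ (- 2^-1)) ^+ 2 = dd^-1.
  by rewrite -powR_mulrn ?powR_ge0 // -powRrM mulNr mulVf // powR_inv1 // ltW.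
rewrite exprMn dh; apply: (@le_trans _ _ dd^-1); first by rewrite lef_pV2 ?posrE.
by rewrite ler_peMl ?invr_ge0 ?(ltW dd0) // exprn_ege1.
Qed.

Lemma expR_ln_n (k : nat) : expR (- (k%:R * p)) = n%:R^-1 ^+ k.
Proof. by rewrite expRN mulrC expRM_natr lnK ?posrE // exprVn. Qed.

Let q30 : q <= n%:R^-1 ^+ 30.
Proof.
rewrite -expR_ln_n /q ler_expR lerN2; apply: ler_wpM2r => //; exact: le_trans p1.
Qed.

Let iN : R := n%:R^-1.
Let iN0 : 0 <= iN. Proof. by rewrite invr_ge0 ltW. Qed.
Let iNc : iN <= 100^-1 /\ iN / c <= 1.
Proof.
have Y1 := Y_small p1; have Yn : 0 <= Ysm p by rewrite invr_ge0 mulr_ge0 ?exprn_ge0 // (le_trans _ p1).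
have Y2 : Ysm p <= 100^-1.
  by move: Y1; rewrite !exprS expr0 mulr1; lra.
have h0 := inv_n_pow dl0 p1 c0 c1 small_rho (j := 0) isT; rewrite expr0 divr1 in h0.
have h1 := inv_n_pow dl0 p1 c0 c1 small_rho (j := 1) isT; rewrite expr1 in h1.
by split; [exact: le_trans Y2 | apply: le_trans h1 _; lra].
Qed.

Let iN1 : iN <= 1. Proof. by have [h _] := iNc; lra. Qed.

(** The moment of order p = ln n is among those assumed: p >= 2 gives ln p >= 1 - 1 / p >= 1/2, so
    the exponent 10 ln p is at least 1. *)
Let pk : p <= ln n%:R `^ (10 * ln (ln n%:R)).
Proof.
have pp : 0 < p by apply: lt_le_trans p1.
have h : 1 <= 10 * ln p.
  have := expR_ge1Dx (- ln p); rewrite expRN lnK ?posrE // => h.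
  have : p^-1 <= 2^-1 by rewrite lef_pV2 ?posrE.
  by lra.
by rewrite -{1}[p]powRr1 ?(ltW pp) //; apply: ler_powR.
Qed.

(** Dividing the moment of order p by tau^p cancels the powers of C and leaves exp(-dl p) d / n,
    hence at most n^-dl since p = ln n and d <= n. The factor exp(dl) in [cutoff] is there for
    this. *)
Lemma tail_wigner (f : T -> R) : measurable_fun setT f ->
  ('E_P[fun w => (`|f w| `^ p)%R] <= (Cm `^ p / (n%:R * dd `^ ((p - 2) / 2)))%:E)%E ->
  tail_bound P p tau q f.
Proof.
move=> mf hE.
have [|||hi he] := @itg_ge0 _ _ _ P (fun w => `|f w| `^ p) (Cm `^ p / (n%:R * dd `^ ((p - 2) / 2))) => //.
  by apply: (measurableT_comp (measurable_powR p)); exact: measurableT_comp.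
have [hi' he'] := itgZ ((tau `^ p)^-1) hi.
have eqf : (fun w => tailw p tau (f w)) = (fun w => (tau `^ p)^-1 * `|f w| `^ p).
  by apply/funext => w; rewrite /tailw mulrC.
rewrite /tail_bound eqf; split => //; rewrite he'.
have tp0 : 0 < tau `^ p by exact: powR_gt0.
rewrite ler_pdivrMl //; apply: (le_trans he).
have pp : 0 <= p by apply: le_trans p1.
have CCn : 0 <= CC by apply: le_trans CC1.
have -> : tau `^ p * q = CC `^ p * (dd `^ ((p - 2) / 2))^-1 * dd^-1.
  rewrite /cutoff !powRM ?mulr_ge0 ?expR_ge0 ?powR_ge0 // -expRM -powRrM /q expRN.
  have -> : - 2^-1 * p = - ((p - 2) / 2) + (- 1) by field.
  rewrite powRD; last by rewrite (gt_eqF dd0) implybT.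
  rewrite powRN powR_inv1 ?(ltW dd0) //; field.
  by rewrite !gt_eqF ?powR_gt0 ?expR_gt0.
rewrite invfM mulrA mulrAC -!mulrA; apply: ler_pM; rewrite ?powR_ge0 //.
- by rewrite mulr_ge0 // invr_ge0 ?powR_ge0 // ltW.
- by apply: ge0_ler_powR; rewrite ?nnegrE ?(ltW Cm0) // le_max lexx orbT.
- by apply: ler_wpM2l; rewrite ?invr_ge0 ?powR_ge0 // lef_pV2 ?posrE.
Qed.

Let mAB i j : measurable_fun setT (fun w => A w i j) /\ measurable_fun setT (fun w => B w i j).
Proof. by case: W => _ [h _]; exact: h. Qed.

Let mZ ij : measurable_fun setT (Z ij).
Proof. by apply: measurable_fun_pair; [exact: (mAB _ _).1 | exact: (mAB _ _).2]. Qed.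

Let indZ (S : I -> set (R * R)) : (forall i, measurable (S i)) ->
  fine (P (\bigcap_(i in [set i | ordp i]) (Z i @^-1` S i))) = \prod_(i | ordp i) fine (P (Z i @^-1` S i)).
Proof.
case: W => _ [_ [h _]] mS; have := h (fun i j => S (i, j)) (fun i j => mS (i, j)).
have e ij : [set w | (A w ij.1 ij.2, B w (pi ij.1) (pi ij.2)) \in S (ij.1, ij.2)] = Z ij @^-1` S ij.
  by case: ij => i j; apply/seteqP; split => w /=; rewrite inE.
have -> : \bigcap_(ij in [set ij : I | (ij.1 <= ij.2)%N]) [set w | (A w ij.1 ij.2, B w (pi ij.1) (pi ij.2)) \in S (ij.1, ij.2)] =
   \bigcap_(i in [set i | ordp i]) (Z i @^-1` S i).
  by apply: eq_bigcapr => ij _; exact: e.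
by move=> ->; apply: eq_bigr => ij _; rewrite e.
Qed.

Let symA w i j : A w i j = A w j i.
Proof. by case: W => h _; rewrite -{1}(h w).1 mxE. Qed.
Let symB w i j : B w i j = B w j i.
Proof. by case: W => h _; rewrite -{1}(h w).2 mxE. Qed.

Let sAt w : (At w)^T = At w. Proof. by apply/matrixP => i j; rewrite !mxE symA. Qed.
Let sBt w : (Bt w)^T = Bt w. Proof. by apply/matrixP => i j; rewrite !mxE symB. Qed.

Let AtZ i j : exists2 h, measurable_fun setT h & forall w, At w i j = h (Z (upair i j) w).
Proof.
exists (fun x : R * R => trunc tau x.1); first by apply: measurableT_comp => //; exact: trunc_meas.
by move=> w; rewrite mxE /upair /Z; case: ifP => _ //=; rewrite symA.
Qed.

Let BtZ i j : exists2 h, measurable_fun setT h & forall w, Bt w i j = h (Z (upair i j) w).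
Proof.
exists (fun x : R * R => trunc tau x.2); first by apply: measurableT_comp => //; exact: trunc_meas.
by move=> w; rewrite !mxE /upair /Z; case: ifP => _ //=; rewrite symB.
Qed.

Let Atau w i j : `|At w i j| <= tau. Proof. by rewrite mxE trunc_le // ltW. Qed.
Let Btau w i j : `|Bt w i j| <= tau. Proof. by rewrite mxE trunc_le // ltW. Qed.

Let tailA i j : tail_bound P p tau q (fun w => A w i j).
Proof.
apply: tail_wigner (mAB i j).1 _.
by case: W => _ [_ [_ [_ [_ [h _]]]]]; exact: (h i j p p2 pk).1.
Qed.

Let tailB i j : tail_bound P p tau q (fun w => B w i j).
Proof.
apply: tail_wigner (mAB i j).2 _.
by case: W => _ [_ [_ [_ [_ [h _]]]]]; exact: (h i j p p2 pk).2.
Qed.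

Let meanA i j : ('E_P[fun w => A w i j] = 0)%E. Proof. by case: W => _ [_ [_ [h _]]]; exact: (h i j).1. Qed.
Let meanB i j : ('E_P[fun w => B w i j] = 0)%E. Proof. by case: W => _ [_ [_ [h _]]]; exact: (h i j).2. Qed.
Let varA i j : i != j -> ('E_P[fun w => (A w i j ^+ 2)%R] = (n%:R^-1)%:E)%E.
Proof. by case: W => _ [_ [_ [_ [h _]]]] ij; exact: (h i j ij).1. Qed.
Let varB i j : i != j -> ('E_P[fun w => (B w (pi i) (pi j) ^+ 2)%R] = (n%:R^-1)%:E)%E.
Proof. by case: W => _ [_ [_ [_ [h _]]]] ij; apply: (h (pi i) (pi j) _).2; rewrite (inj_eq perm_inj). Qed.

Let nu := tau * q.
Let nu0 : 0 <= nu. Proof. by rewrite mulr_ge0 // ltW. Qed.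

Let qn2 : q * n%:R ^+ 2 <= 1.
Proof.
apply: (@le_trans _ _ (iN ^+ 30 * n%:R ^+ 2)); first by apply: ler_wpM2r; rewrite ?sqr_ge0.
have -> : iN ^+ 30 * n%:R ^+ 2 = iN ^+ 28 by rewrite /iN; field; rewrite gt_eqF.
exact: exprn_ile1.
Qed.

Let nut : nu * n%:R ^+ 2 <= tau.
Proof. by rewrite /nu -mulrA ler_piMr // ltW. Qed.

Let EA i j : i != j -> `|Ex P (fun w => At w i j)| <= nu.
Proof.
by move=> ij; under eq_fun do rewrite mxE; have h := trunc_mean p2 t0 (mAB i j).1 (tailA i j) (varA ij) (meanA i j); exact: h.
Qed.
Let EB i j : i != j -> `|Ex P (fun w => Bt w i j)| <= nu.
Proof.
move=> ij; under eq_fun do rewrite !mxE.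
have h := trunc_mean p2 t0 (mAB _ _).2 (tailB _ _) (varB ij) (meanB _ _); exact: h.
Qed.
Let EA2 i j : i != j -> Ex P (fun w => At w i j ^+ 2) <= n%:R^-1 /\ `|Ex P (fun w => At w i j ^+ 2) - n%:R^-1| <= nu * tau.
Proof.
by move=> ij; under eq_fun do rewrite mxE; have h := trunc_second p2 t0 (mAB i j).1 (tailA i j) (varA ij); exact: h.
Qed.
Let EB2 i j : i != j -> Ex P (fun w => Bt w i j ^+ 2) <= n%:R^-1 /\ `|Ex P (fun w => Bt w i j ^+ 2) - n%:R^-1| <= nu * tau.
Proof.
move=> ij; under eq_fun do rewrite !mxE.
have h := trunc_second p2 t0 (mAB _ _).2 (tailB _ _) (varB ij); exact: h.
Qed.

Let xi := sigma ^+ 2 / n%:R + 2 * tau ^+ 2 * q.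
Let xi0 : 0 <= xi.
Proof. by rewrite addr_ge0 // ?divr_ge0 ?sqr_ge0 ?(ltW nR) // mulr_ge0 // mulr_ge0 ?sqr_ge0. Qed.

Let eexi k j : `|ecov P At Bt k j - n%:R^-1| <= xi.
Proof.
rewrite /ecov; case: eqVneq => [_|kj]; first by rewrite subrr normr0.
under eq_fun do rewrite !mxE.
have cov : (((1 - sigma ^+ 2) / n%:R)%:E <= 'E_P[fun w => (A w k j * B w (pi k) (pi j))%R])%E.
  by case: W => _ [_ [_ [_ [_ [_ [h _]]]]]]; exact: h.
have lov : (1 - sigma ^+ 2) / n%:R <= n%:R^-1 by rewrite ler_piMl // lerBlDr lerDl sqr_ge0.
have := trunc_cov p2 t0 (mAB k j).1 (mAB _ _).2 (tailA k j) (tailB _ _) (varA kj) (varB kj) cov lov.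
by have -> : n%:R^-1 - (1 - sigma ^+ 2) / n%:R = sigma ^+ 2 / n%:R by ring.
Qed.

Let op_event : pgood P (fun w => specnorm (A w - conjp pi (B w)) <= Cs * sigma) (iN ^+ 12).
Proof.
case: W => _ [_ [_ [_ [_ [_ [_ h]]]]]].
have [|F [mF [FE PF]]] := h 12 _ n12; first by [].
exists (~` F); split; first exact: measurableC.
- rewrite probability_setC // leeBlDr ?fin_num_measure //.
  have e : n%:R `^ (- 12) = iN ^+ 12 :> R by rewrite powRN (powR_mulrn 12) ?(ltW nR) // exprVn.
  rewrite e in PF; apply: le_trans (leeD (lexx _) PF); rewrite -EFinD lee_fin.
  by rewrite addrC subrK.
- by move=> w /contrapT /FE /=; rewrite conjpE.
Qed.

Let entries : pgood P (fun w => forall ij : I, `|A w ij.1 ij.2| <= tau /\ `|B w ij.1 ij.2| <= tau)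
  (n%:R ^+ 2 * (q + q)).
Proof.
have -> : n%:R ^+ 2 = #|{: I}|%:R :> R by rewrite card_prod card_ord natrM expr2.
by apply: pgood_all => ij; apply: pgood_and;
  [exact: (tail_prob p2 t0 (mAB _ _).1 (tailA _ _)) | exact: (tail_prob p2 t0 (mAB _ _).2 (tailB _ _))].
Qed.

Definition bn_of : nat := (Num.truncn (p ^+ 3 / c ^+ 2)).+1.

Lemma wigner_bound : pgood P (fun w => forall V U lam mu,
  spec_decomp (A w) V lam -> spec_decomp (B w) U mu ->
  forall k l, `|Xmat (2 * c) V U lam mu k (pi l) - (if k == l then (2 * c)^-1 else 0)| <=
    600 * K ^+ 2 * (p / Num.sqrt c) + (if k == l then 80 * (sigma ^+ 2 / c) + 160 * (Cs * sigma / c ^+ 2) +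
      100 * K / (Num.sqrt p * c) + 172 else 0)) (iN ^+ 10).
Proof.
have x1 : 1 <= p ^+ 3 / c ^+ 2.
  rewrite ler_pdivlMr ?exprn_gt0 // mul1r; apply: (@le_trans _ _ 1); last exact: exprn_ege1.
  by rewrite exprn_ile1 // ltW.
have x0 : 0 <= p ^+ 3 / c ^+ 2 by apply: le_trans x1.
have [tr1 tr2] := andP (truncn_itv x0).
have bn_ge : p ^+ 3 / c ^+ 2 <= bn_of%:R by exact: ltW.
have bn_le : bn_of%:R <= 2 * p ^+ 3 / c ^+ 2.
  rewrite /bn_of -natr1 -mulrA; lra.
have X := X_random mZ indZ n0 dl0 p1 c0 c1 t0 t1 nu0 nut ntau small_tau small_rho large_p bn_ge bn_le
  sAt sBt AtZ BtZ Atau Btau EA EB (fun i j h => (EA2 h).1) (fun i j h => (EB2 h).1)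
  (fun i j h => (EA2 h).2) (fun i j h => (EB2 h).2) xi0 eexi.
have := pgood_and X (pgood_and op_event entries).
apply: pgood_imp; last first.
  have [h100 _] := iNc.
  have pw (i j : nat) : (i <= j)%N -> iN ^+ j <= iN ^+ i by move=> ij; exact: ler_wiXn2l.
  have e1 : 100 * 3 * n%:R ^+ 15 * q <= 100 * 3 * (iN * iN * iN ^+ 12).
    rewrite -mulrA; apply: ler_wpM2l => //.
    apply: (@le_trans _ _ (n%:R ^+ 15 * iN ^+ 30)); first by apply: ler_wpM2l; rewrite ?exprn_ge0 ?(ltW nR).
    have -> : n%:R ^+ 15 * iN ^+ 30 = iN ^+ 15 by rewrite /iN; field; rewrite gt_eqF.
    by rewrite -mulrA -!exprS; exact: pw.
  have e2 : n%:R ^+ 2 * (q + q) <= 2 * iN ^+ 12.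
    apply: (@le_trans _ _ (2 * (n%:R ^+ 2 * iN ^+ 30))).
      have -> : n%:R ^+ 2 * (q + q) = 2 * (n%:R ^+ 2 * q) by ring.
      by apply: ler_wpM2l => //; apply: ler_wpM2l; rewrite ?exprn_ge0 ?(ltW nR).
    have -> : n%:R ^+ 2 * iN ^+ 30 = iN ^+ 28 by rewrite /iN; field; rewrite gt_eqF.
    by apply: ler_wpM2l => //; exact: pw.
  have n12' : 0 <= iN ^+ 12 by exact: exprn_ge0.
  have i2 : iN * iN <= 100^-1 * 100^-1 by apply: ler_pM.
  have e3 : iN * iN * iN ^+ 12 <= 100^-1 * 100^-1 * iN ^+ 12 by apply: ler_wpM2r.
  have e4 : iN ^+ 12 <= 100^-1 * 100^-1 * iN ^+ 10.
    by rewrite (exprD iN 2 10) expr2; apply: ler_wpM2r => //; exact: exprn_ge0.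
  have n10' : 0 <= iN ^+ 10 by exact: exprn_ge0.
  apply: le_trans (lerD e1 (lerD (lexx _) e2)) _.
  move: e3 e4 n12' n10'; move: (iN * iN * iN ^+ 12) (iN ^+ 12) (iN ^+ 10) => a1 a2 a3; lra.
move=> w [hX [hop hent]] V U lam mu sdA sdB k l.
(* On this event no entry exceeds the cutoff, so truncation changes nothing and the bound proved for
   the truncated matrices holds for A and the relabelled B. *)
have eA : At w = A w.
  by apply/matrixP => i j; rewrite mxE /trunc (hent (i, j)).1.
have eB : Bt w = conjp pi (B w).
  by apply/matrixP => i j; rewrite !mxE /trunc (hent (pi i, pi j)).2.
have [s0 s1] := andP sig.
have th0 : 0 <= Cs * sigma by rewrite mulr_ge0 // ltW.
have sdA' : spec_decomp (At w) V lam by rewrite eA.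
have sdB' : spec_decomp (Bt w) (row_perm pi U) mu by rewrite eB; exact: spec_decomp_conjp.
have opAB v : n2 (toCm (At w - Bt w) *m v) <= (Cs * sigma) ^+ 2 * n2 v by rewrite eA eB; exact: specnorm_n2.
have := hX _ _ _ _ _ th0 sdA' sdB' opAB k l; rewrite Xmat_conjp => h.
apply: (le_trans h); rewrite lerD2l; case: (k == l) => //.
have hx : 80 * xi * (n%:R / c) <= 80 * (sigma ^+ 2 / c) + 160.
  have -> : 80 * xi * (n%:R / c) = 80 * (sigma ^+ 2 / c) + 160 * (tau ^+ 2 * (q * n%:R ^+ 2) * (iN / c)).
    by rewrite /xi /iN; field; rewrite !gt_eqF.
  have qn0 : 0 <= q * n%:R ^+ 2 by rewrite mulr_ge0 ?sqr_ge0.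
  have tq0 : 0 <= tau ^+ 2 * (q * n%:R ^+ 2) by rewrite mulr_ge0 ?sqr_ge0.
  have tq1 : tau ^+ 2 * (q * n%:R ^+ 2) <= 1 * 1.
    by apply: ler_pM; rewrite ?sqr_ge0 // exprn_ile1 // ltW.
  have h2 : tau ^+ 2 * (q * n%:R ^+ 2) * (iN / c) <= 1 * 1 * 1.
    by apply: ler_pM => //; [rewrite divr_ge0 // ltW | exact: iNc.2].
  by move: h2; rewrite !mulr1; move: (_ * (iN / c)) => x h2; lra.
rewrite -/K -/p; move: hx; set a := 80 * xi * _; set b := 80 * (sigma ^+ 2 / c).
set c' := 160 * (Cs * sigma / c ^+ 2); set e := 100 * K / _; lra.
Qed.

End WignerBound.

(** * How large n must be *)

Section Thresholds.
Context {R : realType}.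
Variables (a c0 Cm K dl : R).
Hypotheses (a0 : 0 < a) (c0a : Num.max (32 + 4 * a) (4 + 7 * a) < c0) (K1 : 1 <= K).

Let CC := Num.max 1 Cm.
(** Since tau is of order p^(-c0/2), p^6 tau is of order p^-s p^(-3a), so s is the exponent left to
    beat the constants once c^3 is matched. The exponent b is chosen so that p^7 / p^b = p^-1
    p^(-4a). The factors 8 and 16 are 2^3 and 2^4, from c = eta / 2. *)
Let s := c0 / 2 - 6 - 3 * a.
Let b := 8 + 4 * a.
Let M1 := 8 * (100 ^+ 3 * K ^+ 4 * (CC * expR dl)).
Let M2 := 16 * (100 ^+ 3 * K ^+ 4 * (2 * b) `^ b).

Definition pmin : R := 1 + (10 * K) ^+ 2 + M1 `^ s^-1 + M2.

(** One third of the first lower bound on c0 plus two thirds of the second gives c0 > 40/3 + 6 a,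
    more than the required 12 + 6 a. *)
Let s0 : 0 < s.
Proof. by move: c0a; rewrite gt_max => /andP[h1 h2]; rewrite /s; lra. Qed.
Let b0 : 0 < b. Proof. by rewrite /b; have := a0; lra. Qed.
Let Kn : 0 <= K. Proof. by have := K1; lra. Qed.
Let CC1 : 1 <= CC. Proof. by rewrite le_max lexx. Qed.
Let CCn : 0 <= CC. Proof. exact: le_trans CC1. Qed.
Let M1n : 0 <= M1. Proof. by rewrite /M1; have h := expR_ge0 dl; nonneg. Qed.
Let M2n : 0 <= M2. Proof. by rewrite /M2; have h := powR_ge0 (2 * b) b; nonneg. Qed.

Variables (n : nat) (eta dd : R).
Let p : R := ln n%:R.
Hypotheses (pp : pmin <= p) (adm : admissible a c0 n eta dd).

Let sq0 : 0 <= (10 * K) ^+ 2. Proof. exact: sqr_ge0. Qed.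
Let w0 : 0 <= M1 `^ s^-1. Proof. exact: powR_ge0. Qed.
Let p1 : 1 <= p. Proof. by have := pp; rewrite /pmin; have := sq0; have := w0; have := M2n; lra. Qed.
Let p0 : 0 < p. Proof. exact: lt_le_trans p1. Qed.

Lemma thr_sqrt : 10 * K <= Num.sqrt p.
Proof.
rewrite -[10 * K]ger0_norm; last by nonneg.
rewrite -sqrtr_sqr ler_wsqrtr //.
by have := pp; rewrite /pmin; have := w0; have := M2n; lra.
Qed.

Let eta_ge : p `^ (- a) <= eta. Proof. by case: adm. Qed.

Lemma eta_gt0 : 0 < eta. Proof. by apply: lt_le_trans eta_ge; exact: powR_gt0. Qed.
Lemma dd_gt0 : 0 < dd. Proof. by case: adm => _ _ h _; apply: lt_le_trans h; exact: powR_gt0. Qed.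

Lemma c_pow (k : nat) : p `^ (- (k%:R * a)) <= 2 ^+ k * (eta / 2) ^+ k.
Proof.
have -> : 2 ^+ k * (eta / 2) ^+ k = eta ^+ k by rewrite -exprMn; congr (_ ^+ _); field.
have -> : - (k%:R * a) = - a * k%:R by ring.
rewrite powRrM powR_mulrn ?powR_ge0 // lerXn2r ?nnegrE ?powR_ge0 //.
exact: ltW eta_gt0.
Qed.

Lemma thr_tau : 100 ^+ 3 * K ^+ 4 * p ^+ 6 * cutoff dd Cm dl <= (eta / 2) ^+ 3.
Proof.
have h1 : dd `^ (- 2^-1) <= p `^ (- (c0 / 2)).
  rewrite !powRN lef_pV2 ?posrE ?powR_gt0 ?dd_gt0 // powRrM; apply: ge0_ler_powR; rewrite ?nnegrE ?powR_ge0 ?(ltW dd_gt0) //.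
  by case: adm.
have h2 : M1 <= p `^ s.
  have -> : M1 = (M1 `^ s^-1) `^ s by rewrite -powRrM mulVf ?gt_eqF // powRr1.
  apply: ge0_ler_powR; rewrite ?nnegrE ?powR_ge0 ?(ltW s0) ?(ltW p0) //.
  by have := pp; rewrite /pmin; have := sq0; have := M2n; lra.
have e1 : p ^+ 6 * p `^ (- (c0 / 2)) = (p `^ s)^-1 * p `^ (- (3%:R * a)).
  rewrite -powR_mulrn ?(ltW p0) // -powRN -!powRD ?(gt_eqF p0) ?implybT //.
  by congr (_ `^ _); rewrite /s; ring.
have h3 := c_pow 3.
have ps : 0 < p `^ s by exact: powR_gt0.
have u : 0 <= 100 ^+ 3 * K ^+ 4 * (CC * expR dl) by have h := expR_ge0 dl; nonneg.
apply: (@le_trans _ _ (100 ^+ 3 * K ^+ 4 * (CC * expR dl) * (p ^+ 6 * p `^ (- (c0 / 2))))).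
  have -> : 100 ^+ 3 * K ^+ 4 * p ^+ 6 * cutoff dd Cm dl =
     100 ^+ 3 * K ^+ 4 * (CC * expR dl) * (p ^+ 6 * dd `^ (- 2^-1)) by rewrite /cutoff -/CC; ring.
  by apply: ler_wpM2l => //; apply: ler_wpM2l => //; rewrite exprn_ge0 // ltW.
rewrite e1 mulrA.
have h4 : 100 ^+ 3 * K ^+ 4 * (CC * expR dl) * (p `^ s)^-1 <= 8^-1.
  by rewrite ler_pdivrMr //; move: h2; rewrite /M1; move: (_ * (CC * expR dl)) (p `^ s) => x y; lra.
apply: (@le_trans _ _ (8^-1 * (2 ^+ 3 * (eta / 2) ^+ 3))).
  by apply: ler_pM => //; rewrite ?powR_ge0 // mulr_ge0 // invr_ge0 ltW.
by rewrite le_eqVlt; apply/orP; left; apply/eqP; field.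
Qed.

(** The exponential beats every power of p: sqrt n = exp(p / 2) is the b-th power of exp(p / (2 b)),
    which exceeds p / (2 b). *)
Lemma thr_rho : 100 ^+ 3 * K ^+ 4 * p ^+ 6 * Num.sqrt (n%:R^-1 * p) <= (eta / 2) ^+ 4.
Proof.
have nR : 0 < n%:R :> R.
  rewrite ltr0n lt0n; apply/eqP => n0; have := p1; rewrite /p n0 ln0 //; lra.
have en : n%:R = expR p by rewrite lnK.
have sn : Num.sqrt n%:R = expR (p / 2).
  by rewrite en -[RHS]ger0_norm ?expR_ge0 // -sqrtr_sqr expr2 -expRD; congr (Num.sqrt (expR _)); field.
have sn0 : 0 < Num.sqrt n%:R :> R by rewrite sn expR_gt0.
have low : (p / (2 * b)) `^ b <= Num.sqrt n%:R.
  have -> : Num.sqrt n%:R = expR (p / (2 * b)) `^ b.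
    by rewrite sn -expRM; congr expR; field; rewrite gt_eqF.
  apply: ge0_ler_powR; rewrite ?nnegrE ?expR_ge0 ?(ltW b0) //.
    by rewrite divr_ge0 ?(ltW p0) // mulr_ge0 // ltW.
  by apply: le_trans (expR_ge1Dx _); rewrite lerDr.
have b20 : 0 < 2 * b by rewrite mulr_gt0.
have q0 : 0 < (p / (2 * b)) `^ b by rewrite powR_gt0 // divr_gt0.
have hs : Num.sqrt p <= p.
  rewrite -{2}(ger0_norm (ltW p0)) -sqrtr_sqr ler_wsqrtr // expr2.
  by rewrite -{1}[p]mulr1 ler_wpM2l // ltW.
have e1 : p ^+ 7 / (p / (2 * b)) `^ b = (2 * b) `^ b * p^-1 * p `^ (- (4%:R * a)).
  have ex : (p / (2 * b)) `^ b = p `^ b * ((2 * b) `^ b)^-1.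
    rewrite powRM ?invr_ge0 ?(ltW p0) ?(ltW b20) //; congr (_ * _).
    by rewrite -[(2 * b)^-1]powR_inv1 ?(ltW b20) // -powRrM mulN1r powRN.
  have ep : p ^+ 7 * (p `^ b)^-1 = p^-1 * p `^ (- (4%:R * a)).
    rewrite -[p^-1]powR_inv1 ?(ltW p0) // -powR_mulrn ?(ltW p0) // -powRN -!powRD ?(gt_eqF p0) ?implybT //.
    by congr (_ `^ _); rewrite /b; ring.
  rewrite ex invfM invrK mulrA ep; ring.
have u : 0 <= 100 ^+ 3 * K ^+ 4 by nonneg.
have hq : Num.sqrt (n%:R^-1 * p) <= p / (p / (2 * b)) `^ b.
  rewrite mulrC sqrtrM ?(ltW p0) // sqrtrV ?(ltW nR) //; apply: ler_pM; rewrite ?invr_ge0 ?sqrtr_ge0 //.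
  by rewrite lef_pV2 ?posrE.
apply: (@le_trans _ _ (100 ^+ 3 * K ^+ 4 * (p ^+ 7 / (p / (2 * b)) `^ b))).
  rewrite -mulrA; apply: ler_wpM2l => //.
  have -> : p ^+ 7 / (p / (2 * b)) `^ b = p ^+ 6 * (p / (p / (2 * b)) `^ b) by ring.
  by apply: ler_wpM2l => //; rewrite exprn_ge0 // ltW.
rewrite e1; have h3 := c_pow 4.
have hM : M2 <= p by have := pp; rewrite /pmin; have := sq0; have := w0; lra.
have h4 : 100 ^+ 3 * K ^+ 4 * ((2 * b) `^ b * p^-1) <= 16^-1.
  rewrite mulrA ler_pdivrMr //; move: hM; rewrite /M2; move: (_ * (2 * b) `^ b) => x; lra.
have hw : 0 <= (2 * b) `^ b * p^-1 by rewrite mulr_ge0 ?powR_ge0 // invr_ge0 ltW.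
apply: (@le_trans _ _ (16^-1 * (2 ^+ 4 * (eta / 2) ^+ 4))).
  rewrite mulrA; apply: ler_pM => //; rewrite ?powR_ge0 //; exact: mulr_ge0.
by rewrite le_eqVlt; apply/orP; left; apply/eqP; field.
Qed.

Lemma thr_cutoff : 0 < eta <= 1 -> 0 < cutoff dd Cm dl -> cutoff dd Cm dl <= 1.
Proof.
move=> /andP[e0 e1] t0; have h := thr_tau.
have h2 : (eta / 2) ^+ 3 <= 1 by apply: exprn_ile1; lra.
apply: le_trans (le_trans h h2); rewrite ler_peMl ?(ltW t0) //.
rewrite -[1]mulr1; apply: ler_pM => //; last exact: exprn_ege1.
by rewrite -[1]mulr1; apply: ler_pM => //; apply: exprn_ege1 => //; lra.
Qed.

End Thresholds.

Section LargeLogarithm.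
Context {R : realType}.

Definition nmin (x : R) : nat := (Num.truncn (expR x)).+1.

Lemma nmin_ln (x : R) (n : nat) : (nmin x <= n)%N -> x <= ln n%:R.
Proof.
move=> h; rewrite -[x]expRK; have [_ t2] := andP (truncn_itv (expR_ge0 x)).
have e : expR x <= n%:R by apply: (le_trans (ltW t2)); rewrite ler_nat.
by rewrite ler_ln ?posrE ?expR_gt0 // (lt_le_trans (expR_gt0 x)).
Qed.

Lemma inv_sqrt_ln_small (eps : R) : 0 < eps -> exists N : nat, forall n : nat, (N <= n)%N ->
  `|(Num.sqrt (ln n%:R : R))^-1| <= eps.
Proof.
move=> e0; exists (nmin (eps^-1 ^+ 2)) => n /nmin_ln h.
have ei : 0 < eps^-1 by rewrite invr_gt0.
rewrite ger0_norm ?invr_ge0 ?sqrtr_ge0 // -[leRHS]invrK lef_pV2 ?posrE //.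
  by rewrite -[eps^-1]ger0_norm ?(ltW ei) // -sqrtr_sqr ler_wsqrtr.
by rewrite sqrtr_gt0; apply: lt_le_trans h; rewrite exprn_gt0.
Qed.

End LargeLogarithm.

(** The bilinear estimate carries ln n to the first power, and (ln n)^kappa dominates it as soon as
    kappa >= 1. *)
Lemma main_conclusion (R : realType) (a kappa c0 Cm Cs : R) (n0m : R -> nat) (oK : option R) :
  0 < a -> 0 < Cm -> 0 < Cs -> Num.max (32 + 4 * a) (4 + 7 * a) < c0 -> 1 <= kappa ->
  thm_conclusion a kappa c0 Cm Cs n0m oK.
Proof.
move=> a0 Cm0 Cs0 c0a k1.
(* The union bound costs n^15 up to a constant and single failures have probability n^-30, which
   leaves ample room below n^-10. *)
pose dl : R := 30; pose K : R := 2 * (dl + 1).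
have K1 : 1 <= K by rewrite /K /dl; lra.
have K60 : 60 <= K by rewrite /K /dl; lra.
have K20 : 0 < K ^+ 2 by rewrite exprn_gt0 //; lra.
(* The rate r is that of the averaged law over blocks, (ln n)^(-1/2). Taking [n0m] at 12 makes the
   spectral norm bound fail with probability at most n^-12, again with room below n^-10. *)
exists (60 * 60 * (K ^+ 2 + Cs)), (maxn (nmin (pmin a c0 Cm K dl)) (n0m 12)), (fun n _ _ => (Num.sqrt (ln n%:R))^-1).
have KK : K <= K ^+ 2 by rewrite expr2 ler_peMl //; lra.
have C0 : 0 < 60 * 60 * (K ^+ 2 + Cs) by apply: mulr_gt0; [exact: mulr_gt0 | exact: addr_gt0].
split; first exact: C0.
split; first by rewrite leq_max.
split.
  by move=> eps /inv_sqrt_ln_small [N hN]; exists N => n eta dd /hN h _.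
move=> n eta dd sigma pi d T P A B; rewrite geq_max => /andP[nn n12] adm sig W _.
have pp := nmin_ln nn.
have eta0 := eta_gt0 K1 pp adm.
have dd0 := dd_gt0 K1 pp adm.
have [_ eta1 _ ddn] := adm.
have c00 : 0 < eta / 2 by rewrite divr_gt0.
have c01 : eta / 2 <= 1 by lra.
have dl30 : 30 <= dl by exact: lexx.
have t0 : 0 < cutoff dd Cm dl by rewrite /cutoff !mulr_gt0 ?expR_gt0 ?powR_gt0 // lt_max ltr01.
have eta01 : 0 < eta <= 1 by rewrite eta0.
have t1 := thr_cutoff c0a K1 pp adm eta01 t0.
have [F [mF PF FG]] := wigner_bound W Cm0 Cs0 sig dd0 ddn dl30 c00 c01 t1
  (thr_tau c0a K1 pp adm) (thr_rho a0 K1 pp adm) (thr_sqrt K1 pp) n12.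
exists (~` F)%classic; split; first exact: measurableC.
split; last first.
  rewrite probability_setC // EFinB; apply: leeB => //.
  by rewrite -exprVn.
move=> w nF V U lam mu sdA sdB X.
have hX := FG w nF V U lam mu sdA sdB.
pose p : R := ln n%:R; pose PP := p `^ kappa / Num.sqrt eta.
have p1 : 1 <= p.
  have h := thr_sqrt K1 pp; rewrite -/p in h.
  have s1 : 1 <= Num.sqrt p by lra.
  have pn : 0 <= p by rewrite leNgt; apply/negP => hn; move: s1; rewrite ler0_sqrtr ?(ltW hn) //; lra.
  by rewrite -[p]sqr_sqrtr // exprn_ege1.
have p0 : 0 < p by apply: lt_le_trans p1.
have se0 : 0 < Num.sqrt eta by rewrite sqrtr_gt0.
have pk : p <= p `^ kappa by rewrite -{1}[p]powRr1 ?(ltW p0) //; exact: ler_powR.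
have P1 : 1 <= PP.
  rewrite /PP ler_pdivlMr // mul1r; apply: (@le_trans _ _ 1).
    by rewrite -[leRHS](sqrtr1 R); exact: ler_wsqrtr.
  exact: le_trans pk.
have e2c : 2 * (eta / 2) = eta by field.
have PPc : p / Num.sqrt (eta / 2) <= 2 * PP.
  have sc0 : 0 < Num.sqrt (eta / 2) by rewrite sqrtr_gt0.
  have h : Num.sqrt eta <= 2 * Num.sqrt (eta / 2).
    have -> : 2 * Num.sqrt (eta / 2) = Num.sqrt (2 ^+ 2 * (eta / 2)).
      by rewrite [in RHS]sqrtrM ?sqr_ge0 // sqrtr_sqr ger0_norm.
    by apply: ler_wsqrtr; rewrite expr2; lra.
  have h2 : (Num.sqrt (eta / 2))^-1 <= 2 / Num.sqrt eta.
    by rewrite ler_pdivlMr // mulrC ler_pdivrMr.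
  have -> : 2 * PP = p `^ kappa * (2 / Num.sqrt eta) by rewrite /PP; ring.
  by apply: ler_pM => //; rewrite ?(ltW p0) // invr_ge0 ltW.
have main : 600 * K ^+ 2 * (p / Num.sqrt (eta / 2)) <= 600 * (2 * (K ^+ 2 * PP)).
  rewrite -[leLHS]mulrA; apply: ler_wpM2l; first exact: ler0n.
  by rewrite [leRHS]mulrCA; apply: ler_wpM2l => //; exact: ltW.
have P0 : 0 <= PP by lra.
have KP : 0 <= K ^+ 2 * PP by apply: mulr_ge0 => //; exact: ltW.
have CP : 0 <= Cs * PP by rewrite mulr_ge0 // ltW.
rewrite -/p -/PP.
split=> [k l lk|k].
  have := hX k (pi^-1 l)%g; rewrite permKV e2c; have [kl|kl] := eqVneq k (pi^-1 l)%g.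
    by move: lk; rewrite kl permKV eqxx.
  rewrite subr0 addr0 => h; apply: (le_trans h); apply: (le_trans main).
  have -> : 60 * 60 * (K ^+ 2 + Cs) * PP = 60 * (60 * (K ^+ 2 * PP + Cs * PP)) by ring.
  by move: KP CP; move: (K ^+ 2 * PP) (Cs * PP) => x y; lra.
have := hX k k; rewrite eqxx e2c => h.
have [s0 s1] := andP sig.
pose S := sigma / eta ^+ 2; pose Q := (Num.sqrt p)^-1 / eta.
have S0 : 0 <= S by rewrite divr_ge0 // exprn_ge0 // ltW.
have Q0 : 0 <= Q by rewrite divr_ge0 ?invr_ge0 ?sqrtr_ge0 // ltW.
have ss : sigma ^+ 2 / eta <= S.
  have -> : S = sigma / eta * eta^-1 by rewrite /S; field; rewrite gt_eqF.
  have -> : sigma ^+ 2 / eta = sigma / eta * sigma by ring.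
  apply: ler_wpM2l; first by rewrite divr_ge0 // ltW.
  by apply: (le_trans s1); rewrite invf_ge1.
(* The estimate is centred at 1 / eta; moving the centre to (1 - sigma^2) / eta costs sigma^2 / eta,
   which is at most sigma / eta^2 because sigma and eta are at most 1. *)
have -> : X k (pi k) - (1 - sigma ^+ 2) / eta = (X k (pi k) - eta^-1) + sigma ^+ 2 / eta by ring.
apply: le_trans (ler_normD _ _) _.
rewrite [`|sigma ^+ 2 / eta|]ger0_norm; last by rewrite divr_ge0 ?sqr_ge0 // ltW.
apply: (le_trans (lerD h ss)).
have -> : 80 * (sigma ^+ 2 / (eta / 2)) = 160 * (sigma ^+ 2 / eta) by field; rewrite gt_eqF.
have -> : 160 * (Cs * sigma / (eta / 2) ^+ 2) = 640 * (Cs * S) by rewrite /S; field; rewrite gt_eqF.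
have -> : 100 * K / (Num.sqrt (ln n%:R) * (eta / 2)) = 200 * (K * Q).
  by rewrite /Q; field; rewrite !gt_eqF // sqrtr_gt0.
have -> : 60 * 60 * (K ^+ 2 + Cs) * ((Num.sqrt p)^-1 / eta + sigma / eta ^+ 2 + PP) =
  60 * (60 * (K ^+ 2 * Q + Cs * Q + (K ^+ 2 * S + Cs * S) + (K ^+ 2 * PP + Cs * PP))).
  by rewrite -/Q -/S; ring.
have CS : 0 <= Cs * S by rewrite mulr_ge0 // ltW.
have CQ : 0 <= Cs * Q by rewrite mulr_ge0 // ltW.
have KQ : K * Q <= K ^+ 2 * Q by apply: ler_wpM2r.
have KS : S <= K ^+ 2 * S by rewrite ler_peMl // exprn_ege1.
have KPP : 10 * PP <= K ^+ 2 * PP.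
  by apply: ler_wpM2r => //; apply: le_trans KK; lra.
have KQ0 : 0 <= K * Q by rewrite mulr_ge0 //; lra.
move: main ss KQ KS KPP KQ0 CQ CS CP KP P1 S0 Q0.
move: (600 * K ^+ 2 * (p / _)) (sigma ^+ 2 / eta) => m ss'.
move: (K * Q) (K ^+ 2 * Q) (K ^+ 2 * S) (K ^+ 2 * PP) (Cs * Q) (Cs * S) (Cs * PP) => x1 x2 x3 x4 x5 x6 x7.
move: (PP) (S) (Q) => y1 y2 y3 *; lra.
Qed.

Theorem theorem2p1 (R : realType) (a c0 Cm Cs : R) (n0m : R -> nat) :
  0 < a -> 0 < Cm -> 0 < Cs ->
  Num.max (32 + 4 * a) (4 + 7 * a) < c0 ->
  (forall kappa : R, 2 < kappa -> thm_conclusion a kappa c0 Cm Cs n0m None) /\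
  (forall K : R, 0 < K -> thm_conclusion a 1 c0 Cm Cs n0m (Some K)).
Proof.
move=> a0 Cm0 Cs0 c0a; split=> [kappa k2|K _]; apply: main_conclusion => //.
by apply: le_trans (ltW k2); rewrite ler1n.
Qed.
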